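(* Let $\Omega\subset\mathbb{R}^n$ be a bounded domain and assume that $n\ge3$ is odd. Let $\mathcal{M}\in L^\infty(\Omega,\mathcal{L}(\Lambda\mathbb{R}^n))$ and set $M=\operatorname{ess\,sup}_{x\in\Omega}\|\mathcal{M}(x)\|$ (operator norm). If $$M\,\|\mathcal{S}\|_{2n}<1,$$ where $\|\mathcal{S}\|_{2n}$ is the norm of the Beurling–Ahlfors transform on $L^{2n}(\mathbb{R}^n,\Lambda\mathbb{R}^n)$, then any solution $F\in W^{1,2}_{d,\delta}(\Omega,\Lambda\mathbb{R}^n)$ of $$\mathcal{D}^-F(x)=\mathcal{M}(x)\,\mathcal{D}^+F(x)\quad\text{in }\Omega$$ is locally Hölder continuous in $\Omega$ with Hölder exponent $\alpha=1/2$.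
   Context: $\Lambda\mathbb{R}^n$ is the exterior algebra with its induced Euclidean inner product; the interior product is defined by $\langle\Theta\lrcorner w_1,w_2\rangle=\langle w_1,\Theta\wedge w_2\rangle$. $dF=\sum_j e_j\wedge\partial_jF$, $\delta F=\sum_j e_j\lrcorner\partial_jF$ (so $\delta=-d^*$) in the sense of distributions; $\mathcal{D}^\pm=d\pm\delta$. $W^{1,2}_{d,\delta}(\Omega,\Lambda\mathbb{R}^n)=\{F\in\mathscr{D}'(\Omega,\Lambda\mathbb{R}^n):F,dF,\delta F\in L^2(\Omega,\Lambda\mathbb{R}^n)\}$. The Beurling–Ahlfors transform $\mathcal{S}$ on $L^p(\mathbb{R}^n,\Lambda\mathbb{R}^n)$, $1<p<\infty$, is the bounded operator $\mathcal{S}(d\alpha+\delta\beta)=d\alpha-\delta\beta$ defined through the Hodge decomposition $\omega=d\alpha+\delta\beta$; equivalently $\mathcal{S}=(d\delta-\delta d)\circ\Delta^{-1}$ with $\Delta=d\delta+\delta d$. *)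

(* Defs.v *)
From HB Require Import structures.
From mathcomp Require Import all_boot all_order all_algebra.
From mathcomp Require Import all_classical all_reals all_analysis.
From mathcomp Require Import ess_sup_inf.

Set Implicit Arguments.
Unset Strict Implicit.
Unset Printing Implicit Defensive.

Import Order.TTheory GRing.Theory Num.Theory.
Import numFieldNormedType.Exports.

Local Open Scope classical_set_scope.
Local Open Scope ring_scope.

(** * Lebesgue measure on R^n = 'rV[R]_n *)

Definition measure_rV_display : measure_display. Proof. exact. Qed.

Section measurable_rV.
Context {R : realType} (n : nat).

(* The sigma-algebra generated by the n coordinates, i.e. the Borel one. *)
Let coord (i : 'I_n) (x : 'rV[R]_n) : R := x ord0 i.

Let rV_set0 : g_sigma_preimage coord set0.
Proof. exact: sigma_algebra0. Qed.

Let rV_setC A : g_sigma_preimage coord A -> g_sigma_preimage coord (~` A).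
Proof. exact: sigma_algebraC. Qed.

Let rV_bigcup (F : (set 'rV[R]_n)^nat) :
  (forall i, g_sigma_preimage coord (F i)) ->
  g_sigma_preimage coord (\bigcup_i (F i)).
Proof. exact: sigma_algebra_bigcup. Qed.

HB.instance Definition _ := @isMeasurable.Build measure_rV_display
  'rV[R]_n (g_sigma_preimage coord) rV_set0 rV_setC rV_bigcup.

Lemma measurable_rV_coord (i : 'I_n) :
  measurable_fun [set: 'rV[R]_n] (fun x : 'rV[R]_n => x ord0 i).
Proof.
move=> _ Y mY; rewrite setTI; apply: sub_sigma_algebra => /=.
rewrite -bigcup_seq/=; exists i => /=; first by rewrite mem_index_enum.
by exists Y => //; rewrite setTI.
Qed.

Lemma measurable_fun_rVP d (T : measurableType d) (f : T -> 'rV[R]_n) :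
  (forall i, measurable_fun [set: T] (fun t => f t ord0 i)) ->
  measurable_fun [set: T] f.
Proof.
move=> mf; have : measurable_fun [set: T] f <->
    g_sigma_preimage (fun i => coord i \o f) `<=` measurable.
  rewrite g_sigma_preimage_comp; split=> [h A [/= C preC <-]|prefS].
    exact: h.
  by move=> _ A mA; apply: prefS; exists A.
case=> _; apply; apply: smallest_sub; first exact: sigma_algebra_measurable.
rewrite -bigcup_seq => A [i _ [B mB <-]].
exact: mf.
Qed.

End measurable_rV.

Section lebesgue_rV.
Context {R : realType}.

Definition cons_rV n (p : measurableTypeR R * 'rV[R]_n) : 'rV[R]_n.+1 :=
  \row_i (if unlift ord0 i is Some j then p.2 ord0 j else p.1).

Definition uncons_rV n (x : 'rV[R]_n.+1) : measurableTypeR R * 'rV[R]_n :=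
  (x ord0 ord0, \row_j x ord0 (lift ord0 j)).

Lemma cons_rVK n : cancel (@cons_rV n) (@uncons_rV n).
Proof.
move=> [a x]; rewrite /uncons_rV /cons_rV /=; congr (_, _).
  by rewrite mxE unlift_none.
by apply/rowP => j; rewrite !mxE liftK.
Qed.

Lemma measurable_cons_rV n : measurable_fun setT (@cons_rV n).
Proof.
apply: measurable_fun_rVP => i; rewrite /cons_rV.
case: (unliftP ord0 i) => [j ->|->].
  rewrite (_ : (fun _ => _) = (fun x : 'rV[R]_n => x ord0 j) \o snd).
    by apply: measurableT_comp => //; exact: measurable_rV_coord.
  by apply/funext => p /=; rewrite mxE liftK.
rewrite (_ : (fun _ => _) = fst) //.
by apply/funext => p /=; rewrite mxE unlift_none.
Qed.

Lemma measurable_uncons_rV n : measurable_fun setT (@uncons_rV n).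
Proof.
apply: measurable_fun_pair; first exact: measurable_rV_coord.
apply: measurable_fun_rVP => j.
rewrite (_ : (fun _ => _) = (fun x : 'rV[R]_n.+1 => x ord0 (lift ord0 j))).
  exact: measurable_rV_coord.
by apply/funext => x /=; rewrite mxE.
Qed.

Section step.
Variables (n : nat) (m : {sigma_finite_measure set 'rV[R]_n -> \bar R}).

Definition lebesgue_rV_step : set 'rV[R]_n.+1 -> \bar R :=
  pushforward (lebesgue_measure \x m)%E (@cons_rV n).

Let step0 : lebesgue_rV_step set0 = 0%E.
Proof. by rewrite /lebesgue_rV_step /pushforward preimage_set0 measure0. Qed.

Let step_ge0 A : (0 <= lebesgue_rV_step A)%E.
Proof. by rewrite /lebesgue_rV_step /pushforward; exact: measure_ge0. Qed.

Let step_sigma_additive : semi_sigma_additive lebesgue_rV_step.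
Proof.
have mc := @measurable_cons_rV n.
move=> F mF tF mUF; rewrite /lebesgue_rV_step /pushforward preimage_bigcup.
apply: measure_semi_sigma_additive.
- by move=> k; rewrite -[X in measurable X]setTI; exact: mc.
- apply/trivIsetP => /= i j _ _ ij; rewrite -preimage_setI.
  by move/trivIsetP : tF => /(_ _ _ _ _ ij) ->//; rewrite preimage_set0.
- by rewrite -preimage_bigcup -[X in measurable X]setTI; exact: mc.
Qed.

HB.instance Definition _ := isMeasure.Build _ _ _
  lebesgue_rV_step step0 step_ge0 step_sigma_additive.

Let step_sigma_finite : sigma_finite setT lebesgue_rV_step.
Proof.
have /sigma_finiteP[F [TF ndF Foo]] := sigma_finiteT (@lebesgue_measure R).
have /sigma_finiteP[G [TG ndG Goo]] := sigma_finiteT m.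
exists (fun k => @uncons_rV n @^-1` (F k `*` G k)).
  rewrite -preimage_bigcup (_ : \bigcup_i _ = setT) ?preimage_setT//.
  rewrite predeqE => -[x y]; split => // _.
  have [i _ Fix] : (\bigcup_i F i) x by rewrite -TF.
  have [j _ Gjy] : (\bigcup_i G i) y by rewrite -TG.
  exists (maxn i j) => //; split.
  - by move: x Fix; exact/subsetPset/ndF/leq_maxl.
  - by move: y Gjy; exact/subsetPset/ndG/leq_maxr.
move=> k; have [mF Fk] := Foo k; have [mG Gk] := Goo k; split.
  rewrite -[X in measurable X]setTI; apply: measurable_uncons_rV => //.
  exact: measurableX.
rewrite /lebesgue_rV_step /pushforward -comp_preimage.
rewrite (_ : _ \o _ = id); last by apply/funext => p /=; rewrite cons_rVK.
by rewrite preimage_id product_measure1E// lte_mul_pinfty// ge0_fin_numE.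
Qed.

HB.instance Definition _ := Measure_isSigmaFinite.Build _ _ _
  lebesgue_rV_step step_sigma_finite.

End step.

Fixpoint lebesgue_rV n : {sigma_finite_measure set 'rV[R]_n -> \bar R} :=
  match n with
  | 0 => [the {sigma_finite_measure set 'rV[R]_0 -> \bar R} of
            \d_(const_mx 0 : 'rV[R]_0)]
  | k.+1 => [the {sigma_finite_measure set 'rV[R]_k.+1 -> \bar R} of
             lebesgue_rV_step (lebesgue_rV k)]
  end.

Lemma lebesgue_rV_prod n (A : 'I_n -> set (measurableTypeR R)) :
  (forall i, measurable (A i)) ->
  lebesgue_rV n [set x : 'rV[R]_n | forall i, A i (x ord0 i)] =
  (\prod_(i < n) lebesgue_measure (A i))%E.
Proof.
elim: n A => [|n IHn] A mA.
  rewrite big_ord0 /= diracE mem_set //.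
  by case.
rewrite big_ord_recl -(IHn (fun i => A (lift ord0 i))) //=.
set B := (X in lebesgue_rV n X).
have mB : measurable B.
  rewrite (_ : B = \bigcap_(i in [set: 'I_n])
      (fun x : 'rV[R]_n => x ord0 i) @^-1` A (lift ord0 i)).
    apply: fin_bigcap_measurable => // i _.
    have := @measurable_rV_coord R n i measurableT _ (mA (lift ord0 i)).
    by rewrite setTI.
  by apply/seteqP; split=> x h i; [move=> _; exact: h|exact: (h i I)].
rewrite /lebesgue_rV_step /pushforward (_ : _ @^-1` _ = A ord0 `*` B).
  exact: product_measure1E.
apply/seteqP; split=> -[a x] /=.
  move=> h; split=> [|i]; first by have := h ord0; rewrite mxE unlift_none.
  by have := h (lift ord0 i); rewrite mxE liftK.
by move=> [h0 h] i; rewrite mxE; case: unliftP => [j ->|->].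
Qed.

End lebesgue_rV.

Arguments lebesgue_rV {R} n.

(** * The exterior algebra of R^n *)

(* An element u is the family of its coordinates u I in the basis
   e_I = e_{i_1} /\ ... /\ e_{i_k}, where i_1 < ... < i_k enumerate I. *)
Notation exterior R n := {ffun {set 'I_n} -> R^o}.

Section exterior_algebra.
Context {R : realType} {n : nat}.
Implicit Types u v w : exterior R n.

Definition ebasis (I : {set 'I_n}) : exterior R n :=
  [ffun J => (J == I)%:R].

Definition evec (j : 'I_n) : exterior R n := ebasis [set j].

(* e_I /\ e_J = wedge_sign I J * e_(I :|: J) for disjoint I and J: the
   exponent counts the inversions of the concatenation of I and J. *)
Definition wedge_sign (I J : {set 'I_n}) : R :=
  (-1) ^+ #|[set p : 'I_n * 'I_n | [&& p.1 \in I, p.2 \in J & (p.2 < p.1)%N]]|.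

Definition wedge u v : exterior R n :=
  [ffun K : {set 'I_n} => \sum_(I : {set 'I_n} | I \subset K)
     wedge_sign I (K :\: I) * (u I * v (K :\: I))].

Definition einner u v : R := \sum_(I : {set 'I_n}) u I * v I.

Definition enorm u : R := Num.sqrt (einner u u).

Definition interior_prod theta w : exterior R n :=
  [ffun K => einner w (wedge theta (ebasis K))].

Lemma interior_prodE theta w1 w2 :
  einner (interior_prod theta w1) w2 = einner w1 (wedge theta w2).
Proof.
rewrite /einner.
under eq_bigr do rewrite ffunE /einner mulr_suml.
rewrite exchange_big /=; apply: eq_bigr => J _.
under eq_bigr do rewrite -mulrA.
rewrite -mulr_sumr; congr (_ * _).
under eq_bigr do rewrite ffunE mulr_suml.
rewrite ffunE exchange_big /=; apply: eq_bigr => I _.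
rewrite (bigD1 (J :\: I)) //= big1 ?addr0; last first.
  by move=> K KJ; rewrite ffunE eq_sym (negbTE KJ) !mulr0 mul0r.
by rewrite ffunE eqxx mulr1 mulrA.
Qed.

Definition opnorm (T : 'End(exterior R n)) : R :=
  sup [set enorm (T w) | w in [set w | enorm w <= 1]].

End exterior_algebra.

(** * Lebesgue spaces of (Lambda R^n)-valued functions *)

Section function_spaces.
Context {R : realType} {n : nat}.
Implicit Types (D : set 'rV[R]_n) (f : 'rV[R]_n -> exterior R n) (p : R).

Definition measurable_form D f :=
  forall I, measurable_fun D (fun x => f x I : R).

Definition Lp_norm D p f : \bar R :=
  Lnorm (lebesgue_rV n) p%:E (fun x => (((enorm \o f) \_ D) x)%:E).

Definition in_Lp D p f := measurable_form D f /\ (Lp_norm D p f < +oo)%E.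

Definition in_L1loc D f := measurable_form D f /\
  forall K, compact K -> K `<=` D ->
    (\int[lebesgue_rV n]_(x in K) (enorm (f x))%:E < +oo)%E.

Definition ae_on D (P : 'rV[R]_n -> Prop) :=
  {ae lebesgue_rV n, forall x, D x -> P x}.

(* Extension by 0 outside of D does not affect the essential supremum over D
   of a nonnegative function, when D is open and nonempty. *)
Definition ess_sup_opnorm D (M : 'rV[R]_n -> 'End(exterior R n)) : \bar R :=
  ess_sup (lebesgue_rV n) (fun x => (((opnorm \o M) \_ D) x)%:E).

Definition in_Linf D (M : 'rV[R]_n -> 'End(exterior R n)) :=
  (forall w, measurable_form D (fun x => M x w)) /\
  (ess_sup_opnorm D M < +oo)%E.

Definition domain D := [/\ open D, connected D & D !=set0].

End function_spaces.

(** * Distributions *)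

Section distributions.
Context {R : realType} {n : nat}.

Definition partial (j : 'I_n) (phi : 'rV[R]_n -> R) : 'rV[R]_n -> R :=
  'D_(delta_mx ord0 j) phi.

Definition smooth (phi : 'rV[R]_n -> R) := forall s : seq 'I_n,
  let psi := foldr partial phi s in
  continuous psi /\ forall x j, derivable psi x (delta_mx ord0 j).

Definition test_function (D : set 'rV[R]_n) (phi : 'rV[R]_n -> R) :=
  let supp := closure [set x | phi x != 0] in
  [/\ smooth phi, compact supp & supp `<=` D].

(* (Lambda R^n)-valued distributions, paired with scalar test functions; only
   the values on the test functions of the domain under consideration matter
   (see [eq_distr]). *)
Definition distr := ('rV[R]_n -> R) -> exterior R n.
Implicit Types T U : distr.

Definition eq_distr (D : set 'rV[R]_n) T U :=
  forall phi, test_function D phi -> T phi = U phi.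

Definition distr_of (D : set 'rV[R]_n) (f : 'rV[R]_n -> exterior R n) : distr :=
  fun phi => [ffun I =>
    Rintegral (lebesgue_rV n) D (fun x => phi x * (f x I : R))].

Definition distr_partial (j : 'I_n) T : distr :=
  fun phi => - T (partial j phi).

Definition distr_d T : distr :=
  fun phi => \sum_j wedge (evec j) (distr_partial j T phi).

Definition distr_delta T : distr :=
  fun phi => \sum_j interior_prod (evec j) (distr_partial j T phi).

Definition dirac_plus T : distr := fun phi => distr_d T phi + distr_delta T phi.

Definition dirac_minus T : distr :=
  fun phi => distr_d T phi - distr_delta T phi.

Definition distr_in_Lp (D : set 'rV[R]_n) (p : R) T :=
  exists2 g, in_Lp D p g & eq_distr D T (distr_of D g).

Definition W12_d_delta (D : set 'rV[R]_n) (F : 'rV[R]_n -> exterior R n) :=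
  [/\ in_Lp D 2 F, distr_in_Lp D 2 (distr_d (distr_of D F))
    & distr_in_Lp D 2 (distr_delta (distr_of D F))].

(* For F in [W12_d_delta D], D^-F and D^+F are (represented by) square
   integrable functions P and Q, which are unique up to null sets. *)
Definition dirac_solution (D : set 'rV[R]_n)
    (M : 'rV[R]_n -> 'End(exterior R n)) (F : 'rV[R]_n -> exterior R n) :=
  exists P Q : 'rV[R]_n -> exterior R n,
    [/\ in_Lp D 2 P /\ in_Lp D 2 Q,
        eq_distr D (dirac_minus (distr_of D F)) (distr_of D P),
        eq_distr D (dirac_plus (distr_of D F)) (distr_of D Q)
      & ae_on D (fun x => P x = M x (Q x))].

End distributions.

(** * The Beurling-Ahlfors transform *)

Section beurling_ahlfors.
Context {R : realType} {n : nat}.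
Implicit Types (p : R) (omega : 'rV[R]_n -> exterior R n).

(* omega = a + b with a = d alpha and b = delta beta in L^p(R^n); the functions
   a and b are uniquely determined almost everywhere by omega. *)
Definition hodge_decomposition p omega (a b : 'rV[R]_n -> exterior R n) :=
  [/\ in_Lp setT p a /\ in_Lp setT p b,
      exists2 alpha, in_L1loc setT alpha &
        eq_distr setT (distr_d (distr_of setT alpha)) (distr_of setT a),
      exists2 beta, in_L1loc setT beta &
        eq_distr setT (distr_delta (distr_of setT beta)) (distr_of setT b)
    & ae_on setT (fun x => omega x = a x + b x)].

(* The operator S (d alpha + delta beta) = d alpha - delta beta on L^p(R^n):
   [xget] selects a representative of the class of S omega. By the Hodge
   decomposition theorem, the default value is not used for omega in L^p,
   1 < p < oo. *)
Definition beurling_ahlfors p omega : 'rV[R]_n -> exterior R n :=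
  xget (fun=> 0) [set eta | exists a b, hodge_decomposition p omega a b /\
                                        eta = (fun x => a x - b x)].

Definition Lp_opnorm p
    (S : ('rV[R]_n -> exterior R n) -> ('rV[R]_n -> exterior R n)) : \bar R :=
  ereal_sup [set Lp_norm setT p (S omega) | omega in
    [set omega | in_Lp setT p omega /\ (Lp_norm setT p omega <= 1)%E]].

End beurling_ahlfors.

(** * Local Hoelder continuity *)

Section hoelder_continuity.
Context {R : realType} {n : nat}.

Definition euclidean_norm (x : 'rV[R]_n) : R :=
  Num.sqrt (\sum_i x ord0 i ^+ 2).

Definition locally_hoelder (D : set 'rV[R]_n) (alpha : R)
    (f : 'rV[R]_n -> exterior R n) :=
  forall K, compact K -> K `<=` D -> exists C : R, forall x y, K x -> K y ->
    enorm (f x - f y) <= C * euclidean_norm (x - y) `^ alpha.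

End hoelder_continuity.

(* Main.v *)
Require Import Defs.
From HB Require Import structures.
From mathcomp Require Import all_boot all_order all_algebra.
From mathcomp Require Import all_classical all_reals all_analysis.
From mathcomp Require Import measurable_realfun ess_sup_inf ring lra.
Import Order.TTheory GRing.Theory Num.Theory.
Import numFieldNormedType.Exports.
Local Open Scope classical_set_scope.
Local Open Scope ring_scope.
Set Implicit Arguments.
Unset Strict Implicit.
Unset Printing Implicit Defensive.

(* Write D^s = sum_j c_j d_j, where c_j = e_j /\ + s e_j _| and c_j^2 = s for s = 1, -1. A vector
   field that equals x_j / |x|^n off the unit ball and is smooth inside it has a bump function as
   divergence, so, after rescaling, E^t - E^r has divergence eta_t - eta_r for a mollifier eta.
   Convolving with sum_j c_j (E^t - E^r)_j inverts D^s up to the error eta_r * h, which is small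
   for large r; this replaces the Cauchy kernel and singular integrals.

   - The Hodge decomposition in L^p is unique, so that S maps D^+ u to D^- u and back for test
     forms u, and |D^+ u|_2n <= K |D^- u|_2n with K = |S|_2n. In L^2 both norms equal |grad u|_2,
     and K >= 1.
   - Hence D^- - M D^+ is approximately inverted by a Neumann series that converges in L^2 and in
     L^2n at once.
   - Let G = phi F with a cutoff phi. Then h = D^- G - M D^+ G is square integrable and vanishes
     where phi is locally constant; truncate it and solve D^- u - M D^+ u = h approximately with
     test forms u. By Hardy's inequality (this uses n >= 3), u is L^2-close to G on balls.
   - Where h vanishes, |D^- (psi^n u)|_2n is bounded by the L^2 norm of u: the commutator with
     psi^n costs |psi^(n-1) u|_2n, and its n-th power is at most the (n-1)-st power of
     sup |psi^n u| times an L^2 norm. Morrey's inequality in L^2n, proved by comparing mollifications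
     at scales t and t/4, bounds the supremum, and an absorption argument concludes.
   - Morrey's inequality, which has exponent 1 - n/2n = 1/2, then makes the forms psi^n u, and in
     the limit the mollifications of F, uniformly Hoelder.

   If M = 0 almost everywhere, mollifications of F at small scales coincide, since D^- F = 0. *)

(** * Lebesgue measure *)

(** Of the first derivatives of [F] only D^+ F and D^- F are controlled, and only in L^2; an L^2n
    norm of either could be infinite and cannot be absorbed. So the estimates are proved for test
    forms, where all norms are finite, with constants independent of the form, and they reach [F]
    through mollifications. L^2 identifies the approximants with [F] (energy identity, Hardy) and
    L^2n makes them Hoelder; hence one and the same Neumann series must contract in both norms, i.e.
    k <= th and k K <= th < 1, and K >= 1 lets th = k K serve for both. As M is merely measurable,
    residuals leave the test forms after one step: the iteration runs in the bounded measurable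
    forms of bounded support, and this is why the datum is truncated. The power psi^n is dictated by
    |psi^(n-1) u|^(2n) = |psi^n u|^(2(n-1)) |u|^2. If M = 0, the product with |S|_2n = +oo is still
    0, so the hypothesis gives no bound on |S|_2n and the case is treated apart. Scales are written
    t = s^2, which turns the exponent 1/2 into linear growth in s. *)

Section borel_rV.
Context {R : realType} {n : nat}.

(* [`|x|] is the maximum norm of the row vector x, and [sqn x] below its squared Euclidean norm. *)
Lemma le_coord_norm (x : 'rV[R]_n) i : `|x ord0 i| <= `|x|.
Proof.
rewrite [leRHS]/Num.norm /= mx_normrE; apply/bigmax_geP; right => /=.
by exists (ord0, i).
Qed.

Lemma norm_le_rV (x : 'rV[R]_n) r : 0 <= r ->
  (forall i, `|x ord0 i| <= r) -> `|x| <= r.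
Proof.
move=> r0 h; rewrite [leLHS]/Num.norm /= mx_normrE; apply/bigmax_leP; split => //.
by move=> [i j] _ /=; rewrite (ord1 i).
Qed.

Lemma norm_lt_rV (x : 'rV[R]_n) r : 0 < r ->
  (forall i, `|x ord0 i| < r) -> `|x| < r.
Proof.
move=> r0 h; rewrite [ltLHS]/Num.norm /= mx_normrE; apply/bigmax_ltP; split => //.
by move=> [i j] _ /=; rewrite (ord1 i).
Qed.

Lemma measurable_box (A : 'I_n -> set (measurableTypeR R)) :
  (forall i, measurable (A i)) ->
  measurable [set x : 'rV[R]_n | forall i, A i (x ord0 i)].
Proof.
move=> mA; rewrite (_ : mkset _ = \bigcap_(i in [set: 'I_n])
    (fun x : 'rV[R]_n => x ord0 i) @^-1` A i).
  apply: fin_bigcap_measurable => // i _.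
  by have := @measurable_rV_coord R n i measurableT _ (mA i); rewrite setTI.
by apply/seteqP; split=> x h i; [move=> _; exact: h|exact: (h i I)].
Qed.

Lemma measurable_ball_rV (x : 'rV[R]_n) (r : R) : measurable (ball x r).
Proof.
case: (ltP 0 r) => [r0|r0]; last first.
  rewrite (_ : ball x r = set0)//; apply/seteqP; split=> // y [r0' _].
  by move: (lt_le_trans r0' r0); rewrite ltxx.
rewrite (_ : ball x r = [set y | forall i, ball (x ord0 i) r (y ord0 i)]).
  by apply: (@measurable_box (fun i => ball (x ord0 i) r)) => i; exact: measurable_ball.
apply/seteqP; split=> y; rewrite /ball/= /mx_ball.
  by move=> /= [_ h] i; exact: h.
by move=> /= h; split => // i j; rewrite (ord1 i); exact: h.
Qed.

(** The sigma-algebra is generated by the coordinates, so an open set is exhibited as a countable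
    union: the cubes with rational centre and radius 1/(k+1) contained in it. *)
Lemma open_measurable_rV (U : set 'rV[R]_n) : open U -> measurable U.
Proof.
move=> oU.
pose c (q : 'rV[rat]_n) : 'rV[R]_n := \row_j ratr (q ord0 j).
pose B (q : 'rV[rat]_n) (k : nat) : set 'rV[R]_n :=
  if pselect (ball (c q) k.+1%:R^-1 `<=` U) then ball (c q) k.+1%:R^-1 else set0.
rewrite (_ : U = \bigcup_q \bigcup_k B q k).
  apply: countable_bigcupT_measurable => //= q.
  apply: bigcup_measurable => k _; rewrite /B; case: pselect => //= _.
  exact: measurable_ball_rV.
apply/seteqP; split => [x Ux|x [q _ [k _]]]; last first.
  by rewrite /B; case: pselect => // qU; exact: qU.
have [e/= e0 xeU] : nbhs_ball x U by apply/nbhs_ballP; exact: open_nbhs_nbhs.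
have [k ke] : exists k, k.+1%:R^-1 < e / 2.
  exists (Num.truncn (e / 2)^-1); rewrite invf_plt ?posrE ?divr_gt0//.
  exact: truncnS_gt.
have k0 : (0 : R) < k.+1%:R^-1 by rewrite invr_gt0.
have qP i : exists q : rat, `|x ord0 i - ratr q| < k.+1%:R^-1.
  have /rat_in_itvoo[q] : x ord0 i - k.+1%:R^-1 < x ord0 i + k.+1%:R^-1.
    by rewrite ltrBlDr -addrA ltrDl addr_gt0.
  rewrite in_itv/= => /andP[q1 q2]; exists q.
  by rewrite ltr_norml; apply/andP; split; [rewrite ltrBrDr addrC ltrBlDr addrC// addrC|rewrite ltrBlDr addrC -ltrBlDr].
exists (\row_j projT1 (cid (qP j))) => //; exists k => //.
have cx : ball (c (\row_j projT1 (cid (qP j)))) k.+1%:R^-1 x.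
  rewrite -ball_normE/=; apply: norm_lt_rV => // i.
  by rewrite !mxE distrC; case: cid.
rewrite /B; case: pselect => // -[] y.
rewrite -ball_normE/= => yB; apply: xeU; rewrite -ball_normE/=.
move: cx; rewrite -ball_normE/= => cx.
rewrite -(subrKA (c (\row_j projT1 (cid (qP j))))) (le_lt_trans (ler_normD _ _))//.
by rewrite [ltRHS]splitr ltrD// (lt_trans _ ke)// distrC.
Qed.

Lemma closed_measurable_rV (U : set 'rV[R]_n) : closed U -> measurable U.
Proof.
move=> cU; rewrite -(setCK U); apply: measurableC; apply: open_measurable_rV.
by rewrite openC.
Qed.

Lemma continuous_measurable_rV (f : 'rV[R]_n -> R) :
  continuous f -> measurable_fun setT f.
Proof.
move=> cf; apply: (measurability _ (RGenOpens.measurableE R)) => //=.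
move=> _ [_ [a [b ->] <-]]; rewrite setTI; apply: open_measurable_rV.
by apply: open_comp => // x _; exact: cf.
Qed.

Lemma measurable_rVB d (T : measurableType d) (f g : T -> 'rV[R]_n) :
  measurable_fun setT f -> measurable_fun setT g ->
  measurable_fun setT (fun x => f x - g x).
Proof.
move=> mf mg; apply: measurable_fun_rVP => i.
under eq_fun do rewrite !mxE.
apply: measurable_funB.
  by apply: (measurableT_comp (measurable_rV_coord i)) mf.
by apply: (measurableT_comp (measurable_rV_coord i)) mg.
Qed.

End borel_rV.

(** * Invariance of Lebesgue measure under reflections and translations *)

Section lebesgue_rV_theory.
Context {R : realType}.
Local Open Scope ereal_scope.

Let refl (a : R) : measurableTypeR R -> measurableTypeR R := fun t : R => (a - t)%R.

Let measurable_refl a : measurable_fun setT (refl a).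
Proof. by apply: (@measurable_funB _ R R _ (cst a) id). Qed.

(** By uniqueness of Lebesgue measure it is enough to look at half-open intervals; reflection moves
    the closed end to the other side, which does not change the length. *)
Lemma lebesgue_measure_reflect (a : R) (A : set (measurableTypeR R)) : measurable A ->
  pushforward lebesgue_measure (refl a) A = lebesgue_measure A.
Proof.
move=> mA; apply/esym; apply: (@lebesgue_measure_unique R (measure_function_pushforward__canonical__measure_function_Measure lebesgue_measure (@measurable_refl a))) => //.
move=> X /= [[b c]] _ <-.
rewrite /pushforward.
have -> : refl a @^-1` `]b, c]%classic = `[(a - c)%R, (a - b)%R[%classic.
  apply/seteqP; split => t /=; rewrite /refl !in_itv/= => /andP[h1 h2]; apply/andP; split; lra.
rewrite !lebesgue_measure_itv/= !lte_fin ltrD2l ltrN2.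
by case: ifPn => // _; rewrite -!EFinD; congr EFin; ring.
Qed.

Lemma integral_reflect_R (a : R) (f : measurableTypeR R -> \bar R) :
  measurable_fun setT f -> (forall x, 0 <= f x) ->
  \int[lebesgue_measure]_t f (a - t)%R = \int[lebesgue_measure]_t f t.
Proof.
move=> mf f0.
have := @ge0_integral_pushforward _ _ (measurableTypeR R) (measurableTypeR R) R
  _ (@measurable_refl a) lebesgue_measure setT f measurableT mf (fun x _ => f0 x).
rewrite preimage_setT => <-.
by apply: eq_measure_integral => //= A mA _; exact/lebesgue_measure_reflect.
Qed.

Lemma integral_rVS n (f : 'rV[R]_n.+1 -> \bar R) :
  measurable_fun setT f -> (forall x, 0 <= f x) ->
  \int[lebesgue_rV n.+1]_x f x =
  \int[lebesgue_measure]_t \int[lebesgue_rV n]_x f (cons_rV (t, x)).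
Proof.
move=> mf f0.
have mc := @measurable_cons_rV R n.
rewrite /= (_ : \int[lebesgue_rV_step (lebesgue_rV n)]_x f x =
  \int[pushforward (lebesgue_measure \x (lebesgue_rV n)) (@cons_rV R n)]_x f x); last by [].
rewrite ge0_integral_pushforward//= preimage_setT fubini_tonelli1//.
exact: measurableT_comp.
Qed.

(** Tonelli splits off the first coordinate and the induction treats the others. Reflections come
    first because convolutions integrate over x - y. *)
Lemma integral_reflect n (a : 'rV[R]_n) (f : 'rV[R]_n -> \bar R) :
  measurable_fun setT f -> (forall x, 0 <= f x) ->
  \int[lebesgue_rV n]_x f (a - x)%R = \int[lebesgue_rV n]_x f x.
Proof.
elim: n a f => [|n IHn] a f mf f0.
  by apply: eq_integral => x _; congr (f _); apply/rowP => -[].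
have mB : measurable_fun setT (fun x : 'rV[R]_n.+1 => a - x)%R.
  exact: measurable_rVB.
rewrite (integral_rVS mf f0) (@integral_rVS _ (fun x => f (a - x)%R)) => [||//]; last exact: measurableT_comp.
rewrite -(@integral_reflect_R (a ord0 ord0)%R (fun t => \int[lebesgue_rV n]_x f (cons_rV (t, x)))); last 2 first.
- apply: (@measurable_fun_fubini_tonelli_F _ _ _ _ _ (lebesgue_rV n) (fun z => f (cons_rV z))) => //.
  by apply: measurableT_comp => //; exact: measurable_cons_rV.
- by move=> x; exact: integral_ge0.
apply: eq_integral => t _.
rewrite -(IHn (\row_j a ord0 (lift ord0 j)) (fun x => f (cons_rV ((a ord0 ord0 - t)%R, x)))); last 2 first.
- have : measurable_fun setT (fun x : 'rV[R]_n => (((a ord0 ord0 - t)%R : measurableTypeR R), x)).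
    by apply: measurable_fun_pair => //; exact: measurable_cst.
  by move/(measurableT_comp (@measurable_cons_rV R n)) => h; apply: (measurableT_comp mf h).
- by [].
apply: eq_integral => x _; congr (f _).
apply/rowP => j; rewrite !mxE; case: unliftP => [k ->|->]//=.
by rewrite !mxE.
Qed.

(** A translation is the composite of two reflections. *)
Lemma integral_translate n (a : 'rV[R]_n) (f : 'rV[R]_n -> \bar R) :
  measurable_fun setT f -> (forall x, 0 <= f x) ->
  \int[lebesgue_rV n]_x f (x + a)%R = \int[lebesgue_rV n]_x f x.
Proof.
move=> mf f0; rewrite -(integral_reflect 0%R mf f0).
rewrite -(@integral_reflect _ (- a)%R (fun x => f (0 - x)%R)) => [||//]; last first.
  by apply: measurableT_comp => //; exact: measurable_rVB.
by apply: eq_integral => x _; congr (f _); apply/rowP => j; rewrite !mxE; ring.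
Qed.

Lemma lebesgue_rV_cube n (a : 'rV[R]_n) (r : R) : (0 <= r)%R ->
  lebesgue_rV n [set x | `|x - a| <= r]%R = ((2 * r) ^+ n)%:E.
Proof.
move=> r0.
have -> : [set x | `|x - a| <= r]%R =
    [set x | forall i, `[(a ord0 i - r)%R, (a ord0 i + r)%R]%classic (x ord0 i)].
  apply/seteqP; split => x /=.
    move=> h i; have := le_trans (le_coord_norm (x - a)%R i) h.
    by rewrite !mxE ler_norml in_itv/= => /andP[h1 h2]; apply/andP; split; lra.
  move=> h; apply: norm_le_rV => // i; have := h i.
  by rewrite !mxE ler_norml in_itv/= => /andP[h1 h2]; apply/andP; split; lra.
rewrite [LHS](@lebesgue_rV_prod _ _ (fun i => `[(a ord0 i - r)%R, (a ord0 i + r)%R]%classic))//.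
under eq_bigr do rewrite lebesgue_measure_itv/= lte_fin.
rewrite (eq_bigr (fun=> (2 * r)%:E)) => [|i _]; last first.
  case: ifPn => [_|]; first by rewrite -EFinD; congr EFin; ring.
  rewrite -leNgt => h; have -> : r = 0%R by lra.
  by rewrite mulr0.
by rewrite prodEFin big_const_ord iter_mulr_1.
Qed.

End lebesgue_rV_theory.

(** * Smooth functions and test functions *)

Section directional.
Context {R : realType} {V : normedModType R}.
Implicit Types (f : V -> R) (x v : V).

Lemma derive_line f x v :
  'D_(1 : R) (fun h : R => f (h *: v + x)) (0 : R) = 'D_v f x.
Proof.
rewrite /derive; set g1 := fun h => h^-1 *: _; set g2 := fun h => h^-1 *: _.
suff -> : g1 = g2 by [].
by rewrite funeqE /g1 /g2 => h /=; rewrite addr0 scale0r add0r [_%:A]mulr1.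
Qed.

Lemma is_derive_line f x v (d : R) :
  is_derive (0 : R) (1 : R) (fun h : R => f (h *: v + x)) d -> is_derive x v f d.
Proof.
move=> [d1 d2]; split; first exact: (derivable1P f x v).2.
by rewrite -derive_line.
Qed.

Lemma line_is_derive f x v (d : R) :
  is_derive x v f d -> is_derive (0 : R) (1 : R) (fun h : R => f (h *: v + x)) d.
Proof.
move=> [d1 d2]; split; first exact: (derivable1P f x v).1.
by rewrite derive_line.
Qed.

Lemma is_derive_chain (F : R -> R) f x v d D :
  is_derive x v f d -> is_derive (f x) 1 F D -> is_derive x v (F \o f) (D * d).
Proof.
move=> /line_is_derive df dF; apply: is_derive_line.
have dF' : is_derive ((fun h : R => f (h *: v + x)) 0) 1 F D by rewrite scale0r add0r.
exact: is_derive1_comp.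
Qed.

(** A second-order error bound is a form of differentiability that survives integration in a
    parameter; it is used at the edge of [flat] and for derivatives of convolutions. *)
Lemma is_derive_quadratic f x v (d C : R) :
  (forall h : R, `|h| <= 1 -> `|f (h *: v + x) - f x - h * d| <= C * h ^+ 2) ->
  is_derive x v f d.
Proof.
move=> hC; have C0 : 0 <= C.
  by have := hC 1; rewrite normr1 expr1n mulr1 => /(_ (lexx _)); apply: le_trans.
have cv : (fun h : R => h^-1 *: ((f \o shift x) (h *: v) - f x)) @ (0 : R)^' --> d.
  apply/cvgrPdist_le => e e0.
  near=> h.
  have h0 : h != 0 by near: h; exact: nbhs_dnbhs_neq.
  have h1 : `|h| <= 1 by near: h; apply: dnbhs0_le.
  have he : `|h| <= e / (C + 1).
    by near: h; apply: dnbhs0_le; rewrite divr_gt0// ltr_wpDl.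
  rewrite /= -[d](mulKf h0) -[_ *: _]/(_ * _) -mulrBr normrM normfV.
  rewrite ler_pdivrMl ?normr_gt0// distrC (le_trans (hC _ h1))//.
  rewrite -real_normK ?num_real// expr2 mulrA mulrC ler_wpM2l//.
  have : `|h| * (C + 1) <= e by rewrite -ler_pdivlMr// ltr_wpDl.
  by have := normr_ge0 h; nra.
by split; [apply: cvgP cv|exact: cvg_lim cv].
Unshelve. all: by end_near.
Qed.

End directional.

Section smooth_functions.
Context {R : realType} {n : nat}.
Implicit Types (f g : 'rV[R]_n -> R) (x : 'rV[R]_n).
Notation e_ j := (delta_mx ord0 j : 'rV[R]_n).

(** The induction over iterated partial derivatives is done here once; later proofs of smoothness
    only exhibit a class stable under [partial]. *)
Lemma smooth_class (P : set ('rV[R]_n -> R)) :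
  (forall f, P f -> continuous f) ->
  (forall f x j, P f -> derivable f x (e_ j)) ->
  (forall f j, P f -> P (partial j f)) -> forall f, P f -> smooth f.
Proof.
move=> Pc Pd Pp f Pf s.
have : P (foldr partial f s) by elim: s => //= j s; exact: Pp.
by move=> Ps; split; [exact: Pc|move=> x j; exact: Pd].
Qed.

Lemma smooth_continuous f : smooth f -> continuous f.
Proof. by move=> /(_ [::])[]. Qed.

Lemma smooth_derivable f x j : smooth f -> derivable f x (e_ j).
Proof. by move=> /(_ [::])[_]; exact. Qed.

Lemma smooth_partial f j : smooth f -> smooth (partial j f).
Proof. by move=> sf s; have := sf (rcons s j); rewrite foldr_rcons. Qed.

Lemma smooth_is_derive f x j : smooth f -> is_derive x (e_ j) f (partial j f x).
Proof. by move=> sf; apply: derivableP; exact: smooth_derivable. Qed.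

Lemma partialE f j x d : is_derive x (e_ j) f d -> partial j f x = d.
Proof. by move=> fd; rewrite /partial derive_val. Qed.

End smooth_functions.

(** * Functions with a zero of infinite order *)

Section flat.
Context {R : realType}.

(** The family exp(-1/s) s^(-k), extended by 0 to s <= 0. The index [k] makes it closed under
    differentiation: the derivative of member k is member k+2 minus k times member k+1. *)
Definition flat (k : nat) (s : R) : R :=
  if 0 < s then expR (- s^-1) * s^-1 ^+ k else 0.

Lemma flat_ge0 k s : 0 <= flat k s.
Proof.
by rewrite /flat; case: ifP => // s0; rewrite mulr_ge0 ?expR_ge0// exprn_ge0// invr_ge0 ltW.
Qed.

Lemma flat_gt0 k s : 0 < s -> 0 < flat k s.
Proof. by move=> s0; rewrite /flat s0 mulr_gt0 ?expR_gt0// exprn_gt0// invr_gt0. Qed.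

Lemma flat_le0 k s : s <= 0 -> flat k s = 0.
Proof. by rewrite leNgt /flat => /negbTE ->. Qed.

(** From exp(y) >= y^(k+2) / (k+2)! at y = 1/s. The quadratic bound is what [is_derive_quadratic]
    needs at the origin. *)
Lemma flat_le_sqr k s : flat k s <= k.+2`!%:R * s ^+ 2.
Proof.
have [s0|s0] := ltP 0 s; last by rewrite flat_le0// mulr_ge0// sqr_ge0.
have s'0 : 0 < s^-1 by rewrite invr_gt0.
rewrite /flat s0 expRN mulrC ler_pdivrMr ?expR_gt0//.
have h := expR_ge1Dxn k.+1 (ltW s'0).
have {}h : s^-1 ^+ k.+2 <= k.+2`!%:R * expR s^-1.
  rewrite -ler_pdivrMl ?ltr0n ?fact_gt0// mulrC; apply: le_trans h.
  by rewrite lerDr.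
have := ler_wpM2r (sqr_ge0 s) h.
by rewrite -addn2 exprD -mulrA -exprMn mulVf ?gt_eqF// expr1n mulr1 mulrAC.
Qed.

Lemma is_derive_flat k (s : R) :
  is_derive s (1 : R) (flat k) (flat k.+2 s - k%:R * flat k.+1 s).
Proof.
have [s0|s0|<-] := ltgtP 0 s; last first.
- rewrite !flat_le0// mulr0 subr0; apply: (@is_derive_quadratic _ _ _ _ _ _ k.+2`!%:R) => h _.
  by rewrite addr0 [_%:A]mulr1 mulr0 subr0 [flat k 0]flat_le0// subr0 ger0_norm ?flat_ge0// flat_le_sqr.
- rewrite !flat_le0 ?ltW// mulr0 subr0.
  apply: (@near_eq_is_derive R R R (cst 0) (flat k) s 1 0).
  near=> t; rewrite flat_le0//; apply/ltW.
  by near: t; exact: lt_nbhsl.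
- apply: (@near_eq_is_derive R R R (fun t : R => expR (- t^-1) * t^-1 ^+ k)).
    near=> t; rewrite /flat ifT//.
    by near: t; exact: lt_nbhsr.
  have s0' : id s != 0 by rewrite gt_eqF.
  have dV := is_deriveV s0' (is_derive_id s 1).
  have dN : is_derive s (1 : R) (fun t : R => - t^-1) (s ^- 2).
    apply: is_derive_eq (is_deriveN dV) _.
    by rewrite -[_ *: _]/(_ * _) mulr1 opprK.
  have dE := @is_derive1_comp R expR (fun t : R => - t^-1) s _ _ (is_derive_expR (- s^-1)) dN.
  have dX := @is_deriveX _ _ _ k _ _ _ dV.
  have dM := is_deriveM dE dX.
  rewrite (_ : (fun t : R => _) = (expR \o (fun t : R => - t^-1)) * [eta GRing.inv] ^+ k); last first.
    by apply/funext => t; rewrite /= !fctE.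
  apply: is_derive_eq dM _.
  rewrite /flat s0 /= !fctE /GRing.scale/=.
  case: k {dX} => [|k]; rewrite /= !exprS; field; rewrite gt_eqF//.
Unshelve. all: by end_near.
Qed.

End flat.

(** * Closure properties of smooth functions and rules for partial derivatives *)

Section smooth_algebra.
Context {R : realType} {n : nat}.
Implicit Types (f g : 'rV[R]_n -> R) (x : 'rV[R]_n).
Notation e_ j := (delta_mx ord0 j : 'rV[R]_n).

(* Functions built from smooth ones by operations whose partial derivatives are
   again of this form; hence all of them are smooth. *)
Inductive smooth_alg : ('rV[R]_n -> R) -> Prop :=
| SABase f : smooth f -> smooth_alg f
| SACoord i : smooth_alg (fun x => x ord0 i)
| SACst c : smooth_alg (fun=> c)
| SAAdd f g : smooth_alg f -> smooth_alg g -> smooth_alg (fun x => f x + g x)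
| SAMul f g : smooth_alg f -> smooth_alg g -> smooth_alg (fun x => f x * g x)
| SAInv f : smooth_alg f -> (forall x, f x != 0) -> smooth_alg (fun x => (f x)^-1)
| SASqrt f : smooth_alg f -> (forall x, 0 < f x) -> smooth_alg (fun x => Num.sqrt (f x))
| SAFlat k f : smooth_alg f -> smooth_alg (fun x => flat k (f x)).

Lemma continuous_coord i : continuous (fun x : 'rV[R]_n => x ord0 i).
Proof. exact: coord_continuous. Qed.

Lemma is_derive_continuous (f : R -> R) (x d : R) :
  is_derive x (1 : R) f d -> {for x, continuous f}.
Proof. by move=> [h _]; apply: differentiable_continuous; apply/derivable1_diffP. Qed.

Lemma smooth_algP f : smooth_alg f -> continuous f /\
  forall j, exists2 g, smooth_alg g & forall x, is_derive x (e_ j) f (g x).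
Proof.
elim=> {f}.
- move=> f sf; split; first exact: smooth_continuous.
  move=> j; exists (partial j f); first exact/SABase/smooth_partial.
  by move=> x; exact: smooth_is_derive.
- move=> i; split; first exact: continuous_coord.
  move=> j; exists (fun=> (i == j)%:R); first exact: SACst.
  move=> x; apply: (@is_derive_quadratic _ _ _ _ _ _ 0) => h _.
  by rewrite !mxE eqxx/= addrK mul0r normr_le0 subrr.
- move=> c; split; first by move=> x; exact: cst_continuous.
  move=> j; exists (fun=> 0); first exact: SACst.
  by move=> x; exact: is_derive_cst.
- move=> f g _ [cf df] _ [cg dg]; split.
    by move=> x; apply: continuousD; [exact: cf|exact: cg].
  move=> j; have [f' f'a fd] := df j; have [g' g'a gd] := dg j.
  by exists (fun x => f' x + g' x); [exact: SAAdd|move=> x; exact: is_deriveD].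
- move=> f g fa [cf df] ga [cg dg]; split.
    by move=> x; apply: continuousM; [exact: cf|exact: cg].
  move=> j; have [f' f'a fd] := df j; have [g' g'a gd] := dg j.
  exists (fun x => f x * g' x + g x * f' x); first by apply: SAAdd; apply: SAMul.
  by move=> x; exact: (is_deriveM (fd x) (gd x)).
- move=> f fa [cf df] f0; split.
    by move=> x; apply: continuousV => //; exact: cf.
  move=> j; have [f' f'a fd] := df j.
  exists (fun x => (-1 * ((f x)^-1 * (f x)^-1)) * f' x).
    by apply: SAMul => //; apply: SAMul; [exact: SACst|apply: SAMul; exact: SAInv].
  move=> x; have : is_derive (f x) (1 : R) GRing.inv (-1 * ((f x)^-1 * (f x)^-1)).
    have h := @is_deriveV R id (f x) _ 1 (f0 x) (is_derive_id (f x) 1).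
    apply: is_derive_eq h _.
    by rewrite -[_ *: _]/(_ * _) mulr1 expr2 invfM mulN1r.
  exact: is_derive_chain.
- move=> f fa [cf df] f0; split.
    by move=> x; apply: (continuous_comp (cf x)); exact: sqrt_continuous.
  move=> j; have [f' f'a fd] := df j.
  exists (fun x => (2 * Num.sqrt (f x))^-1 * f' x).
    apply: SAMul => //; apply: SAInv => [|x].
      by apply: SAMul; [exact: SACst|exact: SASqrt].
    by rewrite mulf_neq0// gt_eqF// sqrtr_gt0.
  move=> x; have : is_derive (f x) (1 : R) Num.sqrt (2 * Num.sqrt (f x))^-1.
    exact: is_derive1_sqrt.
  exact: is_derive_chain.
- move=> k f fa [cf df]; split.
    move=> x; apply: (continuous_comp (cf x)).
    exact: is_derive_continuous (is_derive_flat k (f x)).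
  move=> j; have [f' f'a fd] := df j.
  exists (fun x => (flat k.+2 (f x) + (- k%:R) * flat k.+1 (f x)) * f' x).
    apply: SAMul => //; apply: SAAdd; first exact: SAFlat.
    by apply: SAMul; [exact: SACst|exact: SAFlat].
  move=> x; have : is_derive (f x) (1 : R) (flat k) (flat k.+2 (f x) + (- k%:R) * flat k.+1 (f x)).
    by rewrite mulNr; exact: is_derive_flat.
  exact: is_derive_chain.
Qed.

Lemma smooth_alg_smooth f : smooth_alg f -> smooth f.
Proof.
move: f; apply: smooth_class.
- by move=> f /smooth_algP[].
- by move=> f x j /smooth_algP[_ /(_ j)[g _ /(_ x)[]]].
- move=> f j /smooth_algP[_ /(_ j)[g ga fd]].
  suff -> : partial j f = g by [].
  by apply/funext => x; exact: partialE.
Qed.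

Lemma smooth_coord i : smooth (fun x : 'rV[R]_n => x ord0 i).
Proof. exact/smooth_alg_smooth/SACoord. Qed.

Lemma smooth_cst (c : R) : smooth ((fun=> c) : 'rV[R]_n -> R).
Proof. exact/smooth_alg_smooth/SACst. Qed.

Lemma smoothD f g : smooth f -> smooth g -> smooth (fun x => f x + g x).
Proof. by move=> sf sg; apply: smooth_alg_smooth; apply: SAAdd; exact: SABase. Qed.

Lemma smoothM f g : smooth f -> smooth g -> smooth (fun x => f x * g x).
Proof. by move=> sf sg; apply: smooth_alg_smooth; apply: SAMul; exact: SABase. Qed.

Lemma smoothX f k : smooth f -> smooth (fun x => f x ^+ k).
Proof.
move=> sf; elim: k => [|k ih]; first exact: smooth_cst.
by rewrite (_ : (fun x => _) = fun x => f x * f x ^+ k); [exact: smoothM|apply/funext => x; rewrite exprS].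
Qed.

Lemma smooth_sum (I : Type) (r : seq I) (P : pred I) (F : I -> 'rV[R]_n -> R) :
  (forall i, P i -> smooth (F i)) -> smooth (fun x => \sum_(i <- r | P i) F i x).
Proof.
move=> sF; elim: r => [|i r ih].
  rewrite (_ : (fun x => _) = fun=> 0); first exact: smooth_cst.
  by apply/funext => x; rewrite big_nil.
rewrite (_ : (fun x => _) = fun x => (if P i then F i x else 0) + \sum_(i <- r | P i) F i x).
  by apply: smoothD => //; case Pi: (P i); [exact: sF|exact: smooth_cst].
by apply/funext => x; rewrite big_cons; case: ifP; rewrite ?add0r.
Qed.

Lemma smooth_inv f : smooth f -> (forall x, f x != 0) -> smooth (fun x => (f x)^-1).
Proof. by move=> sf f0; apply: smooth_alg_smooth; apply: SAInv => //; exact: SABase. Qed.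

Lemma smooth_sqrt f : smooth f -> (forall x, 0 < f x) -> smooth (fun x => Num.sqrt (f x)).
Proof. by move=> sf f0; apply: smooth_alg_smooth; apply: SASqrt => //; exact: SABase. Qed.

Lemma smooth_flat k f : smooth f -> smooth (fun x => flat k (f x)).
Proof. by move=> sf; apply: smooth_alg_smooth; apply: SAFlat; exact: SABase. Qed.

Lemma partialD f g j x : smooth f -> smooth g ->
  partial j (fun x => f x + g x) x = partial j f x + partial j g x.
Proof.
by move=> sf sg; apply: partialE; apply: is_deriveD; exact: smooth_is_derive.
Qed.

Lemma partialM f g j x : smooth f -> smooth g ->
  partial j (fun x => f x * g x) x = partial j f x * g x + f x * partial j g x.
Proof.
move=> sf sg; apply: partialE; rewrite addrC [X in _ + X]mulrC.
exact: (is_deriveM (smooth_is_derive x j sf) (smooth_is_derive x j sg)).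
Qed.

Lemma partialZ f c j x : smooth f ->
  partial j (fun x => c * f x) x = c * partial j f x.
Proof.
move=> sf; apply: partialE; exact: (is_deriveZ c (smooth_is_derive x j sf)).
Qed.

Lemma partial_cst (c : R) j x : partial j (fun=> c) x = 0.
Proof. by apply: partialE; exact: is_derive_cst. Qed.

Lemma partial_coord i j x : partial j (fun x => x ord0 i) x = (i == j)%:R.
Proof.
apply: partialE; apply: (@is_derive_quadratic _ _ _ _ _ _ 0) => h _.
by rewrite !mxE eqxx/= addrK mul0r normr_le0 subrr.
Qed.

Lemma partial_sum (I : Type) (r : seq I) (P : pred I) (F : I -> 'rV[R]_n -> R) j x :
  (forall i, P i -> smooth (F i)) ->
  partial j (fun x => \sum_(i <- r | P i) F i x) x = \sum_(i <- r | P i) partial j (F i) x.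
Proof.
move=> sF; elim: r => [|i r ih].
  by rewrite (_ : (fun x => _) = fun=> 0) ?partial_cst ?big_nil//; apply/funext=> y; rewrite big_nil.
rewrite big_cons; under [in partial _ _]eq_fun do rewrite big_cons.
case: ifP => // Pi; rewrite partialD ?ih//; first exact: sF.
exact: smooth_sum.
Qed.

Lemma is_derive_affine f (a : 'rV[R]_n) (b : R) x j : smooth f ->
  is_derive x (e_ j) (fun y => f (a + b *: y)) (b * partial j f (a + b *: x)).
Proof.
move=> sf; apply: is_derive_line.
have := line_is_derive (smooth_is_derive (a + b *: x) j sf) => H.
have H0 : is_derive (0 : R) (1 : R) (fun h : R => b * h) b.
  have := @is_deriveZ R R R id b 0 1 _ (is_derive_id (0 : R) (1 : R)).
  by rewrite -[b *: 1]/(b * 1) mulr1.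
have H1 : is_derive ((fun h : R => b * h) 0) (1 : R) (fun h : R => f (h *: e_ j + (a + b *: x))) (partial j f (a + b *: x)).
  by rewrite mulr0.
have := is_derive1_comp H1 H0; rewrite mulrC.
congr (is_derive _ _ _ _); apply/funext => h /=; congr (f _).
by rewrite scalerDr scalerA addrCA.
Qed.

Lemma smooth_affine f (a : 'rV[R]_n) (b : R) : smooth f -> smooth (fun y => f (a + b *: y)).
Proof.
move=> sf.
apply: (@smooth_class _ _ [set g | exists2 f, smooth f & exists c, g = fun y => c * f (a + b *: y)]).
- move=> _ [{}f {}sf [c ->]] x.
  apply: continuousM; first exact: cst_continuous.
  have ca : {for x, continuous (fun y : 'rV[R]_n => a + b *: y)}.
    by apply: continuousD; [exact: cst_continuous|exact: scaler_continuous].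
  change {for x, continuous (f \o (fun y : 'rV[R]_n => a + b *: y))}.
  by apply: continuous_comp => //; exact: smooth_continuous.
- move=> _ x j [{}f {}sf [c ->]].
  by have [] := is_deriveZ c (is_derive_affine a b x j sf).
- move=> _ j [{}f {}sf [c ->]]; exists (partial j f); first exact: smooth_partial.
  exists (c * b); apply/funext => x; apply: partialE; rewrite -mulrA.
  exact: (is_deriveZ c (is_derive_affine a b x j sf)).
- by exists f => //; exists 1; apply/funext => y; rewrite mul1r.
Qed.

Lemma partial_affine f (a : 'rV[R]_n) (b : R) x j : smooth f ->
  partial j (fun y => f (a + b *: y)) x = b * partial j f (a + b *: x).
Proof. by move=> sf; apply: partialE; exact: is_derive_affine. Qed.

End smooth_algebra.

(** * Real-valued integrals over R^n *)

Section real_integral.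
Context {R : realType} {n : nat}.
Notation mu := (@lebesgue_rV R n).
Implicit Types (f g : 'rV[R]_n -> R).

Lemma cube_fin (a : 'rV[R]_n) (r : R) : (mu [set x | `|x - a| <= r]%R < +oo)%E.
Proof.
have [r0|r0] := leP 0 r; first by rewrite lebesgue_rV_cube// ltry.
rewrite (_ : [set x | _] = set0) ?measure0//; apply/seteqP; split => // x /= h.
by have := le_trans (normr_ge0 _) h; rewrite leNgt r0.
Qed.

Lemma measurable_cube (a : 'rV[R]_n) (r : R) : measurable [set x | `|x - a| <= r].
Proof.
apply: closed_measurable_rV.
apply: (@closed_comp _ _ (fun x : 'rV[R]_n => `|x - a|) [set t : R | t <= r]); last exact: closed_le.
move=> x _; apply: continuous_comp; last exact: norm_continuous.
by apply: continuousB; [by []|exact: cst_continuous].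
Qed.

Lemma integrable_bounded_support f (C r : R) : measurable_fun setT f ->
  (forall x, `|f x| <= C) -> (forall x, r < `|x| -> f x = 0) ->
  mu.-integrable setT (EFin \o f).
Proof.
move=> mf fC fr.
have mB := measurable_cube 0 r.
have : mu.-integrable [set x | `|x - 0| <= r] (EFin \o f).
  apply: measurable_bounded_integrable => //; first exact: cube_fin.
    exact: measurable_funS mf.
  exists C; split; first exact: num_real.
  by move=> M CM x _ /=; rewrite (le_trans (fC x))// ltW.
move/(integrable_mkcond _ mB).1; congr (integrable _ _ _).
apply/funext => x; rewrite patchE/=; case: ifPn => //.
rewrite notin_setE/= subr0 => /negP; rewrite -ltNge => /fr ->//.
Qed.

Lemma integrable_cube (a : 'rV[R]_n) (r : R) :
  mu.-integrable setT (EFin \o (\1_[set x | `|x - a| <= r] : 'rV[R]_n -> R)).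
Proof.
apply: (@integrable_bounded_support _ 1 (r + `|a|)) => [|x|x xr].
- by apply: measurable_indic; exact: measurable_cube.
- by rewrite indicE; case: (x \in _); rewrite ?normr1 ?normr0.
rewrite indicE memNset//= => xr'; have := ler_normD (x - a) a.
by rewrite subrK; lra.
Qed.

Lemma Rintegral_cube (a : 'rV[R]_n) (r : R) : 0 <= r ->
  \int[mu]_x (\1_[set x | `|x - a| <= r] x : R) = (2 * r) ^+ n.
Proof.
move=> r0; rewrite /Rintegral integral_indic ?setIT//; last exact: measurable_cube.
transitivity (fine ((2 * r) ^+ n)%:E) => //.
by congr fine; exact: lebesgue_rV_cube.
Qed.

Lemma Rintegral_reflect f (a : 'rV[R]_n) : measurable_fun setT f ->
  \int[mu]_x f (a - x) = \int[mu]_x f x.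
Proof.
move=> mf; rewrite /Rintegral; congr fine.
rewrite [LHS]integralE [RHS]integralE; congr (_ - _)%E.
  rewrite -[RHS](integral_reflect a) => [||x]; last exact: funepos_ge0.
  by apply: eq_integral => x _; rewrite !unlock.
  by apply: measurable_funepos; exact/measurable_EFinP.
rewrite -[RHS](integral_reflect a) => [||x]; last exact: funeneg_ge0.
  by apply: eq_integral => x _; rewrite !unlock.
by apply: measurable_funeneg; exact/measurable_EFinP.
Qed.

Lemma Rintegral_translate f (a : 'rV[R]_n) : measurable_fun setT f ->
  \int[mu]_x f (x + a) = \int[mu]_x f x.
Proof.
move=> mf; rewrite /Rintegral; congr fine.
rewrite [LHS]integralE [RHS]integralE; congr (_ - _)%E.
  rewrite -[RHS](integral_translate a) => [||x]; last exact: funepos_ge0.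
  by apply: eq_integral => x _; rewrite !unlock.
  by apply: measurable_funepos; exact/measurable_EFinP.
rewrite -[RHS](integral_translate a) => [||x]; last exact: funeneg_ge0.
  by apply: eq_integral => x _; rewrite !unlock.
by apply: measurable_funeneg; exact/measurable_EFinP.
Qed.

Lemma Rintegral_sum (I : Type) (s : seq I) (P : pred I) (h : I -> 'rV[R]_n -> R) :
  (forall i, P i -> mu.-integrable setT (EFin \o h i)) ->
  \int[mu]_x (\sum_(i <- s | P i) h i x) = \sum_(i <- s | P i) \int[mu]_x h i x.
Proof.
move=> ih; elim: s => [|i s IH].
  by rewrite big_nil; under eq_Rintegral do rewrite big_nil; rewrite Rintegral_cst// mul0r.
rewrite big_cons; under eq_Rintegral do rewrite big_cons.
case: ifPn => // Pi; rewrite RintegralD//; last 2 first.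
- exact: ih.
- rewrite (_ : EFin \o _ = fun x => (\sum_(i <- s | P i) (h i x)%:E)%E).
    by apply: integrable_sum => // j Pj; exact: ih.
  by apply/funext => x /=; rewrite sumEFin.
by rewrite IH.
Qed.

Lemma integrable_sumR (I : Type) (s : seq I) (P : pred I) (h : I -> 'rV[R]_n -> R) :
  (forall i, P i -> mu.-integrable setT (EFin \o h i)) ->
  mu.-integrable setT (EFin \o (fun x => \sum_(i <- s | P i) h i x)).
Proof.
move=> ih; rewrite (_ : EFin \o _ = fun x => (\sum_(i <- s | P i) (h i x)%:E)%E).
  by apply: integrable_sum => // j Pj; exact: ih.
by apply/funext => x /=; rewrite sumEFin.
Qed.

Lemma integrableDR f g : mu.-integrable setT (EFin \o f) ->
  mu.-integrable setT (EFin \o g) ->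
  mu.-integrable setT (EFin \o (fun x => f x + g x)).
Proof. by move=> fi gi; exact: (integrableD measurableT fi gi). Qed.

Lemma integrableBR f g : mu.-integrable setT (EFin \o f) ->
  mu.-integrable setT (EFin \o g) ->
  mu.-integrable setT (EFin \o (fun x => f x - g x)).
Proof. by move=> fi gi; exact: (integrableB measurableT fi gi). Qed.

Lemma integrableZR (c : R) f : mu.-integrable setT (EFin \o f) ->
  mu.-integrable setT (EFin \o (fun x => c * f x)).
Proof. by move=> fi; exact: (integrableZl measurableT c fi). Qed.

Lemma integrable_bddM f g (C : R) : measurable_fun setT f -> (forall x, `|f x| <= C) ->
  mu.-integrable setT (EFin \o g) -> mu.-integrable setT (EFin \o (fun x => f x * g x)).
Proof.
move=> mf fC ig; have mg : measurable_fun setT g by have /measurable_int/measurable_EFinP := ig.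
apply: (le_integrable measurableT _ _ (integrableZR C (integrable_norm ig))).
  by apply/measurable_EFinP; exact: measurable_funM.
move=> x _ /=; rewrite lee_fin !normrM normr_id ler_wpM2r// (le_trans (fC x))//.
exact: ler_norm.
Qed.

Lemma Rintegral_le_bound f g (C : R) : measurable_fun setT f -> (forall x, `|f x| <= C) ->
  mu.-integrable setT (EFin \o g) ->
  `|\int[mu]_x (f x * g x)| <= C * \int[mu]_x `|g x|.
Proof.
move=> mf fC ig; rewrite -RintegralZl//; last exact: integrable_norm.
have := integrable_bddM mf fC ig => ifg.
apply: le_trans (le_normr_Rintegral _ ifg) _ => //.
apply: le_Rintegral => //; first exact: integrable_norm.
  exact/integrableZR/integrable_norm.
by move=> x _; rewrite normrM ler_wpM2r.
Qed.

End real_integral.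

(** * Test functions, uniform Taylor bounds, integrals of derivatives *)

Section test_functions.
Context {R : realType} {n : nat}.
Notation mu := (@lebesgue_rV R n).
Notation e_ j := (delta_mx ord0 j : 'rV[R]_n).
Implicit Types (f g phi : 'rV[R]_n -> R) (x y : 'rV[R]_n).

(** Equivalent to [test_function setT]; the support is replaced by a radius, the form in which
    estimates use it. *)
Definition csmooth phi := smooth phi /\ exists r, forall x, r < `|x| -> phi x = 0.

Lemma closed_cball (a : 'rV[R]_n) (r : R) : closed [set x | `|x - a| <= r].
Proof.
apply: (@closed_comp _ _ (fun x : 'rV[R]_n => `|x - a|) [set t : R | t <= r]); last exact: closed_le.
move=> x _; apply: continuous_comp; last exact: norm_continuous.
by apply: continuousB; [by []|exact: cst_continuous].
Qed.

Lemma compact_cball (r : R) : compact [set x : 'rV[R]_n | `|x| <= r].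
Proof.
apply: bounded_closed_compact; last first.
  by have := @closed_cball 0 r; under eq_set do rewrite subr0.
exists r; split; first exact: num_real.
by move=> M rM x /= h; rewrite (le_trans h)// ltW.
Qed.

Lemma csmooth_test phi : csmooth phi -> test_function setT phi.
Proof.
move=> [sp [r pr]]; split => //.
have cl := @closed_cball 0 r.
apply: (@subclosed_compact _ _ [set x | `|x| <= r]); first exact: closed_closure.
  exact: compact_cball.
have cl' : closed [set x : 'rV[R]_n | `|x| <= r] by move: cl; under eq_set do rewrite subr0.
apply: subset_trans cl'; apply: closure_subset => x /=.
by apply: contraNT; rewrite -ltNge => /pr ->; rewrite eqxx.
Qed.

Lemma test_csmooth (D : set 'rV[R]_n) phi : test_function D phi -> csmooth phi.
Proof.
move=> [sp /compact_bounded[M [_ HM]] _]; split => //; exists (M + 1) => x xM.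
apply: contraTeq xM => px; rewrite -leNgt.
by apply: (HM (M + 1)); [rewrite ltrDl|exact: subset_closure].
Qed.

Lemma near_norm_gt (r : R) x : r < `|x| -> \forall y \near x, r < `|y|.
Proof. by move=> rx; exact: (cvgr_gt _ (@norm_continuous _ _ x) _ rx). Qed.

Lemma partial_near0 f j x : (\forall y \near x, f y = 0) -> partial j f x = 0.
Proof.
move=> f0; rewrite /partial -(@near_eq_derive _ _ _ (cst 0)); first exact: derive_cst.
by near=> y; apply/esym; near: y.
Unshelve. all: by end_near.
Qed.

Lemma csmooth_partial phi j : csmooth phi -> csmooth (partial j phi).
Proof.
move=> [sp [r pr]]; split; first exact: smooth_partial.
exists r => x rx; apply: partial_near0.
near=> y; apply: pr; near: y; exact: near_norm_gt.
Unshelve. all: by end_near.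
Qed.

Lemma csmoothD f g : csmooth f -> csmooth g -> csmooth (fun x => f x + g x).
Proof.
move=> [sf [r fr]] [sg [s gs]]; split; first exact: smoothD.
exists (Num.max r s) => x; rewrite gt_max => /andP[rx sx].
by rewrite fr// gs// addr0.
Qed.

Lemma csmoothMl f g : csmooth f -> smooth g -> csmooth (fun x => f x * g x).
Proof.
move=> [sf [r fr]] sg; split; first exact: smoothM.
by exists r => x rx; rewrite fr// mul0r.
Qed.

Lemma csmoothMr f g : smooth f -> csmooth g -> csmooth (fun x => f x * g x).
Proof.
move=> sf [sg [r fr]]; split; first exact: smoothM.
by exists r => x rx; rewrite fr// mulr0.
Qed.

Lemma csmoothZ (c : R) f : csmooth f -> csmooth (fun x => c * f x).
Proof. by move=> cf; apply: csmoothMr => //; exact: smooth_cst. Qed.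

Lemma csmooth0 : csmooth (fun=> 0).
Proof. by split; [exact: smooth_cst|exists 0]. Qed.

Lemma csmooth_sum (I : Type) (r : seq I) (P : pred I) (F : I -> 'rV[R]_n -> R) :
  (forall i, P i -> csmooth (F i)) -> csmooth (fun x => \sum_(i <- r | P i) F i x).
Proof.
move=> sF; elim: r => [|i r ih].
  rewrite (_ : (fun x => _) = fun=> 0); first exact: csmooth0.
  by apply/funext => x; rewrite big_nil.
rewrite (_ : (fun x => _) = fun x => (if P i then F i x else 0) + \sum_(i <- r | P i) F i x).
  by apply: csmoothD => //; case Pi: (P i); [exact: sF|exact: csmooth0].
by apply/funext => x; rewrite big_cons; case: ifP; rewrite ?add0r.
Qed.

Lemma csmooth_affine f (a : 'rV[R]_n) (b : R) : b != 0 -> csmooth f ->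
  csmooth (fun y => f (a + b *: y)).
Proof.
move=> b0 [sf [r fr]]; split; first exact: smooth_affine.
have b0' : 0 < `|b| by rewrite normr_gt0.
exists ((r + `|a|) / `|b|) => x; rewrite ltr_pdivrMr// => h; apply: fr.
rewrite -ltrBrDr in h; rewrite (lt_le_trans h)// lerBlDr mulrC -normrZ.
by have := ler_normB (a + b *: x) a; rewrite addrAC subrr add0r.
Qed.

Lemma csmooth_bounded f : csmooth f -> exists2 C, 0 < C & forall x, `|f x| <= C.
Proof.
move=> [sf [r fr]].
have cf := smooth_continuous sf.
have : compact (f @` [set x | `|x| <= r]).
  by apply: continuous_compact; [exact: continuous_subspaceT|exact: compact_cball].
move=> /compact_bounded[M [_ HM]].
exists (`|M| + 1); first by rewrite ltr_wpDl.
move=> x; have [xr|xr] := leP `|x| r.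
  by apply: HM; [rewrite (le_lt_trans (ler_norm _))// ltrDl|exists x].
by rewrite fr// normr0 addr_ge0.
Qed.

Lemma smooth_measurable f : smooth f -> measurable_fun setT f.
Proof. by move=> /smooth_continuous; exact: continuous_measurable_rV. Qed.

Lemma csmooth_integrable f : csmooth f -> mu.-integrable setT (EFin \o f).
Proof.
move=> cf; have [C _ fC] := csmooth_bounded cf; have [sf [r fr]] := cf.
by apply: integrable_bounded_support fC fr; exact: smooth_measurable.
Qed.

Lemma is_derive_along f x j (t : R) : smooth f ->
  is_derive t (1 : R) (fun h : R => f (h *: e_ j + x)) (partial j f (t *: e_ j + x)).
Proof.
move=> sf; have := line_is_derive (smooth_is_derive (t *: e_ j + x) j sf) => H.
have H1 : is_derive ((fun h : R => h - t) t) (1 : R) (fun h : R => f (h *: e_ j + (t *: e_ j + x)))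
   (partial j f (t *: e_ j + x)) by rewrite /= subrr.
have H0 : is_derive t (1 : R) (fun h : R => h - t) 1.
  have := is_deriveB (is_derive_id t (1 : R)) (is_derive_cst t t (1 : R)).
  by rewrite subr0.
have := @is_derive1_comp R (fun h : R => f (h *: e_ j + (t *: e_ j + x))) (fun h : R => h - t) t _ _ H1 H0.
rewrite mulr1; congr (is_derive _ _ _ _); apply/funext => h /=.
by rewrite addrA -scalerDl subrK.
Qed.

Lemma mean_value_along f x j (h : R) : smooth f ->
  exists t, `|t| <= `|h| /\ f (h *: e_ j + x) - f x = h * partial j f (t *: e_ j + x).
Proof.
move=> sf; pose g (t : R) := f (t *: e_ j + x).
pose g' (t : R) := partial j f (t *: e_ j + x).
have dg (t : R) : is_derive t (1 : R) g (g' t) by exact: is_derive_along.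
have cg a b : {within `[a, b], continuous g}.
  by apply: continuous_subspaceT => t; exact: is_derive_continuous (dg t).
have gh : f (h *: e_ j + x) - f x = g h - g 0 by rewrite /g scale0r add0r.
rewrite gh; have [h0|h0] := leP 0 h.
  have [t] := MVT_segment h0 (fun t _ => dg t) (cg _ _).
  rewrite in_itv/= => /andP[t0 th] ->; exists t; split; first by rewrite !ger0_norm.
  by rewrite subr0 mulrC.
have [t] := MVT_segment (ltW h0) (fun t _ => dg t) (cg _ _).
rewrite in_itv/= => /andP[t0 th] e; exists t; split.
  by rewrite !ler0_norm ?lerN2// ltW.
by rewrite -opprB e sub0r mulrN opprK mulrC.
Qed.

(** Move from [y] to [x] one coordinate at a time, with the mean value theorem along each axis;
    [z k] already has the first [k] coordinates of [x]. *)
Lemma lipschitz_of_partial f (L : R) : smooth f ->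
  (forall j x, `|partial j f x| <= L) ->
  forall x y, `|f x - f y| <= n%:R * L * `|x - y|.
Proof.
move=> sf fL x y.
pose z (k : nat) : 'rV[R]_n := \row_i (if (i < k)%N then x ord0 i else y ord0 i).
suff H k : (k <= n)%N -> `|f (z k) - f y| <= k%:R * L * `|x - y|.
  have := H n (leqnn n); rewrite (_ : z n = x)//.
  by apply/rowP => i; rewrite mxE ltn_ord.
elim: k => [_|k ih kn].
  rewrite (_ : z 0%N = y); first by rewrite subrr normr0 !mul0r.
  by apply/rowP => i; rewrite mxE.
have zk : z k.+1 = (x - y) ord0 (Ordinal kn) *: e_ (Ordinal kn) + z k.
  apply/rowP => i; rewrite !mxE eqxx/= ltnS.
  have [ik|ik|ik] := ltngtP i k.
  - by rewrite (_ : (i == Ordinal kn) = false) ?mulr0 ?add0r//; apply/eqP => E; rewrite E /= ltnn in ik.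
  - by rewrite (_ : (i == Ordinal kn) = false) ?mulr0 ?add0r//; apply/eqP => E; rewrite E /= ltnn in ik.
  - have -> : i = Ordinal kn by apply: val_inj.
    by rewrite eqxx mulr1 subrK.
rewrite -(subrKA (f (z k))) (le_trans (ler_normD _ _))// -natr1 mulrDl mulrDl mul1r addrC.
rewrite lerD ?ih// 1?ltnW//.
rewrite zk; have [t [_ ->]] := mean_value_along (z k) (Ordinal kn) ((x - y) ord0 (Ordinal kn)) sf.
by rewrite normrM mulrC ler_pM// le_coord_norm.
Qed.

Lemma csmooth_lipschitz f : csmooth f -> exists2 L, 0 < L & forall x y, `|f x - f y| <= L * `|x - y|.
Proof.
move=> cf.
have /all_sig2[C _ fC] : forall j, {C : R | 0 < C & forall x, `|partial j f x| <= C}.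
  by move=> j; apply/cid2; exact/csmooth_bounded/csmooth_partial.
have fC' j x : `|partial j f x| <= \sum_i `|C i|.
  rewrite (le_trans (fC j x))// (bigD1 j)//= (le_trans (ler_norm _))// lerDl.
  exact: sumr_ge0.
exists (n%:R * (\sum_i `|C i|) + 1); first by rewrite ltr_wpDl// mulr_ge0// sumr_ge0.
move=> x y; rewrite (le_trans (lipschitz_of_partial cf.1 fC' x y))//.
by rewrite ler_wpM2r// lerDl.
Qed.

Lemma csmooth_taylor f j : csmooth f -> exists2 C, 0 < C & forall x (h : R),
  `|f (h *: e_ j + x) - f x - h * partial j f x| <= C * h ^+ 2.
Proof.
move=> cf; have [L L0 fL] := csmooth_lipschitz (csmooth_partial j cf).
exists L => // x h; have [t [th ->]] := mean_value_along x j h cf.1.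
rewrite -mulrBr normrM -real_normK ?num_real// expr2 mulrCA ler_wpM2l//.
rewrite (le_trans (fL _ _))// ler_wpM2l ?(ltW L0)//.
rewrite addrK normrZ (le_trans _ th)// ler_piMr// norm_le_rV// => i.
by rewrite mxE eqxx/=; case: (i == j); rewrite ?normr1 ?normr0.
Qed.

(** Instead of Fubini and the fundamental theorem of calculus: translation invariance gives f(x + h
    e_j) and f(x) the same integral, so h times the wanted integral is minus the integral of the
    Taylor remainder. That remainder is O(h^2) on a fixed cube; divide by h and let h tend to 0. *)
Lemma Rintegral_partial0 f j : csmooth f -> \int[mu]_x partial j f x = 0.
Proof.
move=> cf; have [C C0 fC] := csmooth_taylor j cf.
have [sf [r fr]] := cf.
pose B := [set x : 'rV[R]_n | `|x - 0| <= `|r| + 1].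
have mB : measurable B := measurable_cube 0 (`|r| + 1).
have iB := integrable_cube 0 (`|r| + 1).
set v := \int[mu]_x (\1_B x : R).
have v0 : 0 <= v by apply: Rintegral_ge0 => x _; rewrite indicE.
apply/eqP; rewrite -normr_eq0 eq_le normr_ge0 andbT.
apply/ler_addgt0Pr => e e0; rewrite add0r.
(* h <= 1 keeps the translated support inside the cube [B] of radius |r| + 1; the second bound makes
   C h v <= e. *)
pose h := Num.min 1 (e / (C * v + 1)).
have cv : 0 < C * v + 1 by rewrite ltr_wpDl// mulr_ge0// ltW.
have h0 : 0 < h by rewrite lt_min ltr01 divr_gt0.
have h1 : h <= 1 by rewrite ge_min lexx.
have mf := smooth_measurable sf.
have if_ := csmooth_integrable cf.
have ip := csmooth_integrable (csmooth_partial j cf).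
have ift : mu.-integrable setT (EFin \o (fun x => f (x + h *: e_ j))).
  have := csmooth_integrable (csmooth_affine (h *: e_ j) (oner_neq0 R) cf).
  by congr (integrable _ _ (_ \o _)); apply/funext => x; rewrite scale1r addrC.
have E : h * \int[mu]_x partial j f x =
    - \int[mu]_x (f (x + h *: e_ j) - f x - h * partial j f x).
  rewrite RintegralB//; [|exact: integrableBR|exact: integrableZR].
  rewrite RintegralB// Rintegral_translate// subrr sub0r opprK RintegralZl//.
have : h * `|\int[mu]_x partial j f x| <= C * h ^+ 2 * v.
  rewrite -{1}(gtr0_norm h0) -normrM E normrN.
  apply: le_trans (le_normr_Rintegral _ _) _ => //.
    by apply: integrableBR; [exact: integrableBR|exact: integrableZR].
  rewrite -RintegralZl//; apply: le_Rintegral => //.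
  - apply: integrable_norm.
    by apply: integrableBR; [exact: integrableBR|exact: integrableZR].
  - exact: integrableZR.
  move=> x _; rewrite indicE; have [xB|xB] := boolP (x \in B).
    by rewrite mulr1 (addrC x).
  rewrite mulr0; move: xB; rewrite notin_setE /B/= subr0 => /negP; rewrite -ltNge => xr.
  have rx : r < `|x|.
    by rewrite (le_lt_trans (ler_norm _))// (le_lt_trans _ xr)// lerDl.
  rewrite !fr//.
    have [_ [s ps]] := csmooth_partial j cf.
    rewrite (@partial_near0 f)//; last by near=> y; apply: fr; near: y; exact: near_norm_gt.
    by rewrite mulr0 !subr0 normr0.
  have := lerB_dist x (- (h *: e_ j)); rewrite opprK normrN.
  have : `|h *: e_ j| <= 1.
    rewrite normrZ gtr0_norm// (le_trans _ h1)// ler_piMr//; first exact: ltW.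
    rewrite norm_le_rV// => i.
    by rewrite mxE eqxx/=; case: (i == j); rewrite ?normr1 ?normr0.
  by have := ler_norm r; lra.
rewrite expr2 mulrCA -mulrA ler_pM2l// => H; rewrite (le_trans H)//.
have : h <= e / (C * v + 1) by rewrite ge_min lexx orbT.
rewrite ler_pdivlMr// => H2; rewrite (le_trans _ H2)//.
by rewrite mulrAC mulrC ler_wpM2l ?(ltW h0)// lerDl.
Unshelve. all: by end_near.
Qed.

End test_functions.

(** * Mollifiers and regularised Cauchy kernels *)

Section convolution.
Context {R : realType} {n : nat}.
Notation mu := (@lebesgue_rV R n).
Notation e_ j := (delta_mx ord0 j : 'rV[R]_n).
Notation L1 g := (mu.-integrable setT (EFin \o g)).
Implicit Types (K f g phi : 'rV[R]_n -> R) (x y : 'rV[R]_n).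

Definition convol K g x := \int[mu]_y (K (x - y) * g y).

Lemma integrable_measurable g : L1 g -> measurable_fun setT g.
Proof. by move=> /measurable_int/measurable_EFinP. Qed.

Lemma csmooth_reflect x K : csmooth K -> csmooth (fun y => K (x - y)).
Proof.
move=> cK; have m1 : (-1 : R) != 0 by rewrite oppr_eq0 oner_eq0.
have := csmooth_affine x m1 cK.
by congr csmooth; apply/funext => y; rewrite scaleN1r.
Qed.

Lemma partial_reflect x K j y : csmooth K ->
  partial j (fun y => K (x - y)) y = - partial j K (x - y).
Proof.
move=> cK; have E : (fun y => K (x - y)) = (fun y => K (x + (-1) *: y)).
  by apply/funext => z; rewrite scaleN1r.
by rewrite E (partial_affine _ _ _ _ cK.1) mulN1r scaleN1r.
Qed.

Lemma integrable_conv K g x : csmooth K -> L1 g -> L1 (fun y => K (x - y) * g y).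
Proof.
move=> cK ig; have [C _ fC] := csmooth_bounded cK.
have cK' := csmooth_reflect x cK.
by apply: integrable_bddM ig => //; exact: smooth_measurable cK'.1.
Qed.

Lemma conv_bound K g (C : R) x : csmooth K -> (forall x, `|K x| <= C) -> L1 g ->
  `|convol K g x| <= C * \int[mu]_y `|g y|.
Proof.
move=> cK KC ig; apply: Rintegral_le_bound => //.
exact: smooth_measurable (csmooth_reflect x cK).1.
Qed.

Lemma convDl K K' g x : csmooth K -> csmooth K' -> L1 g ->
  convol (fun z => K z + K' z) g x = convol K g x + convol K' g x.
Proof.
move=> cK cK' ig; rewrite /convol -RintegralD//; try exact: integrable_conv.
by apply: eq_Rintegral => y _; rewrite mulrDl.
Qed.

Lemma convZl K c g x : csmooth K -> L1 g ->
  convol (fun z => c * K z) g x = c * convol K g x.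
Proof.
move=> cK ig; rewrite /convol -RintegralZl//; last exact: integrable_conv.
by apply: eq_Rintegral => y _; rewrite mulrA.
Qed.

Lemma convDr K f g x : csmooth K -> L1 f -> L1 g ->
  convol K (fun z => f z + g z) x = convol K f x + convol K g x.
Proof.
move=> cK if_ ig; rewrite /convol -RintegralD//; try exact: integrable_conv.
by apply: eq_Rintegral => y _; rewrite mulrDr.
Qed.

Lemma convZr K c g x : csmooth K -> L1 g ->
  convol K (fun z => c * g z) x = c * convol K g x.
Proof.
move=> cK ig; rewrite /convol -RintegralZl//; last exact: integrable_conv.
by apply: eq_Rintegral => y _; rewrite mulrCA.
Qed.

Lemma conv_suml (I : Type) (r : seq I) (P : pred I) (F : I -> 'rV[R]_n -> R) g x :
  (forall i, P i -> csmooth (F i)) -> L1 g ->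
  convol (fun z => \sum_(i <- r | P i) F i z) g x = \sum_(i <- r | P i) convol (F i) g x.
Proof.
move=> cF ig; rewrite /convol -Rintegral_sum => [|i Pi]; last exact/integrable_conv/ig/cF.
by apply: eq_Rintegral => y _; rewrite mulr_suml.
Qed.

Lemma conv_sumr (I : Type) (r : seq I) (P : pred I) (F : I -> 'rV[R]_n -> R) K x :
  csmooth K -> (forall i, P i -> L1 (F i)) ->
  convol K (fun z => \sum_(i <- r | P i) F i z) x = \sum_(i <- r | P i) convol K (F i) x.
Proof.
move=> cK iF; rewrite /convol -Rintegral_sum => [|i Pi]; last exact/integrable_conv/iF.
by apply: eq_Rintegral => y _; rewrite mulr_sumr.
Qed.

Lemma lipschitz_continuous f (L : R) : 0 < L ->
  (forall x y, `|f x - f y| <= L * `|x - y|) -> continuous f.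
Proof.
move=> L0 h x; apply/(@cvgrPdist_le _ _ _ (nbhs x) (nbhs_filter x)) => e e0.
apply: filterS (nbhsx_ballx x (e / L) (divr_gt0 e0 L0)) => y.
rewrite -ball_normE/= => xy; rewrite (le_trans (h x y))// -ler_pdivlMl// mulrC.
exact: ltW.
Qed.

Lemma conv_lipschitz K g : csmooth K -> L1 g ->
  exists2 L, 0 < L & forall x y, `|convol K g x - convol K g y| <= L * `|x - y|.
Proof.
move=> cK ig; have [L L0 KL] := csmooth_lipschitz cK.
have i0 : 0 <= \int[mu]_y `|g y| by apply: Rintegral_ge0 => y _.
exists (L * (\int[mu]_y `|g y|) + 1); first by rewrite ltr_wpDl// mulr_ge0// ltW.
move=> x y; rewrite /convol -RintegralB//; try exact: integrable_conv.
under eq_Rintegral do rewrite -mulrBl.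
apply: (@le_trans _ _ (L * `|x - y| * \int[mu]_y `|g y|)).
  apply: Rintegral_le_bound => //.
    by apply: measurable_funB; exact: smooth_measurable (csmooth_reflect _ cK).1.
  move=> z; rewrite (le_trans (KL _ _))//.
  by rewrite opprD addrACA opprK addNr addr0.
by rewrite mulrAC ler_wpM2r// lerDl.
Qed.

(** The Taylor bound of [K] is uniform in the base point, so it may be integrated against [g]; no
    dominated convergence is involved. *)
Lemma is_derive_conv K g x j : csmooth K -> L1 g ->
  is_derive x (e_ j) (convol K g) (convol (partial j K) g x).
Proof.
move=> cK ig; have [C C0 KC] := csmooth_taylor j cK.
have cpK := csmooth_partial j cK.
apply: (@is_derive_quadratic _ _ _ _ _ _ (C * \int[mu]_y `|g y|)) => h _.
have ->: convol K g (h *: e_ j + x) - convol K g x - h * convol (partial j K) g x =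
   \int[mu]_y ((K (h *: e_ j + (x - y)) - K (x - y) - h * partial j K (x - y)) * g y).
  rewrite /convol -RintegralZl//; last exact: integrable_conv.
  rewrite -RintegralB//; [|exact: integrable_conv|exact: integrable_conv].
  rewrite -RintegralB//; last exact/integrableZR/integrable_conv.
    by apply: eq_Rintegral => y _; rewrite addrA; ring.
  by apply: integrableBR; exact: integrable_conv.
rewrite mulrAC; apply: Rintegral_le_bound => //.
apply: measurable_funB.
  apply: measurable_funB; last exact: smooth_measurable (csmooth_reflect _ cK).1.
  under eq_fun do rewrite addrA.
  exact: smooth_measurable (csmooth_reflect _ cK).1.
apply: measurable_funM => //.
exact: smooth_measurable (csmooth_reflect _ cpK).1.
Qed.

Lemma smooth_conv K g : csmooth K -> L1 g -> smooth (convol K g).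
Proof.
move=> cK ig.
apply: (@smooth_class _ _ [set f | exists2 K, csmooth K & f = convol K g]).
- by move=> _ [{}K {}cK ->]; have [L L0 h] := conv_lipschitz cK ig; exact: lipschitz_continuous h.
- by move=> _ x j [{}K {}cK ->]; have [] := is_derive_conv x j cK ig.
- move=> _ j [{}K {}cK ->]; exists (partial j K); first exact: csmooth_partial.
  by apply/funext => x; apply: partialE; exact: is_derive_conv.
- by exists K.
Qed.

Lemma partial_conv K g j x : csmooth K -> L1 g ->
  partial j (convol K g) x = convol (partial j K) g x.
Proof. by move=> cK ig; apply: partialE; exact: is_derive_conv. Qed.

Lemma conv_support K g (r s : R) x : (forall x, r < `|x| -> K x = 0) ->
  (forall x, s < `|x| -> g x = 0) -> r + s < `|x| -> convol K g x = 0.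
Proof.
move=> Kr gs rsx; rewrite /convol; under eq_Rintegral => y _.
  rewrite (_ : _ * _ = 0); last first.
    have [ys|/gs->] := leP `|y| s; last by rewrite mulr0.
    rewrite Kr ?mul0r//; have := ler_normD (x - y) y; rewrite subrK; lra.
  over.
by rewrite Rintegral_cst// mul0r.
Qed.

Lemma csmooth_conv K g (s : R) : csmooth K -> L1 g ->
  (forall x, s < `|x| -> g x = 0) -> csmooth (convol K g).
Proof.
move=> cK ig gs; split; first exact: smooth_conv.
by have [_ [r Kr]] := cK; exists (r + s) => x; exact: conv_support.
Qed.

Lemma conv_by_parts K g j x : csmooth K -> csmooth g ->
  convol (partial j K) g x = convol K (partial j g) x.
Proof.
move=> cK cg.
have cK' := csmooth_reflect x cK.
have cpK := csmooth_partial j cK; have cpg := csmooth_partial j cg.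
have := Rintegral_partial0 j (csmoothMl cK' cg.1).
have E y : partial j (fun y => K (x - y) * g y) y =
    K (x - y) * partial j g y - partial j K (x - y) * g y.
  by rewrite (partialM _ _ cK'.1 cg.1) partial_reflect// mulNr addrC.
under eq_Rintegral do rewrite E.
rewrite RintegralB//; try exact/integrable_conv/csmooth_integrable.
by move=> /eqP; rewrite subr_eq0 => /eqP /esym.
Qed.

End convolution.

(** * The regularised kernel x_j / |x|^n and the mollifier *)

Section kernel.
Context {R : realType} {n : nat}.
Notation mu := (@lebesgue_rV R n).
Implicit Types (f g : 'rV[R]_n -> R) (x y : 'rV[R]_n) (t s : R).

Lemma partialX f k j x : smooth f ->
  partial j (fun x => f x ^+ k) x = k%:R * f x ^+ k.-1 * partial j f x.
Proof.
move=> sf; elim: k => [|k ih].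
  by under [in partial _ _]eq_fun do rewrite expr0; rewrite partial_cst !mul0r.
under [in partial _ _]eq_fun do rewrite exprS.
rewrite (partialM j x sf (smoothX k sf)) ih; case: k {ih} => [|k]; first by rewrite expr0; ring.
by rewrite /= exprS -[k.+2%:R]natr1; ring.
Qed.

Lemma partial_flat f k j x : smooth f ->
  partial j (fun x => flat k (f x)) x =
  (flat k.+2 (f x) - k%:R * flat k.+1 (f x)) * partial j f x.
Proof.
move=> sf; apply: partialE.
exact: (is_derive_chain (smooth_is_derive x j sf) (is_derive_flat k (f x))).
Qed.

Definition sqn x : R := \sum_i x ord0 i ^+ 2.

Lemma sqn_ge0 x : 0 <= sqn x.
Proof. by apply: sumr_ge0 => i _; exact: sqr_ge0. Qed.

Lemma sqnZ (c : R) x : sqn (c *: x) = c ^+ 2 * sqn x.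
Proof. by rewrite /sqn mulr_sumr; apply: eq_bigr => i _; rewrite mxE exprMn. Qed.

Lemma norm_sqn x : `|x| ^+ 2 <= sqn x.
Proof.
have h : `|x| <= Num.sqrt (sqn x).
  apply: norm_le_rV => [|i]; first exact: sqrtr_ge0.
  rewrite -sqrtr_sqr ler_wsqrtr// /sqn (bigD1 i)//= lerDl.
  by apply: sumr_ge0 => k _; exact: sqr_ge0.
by rewrite -[leRHS]sqr_sqrtr ?sqn_ge0// lerXn2r ?nnegrE ?sqrtr_ge0.
Qed.

Lemma sqn_ge1 x : 1 <= `|x| -> 1 <= sqn x.
Proof. by move=> h; rewrite (le_trans _ (norm_sqn x))// exprn_ege1. Qed.

Lemma smooth_sqn : smooth sqn.
Proof. by apply: smooth_sum => i _; apply: smoothX; exact: smooth_coord. Qed.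

Lemma partial_sqn j x : partial j sqn x = 2 * x ord0 j.
Proof.
rewrite /sqn partial_sum => [|i _]; last by apply: smoothX; exact: smooth_coord.
rewrite (bigD1 j)//= big1 => [|i ij]; rewrite partialX ?partial_coord; try exact: smooth_coord.
  by rewrite eqxx/= expr1 mulr1 addr0.
by rewrite (negbTE ij) mulr0.
Qed.

(* Agrees with |x|^2 off the unit ball, and is smooth and positive everywhere. *)
Definition regsq x : R := sqn x + flat 0 (1 - sqn x).

Let smooth_1Bsqn : smooth (fun x => 1 - sqn x).
Proof.
have := smoothD (smooth_cst 1) (smoothM (smooth_cst (-1)) smooth_sqn).
by congr smooth; apply/funext => x; rewrite mulN1r.
Qed.

Let partial_1Bsqn j x : partial j (fun x => 1 - sqn x) x = - (2 * x ord0 j).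
Proof.
have E : (fun x => 1 - sqn x) = (fun x => 1 + (-1) * sqn x).
  by apply/funext => y; rewrite mulN1r.
rewrite E (partialD j x (smooth_cst 1) (smoothM (smooth_cst (-1)) smooth_sqn)).
by rewrite partial_cst (partialZ _ _ _ smooth_sqn) partial_sqn mulN1r add0r.
Qed.

Lemma regsq_gt0 x : 0 < regsq x.
Proof.
rewrite /regsq; have := sqn_ge0 x; rewrite le_eqVlt => /orP[/eqP <-|h].
  by rewrite add0r flat_gt0// subr0.
by rewrite ltr_wpDr// flat_ge0.
Qed.

Lemma regsq_out x : 1 <= sqn x -> regsq x = sqn x.
Proof. by move=> h; rewrite /regsq flat_le0 ?addr0// subr_le0. Qed.

Lemma smooth_regsq : smooth regsq.
Proof. by apply: smoothD smooth_sqn _; exact: smooth_flat. Qed.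

Lemma partial_regsq j x :
  partial j regsq x = 2 * x ord0 j * (1 - flat 2 (1 - sqn x)).
Proof.
rewrite /regsq (partialD j x smooth_sqn (smooth_flat 0 smooth_1Bsqn)).
by rewrite partial_sqn (partial_flat _ _ _ smooth_1Bsqn) partial_1Bsqn; ring.
Qed.

(** A smooth positive substitute for |x|^(-n), equal to it off the unit ball. *)
Definition regpow x : R := (Num.sqrt (regsq x))^-1 ^+ n.

Let sqrt_gt0 x : 0 < Num.sqrt (regsq x).
Proof. by rewrite sqrtr_gt0 regsq_gt0. Qed.

Let smooth_rt : smooth (fun x => Num.sqrt (regsq x)).
Proof. by apply: smooth_sqrt; [exact: smooth_regsq|exact: regsq_gt0]. Qed.

Let smooth_rtV : smooth (fun x => (Num.sqrt (regsq x))^-1).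
Proof. by apply: smooth_inv => // x; rewrite gt_eqF. Qed.

Lemma smooth_regpow : smooth regpow.
Proof. exact: smoothX. Qed.

Lemma regpow_gt0 x : 0 < regpow x.
Proof. by rewrite exprn_gt0// invr_gt0. Qed.

Let partial_rt j x : partial j (fun x => Num.sqrt (regsq x)) x =
  partial j regsq x / (2 * Num.sqrt (regsq x)).
Proof.
have E : regsq = fun x => Num.sqrt (regsq x) * Num.sqrt (regsq x).
  by apply/funext => y; rewrite -expr2 sqr_sqrtr// ltW// regsq_gt0.
have -> : partial j regsq x = partial j (fun x => Num.sqrt (regsq x)) x * Num.sqrt (regsq x) +
    Num.sqrt (regsq x) * partial j (fun x => Num.sqrt (regsq x)) x.
  by rewrite -(partialM j x smooth_rt smooth_rt) -E.
by field; rewrite gt_eqF.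
Qed.

Let partial_rtV j x : partial j (fun x => (Num.sqrt (regsq x))^-1) x =
  - (partial j regsq x / (2 * Num.sqrt (regsq x) * regsq x)).
Proof.
have := partialM j x smooth_rtV smooth_rt.
under [in partial _ _]eq_fun do rewrite mulVf ?gt_eqF//.
rewrite partial_cst partial_rt; set P := partial j _ x.
have h : Num.sqrt (regsq x) ^+ 2 = regsq x by rewrite sqr_sqrtr// ltW// regsq_gt0.
have s0 := sqrt_gt0 x; set a := Num.sqrt (regsq x) in s0 h *; rewrite -h => e.
have : P * a = - (a^-1 * (partial j regsq x / (2 * a))).
  by apply/eqP; rewrite eq_sym eqr_oppLR -subr_eq0 opprK addrC -e.
move=> /(congr1 (fun z => z / a)); rewrite mulfK ?gt_eqF// => ->.
by field; rewrite gt_eqF.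
Qed.

Lemma partial_regpow j x : partial j regpow x =
  - (n%:R * x ord0 j * (1 - flat 2 (1 - sqn x)) * regpow x / regsq x).
Proof.
rewrite /regpow partialX// partial_rtV partial_regsq.
have s0 := sqrt_gt0 x; have r0 := regsq_gt0 x.
set v := Num.sqrt (regsq x) in s0 *.
have -> : n%:R * v^-1 ^+ n.-1 = n%:R * v^-1 ^+ n * v.
  by case: n => [|m]; [rewrite !mul0r|rewrite /= exprSr -!mulrA mulVf ?mulr1// gt_eqF].
by field; rewrite !gt_eqF.
Qed.

(** Up to a constant factor this is, off the unit ball, the gradient of the fundamental solution of
    the Laplacian. *)
Definition field0 (j : 'I_n) x : R := x ord0 j * regpow x.

(* The divergence of [field0]; it vanishes off the unit ball. *)
Definition molli0 x : R :=
  n%:R * regpow x / regsq x * (flat 0 (1 - sqn x) + sqn x * flat 2 (1 - sqn x)).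

Lemma smooth_field0 j : smooth (field0 j).
Proof. by apply: smoothM; [exact: smooth_coord|exact: smooth_regpow]. Qed.

Lemma partial_field0 i j x : partial i (field0 j) x = (j == i)%:R * regpow x -
  n%:R * (x ord0 i * x ord0 j) * (1 - flat 2 (1 - sqn x)) * regpow x / regsq x.
Proof.
rewrite /field0 partialM ?partial_coord ?partial_regpow; first by ring.
  exact: smooth_coord.
exact: smooth_regpow.
Qed.

(** The field is x_j times a radial function, hence curl-free. This symmetry is what lets the
    off-diagonal Clifford products cancel in [clif_sym_sum], leaving only the divergence. *)
Lemma partial_field0C i j x : partial i (field0 j) x = partial j (field0 i) x.
Proof. by rewrite !partial_field0 eq_sym [x ord0 i * _]mulrC. Qed.

Lemma div_field0 x : \sum_j partial j (field0 j) x = molli0 x.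
Proof.
under eq_bigr do rewrite partial_field0 eqxx mul1r.
rewrite sumrB sumr_const card_ord -!mulr_suml -mulr_sumr.
under eq_bigr do rewrite -expr2.
rewrite -/(sqn x) /molli0 -[regpow x *+ n]mulr_natl.
have r0 := regsq_gt0 x.
transitivity (n%:R * regpow x / regsq x * (regsq x - sqn x * (1 - flat 2 (1 - sqn x)))).
  by field; rewrite gt_eqF.
by congr (_ * _); rewrite {1}/regsq; ring.
Qed.

Lemma smooth_molli0 : smooth molli0.
Proof.
rewrite (_ : molli0 = fun x => \sum_j partial j (field0 j) x).
  by apply: smooth_sum => j _; apply: smooth_partial; exact: smooth_field0.
by apply/funext => x; rewrite div_field0.
Qed.

Lemma molli0_ge0 x : 0 <= molli0 x.
Proof.
rewrite mulr_ge0//; last by rewrite addr_ge0 ?mulr_ge0 ?flat_ge0 ?sqn_ge0.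
by rewrite mulr_ge0 ?invr_ge0 ?(ltW (regsq_gt0 x))// mulr_ge0 ?(ltW (regpow_gt0 x)).
Qed.

Lemma molli0_out x : 1 <= `|x| -> molli0 x = 0.
Proof.
by move=> /sqn_ge1 h; rewrite /molli0 !flat_le0 ?subr_le0// mulr0 addr0 mulr0.
Qed.

Lemma molli0_gt0 : (0 < n)%N -> 0 < molli0 0.
Proof.
move=> n0; have s0 : sqn 0 = 0 by rewrite /sqn big1// => i _; rewrite mxE expr0n.
rewrite /molli0 s0 mul0r addr0 subr0 mulr_gt0 ?flat_gt0//.
by rewrite divr_gt0 ?regsq_gt0// mulr_gt0 ?regpow_gt0 ?ltr0n.
Qed.

Lemma csmooth_molli0 : csmooth molli0.
Proof. by split; [exact: smooth_molli0|exists 1 => x /ltW; exact: molli0_out]. Qed.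

Definition mass : R := \int[mu]_x molli0 x.

Lemma mass_gt0 : (0 < n)%N -> 0 < mass.
Proof.
move=> n0; have b0 := molli0_gt0 n0.
have [L L0 bL] := csmooth_lipschitz csmooth_molli0.
(* On the cube of this radius the Lipschitz bound keeps [molli0] above half of its value at 0. *)
pose r := molli0 0 / (2 * L).
have r0 : 0 < r by rewrite divr_gt0// mulr_gt0.
pose B := [set x : 'rV[R]_n | `|x - 0| <= r].
have mB : measurable B := measurable_cube 0 r.
have : molli0 0 / 2 * (2 * r) ^+ n <= mass.
  have <- : \int[mu]_x (\1_B x : R) = (2 * r) ^+ n.
    by rewrite Rintegral_cube// ltW.
  have iB := integrable_cube (0 : 'rV[R]_n) r.
  rewrite -RintegralZl//; apply: le_Rintegral => //.
  - exact: integrableZR.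
  - exact: csmooth_integrable csmooth_molli0.
  move=> x _; rewrite indicE; have [|_] := boolP (x \in B); last by rewrite mulr0 molli0_ge0.
  rewrite inE /B/= => xr; rewrite mulr1.
  have := bL x 0; have : L * `|x - 0| <= molli0 0 / 2.
    by rewrite mulrC -ler_pdivlMr// (le_trans xr)// /r invfM mulrA.
  by move=> h1 h2; have := le_trans h2 h1; rewrite ler_norml => /andP[h3 _]; lra.
by apply: lt_le_trans; rewrite mulr_gt0 ?divr_gt0// exprn_gt0// mulr_gt0.
Qed.

(** x_j / |x|^n is homogeneous of degree 1 - n, so the factor t^(1-n) makes the field independent of
    [t] where |x| >= t (see [field_out]). Its divergence is [molli t]. *)
Definition field t (j : 'I_n) x : R := mass^-1 * (t * t^-1 ^+ n) * field0 j (t^-1 *: x).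

Definition molli t x : R := mass^-1 * t^-1 ^+ n * molli0 (t^-1 *: x).

(** The far fields cancel, so the difference is a test function: it can be convolved with any
    locally integrable form, and no singular integral appears. *)
Definition dfield t s (j : 'I_n) x : R := field t j x - field s j x.

Let scale_affine f (c : R) : (fun x => f (c *: x)) = fun x => f (0 + c *: x).
Proof. by apply/funext => x; rewrite add0r. Qed.

Lemma smooth_field t j : smooth (field t j).
Proof.
rewrite /field; apply: smoothM; first exact: smooth_cst.
by rewrite scale_affine; apply: smooth_affine; exact: smooth_field0.
Qed.

Lemma partial_field t i j x : 0 < t ->
  partial i (field t j) x = mass^-1 * t^-1 ^+ n * partial i (field0 j) (t^-1 *: x).
Proof.
move=> t0; have s0 := smooth_affine 0 t^-1 (smooth_field0 j).
rewrite /field (_ : (fun x => _) = fun x => mass^-1 * (t * t^-1 ^+ n) * field0 j (0 + t^-1 *: x)).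
  rewrite (partialZ _ _ _ s0) (partial_affine _ _ _ _ (smooth_field0 j)) add0r.
  by rewrite -[RHS]mul1r -[in RHS](mulfV (lt0r_neq0 t0)); ring.
by apply/funext => y; rewrite add0r.
Qed.

Lemma csmooth_molli t : 0 < t -> csmooth (molli t).
Proof.
move=> t0; rewrite /molli; apply: csmoothMr; first exact: smooth_cst.
rewrite scale_affine; apply: csmooth_affine csmooth_molli0.
by rewrite invr_neq0// gt_eqF.
Qed.

Lemma field_out t j x : 0 < t -> t <= `|x| ->
  field t j x = mass^-1 * (x ord0 j * (Num.sqrt (sqn x))^-1 ^+ n).
Proof.
move=> t0 tx; have x0 : 0 < `|x| := lt_le_trans t0 tx.
have q0 : 0 < sqn x by rewrite (lt_le_trans _ (norm_sqn x))// exprn_gt0.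
have h : 1 <= sqn (t^-1 *: x).
  apply: sqn_ge1; rewrite normrZ normfV gtr0_norm// mulrC.
  by rewrite ler_pdivlMr// mul1r.
rewrite /field /field0 /regpow regsq_out// sqnZ mxE.
rewrite sqrtrM ?sqr_ge0// sqrtr_sqr gtr0_norm ?invr_gt0//.
have s0 : 0 < Num.sqrt (sqn x) by rewrite sqrtr_gt0.
rewrite invfM invrK exprMn -!mulrA; congr (_ * _).
rewrite [X in _ = _ * X](_ : _ = (t * t^-1) * (t^-1 * t) ^+ n * (Num.sqrt (sqn x))^-1 ^+ n).
  by rewrite exprMn; ring.
by rewrite mulfV ?mulVf ?gt_eqF// expr1n !mul1r.
Qed.

Lemma dfield_out t s j x : 0 < t -> 0 < s -> t <= `|x| -> s <= `|x| ->
  dfield t s j x = 0.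
Proof. by move=> t0 s0 tx sx; rewrite /dfield !field_out// subrr. Qed.

Lemma csmooth_dfield t s j : 0 < t -> 0 < s -> csmooth (dfield t s j).
Proof.
move=> t0 s0; split.
  have := smoothD (smooth_field t j) (smoothM (smooth_cst (-1)) (smooth_field s j)).
  by congr smooth; apply/funext => x; rewrite mulN1r.
exists (Num.max t s) => x; rewrite gt_max => /andP[tx sx].
by rewrite dfield_out// ltW.
Qed.

Lemma partial_dfield t s i j x : 0 < t -> 0 < s -> partial i (dfield t s j) x =
  partial i (field t j) x - partial i (field s j) x.
Proof.
move=> t0 s0; rewrite /dfield.
rewrite (_ : (fun x => _) = fun x => field t j x + (-1) * field s j x); last first.
  by apply/funext => y; rewrite mulN1r.
have sm := smooth_field s j.
by rewrite (partialD i x (smooth_field t j) (smoothM (smooth_cst (-1)) sm)) (partialZ _ _ _ sm) mulN1r.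
Qed.

Lemma partial_dfieldC t s i j x : 0 < t -> 0 < s ->
  partial i (dfield t s j) x = partial j (dfield t s i) x.
Proof.
move=> t0 s0; rewrite !(partial_dfield _ _ _ t0 s0) !(partial_field _ _ _ t0).
by rewrite !(partial_field _ _ _ s0) !(partial_field0C i j).
Qed.

Lemma div_dfield t s x : 0 < t -> 0 < s ->
  \sum_j partial j (dfield t s j) x = molli t x - molli s x.
Proof.
move=> t0 s0; under eq_bigr do rewrite partial_dfield// !partial_field//.
by rewrite sumrB; congr (_ - _); rewrite -mulr_sumr div_field0.
Qed.

Hypothesis n_gt0 : (0 < n)%N.

Let m0 : 0 < mass := mass_gt0 n_gt0.

Lemma molli_ge0 t x : 0 < t -> 0 <= molli t x.
Proof.
move=> t0; rewrite mulr_ge0 ?molli0_ge0// mulr_ge0 ?invr_ge0 ?(ltW m0)//.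
by rewrite exprn_ge0// invr_ge0 ltW.
Qed.

Lemma molli_out t x : 0 < t -> t <= `|x| -> molli t x = 0.
Proof.
move=> t0 tx; rewrite /molli molli0_out ?mulr0// normrZ normfV gtr0_norm// mulrC.
by rewrite ler_pdivlMr// mul1r.
Qed.

(** For t = 1 this is the normalisation by [mass]. The integral does not depend on [t], since
    [molli t] - [molli 1] is the divergence of the compactly supported field [dfield t 1]. *)
Lemma Rintegral_molli t : 0 < t -> \int[mu]_x molli t x = 1.
Proof.
move=> t0.
have i1 : \int[mu]_x molli 1 x = 1.
  rewrite /molli; under eq_Rintegral do rewrite invr1 expr1n scale1r mulr1.
  rewrite RintegralZl//; last exact: csmooth_integrable csmooth_molli0.
  by rewrite -/mass mulVf// gt_eqF.
rewrite -i1; apply/eqP; rewrite -subr_eq0; apply/eqP.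
have c1 := csmooth_integrable (csmooth_molli ltr01).
have ct := csmooth_integrable (csmooth_molli t0).
rewrite -RintegralB//.
under eq_Rintegral do rewrite -div_dfield//.
rewrite Rintegral_sum => [|j _]; last exact/csmooth_integrable/csmooth_partial/csmooth_dfield.
by rewrite big1// => j _; apply: Rintegral_partial0; exact: csmooth_dfield.
Qed.

Lemma molli_bound : exists2 C, 0 < C & forall t x, 0 < t ->
  `|molli t x| <= C * t^-1 ^+ n.
Proof.
have [C C0 hC] := csmooth_bounded csmooth_molli0.
exists (mass^-1 * C); first by rewrite mulr_gt0// invr_gt0.
move=> t x t0; have tn : 0 <= mass^-1 * t^-1 ^+ n.
  by rewrite mulr_ge0 ?exprn_ge0 ?invr_ge0 ?(ltW m0) ?(ltW t0).
by rewrite /molli normrM (ger0_norm tn) [leRHS]mulrAC ler_wpM2l.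
Qed.

Lemma partial_molli_bound : exists2 C, 0 < C & forall t j x, 0 < t ->
  `|partial j (molli t) x| <= C * t^-1 ^+ n.+1.
Proof.
have [L L0 hL] := csmooth_lipschitz csmooth_molli0.
have /all_sig2[C _ fC] : forall j, {C : R | 0 < C & forall x, `|partial j molli0 x| <= C}.
  by move=> j; apply/cid2; exact/csmooth_bounded/csmooth_partial/csmooth_molli0.
have fC' j x : `|partial j molli0 x| <= \sum_i `|C i| + 1.
  rewrite (le_trans (fC j x))// (bigD1 j)//= (le_trans (ler_norm _))// -addrA lerDl.
  by rewrite addr_ge0// sumr_ge0.
have C0 : 0 < \sum_i `|C i| + 1 by rewrite ltr_wpDl// sumr_ge0.
exists (mass^-1 * (\sum_i `|C i| + 1)); first by rewrite mulr_gt0// invr_gt0.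
move=> t j x t0; have tn : 0 <= mass^-1 * t^-1 ^+ n.+1.
  by rewrite mulr_ge0 ?exprn_ge0 ?invr_ge0 ?(ltW m0) ?(ltW t0).
have -> : partial j (molli t) x = mass^-1 * t^-1 ^+ n.+1 * partial j molli0 (t^-1 *: x).
  have sa := smooth_affine 0 t^-1 smooth_molli0.
  rewrite /molli (_ : (fun x => _) = fun x => mass^-1 * t^-1 ^+ n * molli0 (0 + t^-1 *: x)).
    by rewrite (partialZ _ _ _ sa) (partial_affine _ _ _ _ smooth_molli0) add0r exprSr; ring.
  by apply/funext => y; rewrite add0r.
by rewrite normrM (ger0_norm tn) [leRHS]mulrAC ler_wpM2l.
Qed.

(** The ratio of two consecutive scales: with t = s^2, passing from t to t/4 halves s. *)
Let q : R := 4^-1.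

(** Homogeneity reduces the bounds on [dfield t (t * q)] and its derivatives to t = 1, where they
    are bounds on finitely many test functions. *)
Lemma dfield_scale t j x : 0 < t -> dfield t (t * q) j x =
  t * t^-1 ^+ n * dfield 1 q j (t^-1 *: x).
Proof.
move=> t0; have q0 : 0 < q by rewrite invr_gt0.
rewrite /dfield /field !scalerA invr1 expr1n mulr1 mul1r invfM [_^-1 * q^-1]mulrC exprMn.
move: (field0 j (t^-1 *: x)) (field0 j ((q^-1 / t) *: x)) => a b.
by ring.
Qed.

Lemma dfield_bound : exists2 C, 0 < C & forall t j x, 0 < t ->
  `|dfield t (t * q) j x| <= C * (t * t^-1 ^+ n).
Proof.
have q0 : 0 < q by rewrite invr_gt0.
have /all_sig2[C _ fC] : forall j, {C : R | 0 < C & forall x, `|dfield 1 q j x| <= C}.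
  by move=> j; apply/cid2; exact/csmooth_bounded/csmooth_dfield.
exists (\sum_i `|C i| + 1); first by rewrite ltr_wpDl// sumr_ge0.
move=> t j x t0; have tn : 0 <= t * t^-1 ^+ n by rewrite mulr_ge0 ?exprn_ge0 ?invr_ge0 ?(ltW t0).
rewrite dfield_scale// normrM (ger0_norm tn) mulrC ler_wpM2r//.
rewrite (le_trans (fC j _))// (bigD1 j)//= (le_trans (ler_norm _))// -addrA lerDl.
by rewrite addr_ge0// sumr_ge0.
Qed.

Lemma partial_dfield_bound : exists2 C, 0 < C & forall t i j x, 0 < t ->
  `|partial i (dfield t (t * q) j) x| <= C * t^-1 ^+ n.
Proof.
have q0 : 0 < q by rewrite invr_gt0.
have /all_sig2[C _ fC] : forall ij : 'I_n * 'I_n,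
    {C : R | 0 < C & forall x, `|partial ij.1 (dfield 1 q ij.2) x| <= C}.
  by move=> ij; apply/cid2; exact/csmooth_bounded/csmooth_partial/csmooth_dfield.
exists (\sum_i `|C i| + 1); first by rewrite ltr_wpDl// sumr_ge0.
move=> t i j x t0; have tn : 0 <= t^-1 ^+ n by rewrite exprn_ge0 ?invr_ge0 ?(ltW t0).
have -> : partial i (dfield t (t * q) j) x = t^-1 ^+ n * partial i (dfield 1 q j) (t^-1 *: x).
  have sd := (csmooth_dfield j ltr01 q0).1.
  have sa := smooth_affine 0 t^-1 sd.
  rewrite (_ : dfield t (t * q) j = fun x => (t * t^-1 ^+ n) * dfield 1 q j (0 + t^-1 *: x)).
    rewrite (partialZ _ _ _ sa) (partial_affine _ _ _ _ sd) add0r.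
    move: (partial _ _ _) => P.
    by rewrite -[RHS]mul1r -[in RHS](mulfV (lt0r_neq0 t0)); ring.
  by apply/funext => y; rewrite add0r dfield_scale.
rewrite normrM (ger0_norm tn) mulrC ler_wpM2r//.
rewrite (le_trans (fC (i, j) _))// (bigD1 (i, j))//= (le_trans (ler_norm _))// -addrA lerDl.
by rewrite addr_ge0// sumr_ge0.
Qed.

End kernel.

(** * Clifford multiplication *)

Section clifford.
Context {R : realType} {n : nat}.
Implicit Types (u v w : exterior R n) (K L : {set 'I_n}) (i j : 'I_n).

Lemma extDE u v K : (u + v) K = u K + v K.
Proof. by rewrite ffunE. Qed.

Lemma extZE (a : R) v K : (a *: v) K = a * v K.
Proof. by rewrite ffunE. Qed.

(** The sign picked up when e_j is moved past the basis vectors of smaller index to its place in the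
    product over [K]. *)
Definition nsgn j K : R := (-1) ^+ #|[set p in K | (p < j)%N]|.

Lemma nsgn_sqr j K : nsgn j K * nsgn j K = 1.
Proof. by rewrite -expr2 sqrr_sign. Qed.

Lemma nsgnD1 i j K : i \in K ->
  nsgn j K = (-1) ^+ (i < j)%N * nsgn j (K :\ i).
Proof.
move=> iK; rewrite /nsgn -exprD; congr (_ ^+ _).
rewrite (cardsD1 i) inE iK/=; congr (_ + _)%N; congr #|pred_of_set _|.
by apply/setP => p; rewrite !inE andbA.
Qed.

Lemma nsgnD1_self j K : nsgn j (K :\ j) = nsgn j K.
Proof.
rewrite /nsgn; congr (_ ^+ #|pred_of_set _|); apply/setP => p; rewrite !inE.
by case: eqVneq => // ->; rewrite ltnn !andbF.
Qed.

Lemma wedge_sign1 j K : wedge_sign [set j] K = nsgn j K :> R.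
Proof.
rewrite /wedge_sign /nsgn; congr (_ ^+ _).
rewrite -(card_imset _ (fun p q : 'I_n => fun e : (j, p) = (j, q) => congr1 snd e)).
apply: eq_card => -[a b]; apply/idP/imsetP => [/set_mem/=|[p + [-> ->]]].
  by move=> /and3P[/set1P -> bK bj]; exists b => //; rewrite inE bK.
by rewrite inE => /andP[pK pj]; apply/mem_set/and3P; rewrite /= set11.
Qed.

Lemma wedge_evecE j v K :
  wedge (evec j) v K = if j \in K then nsgn j K * v (K :\ j) else 0.
Proof.
rewrite ffunE; case: ifPn => jK; last first.
  rewrite big1// => I IK; rewrite ffunE; case: eqVneq => [E|_]; last by rewrite !mul0r mulr0.
  by move: IK; rewrite E finset.sub1set (negbTE jK).
rewrite (bigD1 [set j]%SET) ?finset.sub1set//= big1 ?addr0.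
  by rewrite ffunE eqxx mul1r wedge_sign1 nsgnD1_self.
by move=> I /andP[_ IJ]; rewrite ffunE (negbTE IJ) !mul0r mulr0.
Qed.

Lemma interior_evecE j v K :
  interior_prod (evec j) v K = if j \in K then 0 else nsgn j K * v (j |: K).
Proof.
rewrite ffunE /einner (bigD1 (j |: K))//= wedge_evecE finset.setU11 ffunE.
rewrite big1 ?addr0 => [|I IK].
  case: ifPn => jK.
    rewrite (_ : (j |: K) :\ j == K = false) ?mulr0//.
    by apply/negP => /eqP/setP/(_ j); rewrite !inE eqxx jK.
  by rewrite finset.setU1K// eqxx mulr1 mulrC -(nsgnD1_self j (j |: K)) finset.setU1K.
rewrite wedge_evecE; case: ifPn => jI; last by rewrite mulr0.
rewrite ffunE; case: eqVneq => [E|_]; last by rewrite !mulr0.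
by move: IK; rewrite -E finset.setD1K// eqxx.
Qed.

(* [clif 1 j] and [clif (-1) j] are the symbols of D^+ and D^- in the
   direction e_j. *)
Definition clif (s : R) j v : exterior R n :=
  wedge (evec j) v + s *: interior_prod (evec j) v.

Lemma clifE s j v K : clif s j v K =
  nsgn j K * (if j \in K then v (K :\ j) else s * v (j |: K)).
Proof.
rewrite /clif extDE extZE wedge_evecE interior_evecE; case: ifP => _.
  by rewrite mulr0 addr0.
by rewrite add0r mulrCA.
Qed.

Lemma clif_linear s j : linear (clif s j).
Proof.
move=> a u v; apply/ffunP => K; rewrite clifE [RHS]extDE extZE !clifE.
by case: ifP => _; rewrite !extDE !extZE; ring.
Qed.

HB.instance Definition _ s j :=
  GRing.isLinear.Build R (exterior R n) (exterior R n) _ (clif s j) (@clif_linear s j).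

Lemma clif_sqr s j v : clif s j (clif s j v) = s *: v.
Proof.
apply/ffunP => K; rewrite clifE extZE.
case: ifPn => jK; rewrite clifE.
  by rewrite !inE eqxx/= finset.setD1K// nsgnD1_self mulrA nsgn_sqr mul1r.
rewrite finset.setU11 finset.setU1K// -[nsgn j (j |: K)]nsgnD1_self finset.setU1K//.
by rewrite mulrCA; congr (_ * _); rewrite mulrA nsgn_sqr mul1r.
Qed.

(** [clif s i] toggles the membership of [i] in the index set. Toggling [i] and [j] in either order
    gives the same set; the two signs differ because exactly one of i < j and j < i holds. *)
Lemma clif_anticomm s i j v : i != j ->
  clif s i (clif s j v) = - clif s j (clif s i v).
Proof.
move=> ij; have ji : j != i by rewrite eq_sym.
have sg : (-1) ^+ (i < j)%N = - (-1) ^+ (j < i)%N :> R.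
  by case: ltngtP ij => [||/val_inj->]//=; rewrite ?eqxx// expr0 expr1 opprK.
have D1D1 K : K :\ i :\ j = K :\ j :\ i.
  by apply/setP => p; rewrite !inE andbCA.
have U1U1 K : i |: (j |: K) = j |: (i |: K).
  by apply/setP => p; rewrite !inE orbCA.
have D1U1 a b K : a != b -> a |: (K :\ b) = (a |: K) :\ b.
  move=> ab; apply/setP => p; rewrite !inE.
  by case: eqVneq => [->|_]/=; rewrite ?ab.
have nD1 a b K : a != b -> b \in K -> nsgn a (K :\ b) = (-1) ^+ (b < a)%N * nsgn a K.
  by move=> ab bK; rewrite (nsgnD1 a bK) mulrA -expr2 sqrr_sign mul1r.
have nU1 a b K : a != b -> b \notin K -> nsgn a (b |: K) = (-1) ^+ (b < a)%N * nsgn a K.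
  by move=> ab bK; rewrite (@nsgnD1 b a (b |: K)) ?finset.setU11// finset.setU1K.
apply/ffunP => K; rewrite -scaleN1r extZE !clifE.
have [iK|iK] := boolP (i \in K); have [jK|jK] := boolP (j \in K);
  rewrite !inE ?eqxx ?(negbTE ij) ?(negbTE ji) ?iK ?jK ?(negbTE iK) ?(negbTE jK)/=.
- by rewrite !nD1// sg D1D1; ring.
- by rewrite nD1// nU1// sg -D1U1//; ring.
- by rewrite nD1// nU1// sg -D1U1//; ring.
- by rewrite !nU1// sg U1U1; ring.
Qed.

Lemma clif_anticomm_sum s i j v :
  clif s i (clif s j v) + clif s j (clif s i v) = (2 * s * (i == j)%:R) *: v.
Proof.
have [->|ij] := eqVneq i j.
  by rewrite clif_sqr mulr1 -scalerDl -mulr2n mulr_natl.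
by rewrite clif_anticomm// addNr mulr0 scale0r.
Qed.

Lemma einnerC u v : einner u v = einner v u.
Proof. by apply: eq_bigr => K _; rewrite mulrC. Qed.

Lemma einnerDl u v w : einner (u + v) w = einner u w + einner v w.
Proof. by rewrite -big_split; apply: eq_bigr => K _; rewrite extDE mulrDl. Qed.

Lemma einnerZl (a : R) u w : einner (a *: u) w = a * einner u w.
Proof. by rewrite mulr_sumr; apply: eq_bigr => K _; rewrite extZE mulrA. Qed.

Lemma einnerDr u v w : einner w (u + v) = einner w u + einner w v.
Proof. by rewrite einnerC einnerDl !(einnerC w). Qed.

Lemma einnerZr (a : R) u w : einner w (a *: u) = a * einner w u.
Proof. by rewrite einnerC einnerZl einnerC. Qed.

(** Wedge and interior product by e_j are adjoint, so taking the adjoint exchanges the two halves of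
    [clif], which for s^2 = 1 is multiplication by [s]. With [clif_sqr] this makes [clif s j] an
    isometry. *)
Lemma einner_clif s j u v : s * s = 1 ->
  einner (clif s j u) v = s * einner u (clif s j v).
Proof.
move=> s2; rewrite /clif einnerDl einnerZl einnerDr einnerZr interior_prodE.
rewrite [einner (wedge _ _) _]einnerC -interior_prodE [einner (interior_prod _ _) u]einnerC.
by rewrite mulrDr mulrA s2 mul1r addrC.
Qed.

Lemma einner_ge0 u : 0 <= einner u u.
Proof. by apply: sumr_ge0 => K _; exact: sqr_ge0. Qed.

Lemma enorm_ge0 u : 0 <= enorm u.
Proof. exact: sqrtr_ge0. Qed.

Lemma enorm_sqr u : enorm u ^+ 2 = einner u u.
Proof. by rewrite sqr_sqrtr// einner_ge0. Qed.

Lemma enorm_clif s j u : s * s = 1 -> enorm (clif s j u) = enorm u.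
Proof.
move=> s2; rewrite /enorm einner_clif// clif_sqr// einnerZr mulrA s2.
by rewrite mul1r.
Qed.

Lemma einner_eq0 u : einner u u = 0 -> u = 0.
Proof.
move=> /eqP; rewrite psumr_eq0; last by move=> K _; exact: sqr_ge0.
move=> /allP h; apply/ffunP => K; have := h K (mem_index_enum _).
by rewrite ffunE /= -expr2 sqrf_eq0 => /eqP.
Qed.

Lemma enorm0 : enorm (0 : exterior R n) = 0.
Proof. by rewrite /enorm /einner big1 ?sqrtr0// => K _; rewrite ffunE mul0r. Qed.

Lemma enorm_eq0 u : enorm u = 0 -> u = 0.
Proof.
move=> h; apply: einner_eq0; rewrite -enorm_sqr h expr0n.
by [].
Qed.

Lemma enormZ (a : R) u : enorm (a *: u) = `|a| * enorm u.
Proof.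
by rewrite /enorm einnerZl einnerZr mulrA -expr2 sqrtrM ?sqr_ge0// sqrtr_sqr.
Qed.

Lemma enormN u : enorm (- u) = enorm u.
Proof. by rewrite -scaleN1r enormZ normrN1 mul1r. Qed.

Lemma cauchy_schwarz u v : `|einner u v| <= enorm u * enorm v.
Proof.
have [v0|v0] := eqVneq (einner v v) 0.
  rewrite (einner_eq0 v0) enorm0 mulr0 /einner big1 ?normr0// => K _.
  by rewrite ffunE mulr0.
have vp : 0 < einner v v by rewrite lt_neqAle eq_sym v0 einner_ge0.
have := einner_ge0 (u + (- (einner u v / einner v v)) *: v).
rewrite einnerDl !einnerDr !einnerZl !einnerZr (einnerC v u).
set a := einner u u; set b := einner u v; set c := einner v v => h.
have : b ^+ 2 <= a * c.
  rewrite -subr_ge0 -(pmulr_rge0 _ (_ : 0 < c^-1)) ?invr_gt0//.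
  by apply: le_trans h _; rewrite le_eqVlt; apply/orP; left; apply/eqP; field.
rewrite /enorm -sqrtrM ?einner_ge0// -sqrtr_sqr.
exact: ler_wsqrtr.
Qed.

Lemma enormD u v : enorm (u + v) <= enorm u + enorm v.
Proof.
rewrite -(@ler_pXn2r _ 2)// ?nnegrE ?addr_ge0 ?enorm_ge0//.
rewrite enorm_sqr einnerDl !einnerDr (einnerC v u) sqrrD !enorm_sqr.
have := le_trans (ler_norm _) (cauchy_schwarz u v); lra.
Qed.

Lemma enormB u v : enorm (u - v) <= enorm u + enorm v.
Proof. by rewrite -(enormN v) enormD. Qed.

Lemma enorm_sum (I : Type) (r : seq I) (P : pred I) (F : I -> exterior R n) :
  enorm (\sum_(i <- r | P i) F i) <= \sum_(i <- r | P i) enorm (F i).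
Proof.
elim/big_ind2 : _ => //; first by rewrite enorm0.
by move=> a b c d h1 h2; rewrite (le_trans (enormD _ _))// lerD.
Qed.

Lemma coord_le_enorm u K : `|u K| <= enorm u.
Proof.
rewrite -sqrtr_sqr ler_wsqrtr// /einner (bigD1 K)//= expr2 lerDl.
by apply: sumr_ge0 => L _; exact: sqr_ge0.
Qed.

Lemma enorm_le_sum u : enorm u <= \sum_K `|u K|.
Proof.
have E : u = \sum_K u K *: ebasis K.
  apply/ffunP => L; rewrite sum_ffunE (bigD1 L)//= big1 => [|K KL].
    by rewrite extZE ffunE eqxx mulr1 addr0.
  by rewrite extZE ffunE eq_sym (negbTE KL) mulr0.
rewrite {1}E (le_trans (enorm_sum _ _ _))//; apply: ler_sum => K _.
rewrite enormZ (_ : enorm (ebasis K) = 1) ?mulr1// /enorm /einner (bigD1 K)//= big1.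
  by rewrite ffunE eqxx mulr1 addr0 sqrtr1.
by move=> L LK; rewrite ffunE (negbTE LK) mul0r.
Qed.

Lemma ext_basis u : u = \sum_K u K *: ebasis K.
Proof.
apply/ffunP => L; rewrite sum_ffunE (bigD1 L)//= big1 => [|K KL].
  by rewrite extZE ffunE eqxx mulr1 addr0.
by rewrite extZE ffunE eq_sym (negbTE KL) mulr0.
Qed.

End clifford.

(** * Lebesgue norms and mollification *)

Section Lp_scalar.
Context {R : realType} {n : nat}.
Notation mu := (@lebesgue_rV R n).
Notation L1 g := (mu.-integrable setT (EFin \o g)).
Implicit Types (f g : 'rV[R]_n -> R) (p e : R).
Local Open Scope ereal_scope.

Definition NL p f : \bar R := Lnorm mu p%:E (EFin \o f).

Let measurable_absp f p : measurable_fun setT f ->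
  measurable_fun setT (fun x => (`|f x| `^ p)%:E).
Proof.
move=> mf; apply/measurable_EFinP.
apply: (@measurableT_comp _ _ _ _ _ _ (fun x : R => x `^ p)%R) => //=.
exact: measurableT_comp.
Qed.

Lemma NLE p f : NL p f = (\int[mu]_x (`|f x| `^ p)%:E) `^ p^-1.
Proof. by rewrite /NL unlock. Qed.

Let int_itv p f : (\int[mu]_x (`|f x| `^ p)%:E) \in `[0, +oo].
Proof.
by rewrite in_itv/= leey andbT; apply: integral_ge0 => x _; rewrite lee_fin powR_ge0.
Qed.

Lemma NL_ge0 p f : 0 <= NL p f. Proof. exact: Lnorm_ge0. Qed.

Lemma NL_mono_ae p f g : (0 < p)%R -> measurable_fun setT f -> measurable_fun setT g ->
  {ae mu, forall x, (`|f x| <= `|g x|)%R} -> NL p f <= NL p g.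
Proof.
move=> p0 mf mg fg; rewrite !NLE; apply: gt0_ler_poweR => //.
  by rewrite invr_ge0 ltW.
apply: ae_ge0_le_integral => //.
- exact: measurable_absp.
- exact: measurable_absp.
by apply: filterS fg => x h _; rewrite lee_fin ge0_ler_powR ?nnegrE// ltW.
Qed.

Lemma NL_mono p f g : (0 < p)%R -> measurable_fun setT f -> measurable_fun setT g ->
  (forall x, (`|f x| <= `|g x|)%R) -> NL p f <= NL p g.
Proof. by move=> p0 mf mg fg; apply: NL_mono_ae => //; exact: aeW. Qed.

Lemma NL_triangle p f g : (1 <= p)%R -> measurable_fun setT f -> measurable_fun setT g ->
  NL p (fun x => f x + g x)%R <= NL p f + NL p g.
Proof. by move=> p1 mf mg; exact: minkowski_EFin. Qed.

Lemma NLZ p (c : R) f : (0 < p)%R -> measurable_fun setT f ->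
  NL p (fun x => c * f x)%R = `|c|%:E * NL p f.
Proof.
move=> p0 mf; rewrite !NLE.
under eq_integral do rewrite normrM powRM// EFinM.
rewrite ge0_integralZl//; last exact: measurable_absp.
rewrite poweRM ?lee_fin ?powR_ge0//; last by apply: integral_ge0 => x _; rewrite lee_fin powR_ge0.
by rewrite poweR_EFin -powRrM mulfV ?gt_eqF// powRr1.
Qed.

Lemma NL0 p : (0 < p)%R -> NL p (fun=> 0%R) = 0.
Proof. by move=> p0; apply: Lnorm0; rewrite eqe gt_eqF. Qed.

Lemma NL_int_le m f e : (0 < m)%N -> (0 <= e)%R -> NL m%:R f <= e%:E ->
  \int[mu]_x (`|f x| ^+ m)%:E <= (e ^+ m)%:E.
Proof.
move=> m0 e0 h; have mR : (m%:R : R) != 0%R by rewrite pnatr_eq0 -lt0n.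
have -> : \int[mu]_x (`|f x| ^+ m)%:E = NL m%:R f `^ m%:R.
  rewrite poweR_Lnorm//; apply: eq_integral => x _ /=.
  by rewrite powR_mulrn.
rewrite -powR_mulrn// -poweR_EFin; apply: gt0_ler_poweR => //.
- by rewrite in_itv/= NL_ge0 leey.
- by rewrite in_itv/= lee_fin e0 leey.
Qed.

Lemma int_NL_le m f e : (0 < m)%N -> (0 <= e)%R ->
  \int[mu]_x (`|f x| ^+ m)%:E <= (e ^+ m)%:E -> NL m%:R f <= e%:E.
Proof.
move=> m0 e0 h; have mR : (m%:R : R) != 0%R by rewrite pnatr_eq0 -lt0n.
have -> : e = ((e ^+ m) `^ (m%:R)^-1)%R.
  by rewrite -powR_mulrn// -powRrM mulfV// powRr1.
rewrite NLE -poweR_EFin; apply: gt0_ler_poweR => //.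
- by rewrite in_itv/= lee_fin exprn_ge0// leey.
apply: le_trans h; rewrite le_eqVlt; apply/orP; left; apply/eqP.
by apply: eq_integral => x _ /=; rewrite powR_mulrn.
Qed.

Lemma measurable_sumP (I : Type) (r : seq I) (P : pred I) (h : I -> 'rV[R]_n -> R) :
  (forall i, P i -> measurable_fun setT (h i)) ->
  measurable_fun setT (fun x => \sum_(i <- r | P i) h i x)%R.
Proof.
move=> mh; elim: r => [|i r ih].
  rewrite (_ : (fun x => _) = fun=> 0%R); first exact: measurable_cst.
  by apply/funext => x; rewrite big_nil.
rewrite (_ : (fun x => _) = fun x => ((if P i then h i x else 0) + \sum_(i <- r | P i) h i x))%R.
  apply: measurable_funD => //; case Pi: (P i); first exact: mh.
  exact: measurable_cst.
by apply/funext => x; rewrite big_cons; case: ifP; rewrite ?add0r.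
Qed.

Lemma NL_sum_le (I : Type) (r : seq I) (P : pred I) p (h : I -> 'rV[R]_n -> R) :
  (1 <= p)%R -> (forall i, P i -> measurable_fun setT (h i)) ->
  NL p (fun x => \sum_(i <- r | P i) h i x)%R <= \sum_(i <- r | P i) NL p (h i).
Proof.
move=> p1 mh; have p0 : (0 < p)%R := lt_le_trans ltr01 p1.
elim: r => [|i r ih].
  rewrite big_nil (_ : (fun x => _) = fun=> 0%R) ?NL0//.
  by apply/funext => x; rewrite big_nil.
rewrite big_cons; case: ifPn => Pi; last first.
  rewrite (_ : (fun x => _) = fun x => \sum_(i <- r | P i) h i x)%R//.
  by apply/funext => x; rewrite big_cons (negbTE Pi).
rewrite (_ : (fun x => _) = fun x => h i x + \sum_(i <- r | P i) h i x)%R; last first.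
  by apply/funext => x; rewrite big_cons Pi.
apply: le_trans (NL_triangle p1 _ _) _ => //; first exact: mh.
  exact: measurable_sumP.
exact: leeD2l.
Qed.

End Lp_scalar.

(** * Open boxes as a generating pi-system *)

Section boxes.
Context {R : realType} {n : nat}.
Implicit Types a b x : 'rV[R]_n.

Definition obox a b : set 'rV[R]_n :=
  [set x | forall i, x ord0 i \in `]a ord0 i, b ord0 i[].

Lemma measurable_obox a b : measurable (obox a b).
Proof.
apply: (@measurable_box _ _ (fun i => [set` `]a ord0 i, b ord0 i[])) => i.
exact: measurable_itv.
Qed.

Lemma oboxI a b a' b' : obox a b `&` obox a' b' =
  obox (\row_i Num.max (a ord0 i) (a' ord0 i)) (\row_i Num.min (b ord0 i) (b' ord0 i)).
Proof.
apply/seteqP; split => [x [h h'] i|x h].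
  have := h i; have := h' i; rewrite !in_itv/= !mxE gt_max lt_min.
  by move=> /andP[-> ->] /andP[-> ->].
split=> i; have := h i; rewrite !in_itv/= !mxE gt_max lt_min.
  by move=> /andP[/andP[-> _] /andP[-> _]].
by move=> /andP[/andP[_ ->] /andP[_ ->]].
Qed.

Let oboxes : set (set 'rV[R]_n) := [set A | exists a b, A = obox a b].

(** A slab u < x_i < v is the increasing union of the boxes whose other sides are ]-k, k[, so boxes
    generate the coordinate sigma-algebra. They are stable under intersection, which the Dynkin
    argument for [tapprox_measurable] requires. *)
Lemma measurable_rV_obox :
  @measurable _ 'rV[R]_n = <<s [set A | exists a b, A = obox a b] >>.
Proof.
apply/seteqP; split => [A mA|]; last first.
  apply: smallest_sub; first exact: sigma_algebra_measurable.
  by move=> _ [a [b ->]]; exact: measurable_obox.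
pose T := g_sigma_algebraType oboxes.
suff mid : measurable_fun setT (fun x : T => x : 'rV[R]_n).
  by have := mid measurableT _ mA; rewrite setTI.
apply: measurable_fun_rVP => i.
apply: (measurability _ (RGenOpens.measurableE R)) => //=.
move=> _ [_ [u [v ->] <-]]; rewrite setTI.
pose lo (k : nat) : 'rV[R]_n := \row_j (if j == i then u else - k%:R).
pose hi (k : nat) : 'rV[R]_n := \row_j (if j == i then v else k%:R).
rewrite (_ : _ @^-1` _ = \bigcup_k obox (lo k) (hi k)).
  apply: bigcupT_measurable => k; apply: sub_sigma_algebra.
  by exists (lo k), (hi k).
apply/seteqP; split => [x xi|x [k _ /(_ i)]]; last by rewrite !mxE eqxx.
exists (Num.truncn `|x|).+1 => // j; rewrite !mxE.
case: eqVneq => [->//|_]; rewrite in_itv/= -ltr_norml.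
by rewrite (le_lt_trans (le_coord_norm x j))// Num.Theory.truncnS_gt.
Qed.

Definition box_bump a b x : R :=
  \prod_i (flat 0 (x ord0 i - a ord0 i) * flat 0 (b ord0 i - x ord0 i)).

Lemma smooth_prod (I : Type) (r : seq I) (F : I -> 'rV[R]_n -> R) :
  (forall i, smooth (F i)) -> smooth (fun x => \prod_(i <- r) F i x).
Proof.
move=> sF; elim: r => [|i r ih].
  rewrite (_ : (fun x => _) = fun=> 1); first exact: smooth_cst.
  by apply/funext => x; rewrite big_nil.
rewrite (_ : (fun x => _) = fun x => F i x * \prod_(i <- r) F i x).
  exact: smoothM.
by apply/funext => x; rewrite big_cons.
Qed.

Lemma smooth_box_bump a b : smooth (box_bump a b).
Proof.
apply: smooth_prod => i; apply: smoothM; apply: smooth_flat.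
  by apply: smoothD; [exact: smooth_coord|exact: smooth_cst].
rewrite (_ : (fun x => _) = fun x => b ord0 i + (-1) * x ord0 i).
  by apply: smoothD; [exact: smooth_cst|apply: smoothM; [exact: smooth_cst|exact: smooth_coord]].
by apply/funext => x; rewrite mulN1r.
Qed.

Lemma box_bump_ge0 a b x : 0 <= box_bump a b x.
Proof. by apply: prodr_ge0 => i _; rewrite mulr_ge0 ?flat_ge0. Qed.

Lemma box_bump_gt0 a b x : obox a b x -> 0 < box_bump a b x.
Proof.
move=> h; apply: prodr_gt0 => i _; have := h i; rewrite in_itv/= => /andP[h1 h2].
by rewrite mulr_gt0 ?flat_gt0 ?subr_gt0.
Qed.

Lemma box_bump_out a b x : ~ obox a b x -> box_bump a b x = 0.
Proof.
move=> h; have [i hi] : exists i, x ord0 i \notin `]a ord0 i, b ord0 i[.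
  apply: contrapT => h'; apply: h => i; apply: contrapT => /negP hi; apply: h'; by exists i.
rewrite /box_bump (bigD1 i)//=; move: hi; rewrite in_itv/= negb_and -!leNgt.
move=> /orP[h1|h1]; first by rewrite (flat_le0 0 (_ : x ord0 i - _ <= 0)) ?subr_le0// !mul0r.
by rewrite (flat_le0 0 (_ : b ord0 i - _ <= 0)) ?subr_le0// mulr0 mul0r.
Qed.

Lemma obox_bounded a b x : obox a b x -> `|x| <= `|a| + `|b|.
Proof.
move=> h; apply: norm_le_rV => [|i]; first by rewrite addr_ge0.
have := h i; rewrite in_itv/= => /andP[h1 h2].
have := le_coord_norm a i; have := le_coord_norm b i.
rewrite !ler_norml => /andP[h3 h4] /andP[h5 h6].
by apply/andP; split; have := normr_ge0 a; have := normr_ge0 b; lra.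
Qed.

End boxes.

(** * Density of test functions in L^2 *)

Section density.
Context {R : realType} {n : nat}.
Notation mu := (@lebesgue_rV R n).
Notation L1 g := (mu.-integrable setT (EFin \o g)).
Notation mfun f := (measurable_fun [set: 'rV[R]_n] f).
Implicit Types (f g : 'rV[R]_n -> R).

Lemma NL2_dominated (f_ : nat -> 'rV[R]_n -> R) f g (e : R) : 0 < e ->
  (forall k, mfun (f_ k)) -> mfun f ->
  (forall x, f_ k x @[k --> \oo] --> f x) ->
  (forall k x, `|f x - f_ k x| <= g x) -> L1 (fun x => g x ^+ 2)%R ->
  exists k, (NL 2 (fun x => f x - f_ k x)%R <= e%:E)%E.
Proof.
move=> e0 mf_ mf cf fg ig.
have H1 k : measurable_fun setT (fun x => ((f x - f_ k x) ^+ 2)%:E).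
  by apply/measurable_EFinP/measurable_funX; exact: measurable_funB.
have H2 x : setT x -> ((f x - f_ k x) ^+ 2)%:E @[k --> \oo] --> 0%E.
  move=> _; apply/fine_cvgP; split; first exact: nearW.
  rewrite -[X in _ --> X](_ : (f x - f x) ^+ 2 = 0); last by rewrite subrr expr0n.
  have h : (f x - f_ k x) @[k --> \oo] --> f x - f x by apply: cvgB => //; exact: cvg_cst.
  by rewrite expr2; under eq_fun do rewrite /= expr2; exact: cvgM.
have H3 x : setT x -> (g x ^+ 2)%:E \is a fin_num by [].
have H4 k x : setT x -> (`|((f x - f_ k x) ^+ 2)%:E| <= (g x ^+ 2)%:E)%E.
  move=> _; rewrite /= lee_fin ger0_norm ?sqr_ge0// -real_normK ?num_real//.
  by rewrite lerXn2r ?nnegrE// (le_trans _ (fg k x)).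
have := dominated_cvg measurableT H1 H2 H3 ig H4.
rewrite integral0 => /fine_cvgP[fin /cvgrPdist_le/(_ (e ^+ 2)) h].
have /h {}h : 0 < e ^+ 2 by rewrite exprn_gt0.
have [k [/= k1 k2]] := filter_ex (filterI fin h).
exists k; apply: int_NL_le => //; first exact: ltW.
under eq_integral do rewrite real_normK ?num_real//.
rewrite -(fineK k1) lee_fin.
by move: k2; rewrite sub0r normrN; exact: le_trans (ler_norm _).
Qed.

Definition tapprox f := forall e : R, 0 < e ->
  exists2 g, csmooth g & (NL 2 (fun x => f x - g x)%R <= e%:E)%E.

Lemma tapprox_closed f : mfun f -> (forall e : R, 0 < e ->
  exists g, [/\ mfun g, tapprox g & (NL 2 (fun x => f x - g x)%R <= e%:E)%E]) -> tapprox f.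
Proof.
move=> mf h e e0; have e20 : 0 < e / 2 by rewrite divr_gt0.
have [g [mg /(_ _ e20)[g' cg' gg'] fg]] := h _ e20; exists g' => //.
rewrite (_ : (fun x => _) = fun x => (f x - g x) + (g x - g' x)); last first.
  by apply/funext => x; rewrite subrKA.
have mg' := smooth_measurable cg'.1.
apply: le_trans (NL_triangle _ _ _) _; [by rewrite ler1n|exact: measurable_funB|exact: measurable_funB|].
by rewrite [e]splitr EFinD leeD.
Qed.

Lemma tapproxD f g : mfun f -> mfun g -> tapprox f -> tapprox g -> tapprox (fun x => f x + g x).
Proof.
move=> mf mg af ag e e0; have e20 : 0 < e / 2 by rewrite divr_gt0.
have [f' cf' ff'] := af _ e20; have [g' cg' gg'] := ag _ e20.
exists (fun x => f' x + g' x); first exact: csmoothD.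
rewrite (_ : (fun x => _) = fun x => (f x - f' x) + (g x - g' x)); last first.
  by apply/funext => x; rewrite opprD addrACA.
have mg' := smooth_measurable cg'.1; have mf' := smooth_measurable cf'.1.
apply: le_trans (NL_triangle _ _ _) _; [by rewrite ler1n|exact: measurable_funB|exact: measurable_funB|].
by rewrite [e]splitr EFinD leeD.
Qed.

Lemma tapproxZ (c : R) f : mfun f -> tapprox f -> tapprox (fun x => c * f x).
Proof.
move=> mf af e e0; have c0 : 0 < `|c| + 1 by rewrite ltr_wpDl.
have [f' cf' ff'] := af (e / (`|c| + 1)) (divr_gt0 e0 c0).
exists (fun x => c * f' x); first exact: csmoothZ.
have mf' := smooth_measurable cf'.1.
rewrite (_ : (fun x => _) = fun x => c * (f x - f' x)); last first.
  by apply/funext => x; rewrite mulrBr.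
rewrite NLZ//; last exact: measurable_funB.
apply: le_trans (lee_wpmul2l _ ff') _; first by rewrite lee_fin.
by rewrite -EFinM lee_fin mulrCA ler_piMr ?(ltW e0)// ler_pdivrMr// mul1r lerDl.
Qed.

Lemma tapprox_csmooth g : csmooth g -> tapprox g.
Proof.
move=> cg e e0; exists g => //; under [X in NL _ X]eq_fun do rewrite subrr.
by rewrite NL0// lee_fin ltW.
Qed.

Lemma tapprox_obox (a b : 'rV[R]_n) : tapprox (\1_(obox a b) : 'rV[R]_n -> R).
Proof.
have mi : mfun (\1_(obox a b) : 'rV[R]_n -> R) by apply: measurable_indic; exact: measurable_obox.
(* k b / (1 + k b) tends to 1 where b > 0 and is 0 where b = 0, so a smooth function supported in
   the box tends to its indicator. *)
pose t (k : nat) x := k%:R * box_bump a b x * (1 + k%:R * box_bump a b x)^-1.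
have d0 k x : 0 < 1 + k%:R * box_bump a b x.
  by rewrite ltr_pwDl// mulr_ge0// box_bump_ge0.
have st k : smooth (t k).
  have s1 : smooth (fun x => k%:R * box_bump a b x).
    by apply: smoothM; [exact: smooth_cst|exact: smooth_box_bump].
  apply: smoothM => //; apply: smooth_inv => [|x]; last by rewrite gt_eqF.
  by apply: smoothD => //; exact: smooth_cst.
have t0 k x : ~ obox a b x -> t k x = 0.
  by move=> /box_bump_out E; rewrite /t E mulr0 mul0r.
have ct k : csmooth (t k).
  split => //; exists (`|a| + `|b|) => x h; apply: t0 => /obox_bounded.
  by rewrite leNgt h.
apply: tapprox_closed => // e e0.
have H1 k : mfun (t k) by exact: smooth_measurable.
have H2 x : t k x @[k --> \oo] --> (\1_(obox a b) x : R).
  rewrite indicE; have [|xn] := boolP (x \in obox a b); last first.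
    rewrite (_ : t ^~ x = fun=> 0); first exact: cvg_cst.
    by apply/funext => k; apply: t0 => /mem_set h; rewrite h in xn.
  rewrite inE => /box_bump_gt0 p0; apply/cvgrPdist_le => d d1.
  near=> k.
  have kp : 0 < k%:R * box_bump a b x.
    by rewrite mulr_gt0// ltr0n; near: k; exact: nbhs_infty_gt.
  have -> : true%:R - t k x = (1 + k%:R * box_bump a b x)^-1.
    by rewrite /t -[true%:R](mulfV (lt0r_neq0 (d0 k x))) -mulrBl addrK mul1r.
  rewrite ger0_norm ?invr_ge0 ?(ltW (d0 _ _))// invf_ple ?posrE//.
  have : d^-1 / box_bump a b x <= k%:R by near: k; exact: nbhs_infty_ger.
  by rewrite ler_pdivrMr// => h; rewrite (le_trans h)// lerDr.
have H3 k x : `|\1_(obox a b) x - t k x| <= (\1_(obox a b) x : R).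
  rewrite indicE; have [|xn] := boolP (x \in obox a b); last first.
    by rewrite t0 ?subrr ?normr0// => /mem_set h; rewrite h in xn.
  rewrite inE => xb; have h0 : 0 <= k%:R * box_bump a b x by rewrite mulr_ge0// box_bump_ge0.
  rewrite ger0_norm; first by rewrite lerBlDr lerDl /t mulr_ge0 ?invr_ge0 ?(ltW (d0 _ _)).
  by rewrite subr_ge0 /t ler_pdivrMr// mul1r lerDr.
have H4 : L1 (fun x => (\1_(obox a b) x : R) ^+ 2)%R.
  have := integrable_cube (0 : 'rV[R]_n) (`|a| + `|b|).
  apply: le_integrable => //.
    by apply/measurable_EFinP; apply: measurable_funX; exact: mi.
  move=> x _; rewrite /= lee_fin !indicE; have [|] := boolP (x \in obox a b).
    by rewrite inE => /obox_bounded h; rewrite mem_set ?expr1n//= subr0.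
  by rewrite expr0n/= normr0.
have [k hk] := NL2_dominated e0 H1 mi H2 H3 H4.
by exists (t k); split; [exact: smooth_measurable|exact: tapprox_csmooth|].
Unshelve. all: by end_near.
Qed.

(** Dynkin induction from boxes to measurable sets. Intersecting with one fixed box keeps all
    indicators under an L^2 majorant, so countable disjoint unions pass by dominated convergence and
    complements by subtraction. *)
Lemma tapprox_measurable (r : R) (A : set 'rV[R]_n) : measurable A ->
  tapprox (\1_(A `&` obox (const_mx (- r)) (const_mx r)) : 'rV[R]_n -> R).
Proof.
set B := obox _ _ => mA.
have mB : measurable B by exact: measurable_obox.
have mi C : measurable C -> mfun (\1_(C `&` B) : 'rV[R]_n -> R).
  by move=> mC; apply: measurable_indic; exact: measurableI.
have iB : L1 (\1_B : 'rV[R]_n -> R).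
  apply: (@integrable_bounded_support _ _ _ 1 (`|const_mx (- r) : 'rV[R]_n| + `|const_mx r : 'rV[R]_n|)) => [|x|x].
  - exact: measurable_indic.
  - by rewrite indicE; case: (x \in _); rewrite ?normr1 ?normr0.
  - by rewrite indicE => xr; rewrite memNset// => /obox_bounded; rewrite leNgt xr.
pose P (C : set 'rV[R]_n) := tapprox (\1_(C `&` B) : 'rV[R]_n -> R).
have PB : tapprox (\1_B : 'rV[R]_n -> R) by exact: tapprox_obox.
apply: (@dynkin_induction _ _ [set A | exists a b, A = obox a b] P).
- exact: measurable_rV_obox.
- move=> _ _ [a [b ->]] [a' [b' ->]]; rewrite oboxI.
  by eexists; eexists.
- by rewrite /P setTI.
- by move=> _ [a [b ->]]; rewrite /P oboxI; exact: tapprox_obox.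
- move=> C mC PC; rewrite /P.
  rewrite (_ : \1_(~` C `&` B) = fun x => \1_B x + (-1) * \1_(C `&` B) x :> R).
    apply: tapproxD => //; first by apply: measurable_funM; [exact: measurable_cst|exact: mi].
    by apply: tapproxZ => //; exact: mi.
  apply/funext => x; rewrite !indicE !in_setI in_setC.
  by case: (x \in C); case: (x \in B) => /=; ring.
- move=> F mF tF PF; rewrite /P.
  pose U k := \bigcup_(i < k) F i.
  have mU k : measurable (U k) by exact: bigcup_measurable.
  have PU k : P (U k).
    elim: k => [|k ih].
      rewrite /P (_ : U 0%N `&` B = set0); last by rewrite /U bigcup_mkord big_ord0 set0I.
      rewrite indic0; exact: tapprox_csmooth csmooth0.
    rewrite /P (_ : \1_(U k.+1 `&` B) = fun x => \1_(U k `&` B) x + \1_(F k `&` B) x :> R).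
      by apply: tapproxD; [exact: mi|exact: mi|exact: ih|exact: PF].
    apply/funext => x; rewrite !indicE /U bigcup_mkord big_ord_recr/= -bigcup_mkord.
    rewrite !in_setI in_setU.
    have [xF|xF] := boolP (x \in F k); last by rewrite orbF addr0.
    rewrite (_ : x \in \bigcup_(i < k) F i = false)/= ?add0r//.
    apply/negP; rewrite inE => -[i/= ik Fi]; move: xF; rewrite inE => Fk.
    move/trivIsetP : tF => /(_ i k I I); rewrite lt_eqF// => /(_ isT).
    by move/seteqP => [/(_ x) h _]; apply: h.
  apply: tapprox_closed; first by apply: mi; exact: bigcup_measurable.
  move=> e e0.
  have mI : mfun (\1_(\bigcup_k F k `&` B) : 'rV[R]_n -> R).
    by apply: mi; exact: bigcup_measurable.
  have H2 x : (\1_(U k `&` B) x : R) @[k --> \oo] --> (\1_(\bigcup_k F k `&` B) x : R).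
    have [xF|xF] := boolP (x \in \bigcup_k F k).
      move: (xF); rewrite inE => -[i _ Fi].
      apply: cvg_near_cst; near=> k.
      rewrite !indicE !in_setI xF/= (_ : x \in U k)//.
      by apply/mem_set; exists i => //=; near: k; exact: nbhs_infty_gt.
    apply: cvg_near_cst; apply: nearW => k; rewrite !indicE !in_setI (negbTE xF)/=.
    rewrite memNset// => -[i _ Fi]; move/negP: xF; apply; apply/mem_set.
    by exists i.
  have H3 k x : `|\1_(\bigcup_k F k `&` B) x - \1_(U k `&` B) x| <= (\1_B x : R).
    rewrite !indicE !in_setI; case: (x \in B); last by rewrite !andbF subrr normr0.
    rewrite !andbT; case: (x \in _); case: (x \in _); rewrite ?subrr ?subr0 ?sub0r ?normrN ?normr1 ?normr0//.
  have H4 : L1 (fun x => (\1_B x : R) ^+ 2)%R.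
    apply: le_integrable iB => //.
      by apply/measurable_EFinP; apply: measurable_funX; exact: measurable_indic.
    by move=> x _ /=; rewrite !indicE lee_fin; case: (x \in B); rewrite ?expr1n ?expr0n.
  have [k hk] := NL2_dominated e0 (fun k => mi _ (mU k)) mI H2 H3 H4.
  by exists (\1_(U k `&` B)); split; [exact: mi|exact: PU|].
- by rewrite -measurable_rV_obox.
Unshelve. all: by end_near.
Qed.

Lemma tapprox_sum (I : Type) (s : seq I) (h : I -> 'rV[R]_n -> R) :
  (forall i, mfun (h i)) -> (forall i, tapprox (h i)) ->
  tapprox (fun x => \sum_(i <- s) h i x).
Proof.
move=> mh ah; elim: s => [|i s ih].
  rewrite (_ : (fun x => _) = fun=> 0); first exact: tapprox_csmooth csmooth0.
  by apply/funext => x; rewrite big_nil.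
rewrite (_ : (fun x => _) = fun x => h i x + \sum_(i <- s) h i x).
  by apply: tapproxD => //; exact: measurable_sumP.
by apply/funext => x; rewrite big_cons.
Qed.

Lemma tapprox_ge0 f (r : R) : mfun f -> (forall x, 0 <= f x) -> L1 (fun x => f x ^+ 2)%R ->
  (forall x, r < `|x| -> f x = 0) -> tapprox f.
Proof.
move=> mf f0 if2 fr.
pose B := obox (const_mx (- (`|r| + 1)) : 'rV[R]_n) (const_mx (`|r| + 1)).
have rB x : ~ B x -> f x = 0.
  move=> h; apply: fr; rewrite ltNge; apply/negP => xr; apply: h => i.
  rewrite in_itv/= !mxE -ltr_norml (le_lt_trans (le_coord_norm x i))//.
  by rewrite (le_lt_trans xr)// (le_lt_trans (ler_norm r))// ltrDl.
have mB : measurable B by exact: measurable_obox.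
have mf' : measurable_fun [set: 'rV[R]_n] (EFin \o f) by exact/measurable_EFinP.
have f0' x : [set: 'rV[R]_n] x -> (0 <= (EFin \o f) x)%E by move=> _; rewrite lee_fin.
pose g := measurable_fun_approximation.approx setT (EFin \o f).
have mA k i : measurable (dyadic_approx setT (EFin \o f) k i).
  rewrite /dyadic_approx; case: ifPn => [kn|_]//; rewrite -preimage_comp.
  by apply: mf' => //; apply/measurable_image_EFin; exact: measurable_itv.
have mI k : measurable (integer_approx setT (EFin \o f) k).
  exact: emeasurable_fun_c_infty.
have mg k : mfun (g k).
  apply: measurable_funD.
    apply: measurable_sumP => i _; apply: measurable_funM; first exact: measurable_cst.
    exact: measurable_indic.
  by apply: measurable_funM; [exact: measurable_cst|exact: measurable_indic].
have g0 k x : 0 <= g k x.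
  apply: addr_ge0; last by rewrite mulr_ge0// indicE.
  by apply: sumr_ge0 => i _; rewrite mulr_ge0 ?indicE// mulr_ge0// invr_ge0 exprn_ge0.
have gf k x : g k x <= f x.
  by rewrite -lee_fin; exact: (@le_approx _ _ _ setT (EFin \o f) k x f0').
(* The dyadic approximants lie between 0 and [f], hence vanish off [B]; this puts every level set in
   the form covered by [tapprox_measurable]. *)
have gB k : g k = fun x => g k x * \1_B x.
  apply/funext => x; rewrite indicE; have [|xB] := boolP (x \in B); first by rewrite mulr1.
  rewrite mulr0; apply/eqP; rewrite eq_le g0 andbT -(rB x) ?gf// => /mem_set h.
  by rewrite h in xB.
have ag k : tapprox (g k).
  rewrite gB /g /measurable_fun_approximation.approx.
  rewrite (_ : (fun x => _) = fun x => \sum_(i < (k * 2 ^ k)%N) (i%:R * 2 ^- k *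
       \1_(dyadic_approx setT (EFin \o f) k i `&` B) x) +
     k%:R * \1_(integer_approx setT (EFin \o f) k `&` B) x).
    apply: tapproxD.
    - apply: measurable_sumP => i _; apply: measurable_funM; first exact: measurable_cst.
      by apply: measurable_indic; exact: measurableI.
    - apply: measurable_funM; first exact: measurable_cst.
      by apply: measurable_indic; exact: measurableI.
    - apply: tapprox_sum => i.
        apply: measurable_funM; first exact: measurable_cst.
        by apply: measurable_indic; exact: measurableI.
      by apply: tapproxZ; [apply: measurable_indic; exact: measurableI|exact: tapprox_measurable].
    - by apply: tapproxZ; [apply: measurable_indic; exact: measurableI|exact: tapprox_measurable].
  apply/funext => x; rewrite mulrDl mulr_suml; congr (_ + _).
    by apply: eq_bigr => i _; rewrite indicI mulrA.
  by rewrite indicI mulrA.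
apply: tapprox_closed => // e e0.
have H2 x : g k x @[k --> \oo] --> f x.
  by have := @cvg_approx _ _ _ setT (EFin \o f) x f0' I; apply; rewrite ltry.
have H3 k x : `|f x - g k x| <= f x.
  by rewrite ger0_norm ?subr_ge0 ?gf// lerBlDr lerDl.
have [k hk] := NL2_dominated e0 mg mf H2 H3 if2.
by exists (g k).
Qed.

(** Only needed to extend the L^2 convergence of mollifications from test functions to square
    integrable functions of bounded support. *)
Lemma test_dense f (r : R) : mfun f -> L1 (fun x => f x ^+ 2)%R ->
  (forall x, r < `|x| -> f x = 0) -> tapprox f.
Proof.
move=> mf if2 fr.
have mp : mfun (fun x => Num.max (f x) 0) by apply: measurable_maxr => //; exact: measurable_cst.
have mN : mfun (fun x => - f x).
  by apply: measurableT_comp.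
have mm : mfun (fun x => Num.max (- f x) 0) by apply: measurable_maxr => //; exact: measurable_cst.
rewrite (_ : f = fun x => Num.max (f x) 0 + (-1) * Num.max (- f x) 0); last first.
  by apply/funext => x; rewrite /Num.max oppr_lt0; case: (ltgtP (f x) 0) => h; rewrite ?h; ring.
have mx (u v : R) : (u ^+ 2 = v ^+ 2) -> `|Num.max u 0 ^+ 2| <= `|v ^+ 2|.
  move=> <-; rewrite /Num.max; case: ltP => _; last by [].
  by rewrite expr0n normr0.
apply: tapproxD => //; first by apply: measurable_funM => //; exact: measurable_cst.
- apply: (@tapprox_ge0 _ r) => // [x||x /fr ->].
  + by rewrite le_max lexx orbT.
  + apply: le_integrable if2 => //; first by apply/measurable_EFinP; exact: measurable_funX.
    by move=> x _; rewrite /= lee_fin mx.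
  + by rewrite maxxx.
- apply: tapproxZ => //; apply: (@tapprox_ge0 _ r) => // [x||x /fr ->].
  + by rewrite le_max lexx orbT.
  + apply: le_integrable if2 => //; first by apply/measurable_EFinP; exact: measurable_funX.
    by move=> x _; rewrite /= lee_fin mx// sqrrN.
  + by rewrite oppr0 maxxx.
Qed.

End density.

(** * Mollification in L^2 *)

Section mollification.
Context {R : realType} {n : nat}.
Notation mu := (@lebesgue_rV R n).
Notation L1 g := (mu.-integrable setT (EFin \o g)).
Notation mfun f := (measurable_fun [set: 'rV[R]_n] f).
Implicit Types (f g : 'rV[R]_n -> R) (x y : 'rV[R]_n) (t : R).
Hypothesis n_gt0 : (0 < n)%N.

Lemma Rintegral_molli_shift t x : 0 < t -> \int[mu]_y molli t (x - y) = 1.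
Proof.
move=> t0; rewrite Rintegral_reflect ?Rintegral_molli//.
exact: smooth_measurable (csmooth_molli t0).1.
Qed.

Lemma integrable_molli_shift t x : 0 < t -> L1 (fun y => molli t (x - y))%R.
Proof. by move=> t0; exact/csmooth_integrable/csmooth_reflect/csmooth_molli. Qed.

(** A mollification at scale [t] is a weighted mean over the cube of radius [t], so closeness of [f]
    to a constant there is inherited. With e = 0 it says that local constants are reproduced
    exactly. *)
Lemma conv_molli_near t f x (a e : R) : 0 < t -> L1 f ->
  (forall y, `|x - y| <= t -> `|f y - a| <= e) -> `|convol (molli t) f x - a| <= e.
Proof.
move=> t0 if_ fa; have ib := integrable_molli_shift x t0.
have -> : convol (molli t) f x - a = \int[mu]_y (molli t (x - y) * f y - a * molli t (x - y)).
  rewrite RintegralB//; last exact: integrableZR.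
    by rewrite RintegralZl// Rintegral_molli_shift// mulr1.
  exact/integrable_conv/if_/csmooth_molli.
have i1 : L1 (fun y => molli t (x - y) * f y - a * molli t (x - y))%R.
  by apply: integrableBR; [exact/integrable_conv/if_/csmooth_molli|exact: integrableZR].
apply: le_trans (le_normr_Rintegral _ i1) _ => //.
rewrite -[leRHS]mulr1 -(Rintegral_molli_shift x t0) -RintegralZl//.
apply: le_Rintegral => //; [exact: integrable_norm|exact: integrableZR|].
move=> y _; have [xy|xy] := leP `|x - y| t; last first.
  by rewrite molli_out ?(ltW xy)// mul0r !mulr0 subrr normr0.
rewrite [a * _]mulrC -mulrBr normrM (ger0_norm (molli_ge0 _ _ _))// mulrC.
by rewrite ler_wpM2r ?molli_ge0// fa.
Qed.

(** Jensen's inequality as nonnegativity of a variance: with a the mean of [f] for the weight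
    [molli t (x - y)], expand the integral of that weight times (f - a)^2. The right-hand side may
    be infinite, and then there is nothing to show. *)
Lemma sqr_conv_molli t f x : 0 < t -> L1 f ->
  (((convol (molli t) f x) ^+ 2)%:E <= \int[mu]_y (molli t (x - y) * f y ^+ 2)%:E)%E.
Proof.
move=> t0 if_; set I := (X in (_ <= X)%E).
have mf := integrable_measurable if_.
have ib := integrable_molli_shift x t0.
have ifb : L1 (fun y => molli t (x - y) * f y)%R by exact/integrable_conv/if_/csmooth_molli.
have I0 : (0 <= I)%E.
  by apply: integral_ge0 => y _; rewrite lee_fin mulr_ge0 ?molli_ge0 ?sqr_ge0.
have [Iy|Iy] := eqVneq I +oo%E; first by rewrite Iy leey.
have if2 : L1 (fun y => molli t (x - y) * f y ^+ 2)%R.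
  apply/integrableP; split.
    apply/measurable_EFinP; apply: measurable_funM; last exact: measurable_funX.
    by have := integrable_measurable ib.
  rewrite (_ : integral _ _ _ = I); first by rewrite ltey.
  by apply: eq_integral => y _ /=; rewrite ger0_norm// mulr_ge0 ?molli_ge0 ?sqr_ge0.
set a := convol (molli t) f x.
have : 0 <= \int[mu]_y (molli t (x - y) * f y ^+ 2 - (2 * a) * (molli t (x - y) * f y) + a ^+ 2 * molli t (x - y)).
  apply: Rintegral_ge0 => y _.
  rewrite (_ : _ + _ = molli t (x - y) * (f y - a) ^+ 2); last by ring.
  by rewrite mulr_ge0 ?molli_ge0 ?sqr_ge0.
rewrite RintegralD//; last 2 first.
- by apply: integrableBR => //; exact: integrableZR.
- exact: integrableZR.
rewrite RintegralB//; last exact: integrableZR.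
rewrite [X in _ - X + _]RintegralZl// [X in _ + X]RintegralZl// Rintegral_molli_shift// -/(convol (molli t) f x) -/a => h.
have Ifin : I \is a fin_num by rewrite ge0_fin_numE// ltey.
have E : \int[mu]_y (molli t (x - y) * f y ^+ 2) = fine I by [].
by rewrite -(fineK Ifin) lee_fin -E; move: h; rewrite mulr1; lra.
Qed.

Lemma measurable_molli_pair t f : 0 < t -> mfun f ->
  measurable_fun setT (fun z : 'rV[R]_n * 'rV[R]_n => (molli t (z.1 - z.2) * f z.2 ^+ 2)%:E).
Proof.
move=> t0 mf; apply/measurable_EFinP; apply: measurable_funM; last first.
  by apply: measurable_funX; exact: (measurableT_comp mf measurable_snd).
have mB : measurable_fun setT (fun z : 'rV[R]_n * 'rV[R]_n => z.1 - z.2).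
  exact: measurable_rVB.
exact: (measurableT_comp (smooth_measurable (csmooth_molli t0).1) mB).
Qed.

Lemma int_sqr_conv_molli t f : 0 < t -> L1 f ->
  (\int[mu]_x ((convol (molli t) f x) ^+ 2)%:E <= \int[mu]_x (f x ^+ 2)%:E)%E.
Proof.
move=> t0 if_; have mf := integrable_measurable if_.
have mp := measurable_molli_pair t0 mf.
have p0 z : (0 <= (molli t (z.1 - z.2) * f z.2 ^+ 2)%:E)%E.
  by rewrite lee_fin mulr_ge0 ?molli_ge0 ?sqr_ge0.
apply: (@le_trans _ _ (\int[mu]_x \int[mu]_y (molli t (x - y) * f y ^+ 2)%:E)%E).
  apply: ge0_le_integral => //.
  - by move=> x _; rewrite lee_fin sqr_ge0.
  - apply/measurable_EFinP; apply: measurable_funX.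
    by apply: smooth_measurable; apply: smooth_conv if_; exact: csmooth_molli.
  - exact: (measurable_fun_fubini_tonelli_F _ mp p0).
  - by move=> x _; exact: sqr_conv_molli.
have := fubini_tonelli (m1 := mu) (m2 := mu) _ mp p0.
rewrite /= => ->.
apply: ge0_le_integral => //.
- by move=> y _; apply: integral_ge0 => x _; exact: (p0 (x, y)).
- exact: (measurable_fun_fubini_tonelli_G _ mp p0).
- by apply/measurable_EFinP; exact: measurable_funX.
move=> y _; under eq_integral do rewrite mulrC EFinM.
rewrite ge0_integralZl//; last 3 first.
- apply/measurable_EFinP.
  exact: (measurableT_comp (smooth_measurable (csmooth_molli t0).1) (measurable_rVB _ _)).
- by move=> x _; rewrite lee_fin molli_ge0.
- by rewrite lee_fin sqr_ge0.
have -> : (\int[mu]_x (molli t (x - y))%:E = 1)%E.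
  rewrite (@integral_translate _ _ (- y) (fun x => (molli t x)%:E)).
  - have ib := csmooth_integrable (csmooth_molli (n := n) t0).
    rewrite -[RHS](_ : (\int[mu]_x molli t x)%:E = 1%E); last by rewrite Rintegral_molli.
    by rewrite fineK//; exact: integrable_fin_num.
  - by apply/measurable_EFinP; exact: smooth_measurable (csmooth_molli t0).1.
  - by move=> x; rewrite lee_fin molli_ge0.
by rewrite mule1.
Qed.

Lemma NL2_conv_molli t f : 0 < t -> L1 f -> (NL 2 (convol (molli t) f) <= NL 2 f)%E.
Proof.
move=> t0 if_; rewrite !NLE; apply: gt0_ler_poweR.
- by rewrite invr_ge0.
- rewrite in_itv/= leey andbT; apply: integral_ge0 => x _; by rewrite lee_fin powR_ge0.
- rewrite in_itv/= leey andbT; apply: integral_ge0 => x _; by rewrite lee_fin powR_ge0.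
under eq_integral do rewrite powR_mulrn// real_normK ?num_real//.
under [leRHS]eq_integral do rewrite powR_mulrn// real_normK ?num_real//.
exact: int_sqr_conv_molli.
Qed.

Lemma L1_of_L2 f (r : R) : mfun f -> L1 (fun x => f x ^+ 2)%R ->
  (forall x, r < `|x| -> f x = 0) -> L1 f.
Proof.
move=> mf if2 fr; have iB := integrable_cube (0 : 'rV[R]_n) r.
apply: le_integrable (integrableDR iB if2) => //; first exact/measurable_EFinP.
move=> x _ /=; rewrite lee_fin indicE.
rewrite [leRHS]ger0_norm ?addr_ge0 ?sqr_ge0//.
have [xr|/fr ->] := leP `|x| r; last by rewrite normr0 addr_ge0 ?sqr_ge0.
rewrite mem_set/= ?subr0// -real_normK ?num_real//.
by have := sqr_ge0 (`|f x| - 1); have := normr_ge0 (f x); nra.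
Qed.

Lemma conv_molli_csmooth g (e : R) : csmooth g -> 0 < e -> exists2 d, 0 < d &
  forall t, 0 < t -> t <= d -> (NL 2 (fun x => convol (molli t) g x - g x)%R <= e%:E)%E.
Proof.
move=> cg e0; have [L L0 gL] := csmooth_lipschitz cg.
have [sg [r0 gr0]] := cg; pose r := `|r0|; have r_ge0 : 0 <= r by exact: normr_ge0.
have gr x : r < `|x| -> g x = 0 by move=> h; apply: gr0; rewrite (le_lt_trans (ler_norm _)).
have ig := csmooth_integrable cg.
pose v := (2 * (r + 1)) ^+ n + 1.
have v0 : 1 <= v by rewrite /v lerDr exprn_ge0// mulr_ge0// addr_ge0.
have v00 : 0 < v := lt_le_trans ltr01 v0.
exists (Num.min 1 (e / (L * v))); first by rewrite lt_min ltr01 divr_gt0// mulr_gt0.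
move=> t t0; rewrite le_min => /andP[t1 te].
apply: int_NL_le => //; first exact: ltW.
apply: (@le_trans _ _ (\int[mu]_x ((L * t) ^+ 2 * \1_[set x | `|x - 0| <= r + 1]%R x)%:E)%E).
  apply: ge0_le_integral => //.
  - apply/measurable_EFinP; apply: measurable_funX; apply: measurableT_comp => //.
    apply: measurable_funB; last exact: smooth_measurable.
    by apply: smooth_measurable; apply: smooth_conv ig; exact: csmooth_molli.
  - apply/measurable_EFinP; apply: measurable_funM; first exact: measurable_cst.
    by apply: measurable_indic; exact: measurable_cube.
  move=> x _; rewrite lee_fin indicE; have [xr|xr] := leP `|x| (r + 1).
    rewrite mem_set/= ?subr0// mulr1 lerXn2r ?nnegrE ?mulr_ge0 ?(ltW L0) ?(ltW t0)//.
    apply: conv_molli_near => // y xy; rewrite distrC (le_trans (gL x y))//.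
    by rewrite ler_wpM2l// ltW.
  rewrite gr ?(lt_trans _ xr) ?ltrDl// subr0 (@conv_support _ _ _ _ t r) ?normr0 ?expr0n//.
  - by rewrite mulr_ge0 ?sqr_ge0.
  - by move=> y /ltW; exact: molli_out.
  - by rewrite (le_lt_trans _ xr)// addrC lerD2l.
under eq_integral do rewrite EFinM.
have mi : measurable_fun setT (fun x : 'rV[R]_n => (\1_[set x | `|x - 0| <= r + 1]%R x : R)%:E).
  by apply/measurable_EFinP; apply: measurable_indic; exact: measurable_cube.
rewrite ge0_integralZl => [|//|//|x _|]; last 2 first.
- by rewrite lee_fin indicE.
- by rewrite lee_fin sqr_ge0.
rewrite integral_indic ?setIT//; last exact: measurable_cube.
apply: (@le_trans _ _ (((L * t) ^+ 2)%:E * ((2 * (r + 1)) ^+ n)%:E)%E).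
  apply: lee_wpmul2l; first by rewrite lee_fin sqr_ge0.
  rewrite le_eqVlt; apply/orP; left; apply/eqP; apply: lebesgue_rV_cube.
  by rewrite addr_ge0.
rewrite -EFinM lee_fin.
have : L * t * v <= e by rewrite mulrAC -ler_pdivlMl ?mulr_gt0// mulrC.
have Lt : 0 < L * t by rewrite mulr_gt0.
move=> h; apply: (@le_trans _ _ ((L * t * v) ^+ 2)); last by rewrite lerXn2r ?nnegrE ?(ltW e0) ?(ltW (mulr_gt0 Lt v00)).
rewrite [leRHS]exprMn ler_wpM2l ?sqr_ge0// (le_trans (_ : _ <= v)) ?lerDl//.
by rewrite expr2 ler_peMr// ltW.
Qed.

(** Density plus contraction: f is within e/3 of a test function g, mollification does not enlarge
    the error f - g, and g converges uniformly with controlled support. *)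
Lemma conv_molli_cvg f (r e : R) : mfun f -> L1 (fun x => f x ^+ 2)%R ->
  (forall x, r < `|x| -> f x = 0) -> 0 < e -> exists2 d, 0 < d &
  forall t, 0 < t -> t <= d -> (NL 2 (fun x => convol (molli t) f x - f x)%R <= e%:E)%E.
Proof.
move=> mf if2 fr e0; have if1 := L1_of_L2 mf if2 fr.
have e30 : 0 < e / 3 by rewrite divr_gt0.
have [g cg fg] := test_dense mf if2 fr e30.
have [d d0 hd] := conv_molli_csmooth cg e30.
exists d => // t t0 td.
have ig := csmooth_integrable cg; have mg := integrable_measurable ig.
have cb := csmooth_molli (n := n) t0.
have mcg : mfun (convol (molli t) g) by exact: smooth_measurable (smooth_conv cb ig).
have ifg : L1 (fun x => f x - g x)%R by exact: integrableBR.
have mcfg : mfun (convol (molli t) (fun x => f x - g x)) by exact: smooth_measurable (smooth_conv cb ifg).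
rewrite (_ : (fun x => _) = fun x => convol (molli t) (fun x => f x - g x) x +
    ((convol (molli t) g x - g x) + (-1) * (f x - g x))); last first.
  apply/funext => x; have := convDr x cb ifg ig.
  under [in X in X = _ -> _]eq_fun do rewrite subrK.
  by move=> ->; ring.
have m1 : mfun (fun x => convol (molli t) g x - g x) by exact: measurable_funB.
have m2 : mfun (fun x => (-1) * (f x - g x)).
  by apply: measurable_funM; [exact: measurable_cst|exact: measurable_funB].
apply: le_trans (NL_triangle _ _ _) _; [by rewrite ler1n|by []|exact: measurable_funD|].
have -> : e = e / 3 + (e / 3 + e / 3) by field.
rewrite !EFinD; apply: leeD.
  by apply: le_trans (NL2_conv_molli t0 ifg) _.
apply: le_trans (NL_triangle _ _ _) _; [by rewrite ler1n|by []|by []|].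
apply: leeD; first exact: hd.
rewrite NLZ//; last exact: measurable_funB.
by rewrite normrN1 mul1e.
Qed.

End mollification.

Local Opaque partial smooth.

(** * The Dirac operators on test forms *)

Section symmetric_derivatives.
Context {R : realType} {n : nat}.
Notation mu := (@lebesgue_rV R n).
Notation e_ j := (delta_mx ord0 j : 'rV[R]_n).
Implicit Types (f g : 'rV[R]_n -> R) (x : 'rV[R]_n).

Lemma norm_e_le (j : 'I_n) : `|e_ j| <= 1.
Proof.
by rewrite norm_le_rV// => i; rewrite mxE eqxx/=; case: (i == j); rewrite ?normr1 ?normr0.
Qed.

(** The mean value theorem twice: in direction i for the increment of [f] in direction j, then in
    direction j for the partial derivative. The left-hand side is symmetric in i and j, and this
    drives [partialC]. *)
Lemma second_difference f i j x (h : R) : smooth f -> h != 0 ->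
  exists y : 'rV[R]_n, `|y - x| <= `|h| + `|h| /\
  f (h *: e_ i + (h *: e_ j + x)) - f (h *: e_ i + x) - (f (h *: e_ j + x) - f x) =
  h * h * partial j (partial i f) y.
Proof.
move=> sf h0; pose g y := f (h *: e_ j + 1 *: y) + (-1) * f y.
have s1 := smooth_affine (h *: e_ j) 1 sf.
have s2 := smoothM (smooth_cst (-1)) sf.
have sg : smooth g by exact: (smoothD s1 s2).
have [t [th gE]] := mean_value_along x i h sg.
have [r [rh fE]] := mean_value_along (t *: e_ i + x) j h (smooth_partial i sf).
exists (r *: e_ j + (t *: e_ i + x)); split.
  rewrite addrA addrK (le_trans (ler_normD _ _))// !normrZ lerD//.
    by rewrite (le_trans _ rh)// ler_piMr// norm_e_le.
  by rewrite (le_trans _ th)// ler_piMr// norm_e_le.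
rewrite -mulrA -fE.
rewrite (partialD _ _ s1 s2) (partial_affine _ _ _ _ sf) (partialZ _ _ _ sf) in gE.
rewrite mul1r scale1r mulN1r in gE; rewrite -gE /g !scale1r !mulN1r.
rewrite [h *: e_ j + (h *: e_ i + x)]addrCA.
move: (f _) (f _) (f _) (f _) => a b c d; ring.
Qed.

Lemma partialC f i j x : csmooth f ->
  partial i (partial j f) x = partial j (partial i f) x.
Proof.
move=> cf; have sf := cf.1.
have [L L0 fL] := csmooth_lipschitz (csmooth_partial i (csmooth_partial j cf)).
have [K K0 fK] := csmooth_lipschitz (csmooth_partial j (csmooth_partial i cf)).
apply/eqP; rewrite -subr_eq0 -normr_eq0 eq_le normr_ge0 andbT.
apply/ler_addgt0Pr => e e0; rewrite add0r.
(* The two mean value points lie within 2h of [x], so the Lipschitz errors add up to (L + K) 2h =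
   e. *)
pose h := e / (2 * (L + K)).
have h0 : 0 < h by rewrite divr_gt0// mulr_gt0// addr_gt0.
have hn0 : h != 0 by rewrite gt_eqF.
have [y [yx yE]] := second_difference i j x sf hn0.
have [z [zx zE]] := second_difference j i x sf hn0.
have E : partial j (partial i f) y = partial i (partial j f) z.
  have T (a b c d : R) : a - b - (c - d) = a - c - (b - d) by clear; ring.
  have e1 : h *: e_ i + (h *: e_ j + x) = h *: e_ j + (h *: e_ i + x) by exact: addrCA.
  rewrite e1 in yE.
  exact: (mulfI (mulf_neq0 hn0 hn0) (etrans (esym yE) (etrans (T _ _ _ _) zE))).
rewrite (gtr0_norm h0) in yx zx.
have -> : partial i (partial j f) x - partial j (partial i f) x =
  (partial i (partial j f) x - partial i (partial j f) z) +
  (partial j (partial i f) y - partial j (partial i f) x) by rewrite E addrA subrK.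
apply: le_trans (ler_normD _ _) _; apply: le_trans (lerD (fL _ _) (fK _ _)) _.
rewrite (distrC x); have -> : e = L * (h + h) + K * (h + h).
  have : L + K != 0 by rewrite gt_eqF ?addr_gt0.
  by rewrite /h; clear; move: L K => a b ab; field.
exact: (lerD (ler_wpM2l (ltW L0) zx) (ler_wpM2l (ltW K0) yx)).
Qed.

Lemma Rintegral_by_parts f g j : csmooth f -> csmooth g ->
  \int[mu]_x (partial j f x * g x) = - \int[mu]_x (f x * partial j g x).
Proof.
move=> cf cg; have := Rintegral_partial0 j (csmoothMl cf cg.1).
under eq_Rintegral do rewrite (partialM _ _ cf.1 cg.1).
have c1 := csmoothMl (csmooth_partial j cf) cg.1.
have c2 := csmoothMl cf (csmooth_partial j cg).1.
by rewrite RintegralD//; [move/eqP; rewrite addr_eq0 => /eqP|exact: csmooth_integrable|exact: csmooth_integrable].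
Qed.

(** Integrate the divergence of f^2 X with X = x / (1 + |x|^2) and w = 1 / (1 + |x|^2). The
    divergence of X is n w - 2 |x|^2 w^2 >= (n - 2) w >= w, which is where n >= 3 enters; the cross
    term 2 f grad f . X is split by Young's inequality. *)
Lemma hardy f : (3 <= n)%N -> csmooth f ->
  \int[mu]_x (f x ^+ 2 * (1 + sqn x)^-1) <= 4 * \sum_j \int[mu]_x (partial j f x ^+ 2).
Proof.
move=> n3 cf; have q0 x : 0 < 1 + sqn x by rewrite ltr_pwDl// sqn_ge0.
have sq : smooth (fun x : 'rV[R]_n => 1 + sqn x).
  by apply: smoothD; [exact: smooth_cst|exact: smooth_sqn].
have sw : smooth (fun x : 'rV[R]_n => (1 + sqn x)^-1).
  by apply: smooth_inv => // x; rewrite gt_eqF.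
pose w x := (1 + sqn x)^-1; rewrite -/w in sw.
have pw j x : partial j w x = - (2 * x ord0 j * w x ^+ 2).
  have := partialM j x sw sq.
  under [in partial _ _]eq_fun do rewrite mulVf ?gt_eqF//.
  rewrite partial_cst (partialD _ _ (smooth_cst 1) smooth_sqn) partial_cst add0r partial_sqn.
  rewrite -/w; set P := partial j w x => /esym/eqP; rewrite addr_eq0 => /eqP h.
  have : P = - (w x * (2 * x ord0 j)) * w x.
    by rewrite -h -mulrA mulfV ?mulr1// gt_eqF.
  by move=> ->; ring.
pose X j x := x ord0 j * w x.
have sX j : smooth (X j) by exact: (smoothM (smooth_coord j) sw).
have pX j x : partial j (X j) x = w x - 2 * x ord0 j ^+ 2 * w x ^+ 2.
  rewrite (partialM _ _ (smooth_coord j) sw) partial_coord eqxx pw.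
  by move: (w x) (x ord0 j) => a b; rewrite mul1r; ring.
have cX j : csmooth (partial j (fun x => f x * f x * X j x)).
  exact: (csmooth_partial j (csmoothMl (csmoothMl cf cf.1) (sX j))).
have cff : csmooth (fun x => f x * f x) by exact: csmoothMl cf cf.1.
have cfw : csmooth (fun x => f x ^+ 2 * w x).
  by under eq_fun do rewrite expr2; exact: csmoothMl.
have cp j : csmooth (fun x => partial j f x ^+ 2).
  under eq_fun do rewrite expr2.
  exact: (csmoothMl (csmooth_partial j cf) (csmooth_partial j cf).1).
have key : \int[mu]_x (\sum_j partial j (fun x => f x * f x * X j x) x) = 0.
  rewrite Rintegral_sum => [|j _].
    rewrite big1 => [//|j _].
    exact: (Rintegral_partial0 j (csmoothMl cff (sX j))).
  exact: (csmooth_integrable (cX j)).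
have pt x : f x ^+ 2 * w x - 4 * \sum_j partial j f x ^+ 2 <=
    2 * \sum_j partial j (fun x => f x * f x * X j x) x.
  under [in leRHS]eq_bigr do rewrite (partialM _ _ cff.1 (sX _)) (partialM _ _ cf.1 cf.1) pX.
  have w0 : 0 < w x by rewrite invr_gt0.
  have wq : w x * sqn x <= 1 by rewrite /w mulrC ler_pdivrMr// mul1r lerDr.
  have n1 : 3 <= n%:R :> R by rewrite ler_nat.
  rewrite big_split/= -mulr_sumr [\sum_j (w x - _)]sumrB sumr_const card_ord -mulr_suml -mulr_sumr.
  rewrite -/(sqn x) -mulr_natl.
  (* Completing the square in each coordinate, after |x|^2 w <= 1; half of the gain w f^2 is spent
     here. *)
  have cs : - (w x * f x ^+ 2 * 2^-1) - 2 * \sum_j partial j f x ^+ 2 <=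
      \sum_j (partial j f x * f x + f x * partial j f x) * X j x.
    apply: (@le_trans _ _ (- (w x ^+ 2 * sqn x * f x ^+ 2 * 2^-1) - 2 * \sum_j partial j f x ^+ 2)).
      rewrite lerB// lerN2 ler_pM2r// ler_wpM2r ?sqr_ge0// expr2 -mulrA.
      by rewrite -[leRHS]mulr1 ler_pM2l.
    rewrite mulr_sumr -sumrN -[w x ^+ 2 * sqn x * _ * _]mulrA [w x ^+ 2 * _ * _]mulrAC.
    rewrite mulr_sumr -sumrN -big_split/=; apply: ler_sum => j _; rewrite /X.
    have := sqr_ge0 (partial j f x * 2 + f x * x ord0 j * w x).
    nra.
  rewrite [leRHS]mulrDr; set S := \sum_j (_ * X j x) in cs *; set P := \sum_j partial j f x ^+ 2 in cs *.
  have f2 : 0 <= f x * f x by rewrite -expr2 sqr_ge0.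
  have hw : w x <= n%:R * w x - 2 * sqn x * w x ^+ 2.
    have : w x * (w x * sqn x) <= w x * 1 by rewrite ler_pM2l.
    nra.
  have : f x * f x * w x <= f x * f x * (n%:R * w x - 2 * sqn x * w x ^+ 2) by rewrite ler_wpM2l.
  rewrite expr2 in cs *; lra.
have iw := csmooth_integrable cfw.
have ip : mu.-integrable setT (EFin \o (fun x => \sum_j partial j f x ^+ 2)%R).
  by apply: integrable_sumR => j _; exact: csmooth_integrable.
have ik : mu.-integrable setT (EFin \o (fun x => \sum_j partial j (fun x => f x * f x * X j x) x)%R).
  by apply: integrable_sumR => j _; exact: (csmooth_integrable (cX j)).
have i4 := integrableZR 4 ip; have i2 := integrableZR 2 ik.
have := le_Rintegral measurableT (integrableBR iw i4) i2 (fun x _ => pt x).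
rewrite RintegralZl// key mulr0 RintegralB// subr_le0 RintegralZl// Rintegral_sum => [//|j _].
exact: csmooth_integrable.
Qed.

End symmetric_derivatives.

Local Opaque convol.

(** * Test forms: Leibniz rules, approximate inverses, the energy identity *)

Section forms.
Context {R : realType} {n : nat}.
Notation mu := (@lebesgue_rV R n).
Notation form := ('rV[R]_n -> exterior R n).
Notation L1 g := (mu.-integrable setT (EFin \o g)).
Implicit Types (u v w h : form) (K g : 'rV[R]_n -> R) (I : {set 'I_n}) (x y : 'rV[R]_n).

Definition coef u I : 'rV[R]_n -> R := fun x => u x I.

Definition tform u := forall I, csmooth (coef u I).
Definition sform u := forall I, smooth (coef u I).
Definition iform u := forall I, L1 (coef u I).

Definition pform j u : form := fun x => [ffun I => partial j (coef u I) x].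
Definition fconv K u : form := fun x => [ffun I => convol K (coef u I) x].
Definition dir (s : R) u : form := fun x => \sum_j clif s j (pform j u x).

Lemma coef_pform j u I : coef (pform j u) I = partial j (coef u I).
Proof. by apply/funext => x; rewrite /coef ffunE. Qed.

Lemma coef_fconv K u I : coef (fconv K u) I = convol K (coef u I).
Proof. by apply/funext => x; rewrite /coef ffunE. Qed.

Lemma ext_sumE (J : Type) (r : seq J) (P : pred J) (F : J -> exterior R n) I :
  (\sum_(i <- r | P i) F i) I = \sum_(i <- r | P i) F i I.
Proof. by rewrite (big_morph (fun w : exterior R n => w I : R) (id1 := 0) (op1 := +%R)) => [//|a b|]; rewrite ffunE. Qed.

(** [clif s j] acts on coordinates as a signed permutation (up to the factor [s]), so each
    coefficient of its image is a scalar multiple of a single coefficient; smoothness and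
    measurability transfer at once. *)
Definition ctog j I : {set 'I_n} := if j \in I then I :\ j else j |: I.
Definition csgn (s : R) j I : R := nsgn j I * (if j \in I then 1 else s).

Lemma clif_coord s j (v : exterior R n) I : clif s j v I = csgn s j I * v (ctog j I).
Proof. by rewrite clifE /csgn /ctog; case: ifP => _; rewrite ?mulr1 ?mulrA. Qed.

Lemma coef_clif s j u I : coef (fun x => clif s j (u x)) I = fun x => csgn s j I * coef u (ctog j I) x.
Proof. by apply/funext => x; rewrite /coef clif_coord. Qed.

Lemma fcoefD u v I : coef (fun x => u x + v x) I = fun x => coef u I x + coef v I x.
Proof. by apply/funext => x; rewrite /coef extDE. Qed.

Lemma fcoefM g u I : coef (fun x => g x *: u x) I = fun x => g x * coef u I x.
Proof. by apply/funext => x; rewrite /coef extZE. Qed.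

Lemma fcoef_sum (J : Type) (r : seq J) (P : pred J) (F : J -> form) I :
  coef (fun x => \sum_(i <- r | P i) F i x) I = fun x => \sum_(i <- r | P i) coef (F i) I x.
Proof. by apply/funext => x; rewrite /coef ext_sumE. Qed.

Lemma tform_sform u : tform u -> sform u.
Proof. by move=> tu I; exact: (tu I).1. Qed.

Lemma tform_iform u : tform u -> iform u.
Proof. by move=> tu I; exact: (csmooth_integrable (tu I)). Qed.

Lemma tformD u v : tform u -> tform v -> tform (fun x => u x + v x).
Proof. by move=> tu tv I; rewrite fcoefD; exact: (csmoothD (tu I) (tv I)). Qed.

Lemma tformM g u : smooth g -> tform u -> tform (fun x => g x *: u x).
Proof. by move=> sg tu I; rewrite fcoefM; exact: (csmoothMr sg (tu I)). Qed.

Lemma tformZ (c : R) u : tform u -> tform (fun x => c *: u x).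
Proof. exact: (tformM (smooth_cst c)). Qed.

Lemma tformB u v : tform u -> tform v -> tform (fun x => u x - v x).
Proof.
move=> tu tv; have := tformD tu (tformZ (-1) tv).
by under eq_fun do rewrite scaleN1r.
Qed.

Lemma tform0 : tform (fun=> 0).
Proof.
move=> I; have -> : coef (fun=> 0) I = fun=> 0 by apply/funext => x; rewrite /coef ffunE.
exact: csmooth0.
Qed.

Lemma tform_sum (J : Type) (r : seq J) (P : pred J) (F : J -> form) :
  (forall i, P i -> tform (F i)) -> tform (fun x => \sum_(i <- r | P i) F i x).
Proof. by move=> tF I; rewrite fcoef_sum; apply: csmooth_sum => i Pi; exact: (tF i Pi I). Qed.

Lemma tform_clif s j u : tform u -> tform (fun x => clif s j (u x)).
Proof. by move=> tu I; rewrite coef_clif; exact: (csmoothZ _ (tu _)). Qed.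

Lemma tform_pform j u : tform u -> tform (pform j u).
Proof. by move=> tu I; rewrite coef_pform; exact: (csmooth_partial j (tu I)). Qed.

Lemma tform_dir s u : tform u -> tform (dir s u).
Proof. by move=> tu; apply: tform_sum => j _; exact: (tform_clif _ _ (tform_pform j tu)). Qed.

Lemma pform_clif j s k u x : sform u -> pform j (fun x => clif s k (u x)) x = clif s k (pform j u x).
Proof.
move=> su; apply/ffunP => I.
by rewrite clif_coord !ffunE coef_clif (partialZ _ _ _ (su _)).
Qed.

Lemma pform_sum (J : Type) (r : seq J) (P : pred J) (F : J -> form) j x :
  (forall i, P i -> sform (F i)) ->
  pform j (fun x => \sum_(i <- r | P i) F i x) x = \sum_(i <- r | P i) pform j (F i) x.
Proof.
move=> sF; apply/ffunP => I; rewrite ext_sumE ffunE fcoef_sum partial_sum => [|i Pi].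
  by apply: eq_bigr => i _; rewrite ffunE.
exact: (sF i Pi I).
Qed.

Lemma pformD j u v x : sform u -> sform v ->
  pform j (fun x => u x + v x) x = pform j u x + pform j v x.
Proof.
by move=> su sv; apply/ffunP => I; rewrite extDE !ffunE fcoefD (partialD _ _ (su I) (sv I)).
Qed.

Lemma pformM j g u x : smooth g -> sform u ->
  pform j (fun x => g x *: u x) x = partial j g x *: u x + g x *: pform j u x.
Proof.
move=> sg su; apply/ffunP => I.
by rewrite extDE !extZE !ffunE fcoefM (partialM _ _ sg (su I)).
Qed.

Lemma pformZ j (c : R) u x : sform u -> pform j (fun x => c *: u x) x = c *: pform j u x.
Proof.
by move=> su; rewrite (pformM _ _ (smooth_cst c) su) partial_cst scale0r add0r.
Qed.

Lemma pformC i j u x : tform u -> pform i (pform j u) x = pform j (pform i u) x.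
Proof.
move=> tu; apply/ffunP => I.
have E k l : pform k (pform l u) x I = partial k (partial l (coef u I)) x.
  by rewrite ffunE (coef_pform l u I).
have P : partial i (partial j (coef u I)) x = partial j (partial i (coef u I)) x.
  exact: (partialC i j x (tu I)).
exact: (etrans (E i j) (etrans P (esym (E j i)))).
Qed.

Lemma dirD s u v x : sform u -> sform v ->
  dir s (fun x => u x + v x) x = dir s u x + dir s v x.
Proof.
move=> su sv; rewrite /dir -big_split/=; apply: eq_bigr => j _.
by rewrite (pformD _ _ su sv) linearD.
Qed.

Lemma dirZ s (c : R) u x : sform u -> dir s (fun x => c *: u x) x = c *: dir s u x.
Proof.
move=> su; rewrite /dir scaler_sumr; apply: eq_bigr => j _.
by rewrite (pformZ _ _ _ su) linearZ.
Qed.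

Lemma dirB s u v x : tform u -> tform v ->
  dir s (fun x => u x - v x) x = dir s u x - dir s v x.
Proof.
move=> tu tv; rewrite -[in RHS](scaleN1r (dir s v x)) -(dirZ _ _ _ (tform_sform tv)).
rewrite -(dirD _ _ (tform_sform tu) (tform_sform (tformZ (-1) tv))).
by under [in RHS]eq_fun do rewrite scaleN1r.
Qed.

Lemma dirM s g u x : smooth g -> sform u ->
  dir s (fun x => g x *: u x) x = (\sum_j partial j g x *: clif s j (u x)) + g x *: dir s u x.
Proof.
move=> sg su; rewrite /dir scaler_sumr -big_split/=; apply: eq_bigr => j _.
by rewrite (pformM _ _ sg su) linearD !linearZ.
Qed.

Lemma sform_fconv K h : csmooth K -> iform h -> sform (fconv K h).
Proof. by move=> cK ih I; rewrite coef_fconv; exact: (smooth_conv cK (ih I)). Qed.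

Lemma tform_fconv K h (r : R) : csmooth K -> iform h -> (forall x, r < `|x| -> h x = 0) ->
  tform (fconv K h).
Proof.
move=> cK ih hr I; rewrite coef_fconv; apply: (csmooth_conv (s := r) cK (ih I)) => x rx.
by rewrite /coef (hr x rx) ffunE.
Qed.

Lemma pform_fconv j K h x : csmooth K -> iform h ->
  pform j (fconv K h) x = fconv (partial j K) h x.
Proof.
by move=> cK ih; apply/ffunP => I; rewrite !ffunE coef_fconv (partial_conv _ _ cK (ih I)).
Qed.

Lemma fconv_by_parts K h j x : csmooth K -> tform h ->
  fconv (partial j K) h x = fconv K (pform j h) x.
Proof.
by move=> cK th; apply/ffunP => I; rewrite !ffunE coef_pform (conv_by_parts _ _ cK (th I)).
Qed.

Lemma fconv_clif K s j h x : csmooth K -> iform h ->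
  fconv K (fun x => clif s j (h x)) x = clif s j (fconv K h x).
Proof.
move=> cK ih; apply/ffunP => I.
by rewrite clif_coord !ffunE coef_clif (convZr _ _ cK (ih _)).
Qed.

Lemma fconv_sumr (J : Type) (r : seq J) (P : pred J) (F : J -> form) K x :
  csmooth K -> (forall i, P i -> iform (F i)) ->
  fconv K (fun z => \sum_(i <- r | P i) F i z) x = \sum_(i <- r | P i) fconv K (F i) x.
Proof.
move=> cK iF; apply/ffunP => I; rewrite ext_sumE ffunE fcoef_sum (conv_sumr _ _ cK) => [|i Pi].
  by apply: eq_bigr => i _; rewrite ffunE.
exact: (iF i Pi I).
Qed.

Lemma fconv_suml (J : Type) (r : seq J) (P : pred J) (F : J -> 'rV[R]_n -> R) h x :
  (forall i, P i -> csmooth (F i)) -> iform h ->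
  fconv (fun z => \sum_(i <- r | P i) F i z) h x = \sum_(i <- r | P i) fconv (F i) h x.
Proof.
move=> cF ih; apply/ffunP => I; rewrite ext_sumE ffunE (conv_suml _ _ cF (ih I)).
by apply: eq_bigr => i _; rewrite ffunE.
Qed.

Lemma fconvBl K K' h x : csmooth K -> csmooth K' -> iform h ->
  fconv (fun z => K z - K' z) h x = fconv K h x - fconv K' h x.
Proof.
move=> cK cK' ih; apply/ffunP => I; rewrite -scaleN1r extDE extZE !ffunE mulN1r.
have := convDl x cK (csmoothZ (-1) cK') (ih I); rewrite (convZl _ _ cK' (ih I)) mulN1r => <-.
by congr convol; apply/funext => z; rewrite mulN1r.
Qed.

Lemma fconvDr K h h' x : csmooth K -> iform h -> iform h' ->
  fconv K (fun z => h z + h' z) x = fconv K h x + fconv K h' x.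
Proof.
by move=> cK ih ih'; apply/ffunP => I; rewrite extDE !ffunE fcoefD (convDr _ cK (ih I) (ih' I)).
Qed.

Lemma fconvZr K (c : R) h x : csmooth K -> iform h ->
  fconv K (fun z => c *: h z) x = c *: fconv K h x.
Proof.
by move=> cK ih; apply/ffunP => I; rewrite extZE !ffunE fcoefM (convZr _ _ cK (ih I)).
Qed.

Lemma clif_sum (J : Type) (r : seq J) (P : pred J) (F : J -> exterior R n) s j :
  clif s j (\sum_(i <- r | P i) F i) = \sum_(i <- r | P i) clif s j (F i).
Proof. exact: linear_sum. Qed.

(** Add the sum to itself with j and k exchanged: the anticommutator is 2 s on the diagonal and 0
    elsewhere. For second derivatives this reads (D^s)^2 = s Laplacian; for the Jacobian of a
    curl-free kernel only its divergence survives. *)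
Lemma clif_sym_sum s (a : 'I_n -> 'I_n -> exterior R n) :
  (forall j k, a j k = a k j) ->
  \sum_j \sum_k clif s j (clif s k (a j k)) = s *: \sum_j a j j.
Proof.
move=> aC; set S := LHS.
have E : S + S = (2 * s) *: \sum_j a j j.
  rewrite [X in X + _]exchange_big /S -big_split scaler_sumr/=.
  apply: eq_bigr => j _; rewrite -big_split/= (bigD1 j)//= big1 => [|k kj].
    by rewrite clif_anticomm_sum eqxx mulr1 addr0.
  by rewrite aC clif_anticomm_sum (negbTE kj) mulr0 scale0r.
have t0 : (2 : R) != 0 by rewrite pnatr_eq0.
apply: (scalerI t0); rewrite scalerA -E scaler_nat mulr2n; by [].
Qed.

Lemma clif_div_dfield s t t0 h x : 0 < t -> 0 < t0 -> iform h ->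
  \sum_j \sum_k clif s j (clif s k (fconv (partial k (dfield t t0 j)) h x)) =
  s *: (fconv (molli t) h x - fconv (molli t0) h x).
Proof.
move=> tp t0p ih; have cd (j : 'I_n) := csmooth_dfield j tp t0p.
rewrite (@clif_sym_sum s (fun j k => fconv (partial k (dfield t t0 j)) h x)).
  congr (_ *: _); rewrite -(fconvBl _ (csmooth_molli tp) (csmooth_molli t0p) ih).
  rewrite -fconv_suml => [|j _|]; [|exact: (csmooth_partial j (cd j))|exact: ih].
  by congr fconv; apply/funext => y; rewrite div_dfield.
move=> j k.
exact: (congr1 (fun K => fconv K h x) (funext (fun y => partial_dfieldC k j y tp t0p))).
Qed.

Definition invdir (s t t0 : R) h : form := fun x => \sum_j clif s j (fconv (dfield t t0 j) h x).

(** Right inverse up to two mollifications: the one at scale [t] is near the identity for small t,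
    the one at scale [t0] is near 0 for large t0. *)
Lemma dir_invdir s t t0 h x : 0 < t -> 0 < t0 -> iform h ->
  dir s (invdir s t t0 h) x = s *: (fconv (molli t) h x - fconv (molli t0) h x).
Proof.
move=> tp t0p ih; have cd (j : 'I_n) := csmooth_dfield j tp t0p.
have sf j : sform (fconv (dfield t t0 j) h) by exact: (sform_fconv (cd j) ih).
have E k : pform k (invdir s t t0 h) x =
    \sum_j clif s j (fconv (partial j (dfield t t0 k)) h x).
  rewrite pform_sum => [|j _].
    apply: eq_bigr => j _; rewrite (pform_clif _ _ _ _ (sf j)) (pform_fconv _ _ (cd j) ih).
    exact: (congr1 (fun K => clif s j (fconv K h x)) (funext (fun y => partial_dfieldC k j y tp t0p))).
  by move=> I; rewrite coef_clif; exact: (smoothM (smooth_cst _) (sf j _)).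
rewrite /dir; under eq_bigr do rewrite E clif_sum.
exact: (clif_div_dfield _ _ tp t0p ih).
Qed.

(** Left inverse: on test forms the derivative moves from the form to the kernel. It recovers a
    difference of mollifications of [u] from [dir s u] alone, the representation behind Morrey's
    inequality. *)
Lemma invdir_dir s t t0 u x : 0 < t -> 0 < t0 -> tform u ->
  invdir s t t0 (dir s u) x = s *: (fconv (molli t) u x - fconv (molli t0) u x).
Proof.
move=> tp t0p tu; have cd (j : 'I_n) := csmooth_dfield j tp t0p.
have iu := tform_iform tu.
rewrite /invdir /dir; under eq_bigr => j _.
  rewrite (fconv_sumr _ _ (cd j)) => [|k _]; last exact: (tform_iform (tform_clif _ _ (tform_pform k tu))).
  rewrite clif_sum; under eq_bigr => k _.
    rewrite (fconv_clif _ _ _ (cd j) (tform_iform (tform_pform k tu))) -(fconv_by_parts _ _ (cd j) tu).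
    over.
  over.
exact: (clif_div_dfield _ _ tp t0p iu).
Qed.

Lemma tform_invdir s t t0 h r : 0 < t -> 0 < t0 -> iform h -> (forall x, r < `|x| -> h x = 0) ->
  tform (invdir s t t0 h).
Proof.
move=> tp t0p ih hr; apply: tform_sum => j _; apply: tform_clif.
exact: (tform_fconv (csmooth_dfield j tp t0p) ih hr).
Qed.

Lemma csmooth_einner u v : tform u -> tform v -> csmooth (fun x => einner (u x) (v x)).
Proof. by move=> tu tv; apply: csmooth_sum => I _; exact: (csmoothMl (tu I) (tv I).1). Qed.

Lemma Rintegral_einner_parts u v j : tform u -> tform v ->
  \int[mu]_x einner (pform j u x) (v x) = - \int[mu]_x einner (u x) (pform j v x).
Proof.
move=> tu tv; rewrite !Rintegral_sum => [|I _|I _]; last 2 first.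
- exact: (csmooth_integrable (csmoothMl (tu I) (tform_pform j tv I).1)).
- exact: (csmooth_integrable (csmoothMl (tform_pform j tu I) (tv I).1)).
rewrite -sumrN; apply: eq_bigr => I _.
under eq_Rintegral do rewrite ffunE.
under [in RHS]eq_Rintegral do rewrite ffunE.
exact: (Rintegral_by_parts j (tu I) (tv I)).
Qed.

Lemma einner_suml (J : Type) (r : seq J) (P : pred J) (F : J -> exterior R n) (v : exterior R n) :
  einner (\sum_(i <- r | P i) F i) v = \sum_(i <- r | P i) einner (F i) v.
Proof.
elim/big_rec2: _ => [|i a b _ <-]; last by rewrite einnerDl.
by rewrite -[0 in LHS](scale0r (0 : exterior R n)) einnerZl mul0r.
Qed.

(** Move one factor D^s to the other side: the adjoint of c_j is s c_j and integration by parts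
    gives a sign, so (D^s)^2 = s Laplacian appears and s^2 = 1 leaves the Dirichlet integral. In
    particular the result does not depend on the sign of s. *)
Lemma Rintegral_dir_sqr s u : s * s = 1 -> tform u ->
  \int[mu]_x einner (dir s u x) (dir s u x) =
  \sum_j \int[mu]_x einner (pform j u x) (pform j u x).
Proof.
move=> s2 tu; have tp j := tform_pform j tu; have tD := tform_dir s tu.
have cI v w : tform v -> tform w -> L1 (fun x => einner (v x) (w x)).
  by move=> tv tw; exact: (csmooth_integrable (csmooth_einner tv tw)).
under eq_Rintegral do rewrite [X in einner X _]/dir einner_suml.
rewrite Rintegral_sum => [|j _]; last exact: (cI _ _ (tform_clif _ _ (tp j)) tD).
have tc j : tform (fun x => clif s j (dir s u x)) by exact: (tform_clif s j tD).
under eq_bigr => j _.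
  under eq_Rintegral do rewrite (einner_clif _ _ _ s2).
  rewrite (RintegralZl _ measurableT (cI _ _ (tp j) (tc j))) (Rintegral_einner_parts _ tu (tc j)).
  over.
rewrite /= -mulr_sumr sumrN.
have ic j := cI _ _ tu (tform_pform j (tc j)).
have S : \sum_j \int[mu]_x einner (u x) (pform j (fun x => clif s j (dir s u x)) x) =
    \int[mu]_x \sum_j einner (u x) (pform j (fun x => clif s j (dir s u x)) x).
  exact: esym (Rintegral_sum (index_enum _) (P := xpredT) (fun j _ => ic j)).
apply: etrans (congr1 (fun z => s * - z) S) _.
have E x : \sum_j einner (u x) (pform j (fun x => clif s j (dir s u x)) x) =
    s * \sum_j einner (u x) (pform j (pform j u) x).
  under eq_bigr do rewrite einnerC; rewrite -einner_suml.
  under eq_bigr => j _.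
    rewrite (pform_clif _ _ _ _ (tform_sform tD)) pform_sum => [|k _]; last first.
      exact: (tform_sform (tform_clif _ _ (tp k))).
    rewrite clif_sum; under eq_bigr do rewrite (pform_clif _ _ _ _ (tform_sform (tp _))).
    over.
  rewrite (@clif_sym_sum s (fun j k => pform j (pform k u) x)) => [|j k]; last exact: pformC.
  by rewrite einnerZl einner_suml; congr (_ * _); apply: eq_bigr => j _; rewrite einnerC.
under eq_Rintegral do rewrite E.
have i2 j : L1 (fun x => einner (u x) (pform j (pform j u) x)).
  exact: (cI _ _ tu (tform_pform j (tp j))).
rewrite RintegralZl//; last exact: integrable_sumR.
rewrite mulrN mulrA s2 mul1r Rintegral_sum// -sumrN; apply: eq_bigr => j _.
by rewrite (Rintegral_einner_parts _ tu (tp j)).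
Qed.

Lemma hardy_form s u : (3 <= n)%N -> s * s = 1 -> tform u ->
  \int[mu]_x (einner (u x) (u x) * (1 + sqn x)^-1) <=
  4 * \int[mu]_x einner (dir s u x) (dir s u x).
Proof.
move=> n3 s2 tu; rewrite (Rintegral_dir_sqr s2 tu).
have sq : smooth (fun x : 'rV[R]_n => 1 + sqn x) by exact: (smoothD (smooth_cst 1) smooth_sqn).
have sw : smooth (fun x : 'rV[R]_n => (1 + sqn x)^-1).
  by apply: (smooth_inv sq) => x; rewrite gt_eqF// ltr_pwDl// sqn_ge0.
under eq_Rintegral do rewrite mulr_suml.
rewrite Rintegral_sum => [|I _]; last first.
  exact: (csmooth_integrable (csmoothMl (csmoothMl (tu I) (tu I).1) sw)).
have pI j I : L1 (fun x => partial j (coef u I) x * partial j (coef u I) x).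
  have cp := csmooth_partial j (tu I); exact: (csmooth_integrable (csmoothMl cp cp.1)).
have E j : \int[mu]_x einner (pform j u x) (pform j u x) =
    \sum_I \int[mu]_x (partial j (coef u I) x ^+ 2).
  rewrite Rintegral_sum => [|I _].
    by apply: eq_bigr => I _; apply: eq_Rintegral => x _; rewrite !ffunE expr2.
  by under eq_fun do rewrite !ffunE; exact: pI.
under [in leRHS]eq_bigr do rewrite E.
rewrite exchange_big mulr_sumr/=; apply: ler_sum => I _.
exact: (hardy n3 (tu I)).
Qed.

End forms.

Local Transparent convol partial smooth.

(** * Lebesgue norms of forms *)

Section form_norms.
Context {R : realType} {n : nat}.
Notation mu := (@lebesgue_rV R n).
Notation form := ('rV[R]_n -> exterior R n).
Notation L1 g := (mu.-integrable setT (EFin \o g)).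
Notation mfun g := (measurable_fun setT (g : 'rV[R]_n -> R)).
Implicit Types (u v w h f : form) (g : 'rV[R]_n -> R) (I : {set 'I_n}) (x y : 'rV[R]_n) (p e : R).

Definition mform f := forall I, mfun (coef f I).

Lemma iform_mform f : iform f -> mform f.
Proof. by move=> fi I; exact: integrable_measurable (fi I). Qed.

Lemma tform_mform f : tform f -> mform f.
Proof. by move=> tf; exact: iform_mform (tform_iform tf). Qed.

Lemma mformD u v : mform u -> mform v -> mform (fun x => u x + v x).
Proof. by move=> mu_ mv I; rewrite fcoefD; exact: (measurable_funD (mu_ I) (mv I)). Qed.

Lemma mformM g u : mfun g -> mform u -> mform (fun x => g x *: u x).
Proof. by move=> mg mu_ I; rewrite fcoefM; exact: (measurable_funM mg (mu_ I)). Qed.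

Lemma mformZ (c : R) u : mform u -> mform (fun x => c *: u x).
Proof. exact: (mformM (measurable_cst c)). Qed.

Lemma mformB u v : mform u -> mform v -> mform (fun x => u x - v x).
Proof.
move=> mu_ mv; have := mformD mu_ (mformZ (-1) mv).
by under eq_fun do rewrite scaleN1r.
Qed.

Lemma mform_clif s j u : mform u -> mform (fun x => clif s j (u x)).
Proof.
by move=> mu_ I; rewrite coef_clif; exact: (measurable_funM (measurable_cst _) (mu_ _)).
Qed.

Lemma measurable_enorm u : mform u -> mfun (fun x => enorm (u x)).
Proof.
move=> mu_; apply: (@measurableT_comp _ _ _ _ _ _ (@Num.sqrt R) _ (fun x => einner (u x) (u x))).
  by apply: continuous_measurable_fun; exact: sqrt_continuous.
apply: (@measurable_sumP R n _ _ xpredT (fun I x => coef u I x * coef u I x)) => I _.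
exact: (measurable_funM (mu_ I) (mu_ I)).
Qed.

Definition FN p f : \bar R := NL p (fun x => enorm (f x)).

Lemma FN_ge0 p f : (0 <= FN p f)%E. Proof. exact: NL_ge0. Qed.

Lemma FN_mono_ae p (c : R) f h : 0 < p -> 0 <= c -> mform f -> mform h ->
  {ae mu, forall x, enorm (f x) <= c * enorm (h x)} -> (FN p f <= c%:E * FN p h)%E.
Proof.
move=> p0 c0 mf mh fh; have mE := measurable_enorm mh.
have := NLZ c p0 mE; rewrite (ger0_norm c0) => <-.
apply: NL_mono_ae => //; first exact: measurable_enorm.
  exact: (measurable_funM (measurable_cst c) mE).
apply: filterS fh => x; rewrite ger0_norm ?enorm_ge0// ger0_norm ?mulr_ge0 ?enorm_ge0//.
Qed.

Lemma FN_mono p (c : R) f h : 0 < p -> 0 <= c -> mform f -> mform h ->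
  (forall x, enorm (f x) <= c * enorm (h x)) -> (FN p f <= c%:E * FN p h)%E.
Proof. by move=> p0 c0 mf mh fh; apply: FN_mono_ae => //; exact: aeW. Qed.

Lemma FN_ae p f h : 0 < p -> mform f -> mform h -> {ae mu, forall x, f x = h x} ->
  FN p f = FN p h.
Proof.
move=> p0 mf mh fh; apply/eqP; rewrite eq_le; apply/andP; split.
  rewrite -[leRHS]mul1e; apply: FN_mono_ae => //.
  by apply: filterS fh => x ->; rewrite mul1r.
rewrite -[leRHS]mul1e; apply: FN_mono_ae => //.
by apply: filterS fh => x ->; rewrite mul1r.
Qed.

Lemma FN_triangle p f h : 1 <= p -> mform f -> mform h ->
  (FN p (fun x => f x + h x)%R <= FN p f + FN p h)%E.
Proof.
move=> p1 mf mh; have mEf := measurable_enorm mf; have mEh := measurable_enorm mh.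
apply: le_trans (NL_triangle p1 mEf mEh); apply: NL_mono.
- exact: lt_le_trans p1.
- exact: (measurable_enorm (mformD mf mh)).
- exact: measurable_funD.
- by move=> x; rewrite !ger0_norm ?addr_ge0 ?enorm_ge0// enormD.
Qed.

Lemma FNZ p (c : R) f : 0 < p -> mform f -> FN p (fun x => c *: f x)%R = (`|c|%:E * FN p f)%E.
Proof.
move=> p0 mf; have := NLZ c p0 (measurable_enorm mf); rewrite /FN => <-.
apply/eqP; rewrite eq_le; have mZ := measurable_enorm (mformZ c mf).
have mZ' : mfun (fun x => c * enorm (f x)).
  exact: (measurable_funM (measurable_cst c) (measurable_enorm mf)).
have E x : `|enorm (c *: f x)| = `|c * enorm (f x)|.
  by rewrite enormZ normrM normr_id normrM.
by rewrite !NL_mono// => x; rewrite E.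
Qed.

Lemma FNN p f : 0 < p -> mform f -> FN p (fun x => - f x) = FN p f.
Proof.
move=> p0 mf; have := FNZ (-1) p0 mf; rewrite normrN1 mul1e => <-.
by under [in RHS]eq_fun do rewrite scaleN1r.
Qed.

Lemma FN_triangleB p f h : 1 <= p -> mform f -> mform h ->
  (FN p (fun x => f x - h x)%R <= FN p f + FN p h)%E.
Proof.
move=> p1 mf mh; have p0 := lt_le_trans ltr01 p1.
have mN : mform (fun x => - h x).
  by have := mformZ (-1) mh; under eq_fun do rewrite scaleN1r.
by rewrite -[in leRHS](FNN p0 mh); exact: FN_triangle.
Qed.

Lemma NL_abs p g : 0 < p -> mfun g -> NL p (fun x => `|g x|) = NL p g.
Proof.
move=> p0 mg; have ma : mfun (fun x => `|g x|) by exact: measurableT_comp.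
by apply/eqP; rewrite eq_le !NL_mono// => x; rewrite normr_id.
Qed.

Lemma FN_le_coef p f : 1 <= p -> mform f -> (FN p f <= \sum_I NL p (coef f I))%E.
Proof.
move=> p1 mf; have p0 := lt_le_trans ltr01 p1.
under eq_bigr do rewrite -(NL_abs p0 (mf _)).
have ma I : mfun (fun x => `|coef f I x|) by apply: measurableT_comp => //; exact: mf.
apply: le_trans (NL_sum_le (P := xpredT) (h := fun I x => `|coef f I x|) _ p1 (fun I _ => ma I)).
apply: NL_mono => //.
- exact: measurable_enorm.
- exact: (measurable_sumP (P := xpredT) (h := fun I x => `|coef f I x|) _ (fun I _ => ma I)).
- move=> x; rewrite ger0_norm ?enorm_ge0//; apply: le_trans (enorm_le_sum _) _.
  exact: ler_norm.
Qed.

Lemma FN_leP m f e : (0 < m)%N -> 0 <= e -> mform f ->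
  (FN m%:R f <= e%:E)%E <->
  L1 (fun x => enorm (f x) ^+ m) /\ \int[mu]_x (enorm (f x) ^+ m) <= e ^+ m.
Proof.
move=> m0 e0 mf; have mE := measurable_enorm mf.
have mX : mfun (fun x => enorm (f x) ^+ m) by exact: measurable_funX.
have X0 x : 0 <= enorm (f x) ^+ m by rewrite exprn_ge0// enorm_ge0.
split=> [h|[iX hX]].
  have /= := NL_int_le m0 e0 h.
  under eq_integral do rewrite ger0_norm ?enorm_ge0//.
  move=> le; have iX : L1 (fun x => enorm (f x) ^+ m).
    apply/integrableP; split; first exact/measurable_EFinP.
    under eq_integral do rewrite /= ger0_norm//.
    exact: le_lt_trans le (ltry _).
  by split=> //; rewrite -lee_fin fineK//; exact: integrable_fin_num.
apply: int_NL_le => //; under eq_integral do rewrite ger0_norm ?enorm_ge0//.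
by rewrite -(fineK (integrable_fin_num measurableT iX)) lee_fin.
Qed.

Lemma FN_finP m f : (0 < m)%N -> mform f ->
  (FN m%:R f < +oo)%E <-> L1 (fun x => enorm (f x) ^+ m).
Proof.
move=> m0 mf; split=> [h|h].
  have fn : (FN m%:R f \is a fin_num)%E by rewrite ge0_fin_numE ?FN_ge0.
  have e0 : 0 <= fine (FN m%:R f) by rewrite fine_ge0 ?FN_ge0.
  by have [] := (FN_leP m0 e0 mf).1; first by rewrite fineK.
pose a := \int[mu]_x (enorm (f x) ^+ m).
have a0 : 0 <= a by apply: Rintegral_ge0 => x _; rewrite exprn_ge0// enorm_ge0.
(* The bound 1 + a works because a <= 1 + a <= (1 + a)^m. *)
have e0 : 0 <= 1 + a by rewrite addr_ge0.
have := (FN_leP m0 e0 mf).2; move=> /(_ (conj h _))/le_lt_trans -> //; last exact: ltry.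
have : 1 + a <= (1 + a) ^+ m by rewrite ler_eXnr ?ler_wpDr//.
by move=> /(le_trans _) ->//; rewrite lerDr.
Qed.

Lemma tform_FN m u : (0 < m)%N -> tform u -> (FN m%:R u < +oo)%E.
Proof.
move=> m0 tu; apply/(FN_finP m0 (tform_mform tu)).
have cE := csmooth_einner tu tu.
have [C C0 uC] := csmooth_bounded cE; have [_ [r ur]] := cE.
apply: (@integrable_bounded_support _ _ _ ((1 + C) ^+ m) r).
- exact: measurable_funX (measurable_enorm (tform_mform tu)).
- move=> x; rewrite ger0_norm ?exprn_ge0 ?enorm_ge0//.
  apply: lerXn2r; rewrite ?nnegrE ?enorm_ge0 ?addr_ge0 ?ltW//.
  have := uC x; rewrite ger0_norm ?einner_ge0// -enorm_sqr => h.
  have := enorm_ge0 (u x); nra.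
- move=> x /ur h; rewrite (_ : enorm (u x) = 0) ?expr0n; first by case: m m0.
  by rewrite /enorm h sqrtr0.
Qed.

(** Extension by zero, so that functions given on Omega become forms on all of R^n with the same
    pairings and norms. *)
Definition restr (D : set 'rV[R]_n) f : form := fun x => \1_D x *: f x.

Lemma restr_in D f x : D x -> restr D f x = f x.
Proof. by move=> Dx; rewrite /restr indicE mem_set// scale1r. Qed.

Lemma restr_out D f x : ~ D x -> restr D f x = 0.
Proof. by move=> Dx; rewrite /restr indicE memNset// scale0r. Qed.

Lemma enorm_restr D f x : enorm (restr D f x) <= enorm (f x).
Proof.
rewrite /restr indicE; case: (x \in D); rewrite ?scale1r// scale0r enorm0 enorm_ge0 //.
Qed.

Lemma Lp_norm_restr D p f : Lp_norm D p f = FN p (restr D f).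
Proof.
rewrite /Lp_norm /FN /NL; congr Lnorm; apply/funext => x /=.
rewrite patchE /restr indicE; case: (x \in D); rewrite ?scale1r// scale0r enorm0//.
Qed.

Lemma Lp_normT p f : Lp_norm setT p f = FN p f.
Proof.
by rewrite Lp_norm_restr /FN; congr NL; apply/funext => x; rewrite restr_in.
Qed.

Lemma coef_restr D f I : coef (restr D f) I = (coef f I) \_ D.
Proof.
apply/funext => x; rewrite /restr /coef extZE patchE indicE.
by case: (x \in D); rewrite ?mul1r ?mul0r.
Qed.

Lemma mform_restr D f : measurable D -> measurable_form D f -> mform (restr D f).
Proof.
move=> mD mf I; rewrite coef_restr.
exact: (measurable_restrictT _ mD).1 (mf I).
Qed.

Lemma distr_of_restr D f phi : measurable D -> distr_of D f phi = distr_of setT (restr D f) phi.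
Proof.
move=> mD; apply/ffunP => I; rewrite !ffunE [LHS]Rintegral_mkcond.
apply: eq_Rintegral => x _; rewrite /restr extZE patchE indicE.
by case: (x \in D); rewrite ?mul1r// mul0r mulr0.
Qed.

Lemma in_Lp_restr D p f : measurable D -> in_Lp D p f ->
  mform (restr D f) /\ (FN p (restr D f) < +oo)%E.
Proof.
by move=> mD [mf pf]; split; [exact: mform_restr|rewrite -Lp_norm_restr].
Qed.

End form_norms.

Local Opaque convol partial smooth.

(** * Distributional Dirac operators and the Hodge decomposition *)

Section distributional_dirac.
Context {R : realType} {n : nat}.
Notation mu := (@lebesgue_rV R n).
Notation form := ('rV[R]_n -> exterior R n).
Notation L1 g := (mu.-integrable setT (EFin \o g)).
Notation T_ g := (distr_of setT g).
Implicit Types (u v w h f g : form) (K phi : 'rV[R]_n -> R) (I : {set 'I_n}) (x y : 'rV[R]_n).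

(** One family for all operators: s = 0 gives d, s = 1 and s = -1 give D^+ and D^-, and delta is the
    difference of the members at s = 1 and s = 0. *)
Definition ddist (s : R) (T : @distr R n) : @distr R n :=
  fun phi => \sum_j clif s j (- T (partial j phi)).

Lemma wedge_clif j (v : exterior R n) : wedge (evec j) v = clif 0 j v.
Proof. by rewrite /clif scale0r addr0. Qed.

Lemma interior_clif j (v : exterior R n) : interior_prod (evec j) v = clif 1 j v - clif 0 j v.
Proof. by rewrite /clif scale0r addr0 scale1r addrAC subrr add0r. Qed.

Lemma clif_split s j (v : exterior R n) : clif s j v = clif 0 j v + s *: (clif 1 j v - clif 0 j v).
Proof. by rewrite -interior_clif -wedge_clif. Qed.

Lemma distr_d_ddist T phi : distr_d T phi = ddist 0 T phi.
Proof. by apply: eq_bigr => j _; rewrite wedge_clif. Qed.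

Lemma distr_delta_ddist T phi : distr_delta T phi = ddist 1 T phi - ddist 0 T phi.
Proof. by rewrite /ddist -sumrB; apply: eq_bigr => j _; rewrite interior_clif. Qed.

Lemma ddist_split s T phi : ddist s T phi = distr_d T phi + s *: distr_delta T phi.
Proof.
rewrite distr_d_ddist distr_delta_ddist /ddist -sumrB scaler_sumr -big_split/=.
by apply: eq_bigr => j _; exact: clif_split.
Qed.

Lemma dirac_plus_ddist T phi : dirac_plus T phi = ddist 1 T phi.
Proof. by rewrite ddist_split scale1r. Qed.

Lemma dirac_minus_ddist T phi : dirac_minus T phi = ddist (-1) T phi.
Proof. by rewrite ddist_split scaleN1r. Qed.

Lemma dir_split s u x : dir s u x = dir 0 u x + s *: (dir 1 u x - dir 0 u x).
Proof.
rewrite /dir -sumrB scaler_sumr -big_split/=.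
by apply: eq_bigr => j _; exact: clif_split.
Qed.

Lemma fconv_distr K g x : fconv K g x = T_ g (fun y => K (x - y)).
Proof. by []. Qed.

Lemma distr_of_fconv g phi : T_ g phi = fconv (fun z => phi (- z)) g 0.
Proof.
rewrite fconv_distr (_ : (fun y => phi (- (0 - y))) = phi)//.
by apply/funext => y; rewrite sub0r opprK.
Qed.

Lemma csmooth_opp phi : csmooth phi -> csmooth (fun z => phi (- z)).
Proof. by move=> /(csmooth_reflect 0); under eq_fun do rewrite sub0r. Qed.

Lemma ddist_reflect s K g x : csmooth K -> iform g ->
  ddist s (T_ g) (fun y => K (x - y)) = \sum_j clif s j (fconv (partial j K) g x).
Proof.
move=> cK ig; apply: eq_bigr => j _; congr clif.
have -> : partial j (fun y => K (x - y)) = fun y => - partial j K (x - y).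
  by apply/funext => y; exact: partial_reflect.
apply/ffunP => I; rewrite -scaleN1r extZE !ffunE /= mulN1r.
have := convZl (-1) x (csmooth_partial j cK) (ig I).
rewrite mulN1r => h; rewrite -[RHS]opprK -h; congr (- _).
by apply: eq_Rintegral => y _; rewrite mulN1r.
Qed.

Lemma distr_of_by_parts j u phi : tform u -> csmooth phi ->
  - T_ u (partial j phi) = T_ (pform j u) phi.
Proof.
move=> tu cp; apply/ffunP => I; rewrite -scaleN1r extZE !ffunE mulN1r.
under [in RHS]eq_Rintegral do rewrite ffunE.
have := Rintegral_by_parts j cp (tu I) => h; rewrite -[RHS]opprK; congr (- _).
exact: h.
Qed.

Lemma ddist_tform s u phi : tform u -> csmooth phi -> ddist s (T_ u) phi = T_ (dir s u) phi.
Proof.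
move=> tu cp; have co := csmooth_opp cp.
rewrite distr_of_fconv (fconv_sumr _ _ co) => [|j _]; last first.
  exact: (tform_iform (tform_clif _ _ (tform_pform j tu))).
apply: eq_bigr => j _.
rewrite (fconv_clif _ _ _ co (tform_iform (tform_pform j tu))) (distr_of_by_parts _ tu cp).
by rewrite -distr_of_fconv.
Qed.

(** The distributional form of (D^s)^2 = s Laplacian; at s = 0 it is d d = 0. *)
Lemma ddist_zero_sum s T phi : csmooth phi ->
  \sum_j clif s j (ddist s T (partial j phi)) = - (s *: \sum_j T (partial j (partial j phi))).
Proof.
move=> cp; rewrite -(@clif_sym_sum _ _ s (fun j k => T (partial k (partial j phi)))).
  rewrite -sumrN; apply: eq_bigr => j _; rewrite clif_sum -sumrN; apply: eq_bigr => k _.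
  by rewrite (linearN (clif s k)) (linearN (clif s j)).
by move=> j k; exact: (congr1 T (funext (fun x => partialC k j x cp))).
Qed.

Lemma fconv_local K g g' x : (forall y, K (x - y) = 0 \/ g y = g' y) ->
  fconv K g x = fconv K g' x.
Proof.
move=> gg'; apply/ffunP => I; rewrite !ffunE; apply: eq_Rintegral => y _.
by rewrite /coef; case: (gg' y) => ->; rewrite ?mul0r.
Qed.

Lemma distr_of_local phi g g' : (forall y, phi y = 0 \/ g y = g' y) ->
  T_ g phi = T_ g' phi.
Proof.
move=> gg'; rewrite !distr_of_fconv; apply: fconv_local => y.
by rewrite sub0r opprK.
Qed.

(** By [clif_div_dfield] the difference of the two mollifications is a combination of D^s g tested
    on the reflected kernels [dfield t t0 j]. Only these kernels are tested, so the statement is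
    local: their support lies near [x]. *)
Lemma mollify_const s t t0 g x : s != 0 -> 0 < t -> 0 < t0 -> iform g ->
  (forall j, ddist s (T_ g) (fun y => dfield t t0 j (x - y)) = 0) ->
  fconv (molli t) g x = fconv (molli t0) g x.
Proof.
move=> sn0 tp t0p ig h; apply/eqP; rewrite -subr_eq0; apply/eqP.
apply: (scalerI sn0); rewrite scaler0.
rewrite -(clif_div_dfield _ _ tp t0p ig) big1// => j _.
rewrite -clif_sum -(ddist_reflect _ _ (csmooth_dfield j tp t0p) ig) h.
exact: linear0.
Qed.

Lemma distr_of_ae f g phi : mform f -> mform g -> csmooth phi ->
  {ae mu, forall x, f x = g x} -> T_ f phi = T_ g phi.
Proof.
move=> mf mg cp fg; apply/ffunP => I; rewrite !ffunE /Rintegral; congr fine.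
have mp : measurable_fun setT phi := smooth_measurable cp.1.
apply: ae_eq_integral => //.
- by apply/measurable_EFinP; exact: (measurable_funM mp (mf I)).
- by apply/measurable_EFinP; exact: (measurable_funM mp (mg I)).
- by apply: filterS fg => x /= ->.
Qed.

End distributional_dirac.

(** * Small-scale and large-scale limits of mollifications *)

Section mollification_limits.
Context {R : realType} {n : nat}.
Notation mu := (@lebesgue_rV R n).
Notation form := ('rV[R]_n -> exterior R n).
Notation L1 g := (mu.-integrable setT (EFin \o g)).
Notation mfun f := (measurable_fun [set: 'rV[R]_n] f).
Hypothesis n_gt0 : (0 < n)%N.

(** Mollifications converge to [g] in L^2 and uniformly on the bounded set [A] to [h]; uniform
    convergence on a bounded set is L^2 convergence, so both limits agree almost everywhere on
    [A]. *)
Lemma ae_molli_limit (g h : 'rV[R]_n -> R) (A : set 'rV[R]_n) (r rho : R) :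
  mfun g -> L1 (fun x => g x ^+ 2) -> (forall x, r < `|x| -> g x = 0) ->
  mfun h -> measurable A -> (forall x, A x -> `|x| <= rho) -> 0 < rho ->
  (forall e : R, 0 < e -> exists2 d, 0 < d & forall t, 0 < t -> t <= d ->
     forall x, A x -> `|convol (molli t) g x - h x| <= e) ->
  {ae mu, forall x, A x -> g x = h x}.
Proof.
move=> mg g2 gr mh mA Ar rho0 lim.
pose w x := (\1_A x : R) * (g x - h x).
have mi : mfun (\1_A : 'rV[R]_n -> R) by exact: measurable_indic.
have mw : mfun w by apply: measurable_funM => //; exact: measurable_funB.
pose B := [set x : 'rV[R]_n | `|x - 0| <= rho].
have mB : measurable B by exact: measurable_cube.
have mIB : mfun (\1_B : 'rV[R]_n -> R) by exact: measurable_indic.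
pose N := (2 * rho) ^+ n.
have N0 : 0 < N by rewrite exprn_gt0// mulr_gt0.
have nB : (NL 2 (\1_B : 'rV[R]_n -> R) <= (1 + N)%:E)%E.
  apply: (int_NL_le (m := 2)) => //; first by rewrite addr_ge0// ltW.
  have mBN : mu (B `&` setT) = N%:E by rewrite setIT; exact: (lebesgue_rV_cube 0 (ltW rho0)).
  have -> : (\int[mu]_x (`|\1_B x : R| ^+ 2)%:E = N%:E)%E.
    rewrite -mBN -integral_indic//.
    apply: eq_integral => x _; rewrite indicE; congr EFin.
    by case: (x \in B); rewrite ?normr1 ?normr0 ?expr1n ?expr0n.
  by rewrite lee_fin; nra.
have w_le e : 0 < e -> (NL 2 w <= (e + e * (1 + N))%:E)%E.
  move=> e0; have [d1 d10 h1] := lim _ e0.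
  have [d2 d20 h2] := conv_molli_cvg n_gt0 mg g2 gr e0.
  pose t := Num.min d1 d2; have t0 : 0 < t by rewrite lt_min d10.
  have t1 : t <= d1 by rewrite ge_min lexx.
  have t2 : t <= d2 by rewrite ge_min lexx orbT.
  have ig := L1_of_L2 mg g2 gr.
  have mc : mfun (convol (molli t) g).
    exact: smooth_measurable (smooth_conv (csmooth_molli t0) ig).
  have p12 : 1 <= (2 : R) by rewrite ler1n.
  pose a : 'rV[R]_n -> R := fun x => `|convol (molli t) g x - g x|.
  pose b : 'rV[R]_n -> R := fun x => e * (\1_B x : R).
  have ma : mfun a by apply: measurableT_comp => //; exact: measurable_funB.
  have mb : mfun b by exact: measurable_funM.
  apply: (@le_trans _ _ (NL 2 (fun x => a x + b x)%R)).
    apply: NL_mono => //; first exact: measurable_funD.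
    move=> x; rewrite /w indicE; case: (boolP (x \in A)) => [/set_mem Ax|_]; last first.
      by rewrite mul0r normr0.
    have Bx : B x by rewrite /B/= subr0; exact: Ar.
    rewrite mul1r /b indicE mem_set// mulr1 [leRHS]ger0_norm ?addr_ge0 ?(ltW e0)//; last exact: normr_ge0.
    have -> : g x - h x = (convol (molli t) g x - h x) - (convol (molli t) g x - g x).
      by rewrite opprB [RHS]addrC addrA subrK.
    by rewrite (le_trans (ler_normB _ _))// addrC lerD// h1.
  apply: le_trans (NL_triangle p12 ma mb) _.
  rewrite EFinD; apply: leeD.
    rewrite /a NL_abs//; [exact: h2|exact: measurable_funB].
  rewrite /b NLZ// gtr0_norm// EFinM; apply: lee_wpmul2l => //.
  by rewrite lee_fin ltW.
have w0 : NL 2 w = 0%E.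
  apply/eqP; rewrite eq_le NL_ge0 andbT; apply/lee_addgt0Pr => e e0; rewrite add0e.
  have k0 : 0 < 1 + (1 + N) by rewrite !addr_gt0.
  have := w_le (e / (1 + (1 + N))) (divr_gt0 e0 k0).
  by rewrite -{1}[e / _]mulr1 -mulrDr divfK// gt_eqF.
have p2 : (0 < 2%:E :> \bar R)%E by rewrite lte_fin.
have mW : measurable_fun setT (EFin \o w) by exact/measurable_EFinP.
have := Lnorm_eq0_eq0 mW p2 w0.
apply: filterS => x /(_ I) /= [+] Ax; rewrite /w indicE mem_set// mul1r => /eqP.
by rewrite subr_eq0 => /eqP.
Qed.

(** Hoelder's inequality is replaced by the pointwise bound a <= l + a^m / l^(m-1): the constant l
    costs a fixed multiple of itself at every scale, the power only t^(-n) times a finite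
    integral. *)
Lemma conv_molli_decay (m : nat) (f : 'rV[R]_n -> R) (e : R) : (0 < m)%N -> mfun f ->
  L1 (fun x => `|f x| ^+ m) -> 0 < e -> exists2 t0, 0 < t0 & forall t x, t0 <= t ->
  `|convol (molli t) f x| <= e.
Proof.
move=> m0 mf ifm e0; have [C C0 bC] := @molli_bound R n n_gt0.
pose N := \int[mu]_x (`|f x| ^+ m).
have N0 : 0 <= N by apply: Rintegral_ge0 => x _; rewrite exprn_ge0.
(* Chosen so that C t^(-n) l (2t)^n = e/2, the share of the constant part. *)
pose l := e / (2 * C * 2 ^+ n).
have l0 : 0 < l by rewrite divr_gt0// !mulr_gt0// exprn_gt0.
pose c := l / l ^+ m; have c0 : 0 < c by rewrite divr_gt0// exprn_gt0.
have young a : 0 <= a -> a <= l + c * a ^+ m.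
  move=> a0; have [al|la] := leP a l.
    by rewrite ler_wpDr// mulr_ge0 ?(ltW c0)// exprn_ge0.
  rewrite ler_wpDl ?(ltW l0)//.
  have q1 : 1 <= a / l by rewrite ler_pdivlMr// mul1r ltW.
  have := ler_eXnr m0 q1; rewrite expr_div_n -(ler_pM2l l0) mulrCA divff ?gt_eqF// mulr1.
  by rewrite /c -mulrA [_^-1 * _]mulrC.
(* Beyond this scale C t^(-1) c N <= e/2; the summand 1 gives t >= 1, hence t^(-n) <= t^(-1). *)
pose t0 := 1 + 2 * C * c * N / e.
have h0 := mulr_ge0 (mulr_ge0 (mulr_ge0 (ler0n R 2) (ltW C0)) (ltW c0)) N0.
have t00 : 1 <= t0 by rewrite lerDl; exact: (divr_ge0 h0 (ltW e0)).
exists t0 => [|t x tt]; first exact: lt_le_trans t00.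
have tp : 0 < t by rewrite (lt_le_trans _ tt)// (lt_le_trans _ t00).
have t1 : 1 <= t := le_trans t00 tt.
pose B := [set y : 'rV[R]_n | `|y - x| <= t].
pose G y := C * t^-1 ^+ n * (l * (\1_B y : R) + c * `|f y| ^+ m).
have iB : L1 (\1_B : 'rV[R]_n -> R) by exact: integrable_cube.
have iG : L1 G by apply/integrableZR/integrableDR; exact: integrableZR.
have mk : mfun (fun y => molli t (x - y)).
  exact: smooth_measurable (csmooth_reflect x (csmooth_molli tp)).1.
have tn0 : 0 <= C * t^-1 ^+ n by rewrite mulr_ge0 ?(ltW C0)// exprn_ge0// invr_ge0 ltW.
have le y : `|molli t (x - y) * f y| <= G y.
  rewrite normrM /G; have [xy|yx] := leP t `|x - y|.
    rewrite molli_out// normr0 mul0r mulr_ge0// addr_ge0//.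
      by rewrite mulr_ge0 ?(ltW l0)// indicE ler0n.
    by rewrite mulr_ge0 ?(ltW c0)// exprn_ge0.
  rewrite indicE mem_set/= ?mulr1; last by rewrite /B/= distrC ltW.
  by apply: ler_pM => //; [exact: bC|exact: young].
have mF : mfun (fun y => molli t (x - y) * f y) by exact: measurable_funM.
have iF : L1 (fun y => molli t (x - y) * f y).
  apply: le_integrable iG => //; first exact/measurable_EFinP.
  by move=> y _ /=; rewrite lee_fin (le_trans (le y))// ler_norm.
apply: le_trans (le_normr_Rintegral _ iF) _ => //.
apply: le_trans (le_Rintegral _ (integrable_norm iF) iG (fun y _ => le y)) _ => //.
rewrite RintegralZl//; last by apply: integrableDR; exact: integrableZR.
rewrite RintegralD//; try exact: integrableZR.
rewrite !RintegralZl// Rintegral_cube ?(ltW tp)// -/N.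
have -> : C * t^-1 ^+ n * (l * (2 * t) ^+ n + c * N) = e / 2 + C * t^-1 ^+ n * (c * N).
  rewrite mulrDr; congr (_ + _); rewrite exprMn exprVn /l.
  have : t ^+ n != 0 by rewrite expf_neq0// gt_eqF.
  have : (2 : R) ^+ n != 0 by rewrite expf_neq0.
  have : C != 0 by rewrite gt_eqF.
  by clear; move: (t ^+ n) (2 ^+ n) => a b *; field; do ?[apply/andP; split].
have : t^-1 ^+ n <= t^-1.
  rewrite -[leRHS]expr1 ler_wiXn2l// ?invr_ge0 ?(ltW tp)// invf_le1//.
move=> h; have hh : C * t^-1 ^+ n * (c * N) <= C * t^-1 * (c * N).
  exact: (ler_wpM2r (mulr_ge0 (ltW c0) N0) (ler_wpM2l (ltW C0) h)).
have h3 : C * t^-1 * (c * N) <= e / 2.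
  have : e * t0 <= e * t by rewrite ler_wpM2l// ltW.
  rewrite /t0 mulrDr mulr1 [e * (_ / e)]mulrC divfK ?gt_eqF// => h5.
  rewrite mulrAC ler_pdivrMr//; move: h5.
  by move: e0 (c) (N) => + c' N'; clear => e0 h1; lra.
by apply: le_trans (lerD (lexx _) (le_trans hh h3)) _; rewrite -splitr.
Qed.

End mollification_limits.

(** * A Liouville theorem and uniqueness of the Hodge decomposition *)

Section hodge_uniqueness.
Context {R : realType} {n : nat}.
Notation mu := (@lebesgue_rV R n).
Notation form := ('rV[R]_n -> exterior R n).
Notation L1 g := (mu.-integrable setT (EFin \o g)).
Notation mfun f := (measurable_fun [set: 'rV[R]_n] f).
Notation T_ g := (distr_of setT g).
Implicit Types (u v w h f g : form) (K phi : 'rV[R]_n -> R) (I : {set 'I_n}) (x y : 'rV[R]_n).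

Definition cball (r : R) : set 'rV[R]_n := [set x | `|x - 0| <= r].

Lemma measurable_cball r : measurable (cball r).
Proof. exact: measurable_cube. Qed.

Lemma integrable_cball r : L1 (\1_(cball r) : 'rV[R]_n -> R).
Proof. exact: integrable_cube. Qed.

Lemma in_cball r x : cball r x <-> `|x| <= r.
Proof. by rewrite /cball/= subr0. Qed.

Lemma restr_cball_out r f x : r < `|x| -> restr (cball r) f x = 0.
Proof. by move=> rx; apply: restr_out => /in_cball; rewrite leNgt rx. Qed.

Lemma mform_restrT D f : measurable D -> mform f -> mform (restr D f).
Proof. by move=> mD mf; apply: mformM => //; exact: measurable_indic. Qed.

Lemma restr_cball_power (k m : nat) f r I : (0 < k)%N -> (k <= m)%N -> mform f ->
  L1 (fun x => enorm (f x) ^+ m) -> L1 (fun x => coef (restr (cball r) f) I x ^+ k).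
Proof.
move=> k0 km mf fm; have mr := mform_restrT (measurable_cball r) mf.
apply: le_integrable (integrableDR (integrable_cball r) fm) => //.
  by apply/measurable_EFinP; exact: measurable_funX (mr I).
move=> x _ /=; rewrite lee_fin [leRHS]ger0_norm; last first.
  by rewrite addr_ge0 ?exprn_ge0 ?enorm_ge0// indicE ler0n.
rewrite /restr /coef extZE indicE; case: (x \in _); last first.
  by rewrite mul0r expr0n gtn_eqF//= normr0 add0r exprn_ge0// enorm_ge0.
rewrite mul1r normrX; have h := coord_le_enorm (f x) I.
apply: (@le_trans _ _ (enorm (f x) ^+ k)).
  by apply: lerXn2r => //; rewrite nnegrE ?enorm_ge0.
have e0 := enorm_ge0 (f x).
have [e1|e1] := leP (enorm (f x)) 1.
  by rewrite (le_trans (exprn_ile1 k e0 e1))// lerDl exprn_ge0.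
by rewrite ler_wpDl// ler_weXn2l// ltW.
Qed.

(** Local integrability. A form in L^m need not be integrable on R^n, whereas convolutions are set
    up for integrable forms; they are applied to restrictions to large balls. *)
Definition liform f := forall r, iform (restr (cball r) f).

Lemma liform_power (m : nat) f : (0 < m)%N -> mform f ->
  L1 (fun x => enorm (f x) ^+ m) -> liform f.
Proof.
by move=> m0 mf fm r I; have := restr_cball_power r I (ltnSn 0) m0 mf fm; under eq_fun do rewrite expr1.
Qed.

Lemma distr_of_cball phi r f : (forall y, r < `|y| -> phi y = 0) ->
  T_ f phi = T_ (restr (cball r) f) phi.
Proof.
move=> pr; apply: distr_of_local => y; have [yr|ry] := leP `|y| r; last by left; exact: pr.
by right; rewrite restr_in//; exact/in_cball.
Qed.

Lemma distr_ofB phi f g : csmooth phi -> liform f -> liform g ->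
  T_ (fun x => f x - g x) phi = T_ f phi - T_ g phi.
Proof.
move=> cp lf lg; have [_ [r pr]] := cp.
rewrite (distr_of_cball (fun x => f x - g x) pr) (distr_of_cball f pr) (distr_of_cball g pr).
rewrite -(scaleN1r (T_ (restr _ g) phi)) 3!distr_of_fconv.
have co := csmooth_opp cp.
have iN : iform (fun x => (-1) *: restr (cball r) g x).
  by move=> I; rewrite fcoefM; exact: (integrableZR (-1) (lg r I)).
rewrite -(fconvZr _ _ co (lg r)) -(fconvDr _ co (lf r) iN).
by congr fconv; apply/funext => x; rewrite /restr scalerBr scaleN1r.
Qed.

Lemma distr_d_d T phi : csmooth phi ->
  \sum_j wedge (evec j) (distr_d T (partial j phi)) = 0.
Proof.
move=> cp; have := ddist_zero_sum 0 T cp; rewrite scale0r oppr0 => h.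
rewrite -[RHS]h; apply: eq_bigr => j _.
by rewrite wedge_clif distr_d_ddist.
Qed.

(** Read off from the squares: (D^+)^2 + (D^-)^2 = 2 (d d + delta delta), while the left-hand side
    is Laplacian minus Laplacian and d d = 0. *)
Lemma distr_delta_delta T phi : csmooth phi ->
  \sum_j interior_prod (evec j) (distr_delta T (partial j phi)) = 0.
Proof.
move=> cp; have d0 := ddist_zero_sum 0 T cp; rewrite scale0r oppr0 in d0.
have dp := ddist_zero_sum 1 T cp; have dm := ddist_zero_sum (-1) T cp.
have E : \sum_j clif 1 j (ddist 1 T (partial j phi)) + \sum_j clif (-1) j (ddist (-1) T (partial j phi)) =
    2 *: (\sum_j clif 0 j (ddist 0 T (partial j phi)) +
          \sum_j interior_prod (evec j) (distr_delta T (partial j phi))).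
  rewrite -!big_split scaler_sumr /=; apply: eq_bigr => j _.
  rewrite interior_clif !(ddist_split 1) !(ddist_split (-1)) -distr_d_ddist.
  set a := distr_d _ _; set b := distr_delta _ _.
  have S (s : R) (v : exterior R n) : clif s j v = clif 0 j v + s *: (clif 1 j v - clif 0 j v) by exact: clif_split.
  have Dp : clif 1 j (a + b) = clif 1 j a + clif 1 j b by exact: linearD.
  have Dm : clif (-1) j (a - b) = clif (-1) j a - clif (-1) j b by exact: linearB.
  rewrite scale1r scaleN1r Dp Dm (S (-1) a) (S (-1) b).
  move: (clif 0 j a) (clif 0 j b) (clif 1 j a) (clif 1 j b) => p q p' q'.
  have N (v : exterior R n) I : (- v) I = - v I by rewrite ffunE.
  by apply/ffunP => I; rewrite !(extDE, extZE, N); ring.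
move: E; rewrite dp dm d0 scale1r scaleN1r opprK addNr add0r => /esym/eqP.
by rewrite scaler_eq0 pnatr_eq0/= => /eqP.
Qed.

Lemma test_functionT phi : test_function [set: 'rV[R]_n] phi <-> csmooth phi.
Proof. by split; [exact: test_csmooth|exact: csmooth_test]. Qed.

Hypothesis n_gt0 : (0 < n)%N.

Lemma ae_all_cball (P : 'rV[R]_n -> Prop) :
  (forall r : R, 0 < r -> {ae mu, forall x, cball r x -> P x}) -> {ae mu, forall x, P x}.
Proof.
move=> h; have : {ae mu, forall x, forall k : nat, cball k.+1%:R x -> P x}.
  by apply: ae_foralln => k; exact: h.
apply: filterS => x /(_ (Num.truncn `|x|)); apply; apply/in_cball.
by apply/ltW; exact: truncnS_gt.
Qed.

(** If D^s f = 0, mollifications of f at all scales coincide; those at large scales are arbitrarily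
    small because f is in L^m, so all vanish, and f is their limit at small scales. *)
Lemma harmonic_ae0 (m : nat) f s : (1 < m)%N -> s != 0 -> mform f ->
  (FN m%:R f < +oo)%E -> (forall phi, csmooth phi -> ddist s (T_ f) phi = 0) ->
  {ae mu, forall x, f x = 0}.
Proof.
move=> m1 s0 mf fm df; have m0 := ltnW m1.
have fp := (FN_finP m0 mf).1 fm; have lf := liform_power m0 mf fp.
have loc K (x : 'rV[R]_n) r t : csmooth K -> (forall z, t < `|z| -> K z = 0) -> `|x| + t <= r ->
    fconv K f x = fconv K (restr (cball r) f) x.
  move=> cK Kt xr; apply: fconv_local => y; have [yr|ry] := leP `|y| r.
    by right; rewrite restr_in//; exact/in_cball.
  left; apply: Kt; have := ler_normD (x - y) (- x).
  by rewrite addrAC subrr add0r !normrN; lra.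
have mo t (z : 'rV[R]_n) : 0 < t -> t < `|z| -> molli t z = 0 :> R.
  by move=> t0 tz; rewrite molli_out// ltW.
have cst t t0 x : 0 < t -> 0 < t0 -> fconv (molli t) f x = fconv (molli t0) f x.
  move=> tp t0p; pose r := `|x| + Num.max t t0.
  have rt : `|x| + t <= r by rewrite lerD2l le_max lexx.
  have rt0 : `|x| + t0 <= r by rewrite lerD2l le_max lexx orbT.
  rewrite (loc _ x r t (csmooth_molli tp) (fun z => mo t z tp) rt).
  rewrite (loc _ x r t0 (csmooth_molli t0p) (fun z => mo t0 z t0p) rt0).
  apply: (mollify_const s0 tp t0p (lf r)) => j.
  have cF := csmooth_reflect x (csmooth_dfield j tp t0p).
  rewrite -[RHS](df _ cF); apply: eq_bigr => i _; congr (clif s i (- _)).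
  rewrite [RHS](@distr_of_cball _ r)// => y ry; apply: partial_near0.
  near=> z; have rz : r < `|z| by near: z; exact: near_norm_gt.
  have := ler_normD (x - z) (- x); rewrite addrAC subrr add0r !normrN => hz.
  by rewrite dfield_out//; move: hz rz rt rt0; lra.
have c0 t x I : 0 < t -> convol (molli t) (coef f I) x = 0.
  move=> tp; apply/eqP; rewrite -normr_eq0 eq_le normr_ge0 andbT.
  apply/ler_addgt0Pr => e e0; rewrite add0r.
  have fI : L1 (fun x => `|coef f I x| ^+ m).
    apply: le_integrable fp => //.
      by apply/measurable_EFinP; apply: measurable_funX; apply: measurableT_comp => //; exact: mf.
    move=> y _ /=; rewrite lee_fin [leRHS]ger0_norm ?exprn_ge0 ?enorm_ge0// normrX normr_id.
    by apply: lerXn2r; rewrite ?nnegrE ?enorm_ge0//; exact: coord_le_enorm.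
  have [t0 t00 h] := conv_molli_decay n_gt0 m0 (mf I) fI e0.
  have := congr1 (fun w : exterior R n => w I) (cst t t0 x tp t00); rewrite !ffunE => ->.
  exact: h.
apply: ae_all_cball => r r0.
have key I : {ae mu, forall x, cball r x -> coef (restr (cball (r + 1)) f) I x = 0}.
  apply: (@ae_molli_limit _ _ n_gt0 _ (fun=> 0) _ (r + 1) r) => //.
  - exact: (mform_restrT (measurable_cball _) mf I).
  - exact: restr_cball_power fp.
  - by move=> x rx; rewrite /coef restr_cball_out// ffunE.
  - exact: measurable_cball.
  - by move=> x /in_cball.
  - move=> e e0; exists 1 => // t tp t1 x /in_cball xr.
    have xt : `|x| + t <= r + 1 by rewrite lerD.
    have := loc _ x _ t (csmooth_molli tp) (fun z => mo t z tp) xt.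
    move=> /(congr1 (fun w : exterior R n => w I)); rewrite !ffunE (c0 _ _ _ tp) => <-.
    by rewrite subrr normr0 ltW.
have : {ae mu, forall x, forall I, cball r x -> coef (restr (cball (r + 1)) f) I x = 0}.
  exact: filter_forall key.
apply: filterS => x h rx; apply/ffunP => I; rewrite ffunE.
have := h I rx; rewrite /coef restr_in// in_cball; have := (in_cball r x).1 rx; lra.
Unshelve. all: by end_near.
Qed.

(** The form a - a' is closed since d d = 0; it equals b' - b almost everywhere, and is therefore
    also coclosed since delta delta = 0. So D^+ annihilates it and [harmonic_ae0] applies. *)
Lemma hodge_unique (m : nat) omega a b a' b' : (1 < m)%N ->
  hodge_decomposition m%:R omega a b -> hodge_decomposition m%:R omega a' b' ->
  {ae mu, forall x, a x = a' x}.
Proof.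
move=> m1 [[[ma fa] [mb fb]] [al lal dal] [be lbe dbe] ab].
move=> [[[ma' fa'] [mb' fb']] [al' lal' dal'] [be' lbe' dbe'] ab'].
rewrite !Lp_normT in fa fb fa' fb'.
have m0 := ltnW m1; have p1 : 1 <= m%:R :> R by rewrite ler1n.
have lif g : mform g -> (FN m%:R g < +oo)%E -> liform g.
  by move=> mg fg; exact: (liform_power m0 mg ((FN_finP m0 mg).1 fg)).
have da g g1 : eq_distr setT (distr_d (T_ g1)) (T_ g) ->
    forall phi, csmooth phi -> distr_d (T_ g) phi = 0.
  move=> dg phi cp; have := distr_d_d (T_ g1) cp => h0.
  rewrite /distr_d; transitivity (- (\sum_j wedge (evec j) (distr_d (T_ g1) (partial j phi)))).
    rewrite -sumrN; apply: eq_bigr => j _; rewrite /distr_partial.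
    rewrite -(dg (partial j phi)); last exact/test_functionT/csmooth_partial.
    by rewrite !wedge_clif; exact: linearN.
  by rewrite h0 oppr0.
have db g g1 : eq_distr setT (distr_delta (T_ g1)) (T_ g) ->
    forall phi, csmooth phi -> distr_delta (T_ g) phi = 0.
  move=> dg phi cp; have := distr_delta_delta (T_ g1) cp => h0.
  rewrite /distr_delta; transitivity (- (\sum_j interior_prod (evec j) (distr_delta (T_ g1) (partial j phi)))).
    rewrite -sumrN; apply: eq_bigr => j _; rewrite /distr_partial.
    rewrite -(dg (partial j phi)); last exact/test_functionT/csmooth_partial.
    rewrite !interior_clif.
    have N (s : R) (v : exterior R n) : clif s j (- v) = - clif s j v by exact: linearN.
    by rewrite !N opprB opprK addrC.
  by rewrite h0 oppr0.
have NB (s : R) j (v w : exterior R n) : clif s j (- (v - w)) = clif s j (- v) - clif s j (- w).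
  by rewrite opprD; exact: linearB.
have IB j (v w : exterior R n) : interior_prod (evec j) (- (v - w)) =
    interior_prod (evec j) (- v) - interior_prod (evec j) (- w).
  rewrite !interior_clif !NB.
  move: (clif 1 j (- v)) (clif 1 j (- w)) (clif 0 j (- v)) (clif 0 j (- w)) => p q p' q'.
  by rewrite [in LHS]opprD [LHS]addrACA -[in LHS]opprD.
pose f x := a x - a' x; pose g x := b' x - b x.
have mf : mform f by exact: mformB.
have mg : mform g by exact: mformB.
have fg : {ae mu, forall x, f x = g x}.
  move: ab ab'; rewrite /ae_on; apply: filterS2 => x h h'; rewrite /f /g; have := etrans (esym (h I)) (h' I).
  by move/eqP; rewrite -subr_eq0 opprD addrACA addr_eq0 opprB => /eqP.
have ff : (FN m%:R f < +oo)%E.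
  by apply: le_lt_trans (FN_triangleB p1 ma ma') _; exact: lte_add_pinfty.
have := @harmonic_ae0 m f 1 m1 (oner_neq0 _) mf ff.
move=> H; have : {ae mu, forall x, f x = 0}.
  apply: H => phi cp; rewrite ddist_split scale1r.
  have E1 : distr_d (T_ f) phi = 0.
    rewrite -[RHS](subrr (0 : exterior R n)) -{1}(da _ _ dal _ cp) -(da _ _ dal' _ cp).
    rewrite /distr_d -sumrB; apply: eq_bigr => j _; rewrite /distr_partial.
    rewrite (distr_ofB (csmooth_partial j cp) (lif _ ma fa) (lif _ ma' fa')).
    by rewrite !wedge_clif NB.
  have E2 : distr_delta (T_ f) phi = 0.
    have -> : distr_delta (T_ f) phi = distr_delta (T_ g) phi.
      apply: eq_bigr => j _; rewrite /distr_partial; congr (interior_prod _ (- _)).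
      exact: (distr_of_ae mf mg (csmooth_partial j cp) fg).
    rewrite -[RHS](subrr (0 : exterior R n)) -{1}(db _ _ dbe' _ cp) -(db _ _ dbe _ cp).
    rewrite /distr_delta -sumrB; apply: eq_bigr => j _; rewrite /distr_partial.
    rewrite (distr_ofB (csmooth_partial j cp) (lif _ mb' fb') (lif _ mb fb)).
    exact: IB.
  by rewrite E1 E2 addr0.
by apply: filterS => x /eqP; rewrite subr_eq0 => /eqP.
Qed.

(** D^s u = du + s delta u is already decomposed, with potentials u and s u. *)
Lemma hodge_tform (m : nat) u s : (0 < m)%N -> tform u ->
  hodge_decomposition m%:R (dir s u) (dir 0 u) (fun x => s *: (dir 1 u x - dir 0 u x)).
Proof.
move=> m0 tu; have t0 := tform_dir 0 tu; have t1 := tform_dir 1 tu.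
have tb : tform (fun x => s *: (dir 1 u x - dir 0 u x)) by exact: tformZ (tformB t1 t0).
have l1 v : tform v -> in_L1loc setT v.
  move=> tv; split=> [|K cK _]; first exact: tform_mform.
  have iE : L1 (fun x => enorm (v x)).
    have := (FN_finP (ltnSn 0) (tform_mform tv)).1 (tform_FN (ltnSn 0) tv).
    by under eq_fun do rewrite expr1.
  have mK : measurable K by apply: closed_measurable_rV; exact: compact_closed.
  have /integrableP[_] := integrableS measurableT mK (@subsetT _ _) iE.
  by apply: le_lt_trans; apply: ge0_le_integral => //=;
    [move=> x _; rewrite lee_fin enorm_ge0|
     apply/measurable_EFinP; apply: measurable_funS (measurable_enorm (tform_mform tv)) => //|
     apply/measurable_EFinP; apply: measurableT_comp => //; apply: measurable_funS (measurable_enorm (tform_mform tv)) => //|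
     move=> x _; rewrite lee_fin ler_norm].
split.
- by split; split; rewrite ?Lp_normT; [exact: tform_mform|exact: tform_FN|exact: tform_mform|exact: tform_FN].
- exists u => [|phi /test_functionT cp]; first exact: l1.
  by rewrite distr_d_ddist (ddist_tform _ tu cp).
- exists (fun x => s *: u x) => [|phi /test_functionT cp]; first exact/l1/tformZ.
  have ts := tformZ s tu; rewrite distr_delta_ddist !(ddist_tform _ ts cp).
  have lD d : liform (dir d (fun x => s *: u x)).
    have td := tform_dir d ts; apply: (@liform_power 1) => //; first exact: tform_mform.
    exact: (FN_finP (ltnSn 0) (tform_mform td)).1 (tform_FN (ltnSn 0) td).
  rewrite -(distr_ofB cp (lD 1) (lD 0)); congr distr_of; apply/funext => x.
  by rewrite !(dirZ _ _ _ (tform_sform tu)) scalerBr.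
- by apply: aeW => x _; rewrite -dir_split.
Qed.

End hodge_uniqueness.

(** * The Beurling-Ahlfors transform on images of test forms *)

Section beurling_bound.
Context {R : realType} {n : nat}.
Notation mu := (@lebesgue_rV R n).
Notation form := ('rV[R]_n -> exterior R n).
Implicit Types (u v f : form).
Hypothesis n_gt0 : (0 < n)%N.

(** [hodge_tform] shows that the default of [xget] is not taken, and uniqueness identifies whichever
    representative was selected: S (du + s delta u) = du - s delta u. *)
Lemma beurling_dir (m : nat) u s : (1 < m)%N -> tform u ->
  mform (beurling_ahlfors m%:R (dir s u)) /\
  {ae mu, forall x, beurling_ahlfors m%:R (dir s u) x = dir (- s) u x}.
Proof.
move=> m1 tu; have m0 := ltnW m1; have hd := hodge_tform s m0 tu.
have : [set eta | exists a b, hodge_decomposition m%:R (dir s u) a b /\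
    eta = (fun x => a x - b x)] (beurling_ahlfors m%:R (dir s u)).
  by apply: xgetPex; eexists; exists (dir 0 u), (fun x => s *: (dir 1 u x - dir 0 u x)); split; [exact: hd|reflexivity].
move=> [a [b [hab ->]]]; have [[[ma _] [mb _]] _ _ eab] := hab.
split; first exact: (mformB ma mb).
have := hodge_unique n_gt0 m1 hab hd.
move: eab; rewrite /ae_on; apply: filterS2 => x /(_ I) e1 e2.
rewrite dir_split scaleNr; have -> : b x = s *: (dir 1 u x - dir 0 u x).
  by apply: (addrI (a x)); rewrite -e1 [in LHS]dir_split e2.
by rewrite e2.
Qed.

Lemma beurling_bound (m : nat) (K : R) u s : (1 < m)%N -> tform u ->
  Lp_opnorm m%:R (@beurling_ahlfors R n m%:R) = K%:E ->
  (FN m%:R (dir (- s) u) <= K%:E * FN m%:R (dir s u))%E.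
Proof.
move=> m1 tu hK; have m0 := ltnW m1; have p0 : 0 < m%:R :> R by rewrite ltr0n.
have td d := tform_dir d tu; have md d := tform_mform (td d).
have fin d : (FN m%:R (dir d u) \is a fin_num)%E.
  by rewrite ge0_fin_numE ?FN_ge0//; exact: tform_FN.
set a := fine (FN m%:R (dir s u)); set b := fine (FN m%:R (dir (- s) u)).
have aE : FN m%:R (dir s u) = a%:E by rewrite fineK.
have bE : FN m%:R (dir (- s) u) = b%:E by rewrite fineK.
have a0 : 0 <= a by rewrite fine_ge0// FN_ge0.
have b0 : 0 <= b by rewrite fine_ge0// FN_ge0.
have key c : 0 <= c -> c * a <= 1 -> c * b <= K.
  move=> c0 ca; pose w : form := fun x => c *: u x.
  have tw : tform w by exact: tformZ.
  have dE d x : dir d w x = c *: dir d u x by rewrite (dirZ _ _ _ (tform_sform tu)).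
  have E d : FN m%:R (dir d w) = (c%:E * FN m%:R (dir d u))%E.
    by rewrite -[c in RHS]ger0_norm// -(FNZ _ p0 (md d)); congr FN; apply/funext => x; rewrite dE.
  have [mS aS] := beurling_dir s m1 tw.
  have tdw := tform_mform (tform_dir (- s) tw).
  have EN := FN_ae p0 mS tdw aS.
  rewrite -lee_fin EFinM -bE -E -EN -Lp_normT -hK; apply: ereal_sup_ubound.
  exists (dir s w); last by [].
  rewrite /= Lp_normT E aE -EFinM lee_fin ca; split => //.
  split; first exact: (tform_mform (tform_dir s tw)).
  by rewrite Lp_normT E aE -EFinM ltry.
have K0 : 0 <= K by have := key 0 (lexx _); rewrite !mul0r => /(_ ler01).
rewrite aE bE -EFinM lee_fin; apply/ler_addgt0Pr => e e0.
(* The norm [a] of D^s u may be 0, so u is scaled by 1 / (a + d) instead of 1 / a; the resulting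
   excess K d is at most e. *)
pose d := e / (K + 1); have K1 : 0 < K + 1 by rewrite ltr_wpDl.
have d0 : 0 < d by rewrite divr_gt0.
have ad : 0 < a + d by rewrite ltr_wpDl.
have := key (a + d)^-1; rewrite invr_ge0 (ltW ad) mulrC ler_pdivrMr// mul1r lerDl (ltW d0).
move=> /(_ isT isT); rewrite mulrC ler_pdivrMr// => /le_trans; apply.
rewrite mulrDr lerD2l -[leRHS]mul1r /d mulrCA -[1 * e]mulrC ler_wpM2l ?(ltW e0)//.
by rewrite ler_pdivrMr// mul1r lerDl.
Qed.

End beurling_bound.

(** * The inhomogeneous equation *)

Section bounded_fields.
Context {R : realType} {n : nat}.
Notation mu := (@lebesgue_rV R n).
Notation form := ('rV[R]_n -> exterior R n).
Implicit Types (f : form) (u v w : exterior R n).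

Lemma opnorm_has_ub (T : 'End(exterior R n)) :
  has_ubound [set enorm (T v) | v in [set v | enorm v <= 1]].
Proof.
pose C := \sum_K enorm (T (ebasis K)).
have C0 : 0 <= C by apply: sumr_ge0 => K _; exact: enorm_ge0.
have bound v : enorm (T v) <= C * enorm v.
  rewrite {1}[v]ext_basis linear_sum/= (le_trans (enorm_sum _ _ _))// mulr_suml.
  apply: ler_sum => K _; rewrite linearZ/= enormZ mulrC.
  by rewrite ler_wpM2l ?enorm_ge0// coord_le_enorm.
exists C => _ [v /= v1 <-]; rewrite (le_trans (bound v))// -[leRHS]mulr1.
by rewrite ler_wpM2l.
Qed.

Lemma opnorm_ge0 (T : 'End(exterior R n)) : 0 <= opnorm T.
Proof.
apply: le_trans (enorm_ge0 (T 0)) _; apply: ub_le_sup; first exact: opnorm_has_ub.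
by exists 0 => //=; rewrite enorm0.
Qed.

Lemma enorm_opnorm (T : 'End(exterior R n)) w : enorm (T w) <= opnorm T * enorm w.
Proof.
have ub := opnorm_has_ub T.
have [w0|wn0] := eqVneq (enorm w) 0.
  by rewrite (enorm_eq0 w0) linear0 enorm0 mulr0.
have wp : 0 < enorm w by rewrite lt_def wn0 enorm_ge0.
have /ub_le_sup : [set enorm (T v) | v in [set v | enorm v <= 1]] (enorm (T ((enorm w)^-1 *: w))).
  by exists ((enorm w)^-1 *: w) => //=; rewrite enormZ ger0_norm ?invr_ge0 ?enorm_ge0// mulVf.
move=> /(_ ub); rewrite linearZ/= enormZ ger0_norm ?invr_ge0 ?enorm_ge0//.
by rewrite mulrC ler_pdivrMr.
Qed.

(** The coefficient as it is used later: linear and bounded at every point, not just almost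
    everywhere, and compatible with measurability of forms. *)
Definition bounded_field (m : R) (A : 'rV[R]_n -> exterior R n -> exterior R n) :=
  [/\ forall x, linear (A x),
      forall f, mform f -> mform (fun x => A x (f x))
    & forall x v, enorm (A x v) <= m * enorm v].

Hypothesis n_gt0 : (0 < n)%N.

Lemma mu_setT_gt0 : (0 < mu setT)%E.
Proof.
have := lebesgue_rV_cube (0 : 'rV[R]_n) ler01; set B := [set x | _] => BE.
apply: (@lt_le_trans _ _ (mu B)); first by rewrite BE lte_fin mulr1 exprn_gt0.
by apply: le_measure; rewrite ?inE//; exact: measurable_cube.
Qed.

(** Multiply M by the indicator of Omega minus the null set where the essential supremum is
    exceeded. This changes M on a null set of Omega and extends it by 0. *)
Lemma coefficient_field (Omega : set 'rV[R]_n) (M : 'rV[R]_n -> 'End(exterior R n)) :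
  measurable Omega -> in_Linf Omega M -> exists m A,
  [/\ ess_sup_opnorm Omega M = m%:E, 0 <= m, bounded_field m A,
      forall x v, ~ Omega x -> A x v = 0
    & {ae mu, forall x, Omega x -> forall v, A x v = M x v}].
Proof.
move=> mO [mM fM]; set s := ess_sup_opnorm Omega M in fM *.
have op0 x : 0 <= ((opnorm \o M) \_ Omega) x.
  by rewrite patchE; case: ifP => // _ /=; exact: opnorm_ge0.
have s0 : (0 <= s)%E by apply: ess_sup_ger; [exact: mu_setT_gt0|move=> x; rewrite lee_fin].
have sE : s = (fine s)%:E by rewrite fineK// ge0_fin_numE.
set m := fine s in sE; have m0 : 0 <= m by rewrite fine_ge0.
have := @ess_sup_ge _ _ _ mu (fun x => (((opnorm \o M) \_ Omega) x)%:E).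
rewrite -/(ess_sup_opnorm Omega M) -/s sE => -[N [mN N0 NP]].
pose D := Omega `\` N; have mD : measurable D by exact: measurableD.
exists m, (fun x v => \1_D x *: M x v); split => //.
- split.
  + move=> x a v w; rewrite linearP scalerDr; congr (_ + _).
    by rewrite !scalerA mulrC.
  + move=> f mf I; rewrite (_ : coef _ I = fun x => \sum_K coef f K x * coef (restr D (fun x => M x (ebasis K))) I x).
      apply: measurable_sumP => K _; apply: measurable_funM; first exact: mf.
      have mMD : measurable_form D (fun x => M x (ebasis K)).
        by move=> J; apply: (measurable_funS mO) (mM (ebasis K) J); exact: subDsetl.
      exact: (mform_restr mD mMD I).
    apply/funext => x; rewrite /coef /restr extZE {1}[f x]ext_basis linear_sum/= ext_sumE mulr_sumr.
    by apply: eq_bigr => K _; rewrite linearZ/= !extZE mulrCA.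
  + move=> x v; rewrite enormZ indicE; case: (boolP (x \in D)) => [/set_mem[Ox Nx]|_]; last first.
      by rewrite normr0 mul0r mulr_ge0 ?enorm_ge0.
    rewrite normr1 mul1r (le_trans (enorm_opnorm _ _))// ler_wpM2r ?enorm_ge0//.
    have : ~ ~ (((opnorm \o M) \_ Omega) x <= m).
      by move=> h; apply/Nx/NP => /=; rewrite lee_fin.
    by move=> /contrapT; rewrite patchE mem_set.
- by move=> x v Ox; rewrite indicE memNset ?scale0r// => -[].
- exists N; split => // x /= h; apply: contrapT => Nx; apply: h => Ox v.
  by rewrite indicE mem_set ?scale1r.
Qed.

End bounded_fields.

(** * Approximate solution of D^- u - A D^+ u = h in L^2 and L^m at once *)

Section neumann_series.
Context {R : realType} {n : nat}.
Notation mu := (@lebesgue_rV R n).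
Notation form := ('rV[R]_n -> exterior R n).
Notation L1 g := (mu.-integrable setT (EFin \o g)).
Notation mfun f := (measurable_fun [set: 'rV[R]_n] f).
Implicit Types (u v h f : form) (x y : 'rV[R]_n).

Lemma NL_bounded_support (m : nat) (f : 'rV[R]_n -> R) (k r e : R) : (0 < m)%N -> mfun f ->
  (forall x, `|f x| <= k) -> (forall x, r < `|x| -> f x = 0) -> 0 <= r -> 0 <= e ->
  k ^+ m * (2 * r) ^+ n <= e ^+ m -> (NL m%:R f <= e%:E)%E.
Proof.
move=> m0 mf fk fr r0 e0 h; apply: int_NL_le => //.
have k0 : 0 <= k := le_trans (normr_ge0 (f 0)) (fk 0).
have mB := @measurable_cball R n r.
apply: (@le_trans _ _ (\int[mu]_x (k ^+ m * \1_(cball r) x)%:E)%E).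
  apply: ge0_le_integral => //.
  - by apply/measurable_EFinP; apply: measurable_funX; exact: measurableT_comp.
  - by apply/measurable_EFinP; apply: measurable_funM => //; exact: measurable_indic.
  - move=> x _; rewrite lee_fin; have [xr|rx] := leP `|x| r.
      rewrite indicE mem_set ?mulr1; last exact/in_cball.
      by apply: lerXn2r; rewrite ?nnegrE.
    by rewrite fr// normr0 expr0n gtn_eqF//= mulr_ge0 ?exprn_ge0// indicE ler0n.
under eq_integral do rewrite EFinM.
rewrite ge0_integralZl//; last 2 first.
- by apply/measurable_EFinP; exact: measurable_indic.
- by rewrite lee_fin exprn_ge0.
have hB : mu (cball r `&` setT) = ((2 * r) ^+ n)%:E by rewrite setIT; exact: lebesgue_rV_cube.
have -> : (\int[mu]_x (\1_(cball r) x)%:E)%E = ((2 * r) ^+ n)%:E by rewrite -hB -integral_indic.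
by rewrite -EFinM lee_fin.
Qed.

(** |f|^m <= C^(m-2) |f|^2: for uniformly bounded functions, smallness in L^2 is smallness in L^m.
    Thus L^m convergence of mollifications needs no density theorem of its own. *)
Lemma NL_interp (m : nat) (f : 'rV[R]_n -> R) (C d e : R) : (1 < m)%N -> mfun f ->
  (forall x, `|f x| <= C) -> 0 <= d -> 0 <= e -> (NL 2 f <= d%:E)%E ->
  C ^+ (m - 2) * d ^+ 2 <= e ^+ m -> (NL m%:R f <= e%:E)%E.
Proof.
move=> m1 mf fC d0 e0 fd h; apply: int_NL_le => //; first exact: ltnW.
have C0 : 0 <= C := le_trans (normr_ge0 (f 0)) (fC 0).
have := @NL_int_le R n 2 f d isT d0 fd => h2.
apply: (@le_trans _ _ (\int[mu]_x ((C ^+ (m - 2))%:E * (`|f x| ^+ 2)%:E))%E).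
  apply: ge0_le_integral => //.
  - by apply/measurable_EFinP; apply: measurable_funX; exact: measurableT_comp.
  - apply/measurable_EFinP; apply: (measurable_funM (measurable_cst _)).
    by apply: measurable_funX; exact: measurableT_comp.
  - move=> x _; rewrite -EFinM lee_fin -{1}(subnK m1) exprD ler_wpM2r ?exprn_ge0//.
    by apply: lerXn2r; rewrite ?nnegrE.
rewrite ge0_integralZl//; last 2 first.
- by apply/measurable_EFinP; apply: measurable_funX; exact: measurableT_comp.
- by rewrite lee_fin exprn_ge0.
apply: le_trans (lee_wpmul2l _ h2) _; first by rewrite lee_fin exprn_ge0.
by rewrite -EFinM lee_fin.
Qed.

(** The energy identity: both norms equal the Dirichlet integral. In L^2 the transform S thus costs
    nothing. *)
Lemma FN2_dir s s' u : s * s = 1 -> s' * s' = 1 -> tform u ->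
  FN 2 (dir s u) = FN 2 (dir s' u).
Proof.
have le t t' : t * t = 1 -> t' * t' = 1 -> tform u -> (FN 2 (dir t u) <= FN 2 (dir t' u))%E.
  move=> t2 t2' tu; have mt d := tform_mform (tform_dir d tu).
  have fin d := @tform_FN R n 2 _ isT (tform_dir d tu).
  have fn : (FN 2 (dir t' u) \is a fin_num)%E by rewrite ge0_fin_numE ?FN_ge0//; exact: fin.
  have e0 : 0 <= fine (FN 2 (dir t' u)) by rewrite fine_ge0 ?FN_ge0.
  rewrite -(fineK fn); apply/(@FN_leP _ _ 2) => //.
  have iE d := (@FN_finP R n 2 _ isT (mt d)).1 (fin d).
  split; first exact: iE.
  have := (@FN_leP R n 2 _ _ isT e0 (mt t')).1; rewrite fineK// => /(_ (lexx _))[_].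
  apply: le_trans; rewrite le_eqVlt; apply/orP; left; apply/eqP.
  have E d : \int[mu]_x (enorm (dir d u x) ^+ 2) = \int[mu]_x einner (dir d u x) (dir d u x).
    by apply: eq_Rintegral => x _; rewrite enorm_sqr.
  by rewrite !E (Rintegral_dir_sqr t2 tu) (Rintegral_dir_sqr t2' tu).
by move=> s2 s2' tu; apply/eqP; rewrite eq_le !le.
Qed.

(** The space of the iteration: it contains the test forms, is stable under the measurable
    coefficient, and embeds in every L^m. *)
Definition bounded_form h := [/\ mform h, exists C, forall x, enorm (h x) <= C
  & exists r, forall x, r < `|x| -> h x = 0].

Lemma tform_bounded u : tform u -> bounded_form u.
Proof.
move=> tu; split; first exact: tform_mform.
  have [C C0 uC] := csmooth_bounded (csmooth_einner tu tu).
  exists (1 + C) => x; have := uC x; rewrite ger0_norm ?einner_ge0// -enorm_sqr => h.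
  have := enorm_ge0 (u x); nra.
have [_ [r ur]] := csmooth_einner tu tu; exists r => x /ur/einner_eq0//.
Qed.

Lemma bounded_formB u v : bounded_form u -> bounded_form v -> bounded_form (fun x => u x - v x).
Proof.
move=> [mu_ [C uC] [r ur]] [mv [D vD] [s vs]]; split; first exact: mformB.
  by exists (C + D) => x; rewrite (le_trans (enormB _ _))// lerD.
exists (Num.max r s) => x; rewrite gt_max => /andP[rx sx].
by rewrite ur// vs// subrr.
Qed.

Lemma bounded_field_form m A h : 0 <= m -> bounded_field m A -> bounded_form h ->
  bounded_form (fun x => A x (h x)).
Proof.
move=> m0 [lA mA bA] [mh [C hC] [r hr]]; split; first exact: mA.
  by exists (m * C) => x; rewrite (le_trans (bA _ _))// ler_wpM2l.
exists r => x rx; rewrite hr//; apply: enorm_eq0; apply/eqP.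
by rewrite eq_le enorm_ge0 (le_trans (bA _ _))// enorm0 mulr0.
Qed.

Lemma bounded_form_FN (m : nat) h : (0 < m)%N -> bounded_form h -> (FN m%:R h < +oo)%E.
Proof.
move=> m0 [mh [C hC] [r hr]]; apply/(FN_finP m0 mh).
apply: (@integrable_bounded_support _ _ _ (C ^+ m) r).
- exact: measurable_funX (measurable_enorm mh).
- move=> x; rewrite ger0_norm ?exprn_ge0 ?enorm_ge0//; apply: lerXn2r => //.
    by rewrite nnegrE enorm_ge0.
  by rewrite nnegrE (le_trans (enorm_ge0 (h x))).
- by move=> x /hr ->; rewrite enorm0 expr0n gtn_eqF.
Qed.

Hypothesis n_gt0 : (0 < n)%N.

(** For t >= r the mollification is O(t^(-n)) and supported in a cube of radius 2t, so the integral
    of its m-th power is O(t^(n - nm)), which is O(1/t) because m >= 2. *)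
Lemma NL_conv_molli_decay (m : nat) (g : 'rV[R]_n -> R) (C r e : R) : (1 < m)%N -> mfun g ->
  (forall x, `|g x| <= C) -> (forall x, r < `|x| -> g x = 0) -> 0 < e ->
  exists2 t0, 0 < t0 & forall t, t0 <= t -> (NL m%:R (convol (molli t) g) <= e%:E)%E.
Proof.
move=> m1 mg gC gr e0; have [B B0 bB] := @molli_bound R n n_gt0.
have ig := integrable_bounded_support mg gC gr.
pose G := \int[mu]_x `|g x|; have G0 : 0 <= G by apply: Rintegral_ge0.
pose c := (B * G) ^+ m * 4 ^+ n; have em0 : 0 < e ^+ m by exact: exprn_gt0.
have c0 : 0 <= c by rewrite mulr_ge0// exprn_ge0// mulr_ge0// ltW.
pose t0 := 1 + `|r| + c / e ^+ m.
have q0 : 0 <= c / e ^+ m by rewrite divr_ge0// ltW.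
have t00 : 1 <= t0 by rewrite /t0 -addrA lerDl addr_ge0.
exists t0 => [|t tt]; first exact: lt_le_trans t00.
have t1 : 1 <= t := le_trans t00 tt; have tp : 0 < t by exact: lt_le_trans t1.
have rt : r <= t.
  apply: le_trans (ler_norm r) (le_trans _ tt).
  by rewrite /t0 [1 + _]addrC -addrA lerDl addr_ge0.
have ct : c <= e ^+ m * t.
  rewrite mulrC -ler_pdivrMr//; apply: le_trans _ tt.
  by rewrite /t0 lerDr addr_ge0.
have cm := @csmooth_molli R n t tp.
have sup x : t + t < `|x| -> convol (molli t) g x = 0.
  move=> tx; apply: (conv_support (r := t) (s := t)) tx.
    by move=> z tz; rewrite molli_out// ltW.
  by move=> z tz; apply: gr; exact: le_lt_trans tz.
have t20 : 0 <= t + t by rewrite addr_ge0// ltW.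
apply: (@NL_bounded_support _ _ (B * t^-1 ^+ n * G) (t + t)) => //.
- exact: ltnW.
- exact: smooth_measurable (smooth_conv cm ig).
- move=> x; apply: conv_bound => //.
  by move=> z; exact: bB.
- exact: ltW.
have -> : (2 * (t + t)) ^+ n = 4 ^+ n * t ^+ n by rewrite -exprMn; congr (_ ^+ _); ring.
have ti : t^-1 <= 1 by rewrite invf_le1.
have ti0 : 0 < t^-1 by rewrite invr_gt0.
have tn : t^-1 ^+ n <= t^-1 by rewrite -[leRHS]expr1 ler_wiXn2l// ltW.
have tn0 : 0 <= t^-1 ^+ n by rewrite exprn_ge0// ltW.
have tn1 : t^-1 ^+ n <= 1 := le_trans tn ti.
have tm : (t^-1 ^+ n) ^+ m <= t^-1 ^+ n * t^-1 ^+ n by rewrite -expr2 ler_wiXn2l.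
have tt1 : (t^-1 ^+ n) ^+ m * t ^+ n <= t^-1.
  have tn' : 0 < t ^+ n by exact: exprn_gt0.
  apply: le_trans (ler_wpM2r (ltW tn') tm) _.
  by rewrite exprVn -mulrA mulVf ?gt_eqF// mulr1 -exprVn.
have -> : (B * t^-1 ^+ n * G) ^+ m * (4 ^+ n * t ^+ n) = c * ((t^-1 ^+ n) ^+ m * t ^+ n).
  rewrite /c mulrAC !exprMn; move: (B ^+ m) (G ^+ m) (4 ^+ n) (t ^+ n) ((t^-1 ^+ n) ^+ m) => *.
  by ring.
apply: le_trans (ler_wpM2l c0 tt1) _.
by rewrite ler_pdivrMr.
Qed.

(** Take u = - [invdir] of h between a small scale and a large one. By [dir_invdir] the error is h
    minus its mollification at the small scale plus its mollification at the large scale; both are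
    small in both norms. *)
Lemma dir_approx (m : nat) h (e : R) : (1 < m)%N -> bounded_form h -> 0 < e ->
  exists2 u, tform u & (FN 2 (fun x => h x - dir (-1) u x)%R <= e%:E)%E /\
    (FN m%:R (fun x => h x - dir (-1) u x)%R <= e%:E)%E.
Proof.
move=> m1 [mh [C hC] [r hr]] e0; have m0 := ltnW m1.
pose N : R := #|{set 'I_n}|%:R.
have N0 : 0 < N by rewrite ltr0n; apply/card_gt0P; exists finset.set0.
pose d := e / N / 2; have d0 : 0 < d by rewrite !divr_gt0.
have cC I x : `|coef h I x| <= C by rewrite (le_trans (coord_le_enorm _ _)).
have C0 : 0 <= C := le_trans (enorm_ge0 (h 0)) (hC 0).
have cr I x : r < `|x| -> coef h I x = 0 by move=> rx; rewrite /coef hr// ffunE.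
have ih : iform h by move=> I; exact: integrable_bounded_support (mh I) (cC I) (cr I).
have i2 I : L1 (fun x => coef h I x ^+ 2).
  apply: (@integrable_bounded_support _ _ _ (C ^+ 2) r).
  - exact: measurable_funX (mh I).
  - by move=> x; rewrite normrX; apply: lerXn2r; rewrite ?nnegrE.
  - by move=> x /cr ->; rewrite expr0n.
have far I : exists2 t0, 0 < t0 & forall t, t0 <= t ->
    (NL 2 (convol (molli t) (coef h I)) <= d%:E)%E /\
    (NL m%:R (convol (molli t) (coef h I)) <= d%:E)%E.
  have [t1 t10 h1] := @NL_conv_molli_decay 2 _ _ _ _ isT (mh I) (cC I) (cr I) d0.
  have [t2 t20 h2] := NL_conv_molli_decay m1 (mh I) (cC I) (cr I) d0.
  exists (Num.max t1 t2) => [|t]; first by rewrite lt_max t10.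
  by rewrite ge_max => /andP[/h1 ? /h2 ?].
(* An L^2 error of this size, also at most 1, gives an L^m error at most d by [NL_interp]; the
   function h minus its mollification is bounded by 2C. *)
pose k := Num.min d (d ^+ m / (1 + (2 * C) ^+ (m - 2))).
have D0 : 0 < 1 + (2 * C) ^+ (m - 2) by rewrite ltr_pwDl// exprn_ge0// mulr_ge0.
pose d' := Num.min k 1; have d'0 : 0 < d'.
  by rewrite !lt_min d0 ltr01 divr_gt0// exprn_gt0.
have near I : exists2 t0, 0 < t0 & forall t, 0 < t -> t <= t0 ->
    (NL 2 (fun x => coef h I x - convol (molli t) (coef h I) x)%R <= d%:E)%E /\
    (NL m%:R (fun x => coef h I x - convol (molli t) (coef h I) x)%R <= d%:E)%E.
  have [t0 t00 ht] := conv_molli_cvg n_gt0 (mh I) (i2 I) (cr I) d'0.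
  exists t0 => // t tp tt; have cm := @csmooth_molli R n t tp.
  have mc : mfun (convol (molli t) (coef h I)) by exact: smooth_measurable (smooth_conv cm (ih I)).
  pose g x := coef h I x - convol (molli t) (coef h I) x.
  have mg : mfun g by exact: measurable_funB.
  have N2 : (NL 2 g <= d'%:E)%E.
    apply: le_trans (ht t tp tt); apply: NL_mono => //; first exact: measurable_funB.
    by move=> x; rewrite distrC.
  have d'd : d' <= d by rewrite ge_min /k ge_min lexx.
  split; first by apply: le_trans N2 _; rewrite lee_fin.
  apply: (NL_interp (C := 2 * C) m1 mg _ (ltW d'0) (ltW d0) N2).
    move=> x; rewrite /g (le_trans (ler_normB _ _))// mulr_natl mulr2n lerD//.
    have := @conv_molli_near R n n_gt0 t (coef h I) x 0 C tp (ih I).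
    by rewrite subr0; apply => y _; rewrite subr0.
  have d'k : d' <= d ^+ m / (1 + (2 * C) ^+ (m - 2)) by rewrite !ge_min lexx orbT.
  have d'1 : d' <= 1 by rewrite ge_min lexx orbT.
  apply: (@le_trans _ _ ((1 + (2 * C) ^+ (m - 2)) * d')); last by rewrite mulrC -ler_pdivlMr.
  have : d' ^+ 2 <= d' by rewrite expr2 ler_piMr// ltW.
  move=> h2; apply: le_trans (ler_wpM2l _ h2) _; first by rewrite exprn_ge0// mulr_ge0.
  by rewrite ler_wpM2r ?(ltW d'0)// lerDr.
have [tf tf0 tfP] : exists2 t0, 0 < t0 & forall I t, t0 <= t ->
    (NL 2 (convol (molli t) (coef h I)) <= d%:E)%E /\
    (NL m%:R (convol (molli t) (coef h I)) <= d%:E)%E.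
  have [f fP] := choice (fun I => let: ex_intro2 t a b := far I in ex_intro _ t (conj a b)).
  exists (\sum_I f I) => [|I t]; first by rewrite (bigD1 finset.set0)//= ltr_pwDl ?(fP _).1// sumr_ge0// => J _; exact: ltW (fP J).1.
  rewrite (bigD1 I)//= => ft; apply: (fP I).2; apply: le_trans ft; rewrite lerDl.
  by apply: sumr_ge0 => J _; exact: ltW (fP J).1.
have [tn tn0 tnP] : exists2 t0, 0 < t0 & forall I,
    (NL 2 (fun x => coef h I x - convol (molli t0) (coef h I) x)%R <= d%:E)%E /\
    (NL m%:R (fun x => coef h I x - convol (molli t0) (coef h I) x)%R <= d%:E)%E.
  have [f fP] := choice (fun I => let: ex_intro2 t a b := near I in ex_intro _ t (conj a b)).
  (* The inverse of this sum is a positive scale below all of the finitely many [f I]. *)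
  pose S := \sum_I (f I)^-1.
  have S0 I : (f I)^-1 <= S.
    by rewrite /S (bigD1 I)//= lerDl; apply: sumr_ge0 => J _; rewrite invr_ge0 ltW// (fP J).1.
  have Sp : 0 < S by apply: lt_le_trans (S0 finset.set0); rewrite invr_gt0 (fP _).1.
  exists S^-1 => [|I]; first by rewrite invr_gt0.
  apply: (fP I).2; first by rewrite invr_gt0.
  by rewrite -[leRHS]invrK lef_pV2 ?posrE ?invr_gt0 ?(fP I).1.
pose u : form := fun x => (-1) *: invdir (-1) tn tf h x.
have tI := tform_invdir (-1) tn0 tf0 ih hr.
have tu : tform u by exact: tformZ.
have E I : coef (fun x => h x - dir (-1) u x) I =
    fun x => (coef h I x - convol (molli tn) (coef h I) x) + convol (molli tf) (coef h I) x.
  apply/funext => x; rewrite /coef /u (dirZ _ _ _ (tform_sform tI)) (dir_invdir _ _ tn0 tf0 ih).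
  by rewrite scalerA mulN1r opprK scale1r !ffunE; ring.
have mD : mform (fun x => h x - dir (-1) u x).
  exact: mformB mh (tform_mform (tform_dir (-1) tu)).
have bd (p : R) : 1 <= p ->
    (forall I, (NL p (fun x => coef h I x - convol (molli tn) (coef h I) x)%R <= d%:E)%E) ->
    (forall I, (NL p (convol (molli tf) (coef h I)) <= d%:E)%E) ->
    (FN p (fun x => h x - dir (-1) u x)%R <= e%:E)%E.
  move=> p1 h1 h2; apply: le_trans (FN_le_coef p1 mD) _.
  apply: (@le_trans _ _ (\sum_(I : {set 'I_n}) (d + d)%:E)%E); last first.
    rewrite sumEFin lee_fin sumr_const -mulr_natl -splitr -/N mulrC divfK//.
    by rewrite gt_eqF.
  apply: lee_sum => I _; rewrite E EFinD.
  have mc t : 0 < t -> mfun (convol (molli t) (coef h I)).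
    by move=> tp; exact: smooth_measurable (smooth_conv (csmooth_molli tp) (ih I)).
  apply: le_trans (NL_triangle p1 _ _) _.
  - by apply: measurable_funB; [exact: mh|exact: mc].
  - exact: mc.
  - by apply: leeD; [exact: h1|exact: h2].
exists u => //; split; apply: bd.
- by rewrite ler1n.
- by move=> I; exact: (tnP I).1.
- by move=> I; exact: (tfP I tf (lexx _)).1.
- by rewrite ler1n.
- by move=> I; exact: (tnP I).2.
- by move=> I; exact: (tfP I tf (lexx _)).2.
Qed.

Lemma expr_small (a th e : R) : 0 <= th -> th < 1 -> 0 < e -> exists j : nat, th ^+ j * a <= e.
Proof.
move=> t0 t1 e0; have : (fun j => th ^+ j) @ \oo --> (0 : R).
  by apply: cvg_expr; rewrite ger0_norm.
pose d := e / (1 + `|a|); have a0 : 0 < 1 + `|a| by rewrite ltr_pwDl.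
have d0 : 0 < d by rewrite divr_gt0.
move=> /cvgrPdist_le/(_ _ d0)[N _ hN]; exists N.
have := hN N (leqnn N); rewrite /= sub0r normrN ger0_norm ?exprn_ge0// => h.
apply: (@le_trans _ _ (th ^+ N * (1 + `|a|))).
  by rewrite ler_wpM2l ?exprn_ge0// (le_trans (ler_norm a))// lerDr.
by rewrite -ler_pdivlMr.
Qed.

Variables (m : nat) (k K th : R) (A : 'rV[R]_n -> exterior R n -> exterior R n).
Hypotheses (m1 : (1 < m)%N) (k0 : 0 <= k) (kth : k <= th) (kKth : k * K <= th)
  (th1 : th < 1) (bA : bounded_field k A)
  (HK : forall u, tform u -> (FN m%:R (dir 1 u) <= K%:E * FN m%:R (dir (-1) u))%E).

Definition residual h u : form := fun x => h x - (dir (-1) u x - A x (dir 1 u x)).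

Lemma bounded_residual h u : bounded_form h -> tform u -> bounded_form (residual h u).
Proof.
move=> bh tu; apply: bounded_formB => //.
apply: bounded_formB; first exact/tform_bounded/tform_dir.
exact/(bounded_field_form k0 bA)/tform_bounded/tform_dir.
Qed.

(** With D^- u close to h, the residual is a small error plus A D^+ u. The latter is at most k |D^-
    u| in L^2 by [FN2_dir] and at most k K |D^- u| in L^m by [HK], and |D^- u| is nearly at most
    |h|. *)
Lemma residual_step h (e : R) : bounded_form h -> 0 < e -> exists2 u, tform u &
  (FN 2 (residual h u) <= th%:E * FN 2 h + e%:E)%E /\
  (FN m%:R (residual h u) <= th%:E * FN m%:R h + e%:E)%E.
Proof.
move=> bh e0; have e20 : 0 < e / 2 by rewrite divr_gt0.
have [u tu [u2 um]] := dir_approx m1 bh e20; exists u => //.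
have th0 : 0 <= th := le_trans k0 kth.
have [mh _ _] := bh; have [lA mA eA] := bA.
have md d := tform_mform (tform_dir d tu).
have mr := mformB mh (md (-1)); have mAd := mA _ (md 1).
have E : residual h u = fun x => (h x - dir (-1) u x) + A x (dir 1 u x).
  by apply/funext => x; rewrite /residual opprB addrA addrAC.
have main (p : R) : 1 <= p -> (FN p h < +oo)%E ->
    (FN p (fun x => h x - dir (-1) u x)%R <= (e / 2)%:E)%E ->
    (k%:E * FN p (dir 1 u) <= th%:E * FN p (dir (-1) u))%E ->
    (FN p (residual h u) <= th%:E * FN p h + e%:E)%E.
  move=> p1 hf ue kd; have p0 : 0 < p := lt_le_trans ltr01 p1.
  rewrite E; apply: le_trans (FN_triangle p1 mr mAd) _.
  have kA := FN_mono p0 k0 mAd (md 1) (fun x => eA x _).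
  have dh : (FN p (dir (-1) u) <= FN p h + (e / 2)%:E)%E.
    apply: le_trans (leeD2l (FN p h) ue).
    have := FN_triangleB p1 mh mr; under eq_fun do rewrite subKr.
    by [].
  apply: le_trans (leeD ue (le_trans kA kd)) _.
  apply: (@le_trans _ _ ((e / 2)%:E + th%:E * (FN p h + (e / 2)%:E))%E).
    by apply: leeD2l; apply: lee_wpmul2l => //; rewrite lee_fin.
  have fn : (FN p h \is a fin_num)%E by rewrite ge0_fin_numE ?FN_ge0.
  rewrite -(fineK fn); move: (fine (FN p h)) => a.
  have hr : e / 2 + th * (a + e / 2) <= th * a + e.
    have ht : th * (e / 2) <= e / 2 by rewrite ler_piMl ?ltW.
    by rewrite mulrDr; lra.
  by rewrite -lee_fin in hr.
have fin := bounded_form_FN _ bh.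
split; apply: main => //.
- by rewrite ler1n.
- exact: (fin 2).
- have N1 : (-1) * (-1) = 1 :> R by rewrite mulN1r opprK.
  rewrite (FN2_dir (mulr1 1) N1 tu); apply: lee_wpmul2r; first exact: FN_ge0.
  by rewrite lee_fin.
- by rewrite ler1n ltnW.
- exact: fin (ltnW m1).
- apply: (@le_trans _ _ (k%:E * (K%:E * FN m%:R (dir (-1) u)))%E).
    by apply: lee_wpmul2l; [rewrite lee_fin|exact: HK].
  rewrite muleA -EFinM; apply: lee_wpmul2r; first exact: FN_ge0.
  by rewrite lee_fin.
Qed.

(** The residual of u + v for the datum h is the residual of v for the datum [residual h u], so
    steps can be chained and the norms decay like th^j. At each step half of the tolerance is
    reserved for the new error. *)
Lemma residual_small h (e : R) : bounded_form h -> 0 < e -> exists2 u, tform u &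
  (FN 2 (residual h u) <= e%:E)%E /\ (FN m%:R (residual h u) <= e%:E)%E.
Proof.
move=> bh e0; have th0 : 0 <= th := le_trans k0 kth.
have iter j : forall d : R, 0 < d -> exists2 u, tform u &
    (FN 2 (residual h u) <= (th ^+ j)%:E * FN 2 h + d%:E)%E /\
    (FN m%:R (residual h u) <= (th ^+ j)%:E * FN m%:R h + d%:E)%E.
  elim: j => [|j IH] d d0.
    exists (fun=> 0); first exact: tform0.
    have E : residual h (fun=> 0) = h.
      have z s x : dir s (fun=> 0 : exterior R n) x = 0 :> exterior R n.
        have E0 : (fun y : 'rV[R]_n => 0 *: (0 : exterior R n)) = fun=> 0.
          by apply/funext => y; rewrite scale0r.
        by have := dirZ s 0 x (tform_sform tform0); rewrite E0 scale0r.
      apply/funext => x; rewrite /residual !z; have [lA _ _] := bA.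
      have -> : A x 0 = 0 by have := lA x (-1) 0 0; rewrite scaler0 add0r scaleN1r addNr.
      by rewrite !subr0.
    by rewrite E expr0 !mul1e; split; apply: leeDl; rewrite lee_fin ltW.
  have d20 : 0 < d / 2 by rewrite divr_gt0.
  have [u tu [u2 um]] := IH _ d20.
  have br := bounded_residual bh tu.
  have [v tv [v2 vm]] := residual_step br d20.
  exists (fun x => u x + v x); first exact: tformD.
  have E : residual h (fun x => u x + v x) = residual (residual h u) v.
    apply/funext => x; rewrite /residual !(dirD _ _ (tform_sform tu) (tform_sform tv)).
    have [lA _ _] := bA.
    have -> : A x (dir 1 u x + dir 1 v x) = A x (dir 1 u x) + A x (dir 1 v x).
      by have := lA x 1 (dir 1 u x) (dir 1 v x); rewrite !scale1r.
    by rewrite -[in RHS]addrA -opprD; congr (_ - _); rewrite opprD addrACA.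
  have fin (p : nat) : (0 < p)%N -> (FN p%:R h \is a fin_num)%E.
    move=> p0; have fb := bounded_form_FN p0 bh.
    by rewrite ge0_fin_numE; [exact: fb|exact: FN_ge0].
  have comb (a b c : \bar R) : (a \is a fin_num)%E ->
      (b <= (th ^+ j)%:E * a + (d / 2)%:E)%E -> (c <= th%:E * b + (d / 2)%:E)%E ->
      (c <= (th ^+ j.+1)%:E * a + d%:E)%E.
    move=> fa hb hc; apply: (le_trans hc).
    apply: (@le_trans _ _ (th%:E * ((th ^+ j)%:E * a + (d / 2)%:E) + (d / 2)%:E)%E).
      by apply: leeD2r; apply: lee_wpmul2l => //; rewrite lee_fin.
    rewrite -(fineK fa); move: (fine a) => a'.
    have hr : th * (th ^+ j * a' + d / 2) + d / 2 <= th ^+ j.+1 * a' + d.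
      have ht : th * (d / 2) <= d / 2 by rewrite ler_piMl ?ltW.
      by rewrite exprS mulrDr mulrA; lra.
    by rewrite -lee_fin in hr.
  rewrite E; split.
    exact: (comb _ _ _ (fin 2 isT) u2 v2).
  exact: (comb _ _ _ (fin m (ltnW m1)) um vm).
have fin (p : nat) : (0 < p)%N -> (FN p%:R h \is a fin_num)%E.
  move=> p0; have fb := bounded_form_FN p0 bh.
    by rewrite ge0_fin_numE; [exact: fb|exact: FN_ge0].
pose a := fine (FN 2 h) + fine (FN m%:R h).
have a2 : 0 <= fine (FN 2 h) by rewrite fine_ge0 ?FN_ge0.
have am : 0 <= fine (FN m%:R h) by rewrite fine_ge0 ?FN_ge0.
have e20 : 0 < e / 2 by rewrite divr_gt0.
have [j hj] := expr_small a th0 th1 e20.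
have tj : 0 <= th ^+ j by exact: exprn_ge0.
have [u tu [u2 um]] := iter j _ e20; exists u => //; split.
  apply: le_trans u2 _; rewrite -(fineK (fin 2 isT)) -EFinM -EFinD lee_fin [leRHS]splitr lerD2r.
  by apply: le_trans _ hj; rewrite ler_wpM2l// lerDl.
apply: le_trans um _; rewrite -(fineK (fin m (ltnW m1))) -EFinM -EFinD lee_fin [leRHS]splitr lerD2r.
by apply: le_trans _ hj; rewrite ler_wpM2l// lerDr.
Qed.

End neumann_series.

(** * Morrey and a priori estimates *)

Section morrey.
Context {R : realType} {n : nat}.
Notation mu := (@lebesgue_rV R n).
Notation form := ('rV[R]_n -> exterior R n).
Notation L1 g := (mu.-integrable setT (EFin \o g)).
Notation mfun f := (measurable_fun [set: 'rV[R]_n] f).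
Notation m := (2 * n)%N.
Implicit Types (u v w h f : form) (x y : 'rV[R]_n) (I : {set 'I_n}).
Hypothesis n_gt0 : (0 < n)%N.

Let m_gt0 : (0 < m)%N. Proof. by rewrite muln_gt0. Qed.

(** Hoelder's inequality on a cube of radius s^2: the volume s^(2n) to the power 1 - 1/(2n) is
    s^(2n-1). *)
Lemma ball_L1 w (N s : R) x I : mform w -> 0 < N -> 0 < s -> (FN m%:R w <= N%:E)%E ->
  L1 (fun y => \1_[set y | `|y - x| <= s ^+ 2] y * `|coef w I y|) /\
  \int[mu]_y (\1_[set y | `|y - x| <= s ^+ 2] y * `|coef w I y|) <= (2 ^+ n + 1) * N * s ^+ m.-1.
Proof.
move=> mw N0 s0 wN; have [iw lew] := (FN_leP m_gt0 (ltW N0) mw).1 wN.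
set B := [set y | _]; have s20 : 0 < s ^+ 2 by exact: exprn_gt0.
have mB : measurable B by exact: measurable_cube.
have iB : L1 (\1_B : 'rV[R]_n -> R) by exact: integrable_cube.
(* The threshold that balances the two terms of a <= l + a^m / l^(m-1) after integration over the
   cube. *)
pose l := N / s; have l0 : 0 < l by rewrite divr_gt0.
pose c := l / l ^+ m; have c0 : 0 < c by rewrite divr_gt0// exprn_gt0.
have young a : 0 <= a -> a <= l + c * a ^+ m.
  move=> a0; have [al|la] := leP a l.
    by rewrite ler_wpDr// mulr_ge0 ?(ltW c0)// exprn_ge0.
  rewrite ler_wpDl ?(ltW l0)//.
  have q1 : 1 <= a / l by rewrite ler_pdivlMr// mul1r ltW.
  have := ler_eXnr m_gt0 q1; rewrite expr_div_n -(ler_pM2l l0) mulrCA divff ?gt_eqF// mulr1.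
  by rewrite /c -mulrA [_^-1 * _]mulrC.
have iG : L1 (fun y => l * (\1_B y : R) + c * enorm (w y) ^+ m).
  by apply: integrableDR; exact: integrableZR.
have le y : \1_B y * `|coef w I y| <= l * (\1_B y : R) + c * enorm (w y) ^+ m.
  have e0 : 0 <= c * enorm (w y) ^+ m by rewrite mulr_ge0 ?(ltW c0)// exprn_ge0// enorm_ge0.
  rewrite indicE; case: (y \in B); last by rewrite mul0r mulr0 add0r.
  rewrite mul1r mulr1; apply: le_trans (coord_le_enorm _ _) _.
  exact: young (enorm_ge0 _).
have g0 y : 0 <= \1_B y * `|coef w I y| by rewrite mulr_ge0// indicE ler0n.
have iF : L1 (fun y => \1_B y * `|coef w I y|).
  apply: le_integrable iG => //.
    apply/measurable_EFinP; apply: measurable_funM; first exact: measurable_indic.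
    by apply: measurableT_comp => //; exact: mw.
  by move=> y _ /=; rewrite lee_fin ger0_norm// (le_trans (le y))// ler_norm.
split=> //; apply: le_trans (le_Rintegral _ iF iG (fun y _ => le y)) _ => //.
rewrite RintegralD//; [|exact: integrableZR|exact: integrableZR].
rewrite !RintegralZl// Rintegral_cube ?(ltW s20)//.
have sm : s ^+ m = s * s ^+ m.-1 by rewrite -exprS prednK.
have -> : l * (2 * s ^+ 2) ^+ n = 2 ^+ n * N * s ^+ m.-1.
  rewrite exprMn -exprM sm /l; have : s != 0 by rewrite gt_eqF.
  by clear; move: (2 ^+ n) (s ^+ m.-1) => a b sn0; field.
rewrite mulrDl mulrDl lerD2l mul1r.
apply: (@le_trans _ _ (c * N ^+ m)); first by rewrite ler_wpM2l// ltW.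
rewrite /c /l expr_div_n sm le_eqVlt; apply/orP; left; apply/eqP.
have : N ^+ m != 0 by rewrite expf_neq0// gt_eqF.
have : s != 0 by rewrite gt_eqF.
have : s ^+ m.-1 != 0 by rewrite expf_neq0// gt_eqF.
by clear; move: (N ^+ m) (s ^+ m.-1) => a b *; field; do ?[apply/andP; split].
Qed.

Lemma conv_est (K : 'rV[R]_n -> R) w (B N s : R) x I : csmooth K -> (forall z, `|K z| <= B) ->
  (forall z, s ^+ 2 < `|z| -> K z = 0) -> iform w -> 0 < N -> 0 < s ->
  (FN m%:R w <= N%:E)%E ->
  `|convol K (coef w I) x| <= B * ((2 ^+ n + 1) * N * s ^+ m.-1).
Proof.
move=> cK KB Ks iw N0 s0 wN; have [iF leF] := ball_L1 x I (iform_mform iw) N0 s0 wN.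
have iK := integrable_conv x cK (iw I).
have B0 : 0 <= B := le_trans (normr_ge0 (K 0)) (KB 0).
apply: le_trans (le_normr_Rintegral _ iK) _ => //.
apply: le_trans (ler_wpM2l B0 leF); rewrite -RintegralZl//.
apply: le_Rintegral => //; [exact: integrable_norm|exact: integrableZR|].
move=> y _; rewrite normrM indicE; have [xy|yx] := leP `|x - y| (s ^+ 2).
  by rewrite mem_set/= ?mul1r ?ler_wpM2r// distrC.
by rewrite Ks// normr0 mul0r mulr_ge0// mulr_ge0// ler0n.
Qed.

Lemma fconv_est : exists2 D, 0 < D & forall (K : 'rV[R]_n -> R) w (B N s : R) x,
  csmooth K -> (forall z, `|K z| <= B) -> (forall z, s ^+ 2 < `|z| -> K z = 0) ->
  iform w -> 0 < N -> 0 < s -> (FN m%:R w <= N%:E)%E ->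
  enorm (fconv K w x) <= B * (D * N * s ^+ m.-1).
Proof.
pose D : R := #|{set 'I_n}|%:R * (2 ^+ n + 1).
exists D => [|K w B N s x cK KB Ks iw N0 s0 wN].
  rewrite mulr_gt0 ?addr_gt0 ?exprn_gt0// ltr0n; apply/card_gt0P; by exists finset.set0.
apply: le_trans (enorm_le_sum _) _.
apply: (@le_trans _ _ (\sum_(I : {set 'I_n}) B * ((2 ^+ n + 1) * N * s ^+ m.-1))).
  by apply: ler_sum => I _; rewrite ffunE; exact: conv_est.
rewrite sumr_const -[leLHS]mulr_natl /D le_eqVlt; apply/orP; left; apply/eqP; ring.
Qed.

Lemma pow_ratio (s : R) : 0 < s -> (s ^+ 2)^-1 ^+ n * s ^+ m.-1 = s^-1.
Proof.
move=> s0; have sn : s != 0 by rewrite gt_eqF.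
have E : (s ^+ 2) ^+ n = s * s ^+ m.-1 by rewrite -exprM -exprS prednK.
by rewrite exprVn E invfM -mulrA mulVf ?mulr1// expf_neq0.
Qed.

(** By [invdir_dir] the difference is a convolution of [dfield] with D u. The kernel is of size s^2
    s^(-2n) and its derivatives of size s^(-2n); multiplied by N s^(2n-1) from [ball_L1] these give
    N s and N / s. *)
Lemma molli_step (d : R) : d * d = 1 -> exists2 D, 0 < D & forall u (N s : R) x, tform u -> 0 < N -> 0 < s ->
  (FN m%:R (dir d u) <= N%:E)%E ->
  enorm (fconv (molli (s ^+ 2)) u x - fconv (molli ((s / 2) ^+ 2)) u x) <= D * N * s /\
  forall k, enorm (pform k (fconv (molli (s ^+ 2)) u) x - pform k (fconv (molli ((s / 2) ^+ 2)) u) x) <= D * N / s.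
Proof.
move=> d2; have [E E0 hE] := fconv_est.
have [B1 B10 h1] := @dfield_bound R n; have [B2 B20 h2] := @partial_dfield_bound R n.
have n0 : 0 < n%:R :> R by rewrite ltr0n.
exists (n%:R * (B1 + B2) * E) => [|u N s x tu N0 s0 uN].
  by rewrite !mulr_gt0// addr_gt0.
have s20 : 0 < s ^+ 2 by exact: exprn_gt0.
have q0 : 0 < s ^+ 2 * 4^-1 by rewrite mulr_gt0// invr_gt0.
have qE : (s / 2) ^+ 2 = s ^+ 2 * 4^-1 by rewrite expr_div_n; congr (_ / _); ring.
have sn : s != 0 by rewrite gt_eqF.
rewrite qE; have id := tform_iform (tform_dir d tu).
have cd j := @csmooth_dfield R n _ _ j s20 q0.
have out (j : 'I_n) (z : 'rV[R]_n) : s ^+ 2 < `|z| -> dfield (s ^+ 2) (s ^+ 2 * 4^-1) j z = 0.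
  move=> /ltW sz; rewrite dfield_out// (le_trans _ sz)// ler_piMr ?(ltW s20)// invf_le1//; by rewrite ler1n.
have nE (v : exterior R n) : enorm (d *: v) = enorm v.
  rewrite enormZ; suff -> : `|d| = 1 by rewrite mul1r.
  have : `|d| ^+ 2 = 1 by rewrite -normrX expr2 d2 normr1.
  by move/eqP; rewrite sqrp_eq1// => /eqP.
have bd (F : 'I_n -> form) (B c : R) : 0 <= c -> B <= B1 + B2 ->
   (forall j, enorm (F j x) <= B * c) ->
   enorm (\sum_j clif d j (F j x)) <= n%:R * (B1 + B2) * c.
  move=> c0 BB hF; apply: le_trans (enorm_sum _ _ _) _.
  apply: (@le_trans _ _ (\sum_(j < n) (B1 + B2) * c)).
    apply: ler_sum => j _; rewrite (enorm_clif _ _ d2); apply: le_trans (hF j) _.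
    by rewrite ler_wpM2r.
  by rewrite sumr_const card_ord -[leLHS]mulr_natl mulrA.
have sm : s ^+ 2 * (s ^+ 2)^-1 ^+ n * s ^+ m.-1 = s.
  by rewrite -mulrA (pow_ratio s0) expr2 -mulrA divff// mulr1.
split.
  rewrite -nE -(invdir_dir _ _ s20 q0 tu).
  apply: le_trans (bd (fun j => fconv (dfield (s ^+ 2) (s ^+ 2 * 4^-1) j) (dir d u)) B1 (E * N * s) _ _ _) _.
  - by rewrite !mulr_ge0// ltW.
  - by rewrite lerDl ltW.
  - move=> j; have := hE _ _ _ N s x (cd j) (fun z => h1 _ j z s20) (out j) id N0 s0 uN.
    move/le_trans; apply; rewrite le_eqVlt; apply/orP; left; apply/eqP.
    rewrite -[in RHS]sm; move: (s ^+ m.-1) ((s ^+ 2)^-1 ^+ n) (s ^+ 2) => a b c.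
    by ring.
  by rewrite !mulrA.
move=> k; pose W := invdir d (s ^+ 2) (s ^+ 2 * 4^-1) (dir d u).
have cm t := @csmooth_molli R n t; have iu := tform_iform tu.
have sm1 := sform_fconv (cm _ s20) iu; have sm2 := sform_fconv (cm _ q0) iu.
have sN : sform (fun y => (-1) *: fconv (molli (s ^+ 2 * 4^-1)) u y).
  by move=> I; rewrite fcoefM; exact: (smoothM (smooth_cst _) (sm2 I)).
have sD : sform (fun y => fconv (molli (s ^+ 2)) u y + (-1) *: fconv (molli (s ^+ 2 * 4^-1)) u y).
  by move=> I; rewrite fcoefD; exact: (smoothD (sm1 I) (sN I)).
have EW : pform k W x = d *: (pform k (fconv (molli (s ^+ 2)) u) x -
    pform k (fconv (molli (s ^+ 2 * 4^-1)) u) x).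
  have -> : W = fun y => d *: (fconv (molli (s ^+ 2)) u y + (-1) *: fconv (molli (s ^+ 2 * 4^-1)) u y).
    by apply/funext => y; rewrite /W (invdir_dir _ _ s20 q0 tu) scaleN1r.
  by rewrite (pformZ _ _ _ sD) (pformD _ _ sm1 sN) (pformZ _ _ _ sm2) scaleN1r.
rewrite -nE -EW /W /invdir.
have sf j : sform (fconv (dfield (s ^+ 2) (s ^+ 2 * 4^-1) j) (dir d u)) by exact: (sform_fconv (cd j) id).
rewrite pform_sum => [|j _]; last first.
  by move=> I; rewrite coef_clif; exact: (smoothM (smooth_cst _) (sf j _)).
under eq_bigr do rewrite (pform_clif _ _ _ _ (sf _)) (pform_fconv _ _ (cd _) id).
apply: le_trans (bd (fun j => fconv (partial k (dfield (s ^+ 2) (s ^+ 2 * 4^-1) j)) (dir d u)) B2 (E * N / s) _ _ _) _.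
- by rewrite !mulr_ge0// ?invr_ge0 ltW.
- by rewrite lerDr ltW.
- move=> j; have pout z : s ^+ 2 < `|z| -> partial k (dfield (s ^+ 2) (s ^+ 2 * 4^-1) j) z = 0.
    move=> sz; apply: partial_near0; apply: filterS (near_norm_gt sz) => y.
    exact: out.
  have := hE _ _ _ N s x (csmooth_partial k (cd j)) (fun z => h2 _ k j z s20) pout id N0 s0 uN.
  move/le_trans; apply; rewrite le_eqVlt; apply/orP; left; apply/eqP.
  rewrite -[in RHS](pow_ratio s0); move: (s ^+ m.-1) ((s ^+ 2)^-1 ^+ n) => a b.
  by ring.
by rewrite !mulrA.
Qed.

End morrey.

(** * Morrey's inequality by telescoping over dyadic scales *)

Section morrey_embedding.
Context {R : realType} {n : nat}.
Notation mu := (@lebesgue_rV R n).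
Notation form := ('rV[R]_n -> exterior R n).
Notation m := (2 * n)%N.
Implicit Types (u v w h f : form) (x y : 'rV[R]_n) (I : {set 'I_n}).
Hypothesis n_gt0 : (0 < n)%N.

Lemma fconv_molli_pointwise u (e : R) : tform u -> 0 < e ->
  exists2 d, 0 < d & forall t x, 0 < t -> t <= d -> enorm (fconv (molli t) u x - u x) <= e.
Proof.
move=> tu e0; have [L hL] := choice (fun I => let: ex_intro2 l a b := csmooth_lipschitz (tu I) in
  ex_intro (fun l => 0 < l /\ forall x y, `|coef u I x - coef u I y| <= l * `|x - y|) l (conj a b)).
pose S := \sum_I L I; have S0 : 0 < S.
  rewrite /S (bigD1 finset.set0)//= ltr_pwDl ?(hL _).1//; apply: sumr_ge0 => J _.
  exact: ltW (hL J).1.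
exists (e / S) => [|t x t0 te]; first by rewrite divr_gt0.
apply: le_trans (enorm_le_sum _) _; apply: (@le_trans _ _ (\sum_I L I * t)); last first.
  by rewrite -mulr_suml mulrC -ler_pdivlMr.
apply: ler_sum => I _; rewrite -scaleN1r extDE extZE mulN1r ffunE.
apply: (conv_molli_near n_gt0 t0 (csmooth_integrable (tu I))) => y xy.
by apply: le_trans ((hL I).2 y x) _; rewrite distrC ler_wpM2l// ltW// (hL I).1.
Qed.

(** Anchors the upward telescoping: gradients of mollifications of a fixed test form vanish at large
    scales, at a rate that may depend on [u]. *)
Lemma pform_molli_decay u k (e : R) : tform u -> 0 < e ->
  exists2 d, 0 < d & forall t x, d <= t -> enorm (pform k (fconv (molli t) u) x) <= e.
Proof.
move=> tu e0; have [C C0 hC] := @partial_molli_bound R n n_gt0.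
pose S := \sum_I \int[mu]_y `|coef u I y|.
have S0 : 0 <= S by apply: sumr_ge0 => I _; exact: Rintegral_ge0.
have q0 : 0 <= C * S / e by rewrite divr_ge0 ?(ltW e0)// mulr_ge0// ltW.
exists (1 + C * S / e) => [|t x dt]; first by rewrite ltr_pwDl.
have t1 : 1 <= t by apply: le_trans _ dt; rewrite lerDl.
have t0 : 0 < t by exact: lt_le_trans t1.
rewrite (pform_fconv _ _ (csmooth_molli t0) (tform_iform tu)).
apply: le_trans (enorm_le_sum _) _.
have ti0 : 0 < t^-1 by rewrite invr_gt0.
apply: (@le_trans _ _ (\sum_I C * t^-1 * \int[mu]_y `|coef u I y|)).
  apply: ler_sum => I _; rewrite ffunE.
  apply: conv_bound (csmooth_partial k (csmooth_molli t0)) _ (csmooth_integrable (tu I)).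
  move=> z; apply: le_trans (hC t k z t0) _; rewrite ler_wpM2l ?(ltW C0)//.
  by rewrite -[leRHS]expr1 ler_wiXn2l ?(ltW ti0)// invf_le1.
rewrite -mulr_sumr -/S mulrAC ler_pdivrMr// [leRHS]mulrC -ler_pdivrMr//.
by apply: le_trans _ dt; rewrite lerDr.
Qed.

(** Values telescope downwards, s, s/2, s/4, ..., and the steps N s / 2^j are summable; gradients
    telescope upwards, s, 2s, 4s, ..., with steps N / (s 2^j). The ends of both chains are
    controlled qualitatively and do not enter the constant. *)
Lemma morrey_molli (d : R) : d * d = 1 -> exists2 D, 0 < D & forall u (N s : R) x,
  tform u -> 0 < N -> 0 < s -> (FN m%:R (dir d u) <= N%:E)%E ->
  enorm (fconv (molli (s ^+ 2)) u x - u x) <= D * N * s /\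
  forall k, enorm (pform k (fconv (molli (s ^+ 2)) u) x) <= D * N / s.
Proof.
move=> d2; have [D D0 hD] := molli_step n_gt0 d2.
exists (2 * D) => [|u N s x tu N0 s0 uN]; first by rewrite mulr_gt0.
have p2 j : 0 < (2 : R) ^+ j by exact: exprn_gt0.
have DN : 0 < D * N by rewrite mulr_gt0.
split.
  have step j : enorm (fconv (molli (s ^+ 2)) u x - fconv (molli ((s / 2 ^+ j) ^+ 2)) u x)
      <= D * N * s * (2 - 2 / 2 ^+ j).
    elim: j => [|j IH].
      by rewrite expr0 divr1 subrr enorm0 mulr_ge0 ?(ltW (mulr_gt0 DN s0))// divr1 subrr.
    have sj : 0 < s / 2 ^+ j by rewrite divr_gt0.
    have [h _] := hD u N _ x tu N0 sj uN.
    have -> : s / 2 ^+ j.+1 = s / 2 ^+ j / 2 by rewrite exprSr invfM mulrA.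
    set a := fconv _ u x in IH *; set b := fconv (molli ((s / 2 ^+ j) ^+ 2)) u x in IH h.
    rewrite -(subrKA b); apply: le_trans (enormD _ _) _.
    apply: le_trans (lerD IH h) _; rewrite le_eqVlt; apply/orP; left; apply/eqP.
    rewrite exprSr; have := gt_eqF (p2 j); move: (2 ^+ j) => c cn; field; by rewrite cn.
  apply/ler_addgt0Pr => e e0; have [t t0 ht] := fconv_molli_pointwise tu e0.
  have h12 : 0 <= (2^-1 : R) by rewrite invr_ge0.
  have h13 : (2^-1 : R) < 1 by rewrite invf_lt1// ltr1n.
  pose q := Num.min t 1; have q0 : 0 < q by rewrite lt_min t0 ltr01.
  have [j hj] := expr_small s h12 h13 q0.
  have sj : 0 < s / 2 ^+ j by rewrite divr_gt0.
  have sjq : s / 2 ^+ j <= q by rewrite mulrC -exprVn.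
  have sq : (s / 2 ^+ j) ^+ 2 <= t.
    have q1 : q <= 1 by rewrite ge_min lexx orbT.
    have qt : q <= t by rewrite ge_min lexx.
    apply: (le_trans _ qt); apply: (le_trans _ sjq).
    by rewrite expr2 ler_piMr ?(ltW sj)// (le_trans sjq).
  have := ht _ x (exprn_gt0 2 sj) sq => h.
  rewrite -(subrKA (fconv (molli ((s / 2 ^+ j) ^+ 2)) u x)); apply: le_trans (enormD _ _) _.
  apply: lerD h; apply: le_trans (step j) _.
  rewrite mulrC -!mulrA ler_wpM2r// ?mulr_ge0 ?(ltW D0) ?(ltW N0) ?(ltW s0)//.
  by rewrite lerBlDr lerDl divr_ge0// ltW.
move=> k; pose P t := pform k (fconv (molli (t ^+ 2)) u) x.
have step j : enorm (P (s * 2 ^+ j) - P s) <= D * N / s * (1 - (2 ^+ j)^-1).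
  elim: j => [|j IH].
    by rewrite expr0 mulr1 subrr enorm0 mulr_ge0 ?(ltW (divr_gt0 DN s0))// invr1 subrr.
  have sj : 0 < s * 2 ^+ j.+1 by rewrite mulr_gt0.
  have [_ /(_ k)] := hD u N _ x tu N0 sj uN.
  have -> : s * 2 ^+ j.+1 / 2 = s * 2 ^+ j by rewrite exprSr mulrA mulfK.
  rewrite -/(P _) -/(P _) => h.
  rewrite -(subrKA (P (s * 2 ^+ j))); apply: le_trans (enormD _ _) _.
  apply: le_trans (lerD h IH) _; rewrite le_eqVlt; apply/orP; left; apply/eqP.
  rewrite exprSr; have := gt_eqF (p2 j); have := gt_eqF s0.
  move: (2 ^+ j) => c sn cn; field; by rewrite sn cn.
apply/ler_addgt0Pr => e e0; have [t t0 ht] := pform_molli_decay k tu e0.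
have h12 : 0 <= (2^-1 : R) by rewrite invr_ge0.
have h13 : (2^-1 : R) < 1 by rewrite invf_lt1// ltr1n.
have [j hj] := expr_small (1 + t) h12 h13 s0.
have sj : 1 + t <= s * 2 ^+ j.
  by move: hj; rewrite exprVn mulrC ler_pdivrMr.
have sq : t <= (s * 2 ^+ j) ^+ 2.
  have : 0 < t by []. nra.
have := ht _ x sq; rewrite -/(P _) => h; rewrite -/(P s).
have -> : P s = P (s * 2 ^+ j) - (P (s * 2 ^+ j) - P s) by rewrite subKr.
apply: le_trans (enormB _ _) _; rewrite addrC; apply: lerD h.
apply: le_trans (step j) _; have c0 : 0 < D * N / s by rewrite divr_gt0.
have -> : 2 * D * N / s = D * N / s * 2 by rewrite -!mulrA mulrC !mulrA.
rewrite ler_wpM2l ?(ltW c0)//; have : 0 < (2 ^+ j : R)^-1 by rewrite invr_gt0.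
lra.
Qed.

(** With s^2 = |x - y|, replace u at both points by its mollification at scale s^2, at cost N s; the
    gradient bound N / s over the distance s^2 costs N s again. *)
Lemma morrey_hoelder (d : R) : d * d = 1 -> exists2 D, 0 < D & forall u (N : R) x y,
  tform u -> 0 < N -> (FN m%:R (dir d u) <= N%:E)%E ->
  enorm (u x - u y) <= D * N * Num.sqrt `|x - y|.
Proof.
move=> d2; have [D D0 hD] := morrey_molli d2.
pose c : R := #|{set 'I_n}|%:R * n%:R.
have c0 : 0 <= c by rewrite mulr_ge0.
exists ((2 + c) * D) => [|u N x y tu N0 uN]; first by rewrite mulr_gt0// ltr_pwDl.
have [->|xy] := eqVneq x y; first by rewrite !subrr enorm0 normr0 sqrtr0 mulr0.
pose s := Num.sqrt `|x - y|; have s0 : 0 < s by rewrite sqrtr_gt0 normr_gt0 subr_eq0.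
have s2 : s ^+ 2 = `|x - y| by rewrite sqr_sqrtr.
have [hx _] := hD u N s x tu N0 s0 uN; have [hy _] := hD u N s y tu N0 s0 uN.
have t0 : 0 < s ^+ 2 by exact: exprn_gt0.
pose v := fconv (molli (s ^+ 2)) u; rewrite -/v in hx hy.
have sv : sform v by exact: (sform_fconv (csmooth_molli t0) (tform_iform tu)).
have hv : enorm (v x - v y) <= c * (D * N * s).
  apply: le_trans (enorm_le_sum _) _.
  apply: (@le_trans _ _ (\sum_(I : {set 'I_n}) n%:R * (D * N / s) * `|x - y|)).
    apply: ler_sum => I _; rewrite -scaleN1r extDE extZE mulN1r.
    apply: (lipschitz_of_partial (sv I)) => k z.
    have [_ /(_ k) h] := hD u N s z tu N0 s0 uN.
    by apply: le_trans h; apply: le_trans (coord_le_enorm _ I); rewrite ffunE.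
  rewrite sumr_const -[leLHS]mulr_natl -s2 /c le_eqVlt; apply/orP; left; apply/eqP.
  have := gt_eqF s0; clear; move: (_%:R : R) (n%:R : R) => a b sn; field; by rewrite sn.
have -> : u x - u y = (v x - v y) - (v x - u x) + (v y - u y).
  rewrite opprB; move: (u x) (u y) (v x) (v y) => a b a' b'.
  by rewrite [_ + (a - a')]addrC !subrKA.
apply: le_trans (enormD _ _) _; apply: le_trans (lerD (enormB _ _) (lexx _)) _.
apply: le_trans (lerD (lerD hv hx) hy) _; rewrite -/s.
by rewrite le_eqVlt; apply/orP; left; apply/eqP; ring.
Qed.

(** Compare [x] with the point x + (2r + 1) e_j, which lies outside the support. *)
Lemma morrey_sup (d r : R) : d * d = 1 -> 0 < r -> exists2 D, 0 < D & forall u (N : R) x,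
  tform u -> 0 < N -> (FN m%:R (dir d u) <= N%:E)%E -> (forall x, r < `|x| -> u x = 0) ->
  enorm (u x) <= D * N.
Proof.
move=> d2 r0; have [D D0 hD] := morrey_hoelder d2.
have q0 : 0 < 2 * r + 1 by lra.
exists (D * Num.sqrt (2 * r + 1)) => [|u N x tu N0 uN ur]; first by rewrite mulr_gt0// sqrtr_gt0.
have [xr|rx] := leP `|x| r; last first.
  by rewrite ur// enorm0 !mulr_ge0 ?sqrtr_ge0 ?ltW.
pose j := Ordinal n_gt0; pose w : 'rV[R]_n := (2 * r + 1) *: delta_mx ord0 j.
have w1 : `|w| <= 2 * r + 1.
  rewrite /w normrZ gtr0_norm//; have := norm_e_le (R := R) j; nra.
have w2 : 2 * r + 1 <= `|w|.
  have := le_coord_norm w j; rewrite !mxE !eqxx/= mulr1; apply: le_trans.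
  exact: ler_norm.
have wx : r < `|x + w|.
  have := ler_normD (x + w) (- x); rewrite addrAC subrr add0r normrN; lra.
have := hD u N x (x + w) tu N0 uN; rewrite (ur _ wx) subr0 => /le_trans; apply.
rewrite mulrAC ler_wpM2r ?(ltW N0)// ler_wpM2l ?(ltW D0)// ler_wsqrtr//.
by rewrite opprD addrA subrr add0r normrN.
Qed.

End morrey_embedding.

(** * The interior a priori estimate for test forms *)

Section apriori.
Context {R : realType} {n : nat}.
Notation mu := (@lebesgue_rV R n).
Notation form := ('rV[R]_n -> exterior R n).
Notation L1 g := (mu.-integrable setT (EFin \o g)).
Notation m := (2 * n)%N.
Implicit Types (u v w h f : form) (x y : 'rV[R]_n) (I : {set 'I_n}).

Lemma sqn_le x : sqn x <= n%:R * `|x| ^+ 2.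
Proof.
apply: (@le_trans _ _ (\sum_(i < n) `|x| ^+ 2)); last first.
  by rewrite sumr_const card_ord -[leLHS]mulr_natl.
apply: ler_sum => i _; rewrite -real_normK ?num_real//.
by apply: lerXn2r; rewrite ?nnegrE// le_coord_norm.
Qed.

(** On the cube of radius r the weight 1 / (1 + |x|^2) is at least 1/c, since |x|^2 is at most n
    times the square of the maximum norm. Local L^2 closeness thus follows from a global bound on D
    u. *)
Lemma hardy_ball (d r : R) : (3 <= n)%N -> d * d = 1 -> 0 < r -> exists2 C, 0 < C &
  forall u, tform u -> (FN 2 (restr (cball r) u) <= C%:E * FN 2 (dir d u))%E.
Proof.
move=> n3 d2 r0; pose c := 1 + n%:R * r ^+ 2.
have c1 : 1 <= c by rewrite lerDl mulr_ge0// exprn_ge0// ltW.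
exists (2 * c) => [|u tu]; first by rewrite mulr_gt0// (lt_le_trans ltr01).
have td := tform_dir d tu; have md := tform_mform td; have mu_ := tform_mform tu.
have mr := mform_restrT (measurable_cball r) mu_.
have fd := @tform_FN R n 2 _ isT td.
have fn : (FN 2 (dir d u) \is a fin_num)%E by rewrite ge0_fin_numE; [exact: fd|exact: FN_ge0].
rewrite -(fineK fn) -EFinM; set e := fine _.
have e0 : 0 <= e by apply: fine_ge0; exact: FN_ge0.
have ce0 : 0 <= 2 * c * e by rewrite !mulr_ge0// (le_trans ler01).
have [iD leD] : L1 (fun x => enorm (dir d u x) ^+ 2) /\ \int[mu]_x (enorm (dir d u x) ^+ 2) <= e ^+ 2.
  by apply: (@FN_leP R n 2 _ e isT e0 md).1; rewrite fineK.
have q0 x : 0 < 1 + sqn x by rewrite ltr_pwDl// sqn_ge0.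
have sw : smooth (fun x : 'rV[R]_n => (1 + sqn x)^-1).
  apply: (smooth_inv (smoothD (smooth_cst 1) smooth_sqn)) => x.
  by rewrite gt_eqF.
have cE := csmoothMl (csmooth_einner tu tu) sw; have iE := csmooth_integrable cE.
have iR : L1 (fun x => enorm (restr (cball r) u x) ^+ 2).
  apply: (@FN_finP R n 2 _ isT mr).1; apply: bounded_form_FN => //.
  have [_ [C uC] _] := tform_bounded tu; split=> //.
    by exists C => x; apply: le_trans (enorm_restr _ _ _) _.
  by exists r => x; exact: restr_cball_out.
apply/(@FN_leP R n 2 _ _ isT ce0 mr); split=> //.
have pt x : enorm (restr (cball r) u x) ^+ 2 <= c * (einner (u x) (u x) * (1 + sqn x)^-1).
  have [xr|rx] := leP `|x| r; last first.
    have p0 : 0 <= einner (u x) (u x) / (1 + sqn x) by rewrite divr_ge0 ?einner_ge0// ltW.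
    by rewrite restr_cball_out// enorm0 expr0n/=; exact: mulr_ge0 (le_trans ler01 c1) p0.
  rewrite restr_in; last exact/in_cball.
  rewrite enorm_sqr mulrA ler_pdivlMr// mulrC ler_wpM2r ?einner_ge0// lerD2l.
  apply: le_trans (sqn_le x) _; rewrite ler_wpM2l//.
  by apply: lerXn2r; rewrite ?nnegrE// ltW.
apply: le_trans (le_Rintegral _ iR (integrableZR c iE) (fun x _ => pt x)) _ => //.
rewrite RintegralZl//; have H := hardy_form n3 d2 tu.
have c0 : 0 <= c := le_trans ler01 c1.
apply: le_trans (ler_wpM2l c0 H) _.
have E : \int[mu]_x einner (dir d u x) (dir d u x) <= e ^+ 2.
  by apply: le_trans _ leD; rewrite le_eqVlt; apply/orP; left; apply/eqP;
    apply: eq_Rintegral => x _; rewrite enorm_sqr.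
apply: (@le_trans _ _ (c * (4 * e ^+ 2))).
  by rewrite ler_wpM2l// ler_wpM2l.
have -> : (2 * c * e) ^+ 2 = c * (c * (4 * e ^+ 2)) by ring.
by rewrite ler_peMl// mulr_ge0// mulr_ge0// exprn_ge0.
Qed.

Lemma FN_powE (p : nat) f : (0 < p)%N -> mform f -> (FN p%:R f < +oo)%E ->
  \int[mu]_x (enorm (f x) ^+ p) = fine (FN p%:R f) ^+ p.
Proof.
move=> p0 mf ff; have fn : (FN p%:R f \is a fin_num)%E by rewrite ge0_fin_numE ?FN_ge0.
have pR : (p%:R : R) != 0 by rewrite pnatr_eq0 -lt0n.
rewrite /Rintegral.
have -> : (\int[mu]_x (enorm (f x) ^+ p)%:E = FN p%:R f `^ p%:R)%E.
  rewrite poweR_Lnorm//; apply: eq_integral => x _ /=.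
  by rewrite powR_mulrn// ger0_norm ?enorm_ge0.
by rewrite -(fineK fn) poweR_EFin powR_mulrn// fine_ge0// FN_ge0.
Qed.

Hypothesis n_gt0 : (0 < n)%N.

(** Insert X <= c Y in the bound on Y^n and cancel Y^(n-1). *)
Lemma young_power (X Y D L c : R) : 0 <= X -> 0 <= Y -> 0 < D -> 0 <= L -> 0 < c -> X <= c * Y ->
  Y ^+ n <= (D * X) ^+ n.-1 * L -> X <= c * ((D * c) ^+ n.-1 * L).
Proof.
move=> X0 Y0 D0 L0 c0 XY Yn; apply: (le_trans XY); rewrite ler_wpM2l ?(ltW c0)//.
have [->|Yn0] := eqVneq Y 0.
  by rewrite mulr_ge0// exprn_ge0// mulr_ge0 ?ltW.
have Yp : 0 < Y by rewrite lt_def Yn0.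
have : Y ^+ n <= (D * c) ^+ n.-1 * L * Y ^+ n.-1.
  apply: le_trans Yn _; rewrite -mulrA [L * _]mulrC mulrA -exprMn ler_wpM2r//.
  apply: lerXn2r; rewrite ?nnegrE ?mulr_ge0 ?(ltW D0) ?(ltW c0)//.
  by rewrite -mulrA ler_wpM2l// ltW.
by rewrite -{1}(prednK n_gt0) exprS ler_pM2r// exprn_gt0.
Qed.

Variables (k K th : R) (A : 'rV[R]_n -> exterior R n -> exterior R n).
Hypotheses (n3 : (3 <= n)%N) (k0 : 0 <= k) (kKth : k * K <= th)
  (th1 : th < 1) (bA : bounded_field k A)
  (HK : forall u, tform u -> (FN m%:R (dir 1 u) <= K%:E * FN m%:R (dir (-1) u))%E).

(** Let X be the L^2n norm of D^- (psi^n u) and Y that of psi^(n-1) u. The equation and absorption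
    of th X give X <= tau (dl + C1 Y); X is finite because u is a test form. Morrey turns Y into Y^n
    <= (D X)^(n-1) L, and Y cancels. The constant depends on psi but not on u. *)
Lemma apriori (psi : 'rV[R]_n -> R) : csmooth psi -> (forall x, 0 <= psi x <= 1) ->
  exists2 c1, 0 < c1 & forall u h (dl L : R), tform u -> mform h -> (forall x, psi x *: h x = 0) ->
  0 <= dl -> 0 <= L -> (FN m%:R (residual A h u) <= dl%:E)%E ->
  (FN 2 (restr [set x | psi x != 0]%R u) <= L%:E)%E ->
  (FN m%:R (dir (-1) (fun x => psi x ^+ n *: u x)%R) <= (c1 * (dl + L))%:E)%E.
Proof.
move=> cpsi psi01; have m_gt0 : (0 < m)%N by rewrite muln_gt0.
have n1 : (1 < n)%N by exact: leq_trans n3.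
have [_ [r psir]] := cpsi; pose r' := `|r| + 1; have r'0 : 0 < r' by rewrite ltr_wpDl.
have N1 : (-1) * (-1) = 1 :> R by rewrite mulN1r opprK.
have [D D0 hD] := morrey_sup n_gt0 N1 r'0.
have [C C0 hC] : exists2 C, 0 < C & forall j x, `|partial j psi x| <= C.
  have [f hf] := choice (fun j => let: ex_intro2 l a b := csmooth_bounded (csmooth_partial j cpsi) in
    ex_intro (fun l => 0 < l /\ forall x, `|partial j psi x| <= l) l (conj a b)).
  exists (\sum_j f j + 1) => [|j x]; first by rewrite ltr_wpDl// sumr_ge0// => j _; exact: ltW (hf j).1.
  apply: le_trans ((hf j).2 x) _; rewrite (bigD1 j)//= -addrA lerDl addr_ge0// sumr_ge0// => i _.
  exact: ltW (hf i).1.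
have [lA mA eA] := bA.
(* n directions, the factor n from differentiating psi^n, the bound C on the derivatives of psi, and
   1 + k because the commutator enters through D^- and through A D^+. *)
have [C1 C1E] : exists C1, C1 = n%:R * (n%:R * C) * (1 + k) by eexists.
have nR : 0 < n%:R :> R by rewrite ltr0n.
have C10 : 0 < C1 by rewrite C1E !mulr_gt0// ltr_pwDl.
have [tau tauE] : exists tau, tau = (1 - th)^-1 by eexists.
have tau0 : 0 < tau by rewrite tauE invr_gt0 subr_gt0.
have [c cE] : exists c, c = 2 * C1 * tau by eexists.
have c0 : 0 < c by rewrite cE !mulr_gt0.
exists (2 * tau + c * (D * c) ^+ n.-1) => [|u h dl L tu mh psih dl0 L0 hres hL].
  rewrite addr_gt0 ?mulr_gt0// exprn_gt0// mulr_gt0//.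
pose w : form := fun x => psi x ^+ n *: u x.
have spn := smoothX n cpsi.1.
have tw : tform w by exact: (tformM spn tu).
have su := tform_sform tu.
pose g d : form := fun x => \sum_j (n%:R * psi x ^+ n.-1 * partial j psi x) *: clif d j (u x).
have dw d x : dir d w x = g d x + psi x ^+ n *: dir d u x.
  rewrite (dirM _ _ spn su); congr (_ + _); apply: eq_bigr => j _.
  by congr (_ *: _); rewrite (partialX _ _ _ cpsi.1).
pose y : form := fun x => psi x ^+ n.-1 *: u x.
have ty : tform y by exact: (tformM (smoothX _ cpsi.1) tu).
have eg d x : d * d = 1 -> enorm (g d x) <= n%:R * (n%:R * C) * enorm (y x).
  move=> d2; apply: le_trans (enorm_sum _ _ _) _.
  apply: (@le_trans _ _ (\sum_(j < n) (n%:R * C * enorm (y x)))).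
    apply: ler_sum => j _; rewrite enormZ (enorm_clif _ _ d2) /y enormZ !normrM normr_nat.
    rewrite mulrA ler_wpM2r ?enorm_ge0// mulrAC ler_wpM2r// ler_wpM2l//.
  by rewrite sumr_const card_ord -[leLHS]mulr_natl mulrA.
have mdw d := tform_mform (tform_dir d tw).
have pt x : enorm (dir (-1) w x - A x (dir 1 w x)) <= enorm (residual A h u x) + C1 * enorm (y x).
  have AZ (a : R) (v : exterior R n) : A x (a *: v) = a *: A x v.
    have := lA x a v 0; rewrite addr0 => ->.
    have -> : A x 0 = 0 by have := lA x (-1) 0 0; rewrite scaler0 add0r scaleN1r addNr.
    by rewrite addr0.
  have AD (v v' : exterior R n) : A x (v + v') = A x v + A x v'.
    by have := lA x 1 v v'; rewrite !scale1r.
  rewrite !dw AD AZ.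
  (* Since psi h = 0, multiplying the residual by psi^n removes the datum: what remains is the
     commutator and the small residual. *)
  have -> : g (-1) x + psi x ^+ n *: dir (-1) u x - (A x (g 1 x) + psi x ^+ n *: A x (dir 1 u x)) =
      (g (-1) x - A x (g 1 x)) - psi x ^+ n *: residual A h u x.
    have -> : psi x ^+ n *: residual A h u x = - (psi x ^+ n *: (dir (-1) u x - A x (dir 1 u x))).
      rewrite /residual [in LHS]scalerBr; have -> : psi x ^+ n *: h x = 0.
        have pS : psi x ^+ n = psi x ^+ n.-1 * psi x by rewrite -exprSr prednK.
        by rewrite pS -scalerA psih scaler0.
      by rewrite sub0r.
    rewrite opprK scalerBr.
    move: (g (-1) x) (psi x ^+ n *: dir (-1) u x) (A x (g 1 x)) (psi x ^+ n *: A x (dir 1 u x)).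
    by move=> a1 a2 a3 a4; rewrite opprD addrACA.
  apply: le_trans (enormB _ _) _; rewrite addrC; apply: lerD.
    have /andP[p0 p1] := psi01 x; rewrite enormZ ger0_norm ?exprn_ge0//.
    by rewrite ler_piMl ?enorm_ge0// exprn_ile1.
  apply: le_trans (enormB _ _) _; rewrite C1E mulrDr mulr1 mulrDl; apply: lerD; first exact: eg.
  apply: le_trans (eA _ _) _; rewrite [_ * k]mulrC -mulrA ler_wpM2l//.
  by apply: eg; rewrite mulr1.
have mR : mform (residual A h u).
  exact: (mformB mh (mformB (tform_mform (tform_dir (-1) tu)) (mA _ (tform_mform (tform_dir 1 tu))))).
have p1 : 1 <= m%:R :> R by rewrite ler1n.
have p0 : 0 < m%:R :> R by rewrite ltr0n.
have my := tform_mform ty; have mAd := mA _ (mdw 1).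
have mdA : mform (fun x => dir (-1) w x - A x (dir 1 w x)) by exact: (mformB (mdw (-1)) mAd).
have fin v : tform v -> (FN m%:R v \is a fin_num)%E.
  by move=> tv; have := tform_FN m_gt0 tv; rewrite ge0_fin_numE// FN_ge0.
pose X := fine (FN m%:R (dir (-1) w)); pose Y := fine (FN m%:R y).
have XE : FN m%:R (dir (-1) w) = X%:E by rewrite fineK// fin//; exact: tform_dir.
have YE : FN m%:R y = Y%:E by rewrite fineK// fin.
have X0 : 0 <= X by apply: fine_ge0; exact: FN_ge0.
have Y0 : 0 <= Y by apply: fine_ge0; exact: FN_ge0.
have step1 : (FN m%:R (fun x => dir (-1) w x - A x (dir 1 w x))%R <= (dl + C1 * Y)%:E)%E.
  have mEr := measurable_enorm mR; have mEy := measurable_enorm my.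
  have mcy : measurable_fun setT (fun x => C1 * enorm (y x)) by exact: measurable_funM.
  apply: (@le_trans _ _ (NL m%:R (fun x => enorm (residual A h u x) + C1 * enorm (y x))%R)).
    apply: NL_mono => //; [exact: measurable_enorm|exact: measurable_funD|].
    move=> x; rewrite !ger0_norm ?enorm_ge0 ?addr_ge0 ?mulr_ge0 ?enorm_ge0 ?(ltW C10)//.
  apply: le_trans (NL_triangle p1 mEr mcy) _; rewrite EFinD; apply: leeD; first exact: hres.
  by rewrite (NLZ _ p0 mEy) (gtr0_norm C10) -/(FN _ _) YE -EFinM.
have step2 : X <= dl + C1 * Y + th * X.
  rewrite -lee_fin -XE EFinD.
  have := FN_triangle p1 mdA mAd.
  have -> : (fun x => dir (-1) w x - A x (dir 1 w x) + A x (dir 1 w x)) = dir (-1) w.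
    by apply/funext => x; rewrite subrK.
  move=> /le_trans; apply; apply: leeD step1 _.
  apply: le_trans (FN_mono p0 k0 mAd (mdw 1) (fun x => eA x _)) _.
  apply: (@le_trans _ _ (k%:E * (K%:E * FN m%:R (dir (-1) w)))%E).
    by apply: lee_wpmul2l; [rewrite lee_fin|exact: HK].
  by rewrite muleA -EFinM XE -EFinM lee_fin ler_wpM2r.
have step3 : X <= tau * (dl + C1 * Y).
  by rewrite tauE mulrC ler_pdivlMr ?subr_gt0// mulrBr mulr1 [X * th]mulrC lerBlDr.
rewrite -/w XE lee_fin.
have cD0 : 0 <= c * (D * c) ^+ n.-1 by exact: mulr_ge0 (ltW c0) (exprn_ge0 _ (ltW (mulr_gt0 D0 c0))).
have tau2 : 0 <= 2 * tau := mulr_ge0 (ler0n R 2) (ltW tau0).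
(* Either the residual dominates and the estimate is linear, or the commutator does, so that X <= c
   Y and the power argument applies. *)
have [CY|CY] := leP (C1 * Y) dl.
  apply: le_trans step3 _; apply: (@le_trans _ _ (tau * (dl + dl))).
    by rewrite ler_wpM2l ?(ltW tau0)// lerD2l.
  apply: (@le_trans _ _ (2 * tau * dl)); first by rewrite le_eqVlt; apply/orP; left; apply/eqP; ring.
  by apply: ler_pM => //; rewrite lerDl.
have XY : X <= c * Y.
  apply: le_trans step3 _; rewrite cE; apply: (@le_trans _ _ (tau * (C1 * Y + C1 * Y))).
    by rewrite ler_wpM2l ?(ltW tau0)// lerD2r ltW.
  by rewrite le_eqVlt; apply/orP; left; apply/eqP; ring.
have [X00|Xn0] := eqVneq X 0.
  by rewrite X00; exact: mulr_ge0 (addr_ge0 tau2 cD0) (addr_ge0 dl0 L0).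
have Xp : 0 < X by rewrite lt_def Xn0.
have wX x : enorm (w x) <= D * X.
  apply: hD => //; first by rewrite XE.
  move=> z rz; rewrite /w psir ?expr0n ?gtn_eqF ?scale0r//.
  by apply: le_lt_trans rz; rewrite /r' (le_trans (ler_norm r))// lerDl.
have oS : open [set x | psi x != 0].
  have := (smooth_continuous cpsi.1); move/continuousP => /(_ [set t | t != 0]).
  by apply; exact: open_neq.
have mS := open_measurable_rV oS.
have mSu := mform_restrT mS (tform_mform tu).
have [iS leS] := (@FN_leP R n 2 _ L isT L0 mSu).1 hL.
have DX0 : 0 <= D * X := mulr_ge0 (ltW D0) X0.
(* The identity |psi^(n-1) u|^(2n) = |psi^n u|^(2(n-1)) |u|^2, followed by the supremum bound on the
   first factor. *)
have ptY x : enorm (y x) ^+ m <= (D * X) ^+ (n.-1 * 2) * enorm (restr [set x | psi x != 0] u x) ^+ 2.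
  have [px|px] := eqVneq (psi x) 0.
    have n10 : (n.-1 == 0)%N = false by case: (n) n1 => [|[]].
    rewrite /y px expr0n n10 scale0r enorm0 expr0n gtn_eqF//=.
    by rewrite mulr_ge0 ?exprn_ge0 ?enorm_ge0.
  rewrite restr_in//; apply: (@le_trans _ _ (enorm (w x) ^+ (n.-1 * 2) * enorm (u x) ^+ 2)); last first.
    rewrite ler_wpM2r ?exprn_ge0 ?enorm_ge0//; apply: lerXn2r => //; by rewrite nnegrE ?enorm_ge0.
  have /andP[q0 _] := psi01 x.
  rewrite /y /w !enormZ !ger0_norm ?exprn_ge0// !exprMn -!exprM -mulrA -exprD.
  have -> : (n.-1 * 2 + 2 = m)%N by rewrite mulnC -[X in (_ + X)%N]muln1 -mulnDr addn1 prednK.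
  have -> : (n * (n.-1 * 2) = n.-1 * m)%N by rewrite mulnCA [(n * 2)%N]mulnC.
  by [].
have Yn : Y ^+ n <= (D * X) ^+ n.-1 * L.
  have e0 : 0 <= (D * X) ^+ n.-1 * L by rewrite mulr_ge0// exprn_ge0.
  rewrite -(@ler_pXn2r _ 2)// ?nnegrE ?exprn_ge0//.
  rewrite -exprM mulnC -(FN_powE m_gt0 my (tform_FN m_gt0 ty)) exprMn -exprM.
  have iY := (FN_finP m_gt0 my).1 (tform_FN m_gt0 ty).
  apply: le_trans (le_Rintegral _ iY (integrableZR _ iS) (fun x _ => ptY x)) _ => //.
  by rewrite RintegralZl// ler_wpM2l// exprn_ge0.
apply: le_trans (young_power X0 Y0 D0 L0 c0 XY Yn) _.
by rewrite mulrA; apply: ler_pM => //; rewrite lerDr.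
Qed.

End apriori.

(** * Neighbourhoods of compact sets and cutoff functions *)

Section cutoffs.
Context {R : realType} {n : nat}.
Notation mu := (@lebesgue_rV R n).
Implicit Types (x y : 'rV[R]_n) (K U : set 'rV[R]_n).

Lemma compact_cball_subset K U : compact K -> open U -> K `<=` U ->
  exists2 d : R, 0 < d & forall x y, K x -> `|x - y| <= d -> U y.
Proof.
move=> /compact_near_coveringP cK oU KU.
have : \forall d \near (0 : R)^'+, K `<=` [set x | forall y, `|x - y| <= d -> U y].
  apply: cK => x /KU Ux; have /nbhs_ballP[e /= e0 eU] := open_nbhs_nbhs (conj oU Ux).
  have e20 : 0 < e / 2 by rewrite divr_gt0.
  exists (ball x (e / 2), [set d | d < e / 2]) => /=.
    split; first exact: nbhsx_ballx.
    exact: nbhs_right_lt.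
  move=> [x' d] /= [xx' de] y x'y; apply: eU.
  move: xx'; rewrite -!ball_normE /= => xx'.
  rewrite -(subrKA x') (le_lt_trans (ler_normD _ _))// [ltRHS]splitr ltrD//.
  exact: le_lt_trans de.
have h0 : \forall d \near (0 : R)^'+, 0 < d by exact: nbhs_right_gt.
move=> h; have [d [d0 dK]] := filter_ex (filterI h0 h).
by exists d => // x y Kx; exact: dK.
Qed.

Lemma bounded_norm_le K : bounded_set K -> exists r : R, forall x, K x -> `|x| <= r.
Proof.
by move=> [r [_ hr]]; exists (r + 1) => x Kx; apply: hr => //; rewrite ltrDl.
Qed.

Hypothesis n_gt0 : (0 < n)%N.

(** Mollify, at scale rho, the indicator of the 2 rho-neighbourhood: the value is exactly 1 on the
    rho-neighbourhood and 0 off the 3 rho-neighbourhood. *)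
Lemma cutoff K (r0 rho : R) : (forall x, K x -> `|x| <= r0) -> 0 < rho ->
  exists psi : 'rV[R]_n -> R, [/\ csmooth psi, forall x, 0 <= psi x <= 1,
    forall x a, K a -> `|x - a| < rho -> psi x = 1
  & forall x, psi x != 0 -> exists2 a, K a & `|x - a| < 3 * rho].
Proof.
move=> Kr rho0; pose B := \bigcup_(a in K) ball a (2 * rho).
have oB : open B by apply: bigcup_open => a _; apply: ball_open; exact: mulr_gt0.
have mB := open_measurable_rV oB.
have BP y : B y <-> exists2 a, K a & `|y - a| < 2 * rho.
  split=> [[a Ka]|[a Ka h]]; last by exists a => //; rewrite -ball_normE/= distrC.
  by rewrite -ball_normE/= distrC => h; exists a.
pose f : 'rV[R]_n -> R := \1_B.
have mf : measurable_fun setT f by exact: measurable_indic.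
(* Centred at 1/2, so that one application of [conv_molli_near] yields both bounds 0 and 1. *)
have f01 y : `|f y - 2^-1| <= 2^-1.
  by rewrite /f indicE; case: (y \in B); rewrite ler_norml/=; lra.
have f1 y : `|f y| <= 1 by rewrite /f indicE; case: (y \in B); rewrite ?normr1 ?normr0.
have fr y : r0 + 2 * rho < `|y| -> f y = 0.
  move=> ry; rewrite /f indicE memNset// => /BP[a /Kr ar ya].
  by have := ler_normD (y - a) a; rewrite subrK; lra.
have iF := integrable_bounded_support mf f1 fr.
have cm := csmooth_molli (n := n) rho0.
exists (convol (molli rho) f); split.
- exact: (csmooth_conv cm iF fr).
- move=> x; have := conv_molli_near n_gt0 (x := x) rho0 iF (fun y _ => f01 y).
  by rewrite ler_norml => /andP[h1 h2]; apply/andP; split; lra.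
- move=> x a Ka xa; apply/eqP; rewrite -subr_eq0 -normr_eq0 eq_le normr_ge0 andbT.
  apply: (conv_molli_near n_gt0 rho0 iF) => y xy.
  rewrite /f indicE mem_set ?subrr ?normr0//; apply/BP; exists a => //.
  by have := ler_normD (y - x) (x - a); rewrite subrKA [`|y - x|]distrC; lra.
- move=> x; apply: contraNP => /forall2NP h; apply/eqP.
  suff H : forall y, `|x - y| <= rho -> `|f y - 0| <= 0.
    have := conv_molli_near n_gt0 (x := x) (a := 0) (e := 0) rho0 iF H.
    by rewrite subr0 normr_le0 => /eqP.
  move=> y xy; rewrite subr0 /f indicE memNset ?normr0// => /BP[a Ka ya].
  case: (h a) => // ; apply; have := ler_normD (x - y) (y - a); rewrite subrKA; lra.
Qed.

End cutoffs.

(** * Interior regularity *)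

Section hoelder_representative.
Context {R : realType} {n : nat}.
Notation mu := (@lebesgue_rV R n).
Notation form := ('rV[R]_n -> exterior R n).
Notation L1 g := (mu.-integrable setT (EFin \o g)).
Implicit Types (f F : form) (x y : 'rV[R]_n) (K Omega : set 'rV[R]_n) (I : {set 'I_n}).
Hypothesis n_gt0 : (0 < n)%N.

(** Hoelder continuity stated for mollifications. It makes sense for a function known only almost
    everywhere, is preserved by approximation at fixed scales, and contains the Cauchy property as
    the scales tend to 0. *)
Definition molli_hoelder F K := exists C rho : R, [/\ 0 <= C, 0 < rho &
  forall x y t s, K x -> K y -> 0 < t <= rho -> 0 < s <= rho ->
    enorm (fconv (molli t) F x - fconv (molli s) F y) <=
    C * (Num.sqrt t + Num.sqrt s + Num.sqrt `|x - y|)].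

Lemma sqrt_small (C e : R) : 0 <= C -> 0 < e -> exists2 d, 0 < d &
  forall t, 0 < t -> t <= d -> C * Num.sqrt t <= e.
Proof.
move=> C0 e0; have C1 : 0 < C + 1 by rewrite ltr_wpDl.
exists ((e / (C + 1)) ^+ 2) => [|t t0 td]; first by rewrite exprn_gt0// divr_gt0.
have : Num.sqrt t <= e / (C + 1).
  by rewrite -[leRHS]ger0_norm ?divr_ge0 ?(ltW e0) ?(ltW C1)// -sqrtr_sqr ler_wsqrtr.
move=> h; apply: (@le_trans _ _ ((C + 1) * Num.sqrt t)).
  by rewrite ler_wpM2r ?sqrtr_ge0// lerDl.
by rewrite mulrC -ler_pdivlMr.
Qed.

Lemma molli_hoelder_limit F K : molli_hoelder F K -> exists C rho : R, [/\ 0 <= C, 0 < rho &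
  forall x, K x -> forall I,
   cvgn (fun k => fconv (molli k.+1%:R^-1) F x I : R) /\
   forall t, 0 < t <= rho ->
   `|fconv (molli t) F x I - limn (fun k => fconv (molli k.+1%:R^-1) F x I : R)| <= C * Num.sqrt t].
Proof.
move=> [C [rho [C0 rho0 h]]]; exists C, rho; split=> // x Kx I.
pose a k : R := fconv (molli k.+1%:R^-1) F x I.
have inv0 k : 0 < (k.+1%:R : R)^-1 by rewrite invr_gt0.
have near_small (e : R) : 0 < e -> exists N, forall k, (N <= k)%N -> k.+1%:R^-1 <= rho /\
    C * Num.sqrt k.+1%:R^-1 <= e.
  move=> e0; have [d d0 hd] := sqrt_small C0 e0.
  pose q := Num.min d rho; have q0 : 0 < q by rewrite lt_min d0.
  exists (Num.truncn q^-1) => k Nk.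
  have kq : k.+1%:R^-1 <= q.
    rewrite -[leRHS]invrK lef_pV2 ?posrE ?invr_gt0//.
    apply/ltW; apply: lt_le_trans (truncnS_gt _) _; rewrite ler_nat ltnS//.
  split; first by rewrite (le_trans kq)// ge_min lexx orbT.
  by apply: hd => //; rewrite (le_trans kq)// ge_min lexx.
have dist t s : 0 < t <= rho -> 0 < s <= rho ->
    `|fconv (molli t) F x I - fconv (molli s) F x I| <= C * Num.sqrt t + C * Num.sqrt s.
  move=> ht hs; have := h x x t s Kx Kx ht hs.
  rewrite [x - x]subrr normr0 sqrtr0 addr0 mulrDr => hxx; apply: le_trans _ hxx.
  by have := coord_le_enorm (fconv (molli t) F x - fconv (molli s) F x) I; rewrite -scaleN1r extDE extZE mulN1r.
have ca : cvgn a.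
  apply/cauchy_cvgP/cauchy_exP => e e0 /=.
  have e40 : 0 < e / 4 by rewrite divr_gt0.
  have [N hN] := near_small _ e40.
  exists (a N); exists N => // k /= Nk; rewrite -ball_normE/=.
  have [N1 N2] := hN N (leqnn N); have [k1 k2] := hN k Nk.
  apply: le_lt_trans (dist _ _ _ _) _; rewrite ?inv0//.
  by apply: le_lt_trans (lerD N2 k2) _; lra.
split=> // t ht; apply/ler_addgt0Pr => e e0; have e20 : 0 < e / 2 by rewrite divr_gt0.
have [N hN] := near_small _ e20.
have /cvgrPdist_le/(_ _ e20)[N' _ hN'] : a @ \oo --> limn a by [].
pose k := maxn N N'; have [k1 k2] := hN k (leq_maxl _ _).
have := hN' k (leq_maxr _ _) => /= k3.
rewrite -(subrKA (a k)) (le_trans (ler_normD _ _))//.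
have := dist t k.+1%:R^-1 ht; rewrite inv0 k1 => /(_ isT) k4.
apply: le_trans (lerD k4 _) _; first by rewrite distrC; exact: k3.
rewrite -addrA lerD2l [leRHS]splitr; exact: lerD.
Qed.

(** The points of norm at most k + 1 whose distance to the complement is at least 1/(k+1). *)
Lemma compact_exhaustion Omega : open Omega -> exists K_ : nat -> set 'rV[R]_n,
  [/\ forall k, compact (K_ k), forall k, K_ k `<=` Omega
    & forall x, Omega x -> exists k, K_ k x].
Proof.
move=> oO; pose K_ k := [set x : 'rV[R]_n | `|x| <= k.+1%:R] `&`
  \bigcap_(y in ~` Omega) [set x : 'rV[R]_n | k.+1%:R^-1 <= `|x - y|].
have cl y (c : R) : closed [set x : 'rV[R]_n | c <= `|x - y|].
  apply: (@closed_comp _ _ (fun x : 'rV[R]_n => `|x - y|) [set t : R | c <= t]); last exact: closed_ge.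
  move=> x _; apply: continuous_comp; last exact: norm_continuous.
  by apply: continuousB; [by []|exact: cst_continuous].
exists K_; split.
- move=> k; suff clK : closed (K_ k).
    exact: (subclosed_compact clK (@compact_cball R n k.+1%:R) (fun x h => h.1)).
  apply: closedI; last by apply: closed_bigI => y _; exact: cl.
  by have := @closed_cball R n 0 k.+1%:R; under eq_set do rewrite subr0.
- move=> k x [_ h]; apply: contrapT => Ox; have := h x Ox; rewrite /= subrr normr0.
  by rewrite leNgt invr_gt0 ltr0Sn.
- move=> x Ox; have /nbhs_ballP[e /= e0 eO] := open_nbhs_nbhs (conj oO Ox).
  pose k := maxn (Num.truncn `|x|) (Num.truncn e^-1); exists k; split.
    apply/ltW; apply: lt_le_trans (truncnS_gt _) _; by rewrite ler_nat ltnS leq_maxl.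
  move=> y Oy /=; rewrite leNgt; apply/negP => xy; apply/Oy/eO; rewrite -ball_normE/=.
  apply: (lt_le_trans xy); rewrite -[leRHS]invrK lef_pV2 ?posrE ?invr_gt0//.
  by apply/ltW; apply: lt_le_trans (truncnS_gt _) _; rewrite ler_nat ltnS leq_maxr.
Qed.

(** On each compact subset mollifications are uniformly Cauchy. Their limit agrees with F almost
    everywhere by [ae_molli_limit], and countably many compact sets cover Omega; the Hoelder bound
    passes to the limit. *)
Lemma hoelder_representative F Omega (r : R) : open Omega -> mform F ->
  (forall I, L1 (fun x => coef F I x ^+ 2)) -> (forall x, r < `|x| -> F x = 0) ->
  (forall K, compact K -> K `<=` Omega -> molli_hoelder F K) ->
  exists2 G : form, ae_on Omega (fun x => F x = G x) & locally_hoelder Omega 2^-1 G.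
Proof.
move=> oO mF F2 Fr hK.
(* A single pointwise definition for all compact sets at once; the limit exists at every point of
   Omega. *)
pose G : form := fun x => [ffun I => limn (fun k => fconv (molli k.+1%:R^-1) F x I : R)].
have cr I x : r < `|x| -> coef F I x = 0 by move=> rx; rewrite /coef Fr// ffunE.
have iF : iform F by move=> I; exact: L1_of_L2 (mF I) (F2 I) (cr I).
exists G.
  have [K_ [cK KO OK]] := compact_exhaustion oO.
  have key k I : {ae mu, forall x, K_ k x -> coef F I x = coef G I x}.
    have mK : measurable (K_ k) by apply: closed_measurable_rV; exact: compact_closed (cK k).
    have [C [rho [C0 rho0 h]]] := molli_hoelder_limit (hK _ (cK k) (KO k)).
    have [rK hrK] := bounded_norm_le (compact_bounded (cK k)).
    pose H : 'rV[R]_n -> R := (coef G I) \_ (K_ k).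
    have mfk j : measurable_fun setT (coef (fconv (molli (n := n) (j.+1%:R^-1 : R)) F) I).
      rewrite coef_fconv; apply: smooth_measurable; apply: smooth_conv (iF I).
      by apply: csmooth_molli; rewrite invr_gt0.
    have mG : measurable_fun (K_ k) (coef G I).
      apply: (@measurable_fun_cvg _ _ _ _ (fun j => coef (fconv (molli j.+1%:R^-1) F) I)).
        by move=> j; apply: measurable_funS (mfk j).
      move=> x Kx; rewrite /coef/= ffunE; exact: (h x Kx I).1.
    have mH : measurable_fun setT H by exact: ((measurable_restrictT _ mK).1 mG).
    have := @ae_molli_limit R n n_gt0 (coef F I) H (K_ k) r (`|rK| + 1) (mF I) (F2 I) (cr I) mH mK.
    have hr x : K_ k x -> `|x| <= `|rK| + 1.
      by move=> /hrK /le_trans; apply; rewrite (le_trans (ler_norm rK))// lerDl.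
    have r1 : 0 < `|rK| + 1 by rewrite ltr_wpDl.
    move=> /(_ hr r1) Q; have : {ae mu, forall x, K_ k x -> coef F I x = H x}.
      apply: Q => e e0; have [d d0 hd] := sqrt_small C0 e0.
      exists (Num.min d rho) => [|t t0]; first by rewrite lt_min d0.
      rewrite le_min => /andP[td tr] x Kx; rewrite /H patchE mem_set//.
      have [_ /(_ t)] := h x Kx I; rewrite t0 tr => /(_ isT); rewrite /coef !ffunE.
      by move=> /le_trans; apply; exact: hd.
    by apply: filterS => x hx Kx; rewrite hx// /H patchE mem_set.
  have : {ae mu, forall x, forall k, forall I, K_ k x -> coef F I x = coef G I x}.
    by apply: ae_foralln => k; exact: filter_forall (key k).
  apply: filterS => x hx /OK[k Kx]; apply/ffunP => I; exact: hx Kx.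
move=> K cK KO; have mh := hK K cK KO.
have [C [rho [C0 rho0 h]]] := mh; have [C' [rho' [C'0 rho'0 h']]] := molli_hoelder_limit mh.
exists (C : R) => x y Kx Ky.
(* The passage from the maximum norm to the Euclidean norm. *)
have eu : Num.sqrt `|x - y| <= euclidean_norm (x - y) `^ 2^-1.
  rewrite -powR12_sqrt//; apply: ge0_ler_powR; rewrite ?nnegrE ?invr_ge0 ?sqrtr_ge0//.
  by rewrite -[leLHS]normr_id -sqrtr_sqr ler_wsqrtr// norm_sqn.
apply: (@le_trans _ _ (C * Num.sqrt `|x - y|)); last by rewrite ler_wpM2l.
apply/ler_addgt0Pr => e e0; have e40 : 0 < e / 4 by rewrite divr_gt0.
pose N : R := #|{set 'I_n}|%:R; have N0 : 0 <= N by [].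
have [d1 d10 hd1] := sqrt_small C0 e40.
have [d2 d20 hd2] := sqrt_small (mulr_ge0 N0 C'0) e40.
pose t := Num.min (Num.min d1 d2) (Num.min rho rho').
have t0 : 0 < t by rewrite !lt_min d10 d20 rho0.
have td1 : t <= d1 by rewrite !ge_min lexx.
have td2 : t <= d2 by rewrite !ge_min lexx orbT.
have tr : 0 < t <= rho by rewrite t0 !ge_min lexx !orbT.
have tr' : 0 < t <= rho' by rewrite t0 !ge_min lexx !orbT.
have lim z : K z -> enorm (fconv (molli t) F z - G z) <= e / 4.
  move=> Kz; apply: le_trans (hd2 t t0 td2); apply: le_trans (enorm_le_sum _) _.
  apply: (@le_trans _ _ (\sum_(I : {set 'I_n}) C' * Num.sqrt t)).
    apply: ler_sum => I _; rewrite -scaleN1r extDE extZE mulN1r [G z I]ffunE.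
    exact: ((h' z Kz I).2 t tr').
  by rewrite sumr_const -[leLHS]mulr_natl mulrA.
have := h x y t t Kx Ky tr tr; rewrite mulrDr mulrDr => hxy.
have h1 := hd1 t t0 td1.
have -> : G x - G y = (fconv (molli t) F x - fconv (molli t) F y) - (fconv (molli t) F x - G x)
    + (fconv (molli t) F y - G y).
  rewrite opprB; move: (G x) (G y) (fconv _ F x) (fconv _ F y) => a b a' b'.
  by rewrite [_ + (a - a')]addrC !subrKA.
apply: le_trans (enormD _ _) _; apply: le_trans (lerD (enormB _ _) (lexx _)) _.
apply: le_trans (lerD (lerD hxy (lim x Kx)) (lim y Ky)) _; move: h1.
move: (C * Num.sqrt t) (C * Num.sqrt `|x - y|) => p q; clear => h1.
by rewrite -!addrA [q + _]addrCA; lra.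
Qed.

End hoelder_representative.

Local Transparent convol.

(** * Local consequences of distributional equations *)

Section localisation.
Context {R : realType} {n : nat}.
Notation mu := (@lebesgue_rV R n).
Notation form := ('rV[R]_n -> exterior R n).
Notation L1 g := (mu.-integrable setT (EFin \o g)).
Notation T_ g := (distr_of setT g).
Implicit Types (f u F : form) (x y : 'rV[R]_n) (K Omega : set 'rV[R]_n) (I : {set 'I_n}).

Lemma test_function_near Omega K (phi : 'rV[R]_n -> R) (r d : R) : csmooth phi -> r < d ->
  (forall y, phi y != 0 -> exists2 a, K a & `|y - a| < r) ->
  (forall x y, K x -> `|x - y| <= d -> Omega y) -> test_function Omega phi.
Proof.
move=> cphi rd near KO; have [sphi cpt _] := csmooth_test cphi; split => // z cz.
have d0 : 0 < d - r by rewrite subr_gt0.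
have [y [/= /near[a Ka ya]]] := cz _ (nbhsx_ballx z _ d0).
rewrite -ball_normE/= => zy; apply: (KO a) => //.
have := ler_normD (a - y) (y - z); rewrite subrKA [`|a - y|]distrC [`|y - z|]distrC; lra.
Qed.

Hypothesis n_gt0 : (0 < n)%N.

(** For points of K and scales up to half the distance d, the kernels of [mollify_const] are test
    functions of Omega, so mollifications at all small scales coincide and inherit the Lipschitz
    bound of one of them. *)
Lemma molli_hoelder_const s Omega K F : s != 0 -> open Omega -> compact K -> K `<=` Omega ->
  iform F -> (forall phi, test_function Omega phi -> ddist s (T_ F) phi = 0) ->
  molli_hoelder F K.
Proof.
move=> s0 oO cK KO iF dF; have [d d0 hd] := compact_cball_subset cK oO KO.
have [r Kr] := bounded_norm_le (compact_bounded cK).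
pose rho := d / 2; have rho0 : 0 < rho by rewrite divr_gt0.
have cst t x : K x -> 0 < t <= rho -> fconv (molli t) F x = fconv (molli rho) F x.
  move=> Kx /andP[t0 tr]; apply: (mollify_const s0 t0 rho0 iF) => j; apply: dF.
  have rd : rho < d by rewrite /rho; lra.
  apply: (@test_function_near _ K _ ((rho + d) / 2) d).
  - exact: (csmooth_reflect x (csmooth_dfield j t0 rho0)).
  - lra.
  - move=> y; have [xy|yx] := ltP `|y - x| ((rho + d) / 2); first by exists x.
    by rewrite dfield_out ?eqxx// distrC; lra.
  - exact: hd.
have [L hL] := choice (fun I => let: ex_intro2 l a b := conv_lipschitz (csmooth_molli rho0) (iF I) in
  ex_intro (fun l => 0 < l /\ forall x y, `|convol (molli rho) (coef F I) x - convol (molli rho) (coef F I) y| <= l * `|x - y|) l (conj a b)).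
pose S := \sum_I L I; have S0 : 0 <= S by apply: sumr_ge0 => I _; exact: ltW (hL I).1.
(* Lipschitz implies Hoelder on a set of diameter at most 2|r|: one factor sqrt |x - y| is bounded
   by sqrt (2|r|). *)
exists (S * Num.sqrt (`|r| + `|r|)), rho; split=> //; first by rewrite mulr_ge0// sqrtr_ge0.
move=> x y t t' Kx Ky ht ht'; rewrite (cst t x Kx ht) (cst t' y Ky ht').
apply: (@le_trans _ _ (S * `|x - y|)).
  apply: le_trans (enorm_le_sum _) _; rewrite mulr_suml; apply: ler_sum => I _.
  rewrite -scaleN1r extDE extZE mulN1r !ffunE; exact: (hL I).2.
rewrite -mulrA ler_wpM2l//.
apply: (@le_trans _ _ (Num.sqrt (`|r| + `|r|) * Num.sqrt `|x - y|)); last first.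
  by rewrite ler_wpM2l ?sqrtr_ge0// lerDr addr_ge0 ?sqrtr_ge0.
rewrite -{1}[`|x - y|]sqr_sqrtr// expr2 ler_wpM2r ?sqrtr_ge0// ler_wsqrtr//.
apply: le_trans (ler_normB _ _) (lerD _ _); exact: le_trans (Kr _ _) (ler_norm r).
Qed.

(** The Leibniz rule for D^s (phi F) in mollified form. The equation for F is tested on y -> K(x -
    y) phi(y); the derivative falling on phi gives the commutator, the one falling on K gives D^s of
    the convolution. *)
Lemma dir_fconv_cutoff s Omega (phi K : 'rV[R]_n -> R) F P x : csmooth K -> csmooth phi ->
  iform F -> iform P -> test_function Omega (fun y => K (x - y) * phi y) ->
  (forall phi, test_function Omega phi -> ddist s (T_ F) phi = T_ P phi) ->
  dir s (fconv K (fun y => phi y *: F y)) x =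
  fconv K (fun y => phi y *: P y + \sum_j partial j phi y *: clif s j (F y)) x.
Proof.
move=> cK cphi iF iP tPhi dF.
have iM g f : csmooth g -> iform f -> iform (fun y => g y *: f y).
  move=> cg fi I; rewrite fcoefM; have [C _ gC] := csmooth_bounded cg.
  exact: integrable_bddM (smooth_measurable cg.1) gC (fi I).
have cR := csmooth_reflect x cK; have cp j := csmooth_partial j cphi.
have ic j f : iform f -> iform (fun y => clif s j (f y)).
  by move=> fi I; rewrite coef_clif; exact: integrableZR (fi _).
have iS : iform (fun y => \sum_j partial j phi y *: clif s j (F y)).
  move=> I; rewrite fcoef_sum; apply: integrable_sumR => j _.
  exact: (iM _ _ (cp j) (ic j _ iF) I).
rewrite (fconvDr _ cK (iM _ _ cphi iP) iS).
have TP f : fconv K (fun y => phi y *: f y) x = T_ f (fun y => K (x - y) * phi y).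
  apply/ffunP => I; rewrite !ffunE; apply: eq_Rintegral => y _.
  by rewrite fcoefM mulrA.
rewrite TP -(dF _ tPhi) (fconv_sumr _ _ cK) => [|j _]; last exact: (iM _ _ (cp j) (ic j _ iF)).
rewrite /ddist -big_split/=; apply: eq_bigr => j _.
rewrite (pform_fconv _ _ cK (iM _ _ cphi iF)).
have -> : (fun z => partial j phi z *: clif s j (F z)) = (fun z => clif s j (partial j phi z *: F z)).
  by apply/funext => z; rewrite linearZ.
rewrite (fconv_clif _ _ _ cK (iM _ _ (cp j) iF)).
have D (v w : exterior R n) : clif s j (v + w) = clif s j v + clif s j w by exact: linearD.
rewrite -D; congr clif; apply/ffunP => I.
rewrite -scaleN1r extDE extZE !ffunE mulN1r.
have c1 := csmooth_partial j cK; have i1 := iM _ _ cphi iF; have i2 := iM _ _ (cp j) iF.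
have j1 := integrable_conv x c1 (i1 I); have j2 := integrable_conv x cK (i2 I).
have E y : partial j (fun y => K (x - y) * phi y) y * (F y I : R) =
    K (x - y) * coef (fun y => partial j phi y *: F y) I y -
    partial j K (x - y) * coef (fun y => phi y *: F y) I y.
  rewrite (partialM _ _ cR.1 cphi.1) (partial_reflect _ _ _ cK) !fcoefM /coef.
  by rewrite mulNr addrC mulrDl mulNr !mulrA.
under [X in _ = - X + _]eq_Rintegral do rewrite E.
rewrite RintegralB// opprB.
exact: esym (subrK (convol K (coef (fun y => partial j phi y *: F y) I) x)
  (convol (partial j K) (coef (fun y => phi y *: F y) I) x)).
Qed.

Lemma fconv_molli_cvg f (r e : R) : mform f -> (forall I, L1 (fun x => coef f I x ^+ 2)) ->
  (forall x, r < `|x| -> f x = 0) -> 0 < e -> exists2 d, 0 < d & forall t, 0 < t -> t <= d ->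
  (FN 2 (fun x => fconv (molli t) f x - f x)%R <= e%:E)%E.
Proof.
move=> mf f2 fr e0; pose N : R := #|{set 'I_n}|%:R.
have N0 : 0 < N by rewrite ltr0n; apply/card_gt0P; exists finset.set0.
have eN : 0 < e / N by rewrite divr_gt0.
have cr I x : r < `|x| -> coef f I x = 0 by move=> rx; rewrite /coef fr// ffunE.
have iF : iform f by move=> I; exact: L1_of_L2 (mf I) (f2 I) (cr I).
have [d hd] := choice (fun I => let: ex_intro2 l a b := conv_molli_cvg n_gt0 (mf I) (f2 I) (cr I) eN in
  ex_intro (fun l => 0 < l /\ forall t, 0 < t -> t <= l ->
   (NL 2 (fun x => convol (molli t) (coef f I) x - coef f I x)%R <= (e / N)%:E)%E) l (conj a b)).
pose S := \sum_I (d I)^-1.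
have S0 I : (d I)^-1 <= S.
  by rewrite /S (bigD1 I)//= lerDl; apply: sumr_ge0 => J _; rewrite invr_ge0 ltW// (hd J).1.
have Sp : 0 < S by apply: lt_le_trans (S0 finset.set0); rewrite invr_gt0 (hd _).1.
exists S^-1 => [|t t0 tS]; first by rewrite invr_gt0.
have mD : mform (fun x => fconv (molli t) f x - f x).
  apply: mformB mf => I; rewrite coef_fconv.
  exact: smooth_measurable (smooth_conv (csmooth_molli t0) (iF I)).
have p1 : 1 <= (2 : R) by rewrite ler1n.
apply: le_trans (FN_le_coef p1 mD) _.
apply: (@le_trans _ _ (\sum_(I : {set 'I_n}) (e / N)%:E)%E); last first.
  by rewrite sumEFin lee_fin sumr_const -[leLHS]mulr_natl -/N mulrC divfK// gt_eqF.
apply: lee_sum => I _.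
have -> : coef (fun x => fconv (molli t) f x - f x) I = fun x => convol (molli t) (coef f I) x - coef f I x.
  by apply/funext => x; rewrite /coef -scaleN1r extDE extZE mulN1r ffunE.
apply: (hd I).2 => //; apply: (le_trans tS).
by rewrite -[leRHS]invrK lef_pV2 ?posrE ?invr_gt0 ?(hd I).1.
Qed.

(** At a fixed scale, L^2 smallness is uniform smallness, by [sqr_conv_molli] and boundedness of the
    kernel. The factor 1 + B avoids a root, as B <= (1 + B)^2. *)
Lemma fconv_molli_L2 (t : R) : 0 < t -> exists2 D, 0 < D & forall f (e : R) x, iform f -> 0 <= e ->
  (FN 2 f <= e%:E)%E -> enorm (fconv (molli t) f x) <= D * e.
Proof.
move=> t0; have [B B0 hB] := csmooth_bounded (@csmooth_molli R n t t0).
pose N : R := #|{set 'I_n}|%:R.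
have N0 : 0 < N by rewrite ltr0n; apply/card_gt0P; exists finset.set0.
exists (N * (1 + B)) => [|f e x iF e0 fe]; first by rewrite mulr_gt0// addr_gt0.
have mf := iform_mform iF; have [i2 le2] := (@FN_leP R n 2 f e isT e0 mf).1 fe.
apply: le_trans (enorm_le_sum _) _; apply: (@le_trans _ _ (\sum_(I : {set 'I_n}) (1 + B) * e)).
  apply: ler_sum => I _; rewrite ffunE.
  have B1 : 0 <= (1 + B) * e by rewrite mulr_ge0// addr_ge0// ltW.
  rewrite -(@ler_pXn2r _ 2)// ?nnegrE// real_normK ?num_real//.
  have := sqr_conv_molli n_gt0 x t0 (iF I); rewrite -lee_fin => /le_trans; apply.
  apply: (@le_trans _ _ (\int[mu]_y (B * enorm (f y) ^+ 2)%:E)%E).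
    apply: ge0_le_integral => //.
    - by move=> y _; rewrite lee_fin mulr_ge0 ?sqr_ge0// molli_ge0.
    - apply/measurable_EFinP; apply: measurable_funM.
        exact: smooth_measurable (csmooth_reflect x (csmooth_molli t0)).1.
      exact: measurable_funX (mf I).
    - apply/measurable_EFinP; apply: measurable_funM => //.
      exact: measurable_funX (measurable_enorm mf).
    - move=> y _; rewrite lee_fin; apply: ler_pM; rewrite ?sqr_ge0 ?molli_ge0//.
        by have := hB (x - y); rewrite ger0_norm// molli_ge0.
      rewrite -real_normK ?num_real//; apply: lerXn2r; rewrite ?nnegrE ?enorm_ge0//.
      exact: coord_le_enorm.
  have iB : L1 (fun y => B * enorm (f y) ^+ 2) by exact: integrableZR.
  rewrite -(fineK (integrable_fin_num measurableT iB)) lee_fin.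
  rewrite -/(Rintegral mu setT (fun y => B * enorm (f y) ^+ 2)) RintegralZl//.
  apply: le_trans (ler_wpM2l (ltW B0) le2) _; rewrite exprMn ler_wpM2r ?sqr_ge0//.
  by clear -B0; nra.
by rewrite sumr_const -[leLHS]mulr_natl mulrA.
Qed.

End localisation.

(** * Approximating the localised solution by test forms *)

Section main_estimate.
Context {R : realType} {n : nat}.
Notation mu := (@lebesgue_rV R n).
Notation form := ('rV[R]_n -> exterior R n).
Notation L1 g := (mu.-integrable setT (EFin \o g)).
Notation T_ g := (distr_of setT g).
Notation m := (2 * n)%N.
Implicit Types (f u F P Q : form) (x y : 'rV[R]_n) (I : {set 'I_n}).
Variables (k K th : R) (A : 'rV[R]_n -> exterior R n -> exterior R n).
Hypotheses (n3 : (3 <= n)%N) (k0 : 0 <= k) (kth : k <= th) (kKth : k * K <= th)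
  (th1 : th < 1) (bA : bounded_field k A)
  (HK : forall u, tform u -> (FN m%:R (dir 1 u) <= K%:E * FN m%:R (dir (-1) u))%E).

Let n_gt0 : (0 < n)%N. Proof. exact: leq_trans n3. Qed.
Let m_gt1 : (1 < m)%N. Proof. by case: (n) n3 => // j _; rewrite mul2n doubleS. Qed.

Definition square_integrable f := mform f /\ (FN 2 f < +oo)%E.

Definition bounded_support f := exists r : R, forall x, r < `|x| -> f x = 0.

Lemma coef_L2 f I : square_integrable f -> L1 (fun x => coef f I x ^+ 2).
Proof.
move=> [mf ff]; have iE := (@FN_finP R n 2 _ isT mf).1 ff.
apply: le_integrable iE => //; first by apply/measurable_EFinP; exact: measurable_funX (mf I).
move=> x _ /=; rewrite lee_fin !ger0_norm ?sqr_ge0// -real_normK ?num_real//.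
apply: lerXn2r; rewrite ?nnegrE ?enorm_ge0//; exact: coord_le_enorm.
Qed.

Lemma L2_iform f : square_integrable f -> bounded_support f -> iform f.
Proof.
move=> sf [r fr] I; apply: (L1_of_L2 (r := r)) (coef_L2 I sf) _; first exact: sf.1.
by move=> x rx; rewrite /coef fr// ffunE.
Qed.

Lemma square_integrableD f u : square_integrable f -> square_integrable u ->
  square_integrable (fun x => f x + u x).
Proof.
move=> [mf ff] [mu_ fu]; split; first exact: mformD.
by apply: le_lt_trans (FN_triangle _ mf mu_) _; rewrite ?ler1n// lte_add_pinfty.
Qed.

Lemma square_integrable_le (c : R) f u : 0 <= c -> mform f -> square_integrable u ->
  (forall x, enorm (f x) <= c * enorm (u x)) -> square_integrable f.
Proof.
move=> c0 mf [mu_ fu] h; split=> //.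
apply: le_lt_trans (FN_mono _ c0 mf mu_ h) _ => //.
by rewrite lte_mul_pinfty// lee_fin.
Qed.

Lemma square_integrable_sum (J : Type) (r : seq J) (F : J -> form) :
  (forall j, square_integrable (F j)) -> square_integrable (fun x => \sum_(j <- r) F j x).
Proof.
move=> h; elim: r => [|j r IH].
  have -> : (fun x => \sum_(j <- [::]) F j x) = fun=> 0 :> exterior R n by apply/funext => x; rewrite big_nil.
  have t0 := @tform0 R n; split; [exact: tform_mform|exact: (@tform_FN R n 2)].
have -> : (fun x => \sum_(i <- j :: r) F i x) = fun x => F j x + \sum_(i <- r) F i x.
  by apply/funext => x; rewrite big_cons.
exact: square_integrableD.
Qed.

(** Cut f down to the points of Z where |f| <= j: it becomes bounded, still vanishes off Z, and
    converges in L^2 as j grows. *)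
Lemma truncation f (Z : set 'rV[R]_n) (e : R) : square_integrable f -> bounded_support f ->
  measurable Z -> {ae mu, forall x, ~ Z x -> f x = 0} -> 0 < e ->
  exists h, [/\ bounded_form h, forall x, ~ Z x -> h x = 0 &
    (FN 2 (fun x => f x - h x)%R <= e%:E)%E].
Proof.
move=> sf [r fr] mZ Zf e0; have [mf ff] := sf.
pose S j := Z `&` [set x | enorm (f x) <= j%:R].
have mS j : measurable (S j).
  apply: measurableI => //.
  have mm : measurable_fun setT (fun x => enorm (f x)) := measurable_enorm mf.
  have mI : measurable [set t : measurableTypeR R | t <= j%:R].
    exact: (@measurable_itv R `]-oo, j%:R]).
  by have := mm measurableT _ mI; rewrite setTI.
pose h j := restr (S j) f.
have mh j : mform (h j) by exact: (mform_restrT (mS j) mf).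
(* A scalar sequence whose distance to |f| on Z is exactly the pointwise error, so that the
   dominated convergence lemma for scalar functions applies. *)
pose g j x := enorm (restr Z f x) - enorm (restr Z f x - h j x).
have mZf := mform_restrT mZ mf.
have mE := measurable_enorm mZf.
have mg j : measurable_fun setT (g j).
  by apply: measurable_funB => //; exact: measurable_enorm (mformB mZf (mh j)).
have E j x : restr Z f x - h j x = 0 \/ h j x = 0.
  have [Sx|Sx] := pselect (S j x); last by right; rewrite /h restr_out.
  by left; rewrite /h !restr_in ?subrr//; case: Sx.
have gE j x : `|enorm (restr Z f x) - g j x| <= enorm (f x).
  rewrite /g subKr ger0_norm ?enorm_ge0//.
  case: (E j x) => ->; first by rewrite enorm0 enorm_ge0.
  by rewrite subr0 enorm_restr.
have iE := (@FN_finP R n 2 _ isT mf).1 ff.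
have cg x : g j x @[j --> \oo] --> enorm (restr Z f x).
  apply: cvg_near_cst; exists (Num.truncn (enorm (f x))).+1 => // j /= hj.
  rewrite /g; suff -> : restr Z f x - h j x = 0 by rewrite enorm0 subr0.
  have [Zx|Zx] := pselect (Z x); last first.
    by rewrite /h !restr_out ?subrr// => -[].
  rewrite /h !restr_in ?subrr//; split=> //=.
  by apply/ltW; apply: lt_le_trans (truncnS_gt _) _; rewrite ler_nat.
have [j hj] := NL2_dominated e0 mg mE cg gE iE.
exists (h j); split.
- split; first exact: mh.
    exists j%:R => x; have [Sx|Sx] := pselect (S j x).
      by rewrite /h restr_in//; case: Sx.
    by rewrite /h restr_out// enorm0.
  exists r => x /fr fx; have [Sx|Sx] := pselect (S j x); last by rewrite /h restr_out.
  by rewrite /h restr_in.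
- by move=> x Zx; rewrite /h restr_out// => -[].
- apply: le_trans hj; rewrite -[leRHS]mul1e.
  have mfh := mformB mf (mh j).
  have mg' : measurable_fun setT (fun x => enorm (restr Z f x) - g j x) by exact: measurable_funB.
  rewrite mul1e; apply: NL_mono_ae => //; first exact: measurable_enorm.
  apply: filterS Zf => x hx; rewrite /g subKr; suff -> : restr Z f x = f x by [].
  have [Zx|Zx] := pselect (Z x); first by rewrite restr_in.
  by rewrite restr_out// hx.
Qed.

Lemma restr_FN p D f : 0 < p -> measurable D -> mform f -> (FN p (restr D f) <= FN p f)%E.
Proof.
move=> p0 mD mf; rewrite -[leRHS]mul1e; apply: FN_mono => //; first exact: mform_restrT.
by move=> x; rewrite mul1r; exact: enorm_restr.
Qed.

(* [G] is the localised solution; [Pm], [Pp] represent D^- G and D^+ G. *)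
Lemma regular_approximation (G Pm Pp : form) (psi : 'rV[R]_n -> R) : square_integrable G ->
  bounded_support G -> square_integrable Pm -> bounded_support Pm -> square_integrable Pp ->
  bounded_support Pp ->
  (exists2 t1 : R, 0 < t1 & forall t, 0 < t -> t <= t1 ->
     dir (-1) (fconv (molli t) G) = fconv (molli t) Pm /\ dir 1 (fconv (molli t) G) = fconv (molli t) Pp) ->
  csmooth psi -> (forall x, 0 <= psi x <= 1) ->
  {ae mu, forall x, psi x != 0 -> Pm x = A x (Pp x)} ->
  exists2 C, 0 < C & forall (r e : R), 0 < r -> 0 < e -> exists2 u, tform u &
    (FN m%:R (dir (-1) (fun x => psi x ^+ n *: u x)%R) <= C%:E)%E /\
    (FN 2 (restr (cball r) (fun x => G x - u x)%R) <= e%:E)%E.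
Proof.
move=> sG bG sm bm sp bp [t1 t10 comm] cpsi psi01 eqP0.
have p12 : 1 <= (2 : R) by rewrite ler1n.
have p2 : 0 < (2 : R) by [].
have N1 : (-1) * (-1) = 1 :> R by rewrite mulN1r opprK.
have [lA mA eA] := bA.
(* The defect caused by the cutoff. It vanishes where psi does not, but is only square integrable,
   so the Neumann series is applied to a truncation of it. *)
pose h x := Pm x - A x (Pp x).
have mh : mform h by exact: (mformB sm.1 (mA _ sp.1)).
have sh : square_integrable h.
  split=> //; apply: le_lt_trans (FN_triangleB p12 sm.1 (mA _ sp.1)) _.
  rewrite lte_add_pinfty ?sm.2//.
  by have [] := square_integrable_le k0 (mA _ sp.1) sp (fun x => eA x _).
have A0 x : A x 0 = 0 by have := lA x (-1) 0 0; rewrite scaler0 add0r scaleN1r addNr.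
have AB x (v w : exterior R n) : A x (v - w) = A x v - A x w.
  by have := lA x (-1) w v; rewrite !scaleN1r => hl; rewrite [v - w]addrC hl addrC.
have bh : bounded_support h.
  have [r1 h1] := bm; have [r2 h2] := bp; exists (Num.max r1 r2) => x.
  by rewrite gt_max => /andP[x1 x2]; rewrite /h h1// h2// A0 subr0.
pose Z := [set x | psi x = 0].
have mZ : measurable Z.
  apply: closed_measurable_rV; apply: (@closed_comp _ _ psi [set 0 : R]); last exact: closed_eq.
  by move=> x _; exact: smooth_continuous cpsi.1 x.
have hZ : {ae mu, forall x, ~ Z x -> h x = 0}.
  by apply: filterS eqP0 => x hx /eqP/hx e; rewrite /h e subrr.
have [c1 c10 hc1] := apriori n_gt0 n3 k0 kKth th1 bA HK cpsi psi01.
have [rp hrp] := cpsi.2.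
pose NG := fine (FN 2 G); have NG0 : 0 <= NG by apply: fine_ge0; exact: FN_ge0.
have NGE : FN 2 G = NG%:E by rewrite fineK// ge0_fin_numE ?sG.2//; exact: FN_ge0.
have C0 : 0 < c1 * (1 + (1 + NG)) by rewrite mulr_gt0// ltr_pwDl// addr_ge0.
exists (c1 * (1 + (1 + NG))) => // r e r0 e0.
(* Large enough for the prescribed ball and for the support of psi. *)
pose r' := r + `|rp|; have r'0 : 0 < r' by rewrite ltr_pwDl.
have [H H0 hH] := hardy_ball n3 N1 r'0.
have k1 : 0 < 1 - k by rewrite subr_gt0; exact: le_lt_trans th1.
have HH : 0 <= H * 4 / (1 - k) by rewrite divr_ge0 ?(ltW k1)// mulr_ge0// ltW.
have c0 : 0 < 1 + H * 4 / (1 - k) by rewrite ltr_pwDl.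
(* e1 (1 + 4H / (1 - k)) will bound G - u on the ball of radius r'. The bound by e is the required
   accuracy; the bounds by 1 keep the final constant independent of r and e. *)
have [e1 [e10 e11 e1e]] : exists e1, [/\ 0 < e1, e1 <= 1, e1 * (1 + H * 4 / (1 - k)) <= e &
    e1 * (1 + H * 4 / (1 - k)) <= 1].
  exists (Num.min 1 (Num.min 1 e / (1 + H * 4 / (1 - k)))).
  have q0 : 0 < Num.min 1 e by rewrite lt_min ltr01.
  split.
  - by rewrite lt_min ltr01 divr_gt0.
  - by rewrite ge_min lexx.
  - rewrite -ler_pdivlMr// ge_min; apply/orP; right.
    by rewrite ler_wpM2r ?invr_ge0 ?(ltW c0)// ge_min lexx orbT.
  - rewrite -ler_pdivlMr// ge_min; apply/orP; right.
    by rewrite ler_wpM2r ?invr_ge0 ?(ltW c0)// ge_min lexx.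
move=> e12.
have [h' [bh' h'Z hh']] := truncation sh bh mZ hZ e10.
have [u tu [u2 um]] := residual_small n_gt0 m_gt1 k0 kth kKth th1 bA HK bh' e10.
have [rG hG] := bG; have [rm hm] := bm; have [rq hq] := bp.
have [d1 d10 hd1] := fconv_molli_cvg n_gt0 sG.1 (fun I => coef_L2 I sG) hG e10.
have [d2 d20 hd2] := fconv_molli_cvg n_gt0 sm.1 (fun I => coef_L2 I sm) hm e10.
have [d3 d30 hd3] := fconv_molli_cvg n_gt0 sp.1 (fun I => coef_L2 I sp) hq e10.
pose t := Num.min (Num.min d1 d2) (Num.min d3 t1).
have t0 : 0 < t by rewrite !lt_min d10 d20 d30.
have td1 : t <= d1 by rewrite !ge_min lexx.
have td2 : t <= d2 by rewrite !ge_min lexx orbT.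
have td3 : t <= d3 by rewrite !ge_min lexx !orbT.
have tt1 : t <= t1 by rewrite !ge_min lexx !orbT.
have [cm cp] := comm t t0 tt1; have G2 := hd1 t t0 td1.
have M2 := hd2 t t0 td2; have P2 := hd3 t t0 td3.
set Gt := fconv (molli t) G in cm cp G2 *.
set Mt := fconv (molli t) Pm in cm M2 *; set Pt := fconv (molli t) Pp in cp P2 *.
have iG := L2_iform sG bG.
have tGt : tform Gt by exact: (tform_fconv (csmooth_molli t0) iG hG).
(* Mollifying G makes the difference with u a test form, to which Hardy's inequality applies. Its
   image under D^- - A D^+ splits into four errors (two of mollification, one of truncation, the
   residual), each at most e1. *)
pose v x := Gt x - u x; have tv : tform v by exact: tformB.
have mmt : mform (fun x => Mt x - Pm x).
  by rewrite -cm; exact: mformB (tform_mform (tform_dir (-1) tGt)) sm.1.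
have mpt : mform (fun x => Pt x - Pp x).
  by rewrite -cp; exact: mformB (tform_mform (tform_dir 1 tGt)) sp.1.
have mhh : mform (fun x => h x - h' x) by case: bh' => mh' _ _; exact: mformB.
have mres : mform (residual A h' u) by case: (bounded_residual k0 bA bh' tu).
have Lv : (fun x => dir (-1) v x - A x (dir 1 v x)) =
    fun x => ((Mt x - Pm x) - A x (Pt x - Pp x)) + ((h x - h' x) + residual A h' u x).
  apply/funext => x; rewrite /v !(dirB _ _ tGt tu) cm cp !AB /residual /h.
  move: (Mt x) (Pm x) (A x (Pt x)) (A x (Pp x)) (h' x) (dir (-1) u x) (A x (dir 1 u x)).
  have N (w : exterior R n) J : (- w) J = - w J by rewrite ffunE.
  by move=> a1 a2 a3 a4 a5 a6 a7; apply/ffunP => J; rewrite !(extDE, N); ring.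
have e1E : (0 <= e1%:E)%E by rewrite lee_fin ltW.
have mdv d := tform_mform (tform_dir d tv).
have mdA : mform (fun x => dir (-1) v x - A x (dir 1 v x)) by exact: mformB (mdv (-1)) (mA _ (mdv 1)).
have Lv2 : (FN 2 (fun x => dir (-1) v x - A x (dir 1 v x))%R <= (4 * e1)%:E)%E.
  rewrite Lv; have -> : 4 * e1 = (e1 + e1) + (e1 + e1) by ring.
  have m1 := mA _ mpt.
  apply: le_trans (FN_triangle p12 (mformB mmt m1) (mformD mhh mres)) _.
  rewrite EFinD; apply: leeD.
    apply: le_trans (FN_triangleB p12 mmt m1) _; rewrite EFinD; apply: leeD; first exact: M2.
    apply: le_trans (FN_mono p2 k0 m1 mpt (fun x => eA x _)) _.
    apply: (@le_trans _ _ (k%:E * e1%:E)%E); first by apply: lee_wpmul2l; rewrite ?lee_fin.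
    by rewrite -EFinM lee_fin ler_piMl ?(ltW e10)// (le_trans kth)// ltW.
  apply: le_trans (FN_triangle p12 mhh mres) _; rewrite EFinD; apply: leeD; first exact: hh'.
  exact: u2.
have fDv : (FN 2 (dir (-1) v) < +oo)%E by exact: (@tform_FN R n 2 _ isT (tform_dir (-1) tv)).
pose X := fine (FN 2 (dir (-1) v)).
have XE : FN 2 (dir (-1) v) = X%:E by rewrite fineK// ge0_fin_numE//; exact: FN_ge0.
(* Absorption in L^2, with |D^+ v| = |D^- v|; the factor 1 / (1 - k) comes from here. *)
have X1 : X <= 4 * e1 + k * X.
  rewrite -lee_fin -XE EFinD.
  have := FN_triangle p12 mdA (mA _ (mdv 1)).
  have -> : (fun x => dir (-1) v x - A x (dir 1 v x) + A x (dir 1 v x)) = dir (-1) v.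
    by apply/funext => x; rewrite subrK.
  move=> /le_trans; apply; apply: leeD Lv2 _.
  apply: le_trans (FN_mono p2 k0 (mA _ (mdv 1)) (mdv 1) (fun x => eA x _)) _.
  by rewrite (FN2_dir (mulr1 1) N1 tv) XE -EFinM.
have X2 : X <= 4 * e1 / (1 - k) by rewrite ler_pdivlMr// mulrBr mulr1 [X * k]mulrC lerBlDr.
have v2 : (FN 2 (restr (cball r') v) <= (H * (4 * e1 / (1 - k)))%:E)%E.
  by apply: le_trans (hH v tv) _; rewrite XE -EFinM lee_fin; exact: (ler_wpM2l (ltW H0) X2).
have mGu : mform (fun x => G x - u x) by exact: mformB sG.1 (tform_mform tu).
have mGt : mform (fun x => Gt x - G x) by exact: mformB (tform_mform tGt) sG.1.
have key : (FN 2 (restr (cball r') (fun x => G x - u x)%R) <= (e1 * (1 + H * 4 / (1 - k)))%:E)%E.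
  have mc := measurable_cball (n := n) r'.
  have -> : restr (cball r') (fun x => G x - u x) =
      fun x => restr (cball r') v x - restr (cball r') (fun x => Gt x - G x) x.
    apply/funext => x; rewrite /restr -scalerBr; congr (_ *: _); rewrite /v.
    by rewrite opprB [RHS]addrC subrKA.
  have mv := mform_restrT mc (tform_mform tv); have mg := mform_restrT mc mGt.
  apply: le_trans (FN_triangleB p12 mv mg) _.
  have -> : e1 * (1 + H * 4 / (1 - k)) = H * (4 * e1 / (1 - k)) + e1 by ring.
  rewrite EFinD; apply: leeD v2 _.
  exact: le_trans (restr_FN p2 mc mGt) G2.
have mcr := measurable_cball (n := n) r.
exists u => //; split; last first.
  have sub : restr (cball r) (fun x => G x - u x) = restr (cball r) (restr (cball r') (fun x => G x - u x)).
    apply/funext => x; have [xr|rx] := leP `|x| r; last by rewrite !(restr_cball_out _ rx).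
    have cx : cball r x by exact/in_cball.
    rewrite !(restr_in _ cx) restr_in//; apply/in_cball; apply: (le_trans xr); by rewrite lerDl.
  rewrite sub; apply: le_trans (restr_FN p2 mcr (mform_restrT (measurable_cball _) mGu)) _.
  by apply: le_trans key _; rewrite lee_fin.
have [mh' _ _] := bh'.
pose S := [set x | psi x != 0].
have mS : measurable S.
  rewrite (_ : S = ~` Z); first exact: measurableC.
  by apply/seteqP; split=> x /=; [move=> /eqP|move=> /eqP].
(* On the support of psi, u differs from G by at most 1 in L^2, so the bound fed to [apriori]
   depends on G alone. *)
have SL : (FN 2 (restr S u) <= (1 + NG)%:E)%E.
  have -> : restr S u = fun x => restr S G x - restr S (restr (cball r') (fun x => G x - u x)) x.
    apply/funext => x; have [Sx|Sx] := pselect (S x); last by rewrite !(restr_out _ Sx) subr0.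
    rewrite !(restr_in _ Sx) restr_in ?subKr//; apply/in_cball; rewrite leNgt; apply/negP => rx.
    move: Sx; rewrite /S/= hrp ?eqxx//; apply: le_lt_trans rx.
    by rewrite (le_trans (ler_norm rp))// lerDr ltW.
  have m1 := mform_restrT mS sG.1; have m2 := mform_restrT (measurable_cball r') mGu.
  apply: le_trans (FN_triangleB p12 m1 (mform_restrT mS m2)) _.
  rewrite [1 + NG]addrC EFinD; apply: leeD.
    by apply: le_trans (restr_FN p2 mS sG.1) _; rewrite NGE.
  apply: le_trans (restr_FN p2 mS m2) _; apply: le_trans key _; by rewrite lee_fin.
have psih' x : psi x *: h' x = 0.
  have [p0|pn] := eqVneq (psi x) 0; first by rewrite p0 scale0r.
  by rewrite h'Z ?scaler0//=; exact/eqP.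
apply: le_trans (hc1 u h' e1 (1 + NG) tu mh' psih' (ltW e10) _ um SL) _; first by rewrite addr_ge0.
by rewrite lee_fin ler_wpM2l ?(ltW c10)// lerD2r.
Qed.

End main_estimate.

(** * From approximants to the solution, and the theorem *)

Section interior_regularity.
Context {R : realType} {n : nat}.
Notation mu := (@lebesgue_rV R n).
Notation form := ('rV[R]_n -> exterior R n).
Notation L1 g := (mu.-integrable setT (EFin \o g)).
Notation T_ g := (distr_of setT g).
Notation m := (2 * n)%N.
Implicit Types (f u F P Q : form) (x y : 'rV[R]_n) (I : {set 'I_n}).
Hypothesis n3 : (3 <= n)%N.

Let n_gt0 : (0 < n)%N. Proof. exact: leq_trans n3. Qed.
Let m_gt1 : (1 < m)%N. Proof. by case: (n) n3 => // j _; rewrite mul2n doubleS. Qed.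

Lemma fconv_molli_hoelder u (C t : R) x : tform u -> 0 <= C -> 0 < t ->
  (forall y, enorm (u y - u x) <= C * Num.sqrt `|y - x|) ->
  enorm (fconv (molli t) u x - u x) <= #|{set 'I_n}|%:R * (C * Num.sqrt t).
Proof.
move=> tu C0 t0 h; apply: le_trans (enorm_le_sum _) _.
apply: (@le_trans _ _ (\sum_(I : {set 'I_n}) C * Num.sqrt t)); last first.
  by rewrite sumr_const -[leLHS]mulr_natl.
apply: ler_sum => I _; rewrite -scaleN1r extDE extZE mulN1r ffunE.
apply: (conv_molli_near n_gt0 t0 (csmooth_integrable (tu I))) => y xy.
have := coord_le_enorm (u y - u x) I; rewrite -scaleN1r extDE extZE mulN1r => /le_trans; apply.
rewrite scaleN1r; apply: le_trans (h y) _; rewrite ler_wpM2l// ler_wsqrtr//.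
by rewrite distrC.
Qed.

(** Near K the form F equals w = psi^n u plus an L^2-small error. The form w is Hoelder with a
    constant independent of the approximation, and at fixed scales t and s the mollified error tends
    to 0 with e, however large its constants are. *)
Lemma molli_hoelder_of_approx (K : set 'rV[R]_n) F G (psi : 'rV[R]_n -> R) (C rho rK : R) :
  iform F -> iform G -> smooth psi -> 0 < rho -> 0 < C -> (forall x, K x -> `|x| <= rK) ->
  (forall x y, K x -> `|x - y| < rho -> G y = F y /\ psi y = 1) ->
  (forall r e : R, 0 < r -> 0 < e -> exists2 u, tform u &
    (FN m%:R (dir (-1) (fun x => psi x ^+ n *: u x)%R) <= C%:E)%E /\
    (FN 2 (restr (cball r) (fun x => G x - u x)%R) <= e%:E)%E) ->
  molli_hoelder F K.
Proof.
move=> iF iG spsi rho0 C0 Kr loc approx.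
have N1 : (-1) * (-1) = 1 :> R by rewrite mulN1r opprK.
have [D D0 hD] := morrey_hoelder n_gt0 N1.
pose c : R := #|{set 'I_n}|%:R; have c0 : 0 <= c by [].
have DC : 0 <= D * C by rewrite mulr_ge0 ?ltW.
exists ((1 + c) * (D * C)), (rho / 2); split.
- by rewrite mulr_ge0// addr_ge0.
- by rewrite divr_gt0.
move=> x y t s Kx Ky /andP[t0 tr] /andP[s0 sr].
apply/ler_addgt0Pr => dl dl0.
have [D1 D10 hD1] := @fconv_molli_L2 R n n_gt0 t t0.
have [D2 D20 hD2] := @fconv_molli_L2 R n n_gt0 s s0.
have DD : 0 < D1 + D2 by rewrite addr_gt0.
(* D1 and D2 blow up as t and s tend to 0, but both scales are fixed before e is chosen. *)
pose e := dl / (D1 + D2); have e0 : 0 < e by rewrite divr_gt0.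
pose r := `|rK| + rho; have r0 : 0 < r by rewrite ltr_wpDl.
have [u tu [uC uG]] := approx r e r0 e0.
pose w : form := fun x => psi x ^+ n *: u x.
have tw : tform w by exact: tformM (smoothX n spsi) tu.
pose g := restr (cball r) (fun x => G x - u x).
have ig : iform g.
  move=> I; rewrite /g /restr fcoefM; apply: (integrable_bddM (C := 1)).
  - by apply: measurable_indic; exact: measurable_cball.
  - by move=> z; rewrite indicE; case: (z \in _); rewrite ?normr1 ?normr0.
  - rewrite (_ : coef _ I = fun z => coef G I z - coef u I z).
      exact: integrableBR (iG I) (csmooth_integrable (tu I)).
    by apply/funext => z; rewrite /coef -scaleN1r extDE extZE mulN1r.
(* For q <= rho / 2 the mollifier only sees points where psi = 1 and G = F, so there w = u and g = F
   - u. *)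
have split z q : K z -> 0 < q -> q <= rho / 2 ->
    fconv (molli q) F z = fconv (molli q) w z + fconv (molli q) g z.
  move=> Kz q0 qr; have cq := @csmooth_molli R n q q0.
  rewrite -(fconvDr _ cq (tform_iform tw) ig); apply: fconv_local => a.
  have [za|az] := ltP `|z - a| rho; last first.
    by left; rewrite molli_out//; apply: le_trans az; apply: (le_trans qr); lra.
  right; have [Ga pa] := loc z a Kz za.
  rewrite /w pa expr1n scale1r /g restr_in; first by rewrite Ga addrC subrK.
  apply/in_cball; have := ler_normD (a - z) z; rewrite subrK [`|a - z|]distrC.
  have := Kr z Kz; have := ler_norm rK; rewrite /r; lra.
have hw a b : enorm (w a - w b) <= D * C * Num.sqrt `|a - b| by exact: hD.
have w1 z q : 0 < q -> enorm (fconv (molli q) w z - w z) <= c * (D * C * Num.sqrt q).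
  by move=> q0; apply: fconv_molli_hoelder.
have g1 := hD1 g e x ig (ltW e0) uG; have g2 := hD2 g e y ig (ltW e0) uG.
rewrite (split x t Kx t0 tr) (split y s Ky s0 sr).
have -> : fconv (molli t) w x + fconv (molli t) g x - (fconv (molli s) w y + fconv (molli s) g y) =
  ((fconv (molli t) w x - w x) + (w x - w y) - (fconv (molli s) w y - w y)) +
  (fconv (molli t) g x - fconv (molli s) g y).
  move: (fconv _ w x) (fconv _ w y) (w x) (w y) (fconv _ g x) (fconv _ g y) => a1 a2 a3 a4 a5 a6.
  by rewrite opprD addrACA opprB subrKA subrKA.
apply: le_trans (enormD _ _) _.
have h1 : enorm (fconv (molli t) g x - fconv (molli s) g y) <= dl.
  apply: le_trans (enormB _ _) _; apply: le_trans (lerD g1 g2) _.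
  by rewrite -mulrDl mulrC divfK// gt_eqF.
apply: lerD h1; apply: le_trans (enormB _ _) _.
apply: le_trans (lerD (enormD _ _) (lexx _)) _.
apply: le_trans (lerD (lerD (w1 x t t0) (hw x y)) (w1 y s s0)) _.
have st := sqrtr_ge0 t; have ss := sqrtr_ge0 s; have sxy := sqrtr_ge0 `|x - y|.
move: (D * C) DC (Num.sqrt t) (Num.sqrt s) (Num.sqrt `|x - y|) st ss sxy c0.
have [c' ->] : exists c', c = c' by exists c.
clear.
move=> q q0 a b d a0 b0 d0 c0'.
have qa := mulr_ge0 q0 a0; have qb := mulr_ge0 q0 b0; have qd := mulr_ge0 c0' (mulr_ge0 q0 d0).
have -> : (1 + c') * q * (a + b + d) =
    (c' * (q * a) + q * d + c' * (q * b)) + (q * a + q * b + c' * (q * d)) by ring.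
by rewrite lerDl !addr_ge0.
Qed.

Section elliptic.
Variables (k K th : R) (A : 'rV[R]_n -> exterior R n -> exterior R n).
Hypotheses (k0 : 0 <= k) (kth : k <= th) (kKth : k * K <= th)
  (th1 : th < 1) (bA : bounded_field k A)
  (HK : forall u, tform u -> (FN m%:R (dir 1 u) <= K%:E * FN m%:R (dir (-1) u))%E).

(** Two nested cutoffs: phi localises F to G = phi F and creates the defect where it varies; psi
    lives where phi = 1, so the equation for G holds exactly on the support of the inner
    estimate. *)
Lemma molli_hoelder_solution (Omega K0 : set 'rV[R]_n) F P Q : open Omega -> compact K0 ->
  K0 `<=` Omega ->
  square_integrable F -> bounded_support F -> square_integrable P -> bounded_support P ->
  square_integrable Q -> bounded_support Q ->
  (forall phi, test_function Omega phi -> ddist (-1) (T_ F) phi = T_ P phi) ->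
  (forall phi, test_function Omega phi -> ddist 1 (T_ F) phi = T_ Q phi) ->
  {ae mu, forall x, Omega x -> P x = A x (Q x)} -> molli_hoelder F K0.
Proof.
move=> oO cK KO sF bF sP bP sQ bQ dP dQ PQ.
have [d d0 hd] := compact_cball_subset cK oO KO.
have [rK hrK] := bounded_norm_le (compact_bounded cK).
(* psi lives within 3 rho of K0 and phi within 6 rho; any number above 6 would leave room inside
   Omega. *)
pose rho := d / 8; have rho0 : 0 < rho by rewrite divr_gt0.
have dE : d = 8 * rho by rewrite /rho mulrC divfK.
have [psi [cpsi psi01 psi1 psin]] := cutoff n_gt0 hrK rho0.
pose K' := [set x | exists2 a, K0 a & `|x - a| < 3 * rho].
have hrK' x : K' x -> `|x| <= rK + 3 * rho.
  by move=> [a /hrK ar xa]; have := ler_normD (x - a) a; rewrite subrK; lra.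
have [phi [cphi phi01 phi1 phin]] := cutoff n_gt0 hrK' rho0.
have phiK x : phi x != 0 -> exists2 a, K0 a & `|x - a| < 6 * rho.
  move=> /phin[b [a Ka ba] xb]; exists a => //.
  by have := ler_normD (x - b) (b - a); rewrite subrKA; lra.
have iF := L2_iform sF bF; have iP := L2_iform sP bP; have iQ := L2_iform sQ bQ.
have [rp hrp] := cphi.2.
pose G : form := fun x => phi x *: F x.
(* The function representing D^s (phi F) when f represents D^s F. *)
pose V (s : R) (f : form) : form := fun x => phi x *: f x + \sum_j partial j phi x *: clif s j (F x).
have mphi := smooth_measurable cphi.1.
have sM (g : 'rV[R]_n -> R) f : csmooth g -> square_integrable f -> square_integrable (fun x => g x *: f x).
  move=> cg sf; have [C C0 gC] := csmooth_bounded cg.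
  apply: (square_integrable_le (ltW C0) (mformM (smooth_measurable cg.1) sf.1) sf) => x.
  by rewrite enormZ ler_wpM2r ?enorm_ge0.
have sc s j : s * s = 1 -> square_integrable (fun x => clif s j (F x)).
  move=> s2; apply: (square_integrable_le ler01 (mform_clif _ _ sF.1) sF) => x.
  by rewrite enorm_clif// mul1r.
have sV s f : s * s = 1 -> square_integrable f -> square_integrable (V s f).
  move=> s2 sf; apply: square_integrableD; first exact: sM.
  by apply: square_integrable_sum => j; apply: sM (sc s j s2); exact: csmooth_partial.
have bV s f : bounded_support (V s f).
  exists rp => x rx; rewrite /V hrp// scale0r add0r big1// => j _.
  rewrite partial_near0 ?scale0r//; apply: filterS (near_norm_gt rx) => z; exact: hrp.
have bG : bounded_support G by exists rp => x rx; rewrite /G hrp// scale0r.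
have sG : square_integrable G by exact: sM.
have comm s f : iform f -> (forall phi, test_function Omega phi -> ddist s (T_ F) phi = T_ f phi) ->
    forall t, 0 < t -> dir s (fconv (molli t) G) = fconv (molli t) (V s f).
  move=> jf df t t0; apply/funext => x; have cm := @csmooth_molli R n t t0.
  apply: (dir_fconv_cutoff (Omega := Omega)) => //.
  apply: (@test_function_near _ _ _ K0 _ (6 * rho) d) => //.
  - exact: csmoothMl (csmooth_reflect x cm) cphi.1.
  - by rewrite dE; lra.
  - by move=> y; rewrite mulf_eq0 negb_or => /andP[_ /phiK].
have N1 : (-1) * (-1) = 1 :> R by rewrite mulN1r opprK.
(* phi equals 1 on a whole neighbourhood of such a point; the derivative is computed for phi - 1,
   which is locally zero. *)
have flat x : psi x != 0 -> phi x = 1 /\ forall j, partial j phi x = 0.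
  move=> /psin Kx; have phix z : `|z - x| < rho -> phi z = 1 by exact: phi1.
  split; first by apply: phix; rewrite subrr normr0.
  move=> j; have s1 := @smooth_cst R n (-1).
  have : partial j (fun z => phi z + (-1)) x = 0.
    apply: partial_near0; apply: filterS (nbhsx_ballx x _ rho0) => z.
    by rewrite -ball_normE/= distrC => /phix ->; rewrite subrr.
  by rewrite (partialD _ _ cphi.1 s1) partial_cst addr0.
have eqV : {ae mu, forall x, psi x != 0 -> V (-1) P x = A x (V 1 Q x)}.
  apply: filterS PQ => x hx pn; have [p1 pj] := flat x pn.
  have VE s f : V s f x = f x.
    by rewrite /V p1 scale1r big1 ?addr0// => j _; rewrite pj scale0r.
  rewrite !VE; apply: hx; have [a Ka xa] := psin x pn.
  by apply: (hd a) => //; rewrite distrC dE; lra.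
have c1 : exists2 t1 : R, 0 < t1 & forall t, 0 < t -> t <= t1 ->
     dir (-1) (fconv (molli t) G) = fconv (molli t) (V (-1) P) /\
     dir 1 (fconv (molli t) G) = fconv (molli t) (V 1 Q).
  by exists 1 => // t t0 _; split; apply: comm.
have [C C0 hC] := regular_approximation n3 k0 kth kKth th1 bA HK sG bG (sV _ _ N1 sP) (bV _ _)
  (sV _ _ (mulr1 1) sQ) (bV _ _) c1 cpsi psi01 eqV.
apply: (molli_hoelder_of_approx iF (L2_iform sG bG) cpsi.1 rho0 C0 hrK _ hC).
move=> x y Kx xy; split; last by apply: (psi1 y x) => //; rewrite distrC.
have K'y : K' y by exists x => //; rewrite distrC; lra.
by rewrite /G (phi1 y y K'y) ?scale1r// subrr normr0.
Qed.

End elliptic.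

(** The bound applied with s and with -s shows that K < 1 forces D^+ u = 0 in L^2n for every test
    form u. Morrey's inequality then gives u = 0, absurd for a form whose coefficient is a mollifier
    of integral 1. *)
Lemma beurling_opnorm_ge1 (K : R) :
  (forall u s, tform u -> (FN m%:R (dir (- s) u) <= K%:E * FN m%:R (dir s u))%E) -> 1 <= K.
Proof.
move=> hK; rewrite leNgt; apply/negP => K1.
have c1 := @csmooth_molli R n 1 ltr01.
pose u : form := fun x => molli 1 x *: ebasis finset.set0.
have uI : coef u finset.set0 = molli 1.
  by apply/funext => x; rewrite /coef /u extZE ffunE eqxx mulr1.
have tu : tform u.
  move=> I; rewrite /u fcoefM; apply: (csmoothMl c1).
  rewrite (_ : coef _ I = fun=> (I == finset.set0)%:R); first exact: smooth_cst.
  by apply/funext => x; rewrite /coef ffunE.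
have m_gt0 := ltnW m_gt1.
pose N s := fine (FN m%:R (dir s u)).
have NE s : FN m%:R (dir s u) = (N s)%:E.
  by rewrite fineK// ge0_fin_numE ?FN_ge0//; exact: tform_FN (tform_dir s tu).
have N0 s : 0 <= N s by apply: fine_ge0; exact: FN_ge0.
have a1 : N (-1) <= K * N 1 by rewrite -lee_fin EFinM -!NE; exact: hK.
have a2 : N 1 <= K * N (-1) by have := hK u (-1) tu; rewrite opprK !NE -EFinM lee_fin.
have N10 : N 1 = 0.
  have := N0 1; have := N0 (-1); move: a1 a2 K1; move: (N 1) (N (-1)) => p q a1 a2 K1 q0 p0.
  apply/eqP; rewrite eq_le p0 andbT; have [K0|K0] := leP 0 K; nra.
have [_ [r hr]] := c1; pose r' := `|r| + 1.
have r'0 : 0 < r' by rewrite ltr_wpDl.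
have [D D0 hD] := morrey_sup n_gt0 (mulr1 1) r'0.
have u0 x : molli 1 x = 0 :> R.
  apply/eqP; rewrite -normr_eq0 eq_le normr_ge0 andbT; apply/ler_addgt0Pr => e e0; rewrite add0r.
  have eD : 0 < e / D by rewrite divr_gt0.
  have : enorm (u x) <= D * (e / D).
    apply: hD => //; first by rewrite NE N10 lee_fin ltW.
    move=> z rz; rewrite /u hr ?scale0r//; apply: le_lt_trans rz.
    by rewrite (le_trans (ler_norm r))// lerDl.
  rewrite mulrC divfK ?gt_eqF//; apply: le_trans; rewrite -uI; exact: coord_le_enorm.
have := @Rintegral_molli R n n_gt0 1 ltr01; under eq_Rintegral do rewrite u0.
by rewrite Rintegral_cst// mul0r => /eqP; rewrite eq_sym oner_eq0.
Qed.

End interior_regularity.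

Theorem theorem1p4 (R : realType) (n : nat) (Omega : set 'rV[R]_n)
    (M : 'rV[R]_n -> 'End(exterior R n))
    (hn3 : (3 <= n)%N) (hnodd : odd n)
    (hOmega : domain Omega) (hbounded : bounded_set Omega)
    (hM : in_Linf Omega M)
    (hsmall : (ess_sup_opnorm Omega M *
      Lp_opnorm (2 * n)%:R (@beurling_ahlfors R n (2 * n)%:R) < 1)%E)
    (F : 'rV[R]_n -> exterior R n)
    (hF : W12_d_delta Omega F) (hsol : dirac_solution Omega M F) :
  exists2 G : 'rV[R]_n -> exterior R n,
    ae_on Omega (fun x => F x = G x) & locally_hoelder Omega 2^-1 G.
Proof.
have n_gt0 : (0 < n)%N by exact: leq_trans hn3.
have m_gt1 : (1 < 2 * n)%N by case: (n) hn3 => // j _; rewrite mul2n doubleS.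
have [oO _ _] := hOmega; have mO := open_measurable_rV oO.
have [k [A [kE k0 bA Aout AM]]] := coefficient_field mO hM.
rewrite kE in hsmall; have [lF _ _] := hF.
have [P [Q [[lP lQ] dP dQ PQ]]] := hsol.
have [rO hrO] := bounded_norm_le hbounded.
have sR f : in_Lp Omega 2 f -> square_integrable (restr Omega f) by exact: in_Lp_restr.
have bR f : bounded_support (restr Omega f).
  by exists rO => x rx; rewrite restr_out// => /hrO; rewrite leNgt rx.
have sF := sR _ lF; have sP := sR _ lP; have sQ := sR _ lQ.
have ddR s phi : ddist s (distr_of Omega F) phi = ddist s (distr_of setT (restr Omega F)) phi.
  by apply: eq_bigr => j _; rewrite (distr_of_restr _ _ mO).
have dP' phi : test_function Omega phi ->
    ddist (-1) (distr_of setT (restr Omega F)) phi = distr_of setT (restr Omega P) phi.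
  by move=> tphi; rewrite -(distr_of_restr _ _ mO) -(dP _ tphi) dirac_minus_ddist ddR.
have dQ' phi : test_function Omega phi ->
    ddist 1 (distr_of setT (restr Omega F)) phi = distr_of setT (restr Omega Q) phi.
  by move=> tphi; rewrite -(distr_of_restr _ _ mO) -(dQ _ tphi) dirac_plus_ddist ddR.
have PQ' : {ae lebesgue_rV n, forall x, Omega x -> restr Omega P x = A x (restr Omega Q x)}.
  move: PQ AM; rewrite /ae_on; apply: filterS2 => x h1 h2 Ox.
  by rewrite !restr_in// h1// h2.
have [bF hbF] := bR F.
have m1 : (-1 : R) != 0 by rewrite oppr_eq0 oner_eq0.
(* The mollification estimate on compact subsets is all that is needed; the representative comes
   from [hoelder_representative]. *)
suff H K : compact K -> K `<=` Omega -> molli_hoelder (restr Omega F) K.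
  have [G FG hG] := hoelder_representative n_gt0 oO sF.1 (fun I => coef_L2 I sF) hbF H.
  exists G => //; move: FG; rewrite /ae_on; apply: filterS => x h Ox.
  by rewrite -(h Ox) restr_in.
move=> cK KO.
(* For k = 0 the smallness hypothesis holds even if |S|_2n = +oo. In that case D^- F = 0 in Omega,
   and mollifications are locally independent of the scale. *)
have [k00|kn0] := eqVneq k 0.
  have P0 : {ae lebesgue_rV n, forall x, restr Omega P x = 0}.
    apply: filterS PQ' => x h; have [Ox|Ox] := pselect (Omega x); last by rewrite restr_out.
    rewrite h//; apply: enorm_eq0; apply/eqP; rewrite eq_le enorm_ge0 andbT.
    by have [_ _ /(_ x)] := bA; move=> /(_ (restr Omega Q x)); rewrite k00 mul0r.
  have dz phi : test_function Omega phi -> ddist (-1) (distr_of setT (restr Omega F)) phi = 0.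
    move=> tphi; have z0 := @tform0 R n; rewrite (dP' _ tphi).
    have -> : distr_of setT (restr Omega P) phi = distr_of setT (fun=> 0) phi.
      apply: (distr_of_ae sP.1 (tform_mform z0) (test_csmooth tphi)) P0.
    apply/ffunP => I; rewrite /distr_of ffunE [RHS]ffunE -[RHS](mul0r (fine (lebesgue_rV n setT))).
    rewrite -Rintegral_cst//; apply: eq_Rintegral => x _; rewrite -[RHS](mulr0 (phi x)).
    by congr (_ * _); rewrite ffunE.
  exact: (molli_hoelder_const m1 oO cK KO (L2_iform sF (bR F)) dz).
have kp : 0 < k by rewrite lt_def kn0.
set S := Lp_opnorm _ _ in hsmall.
have S0 : (0 <= S)%E.
  have z0 := @tform0 R n; apply: le_trans (ereal_sup_ubound _); last first.
    exists (fun=> 0); last reflexivity.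
    have f0 : FN (2 * n)%:R (fun=> 0 : exterior R n) = 0%E :> \bar R.
      rewrite /FN enorm0; apply: NL0; by rewrite ltr0n ltnW.
    by split; rewrite ?Lp_normT ?f0//; split; [exact: (tform_mform z0)|rewrite Lp_normT f0].
  exact: Lnorm_ge0.
(* k > 0 times +oo would be +oo, against the smallness hypothesis. *)
have Sfin : (S \is a fin_num)%E.
  rewrite ge0_fin_numE// ltey; apply/eqP => Soo; move: hsmall.
  by rewrite Soo gt0_muley ?lte_fin.
pose K1 := fine S; have SE : S = K1%:E by rewrite fineK.
have bb (u : 'rV[R]_n -> exterior R n) s : tform u -> (FN (2 * n)%:R (dir (- s) u) <= K1%:E * FN (2 * n)%:R (dir s u))%E.
  by move=> tu; exact: (beurling_bound n_gt0 s m_gt1 tu SE).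
have K1ge := beurling_opnorm_ge1 hn3 bb.
have kK : k * K1 < 1 by rewrite -lte_fin EFinM -SE.
have HK (u : 'rV[R]_n -> exterior R n) : tform u -> (FN (2 * n)%:R (dir 1 u) <= K1%:E * FN (2 * n)%:R (dir (-1) u))%E.
  by move=> tu; have := bb u (-1) tu; rewrite opprK.
(* The contraction factor is th = k K1 in both norms; in L^2, where only k is needed, this uses K1
   >= 1. *)
have kth : k <= k * K1 by rewrite ler_peMr.
exact: (molli_hoelder_solution hn3 k0 kth (lexx _) kK bA HK oO cK KO sF (bR F) sP (bR P) sQ (bR Q) dP' dQ' PQ').
Qed.
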